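(* Let $[\cdot]_\beta$ be the superexpectation of the $\mathbb{H}^{2|2}$ model on $\Lambda$, let $N=|\Lambda|$, and let $(\tilde X_t,\tilde{\boldsymbol{L}}_t)$ be the time-change by $V$ of the vertex-reinforced jump process (VRJP) with initial local times $\boldsymbol{1}$. Let $(\delta_\epsilon)_{\epsilon>0}$, $\delta_\epsilon\colon\mathbb{R}\to\mathbb{R}$, be a smooth and compactly supported approximation to $\delta_0$. Then for $a\in\Lambda$, $g\colon\mathbb{R}^\Lambda\to\mathbb{R}$ smooth and rapidly decaying, and any $T>0$, $$\mathbb{E}_{a,V(\boldsymbol{1})}\,g\Big(\tilde{\boldsymbol{L}}_T-\frac TN\Big)=\lim_{\epsilon\to0}\sum_{i\in\Lambda}\Big[x_ax_i\,V'(z_i)\,g\Big(V(\boldsymbol{z})-\frac TN\Big)\,\delta_\epsilon\Big(\sum_{j\in\Lambda}\big(V(z_j)-V(1)-\tfrac TN\big)\Big)\Big]_\beta.$$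
   Context: $\Lambda$ is a finite set and $\beta=(\beta_{ij})_{i,j\in\Lambda}$ are edge weights with $\beta_{ij}=\beta_{ji}\ge0$ such that the graph with vertex set $\Lambda$ and edge set $\{\{i,j\}\mid\beta_{ij}>0\}$ is connected. Bold symbols denote objects indexed by $\Lambda$; $V(\boldsymbol{z})=(V(z_i))_{i\in\Lambda}$, $V(\boldsymbol{1})=(V(1))_{i\in\Lambda}$, and subtracting the scalar $T/N$ from a vector means subtracting it from every component. $\delta_\epsilon$ being a smooth compactly supported approximation to $\delta_0$ means $\delta_\epsilon\in C_c^\infty(\mathbb{R})$ is nonnegative with $\int\delta_\epsilon=1$ and support shrinking to $\{0\}$ as $\epsilon\to0$. $g$ has rapid decay if there is a coordinate $\ell_k$ such that $g$ and its derivatives are $O((1+|\ell_k|)^{-p})$ for every $p$, uniformly in the other coordinates. Forms: $\Omega^{2\Lambda}(\mathbb{R}^{2\Lambda})$ is the algebra over $C^\infty(\mathbb{R}^{2\Lambda})$ (coordinates $(x_i,y_i)_{i\in\Lambda}$) generated by pairwise anticommuting (Grassmann) generators $(\xi_i,\eta_i)_{i\in\Lambda}$ (each squaring to $0$); its elements are called forms. $F_0$ denotes the degree-$0$ part of a form $F$, and a form is even if all its terms have even degree in the generators. For even forms $F^1,\dots,F^k$ and a smooth $g$, $g(F^1,\dots,F^k)=\sum_\alpha\frac1{\alpha!}g^{(\alpha)}(F^1_0,\dots,F^k_0)\prod_j(F^j-F^j_0)^{\alpha_j}$ (a finite sum). $\partial_{\xi_i},\partial_{\eta_i}$ are the left derivatives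 (antiderivations over $C^\infty$ with $\partial_{\xi_i}\xi_j=\delta_{ij}=\partial_{\eta_i}\eta_j$, $\partial_{\xi_i}\eta_j=0=\partial_{\eta_i}\xi_j$). $\mathbb{H}^{2|2}$ model: let $z_i=\sqrt{1+x_i^2+y_i^2-2\xi_i\eta_i}$ (an even form), $u_i=(z_i,x_i,y_i,\xi_i,\eta_i)$, $u_i\cdot u_j=-z_iz_j+x_ix_j+y_iy_j-\xi_i\eta_j+\eta_i\xi_j$, $\int_{(\mathbb{H}^{2|2})^\Lambda}F=(2\pi)^{-|\Lambda|}\int_{\mathbb{R}^{2\Lambda}}\prod_{i}dx_i\,dy_i\ \big(\prod_{i}\partial_{\eta_i}\partial_{\xi_i}\big)\frac{1}{\prod_{i}z_i}F$, $H_\beta(\boldsymbol{u})=\frac12\sum_{i,j\in\Lambda}\beta_{ij}(-1-u_i\cdot u_j)$, and $[F]_\beta=\int_{(\mathbb{H}^{2|2})^\Lambda}Fe^{-H_\beta}$. VRJP: for initial vertex $v$ and initial local times $\boldsymbol{L}_0\in(0,\infty)^\Lambda$, $X_0=v$ and $\mathbb{P}_{v,\boldsymbol{L}_0}[X_{t+dt}=j\mid(X_r)_{r\le t},X_t=i]=\beta_{ij}L_t^j\,dt$, where $L_t^i=L_0^i+\int_0^t1_{X_r=i}\,dr$. Time change: here $\boldsymbol{L}_0=\boldsymbol{1}$. $V\colon[1,\infty)\to[V(1),\infty)$ is an increasing diffeomorphism, $A(s)=\int_0^sV'(L_r^{X_r})\,dr=\sum_{i\in\Lambda}(V(L_s^i)-V(1))$,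 and $\tilde X_t=X_{A^{-1}(t)}$, $\tilde L_t^i=V(L_{A^{-1}(t)}^i)=V(1)+\int_0^t1_{\tilde X_r=i}\,dr$. $\mathbb{E}_{a,V(\boldsymbol{1})}$ is the expectation of the time-changed process with $\tilde X_0=a$, $\tilde{\boldsymbol{L}}_0=V(\boldsymbol{1})$, i.e. of the time change of the VRJP started from $(a,\boldsymbol{1})$. *)

(* Defs.v *)
From HB Require Import structures.
From mathcomp Require Import all_boot all_order all_algebra.

Set Implicit Arguments.
Unset Strict Implicit.
Unset Printing Implicit Defensive.

Import Order.TTheory GRing.Theory Num.Theory.

Local Open Scope ring_scope.

(* The Grassmann algebra on generators [I]: [F S] is the coefficient of the
   monomial obtained by multiplying the generators of [S] in increasing
   [enum_rank]. *)
Definition grassmann (R : comNzRingType) (I : finType) : Type := {ffun {set I} -> R}.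

Section Grassmann.
Variables (R : comNzRingType) (I : finType).
Local Notation gr := (grassmann R I).

HB.instance Definition _ := GRing.Lmodule.copy gr {ffun {set I} -> R^o}.

Definition inversions (A B : {set I}) : nat :=
  #|[set p in setX A B | enum_rank p.2 < enum_rank p.1]%N|.

Definition gmul (F G : gr) : gr :=
  [ffun S : {set I} => \sum_(A : {set I})
     \sum_(B : {set I} | [disjoint A & B] && (A :|: B == S))
       (-1) ^+ inversions A B * (F A * G B)].

Definition gone : gr := [ffun S : {set I} => (S == set0)%:R].

Definition ggen (k : I) : gr := [ffun S : {set I} => (S == [set k])%:R].

Definition gbody (F : gr) : R := F set0.

(* The left derivative with respect to the generator [k]; the sign is that of
   moving [k] to the front of the monomial. *)
Definition gder (k : I) (F : gr) : gr :=
  [ffun S : {set I} => if k \in S then 0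
     else (-1) ^+ inversions [set k] S * F (k |: S)].

Lemma inversions0l B : inversions set0 B = 0%N.
Proof. by apply/eqP; rewrite cards_eq0; apply/eqP/setP => p; rewrite !inE. Qed.

Lemma inversions0r A : inversions A set0 = 0%N.
Proof.
by apply/eqP; rewrite cards_eq0; apply/eqP/setP => p; rewrite !inE andbF.
Qed.

Lemma inversionsUl (A B C : {set I}) : [disjoint A & B] ->
  inversions (A :|: B) C = (inversions A C + inversions B C)%N.
Proof.
move=> dAB; apply/esym; rewrite /inversions -cardsUI -[RHS]addn0.
congr (_ + _)%N; first by apply: eq_card => p; rewrite !inE !andb_orl.
apply/eqP; rewrite cards_eq0; apply/eqP/setP => p; rewrite !inE.
have [pA|] := boolP (p.1 \in A) => //=.
by rewrite (disjointFr dAB pA)/= andbF.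
Qed.

Lemma inversionsUr (A B C : {set I}) : [disjoint B & C] ->
  inversions A (B :|: C) = (inversions A B + inversions A C)%N.
Proof.
move=> dBC; apply/esym; rewrite /inversions -cardsUI -[RHS]addn0.
congr (_ + _)%N.
  by apply: eq_card => p; rewrite !inE andb_orr andb_orl.
apply/eqP; rewrite cards_eq0; apply/eqP/setP => p; rewrite !inE.
have [pB|] := boolP (p.2 \in B); last by rewrite !andbF.
by rewrite (disjointFr dBC pB)/= !andbF.
Qed.

Let c (A B S : {set I}) : R :=
  if [disjoint A & B] && (A :|: B == S) then (-1) ^+ inversions A B else 0.

Let gmulE F G S : gmul F G S = \sum_A \sum_B c A B S * (F A * G B).
Proof.
rewrite ffunE; apply: eq_bigr => A _; rewrite big_mkcond; apply: eq_bigr => B _.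
by rewrite /c; case: ifP; rewrite // mul0r.
Qed.

Let cl A B C S : \sum_D c A B D * c D C S = c A B (A :|: B) * c (A :|: B) C S.
Proof.
rewrite (bigD1 (A :|: B))//= big1 ?addr0// => D /negPf nD.
by rewrite /c eq_sym nD andbF mul0r.
Qed.

Let cr A B C S : \sum_D c B C D * c A D S = c B C (B :|: C) * c A (B :|: C) S.
Proof.
rewrite (bigD1 (B :|: C))//= big1 ?addr0// => D /negPf nD.
by rewrite /c eq_sym nD andbF mul0r.
Qed.

Let cA A B C S : \sum_D c A B D * c D C S = \sum_D c B C D * c A D S.
Proof.
rewrite cl cr /c !eqxx !andbT setUA -!setI_eq0 setIUl setIUr !setU_eq0.
rewrite !setI_eq0.
have [dAB|] := boolP [disjoint A & B]; have [dBC|] := boolP [disjoint B & C];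
  have [dAC|] := boolP [disjoint A & C]; rewrite /= ?mul0r ?mulr0//.
case: ifP => _; rewrite ?mulr0// inversionsUl// inversionsUr// -!exprD.
by rewrite addnA [in RHS]addnC.
Qed.

Lemma gmulA : associative gmul.
Proof.
move=> F G H; apply/ffunP => S; rewrite !gmulE.
transitivity (\sum_A \sum_B \sum_C (\sum_D c B C D * c A D S) *
                (F A * (G B * H C))).
  apply: eq_bigr => A _.
  under eq_bigr => D _.
    rewrite gmulE mulr_sumr mulr_sumr; under eq_bigr => B _.
      rewrite mulr_sumr mulr_sumr; over.
    over.
  rewrite exchange_big; apply: eq_bigr => B _.
  rewrite exchange_big; apply: eq_bigr => C _.
  rewrite mulr_suml; apply: eq_bigr => D _.
  by rewrite [F A * _]mulrCA (mulrA (c A D S)) (mulrC (c A D S)).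
transitivity (\sum_A \sum_B \sum_C (\sum_D c A B D * c D C S) *
                (F A * (G B * H C))).
  apply: eq_bigr => A _; apply: eq_bigr => B _; apply: eq_bigr => C _.
  by rewrite cA.
symmetry; under eq_bigr => D _.
  under eq_bigr => C _.
    rewrite gmulE mulr_suml mulr_sumr; under eq_bigr => A _.
      rewrite mulr_suml mulr_sumr; over.
    over.
  rewrite exchange_big; under eq_bigr => A _ do rewrite exchange_big.
  over.
rewrite exchange_big; apply: eq_bigr => A _.
rewrite exchange_big; apply: eq_bigr => B _.
rewrite exchange_big; apply: eq_bigr => C _.
rewrite mulr_suml; apply: eq_bigr => D _.
by rewrite !mulrA (mulrC (c D C S)).
Qed.

Lemma gmul1l : left_id gone gmul.
Proof.
move=> F; apply/ffunP => S; rewrite gmulE (bigD1 set0)//= [X in _ + X]big1.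
  rewrite addr0 (bigD1 S)//= big1 ?addr0; last first.
    by move=> B /negPf nB; rewrite /c set0U nB andbF mul0r.
  by rewrite /c ffunE eqxx set0U eqxx inversions0l disjoints_subset sub0set !mul1r.
by move=> A /negPf nA; rewrite big1// => B _; rewrite ffunE nA mul0r mulr0.
Qed.

Lemma gmul1r : right_id gone gmul.
Proof.
move=> F; apply/ffunP => S; rewrite gmulE exchange_big (bigD1 set0)//=.
rewrite [X in _ + X]big1.
  rewrite addr0 (bigD1 S)//= big1 ?addr0; last first.
    by move=> B /negPf nB; rewrite /c setU0 nB andbF mul0r.
  rewrite /c ffunE eqxx setU0 eqxx inversions0r disjoint_sym.
  by rewrite disjoints_subset sub0set mul1r mulr1.
by move=> A /negPf nA; rewrite big1// => B _; rewrite ffunE nA !mulr0.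
Qed.

Lemma gmulDl : left_distributive gmul +%R.
Proof.
move=> F G H; apply/ffunP => S; rewrite gmulE [RHS]ffunE !gmulE -big_split.
apply: eq_bigr => A _; rewrite -big_split; apply: eq_bigr => B _ /=.
by rewrite ffunE mulrDl mulrDr.
Qed.

Lemma gmulDr : right_distributive gmul +%R.
Proof.
move=> F G H; apply/ffunP => S; rewrite gmulE [RHS]ffunE !gmulE -big_split.
apply: eq_bigr => A _; rewrite -big_split; apply: eq_bigr => B _ /=.
by rewrite ffunE !mulrDr.
Qed.

HB.instance Definition _ := GRing.Zmodule_isPzRing.Build gr
  gmulA gmul1l gmul1r gmulDl gmulDr.

End Grassmann.

From mathcomp Require Import all_classical all_reals all_analysis.
Import numFieldNormedType.Exports.

Local Open Scope classical_set_scope.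
Local Open Scope ring_scope.

Section Calculus.
Variable R : realType.

Definition smooth1 (f : R -> R) : Prop :=
  forall (n : nat) (t : R), derivable (derive1n n f) t 1.

Variable K : finType.

Definition partial (k : K) (g : (K -> R) -> R) : (K -> R) -> R :=
  fun x => derive1 (fun t : R => g [eta x with k |-> t]) (x k).

Definition partials (s : seq K) (g : (K -> R) -> R) : (K -> R) -> R :=
  foldr partial g s.

Definition mderive (alpha : K -> nat) (g : (K -> R) -> R) : (K -> R) -> R :=
  partials (flatten [seq nseq (alpha k) k | k <- enum K]) g.

(* All iterated partial derivatives, in any order, exist and are jointly
   continuous; [{ptws K -> R}] is [K -> R] with the product topology. *)
Definition smooth (g : (K -> R) -> R) : Prop :=
  forall s : seq K,
    continuous (partials s g : {ptws K -> R} -> R) /\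
    forall (k : K) (x : K -> R),
      derivable (fun t : R => partials s g [eta x with k |-> t]) (x k) 1.

Definition rapid_decay (g : (K -> R) -> R) : Prop :=
  exists k : K, forall (s : seq K) (p : nat), exists C : R,
    forall x : K -> R, `|partials s g x| <= C * (1 + `|x k|) ^- p.

(* Iterated Lebesgue integral; by Fubini it is the integral over [R^K] of
   integrable functions, whatever the order of integration. *)
Definition iterated_integral (s : seq K) (f : (K -> R) -> R) : (K -> R) -> R :=
  foldr (fun k h x => \int[lebesgue_measure]_t h [eta x with k |-> t]) f s.

Definition integral_Rn (f : (K -> R) -> R) : R :=
  iterated_integral (enum K) f (fun=> 0).

End Calculus.

(* A smooth function on the half-line [1, +oo[ (resp. [V 1, +oo[) is given
   through a smooth extension to R; nothing below depends on the extension. *)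
Definition increasing_diffeo (R : realType) (V : R -> R) : Prop :=
  [/\ smooth1 V,
      {in `[1, +oo[ &, {homo V : s t / s < t}} &
      exists W : R -> R,
        [/\ smooth1 W,
            forall t, 1 <= t -> W (V t) = t &
            forall t, V 1 <= t -> 1 <= W t /\ V (W t) = t]].

Definition delta_approx (R : realType) (delta : R -> R -> R) : Prop :=
  (forall e, 0 < e ->
     [/\ smooth1 (delta e),
         compact (closure [set t | delta e t != 0]),
         forall t, 0 <= delta e t &
         (\int[lebesgue_measure]_t (delta e t)%:E = 1)%E]) /\
  (forall r, 0 < r -> \forall e \near 0^'+,
     closure [set t | delta e t != 0] `<=` [set t | `|t| <= r]).

Section Forms.
Variables (R : realType) (Lam : finType).

(* [inl i] indexes the coordinate x_i and the generator xi_i, [inr i] the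
   coordinate y_i and the generator eta_i. *)
Definition coord : finType := (Lam + Lam)%type.

(* Coefficients are arbitrary functions of the coordinates; the forms proper
   are those with smooth coefficients.  Sums and products are pointwise. *)
Definition superform : Type := (coord -> R) -> grassmann R coord.

HB.instance Definition _ := GRing.PzRing.on superform.
HB.instance Definition _ := GRing.Lmodule.on superform.

Definition form0 (f : (coord -> R) -> R) : superform :=
  fun p => f p *: (1 : grassmann R coord).
Definition cform (c : R) : superform := form0 (fun=> c).

Definition body (F : superform) : (coord -> R) -> R := fun p => gbody (F p).
Definition soul (F : superform) : superform := F - form0 (body F).

Definition xform (i : Lam) : superform := form0 (fun p => p (inl i)).
Definition yform (i : Lam) : superform := form0 (fun p => p (inr i)).
Definition xi (i : Lam) : superform := fun=> ggen R (inl i).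
Definition eta (i : Lam) : superform := fun=> ggen R (inr i).

(* [g(F^1, ..., F^k)] for even forms: a product of more than [#|coord|] factors
   [F^j - F^j_0] vanishes, so that restricting every exponent to [0, #|coord|]
   keeps all the nonzero terms of the Taylor expansion. *)
Definition fun_forms (K : finType) (g : (K -> R) -> R)
    (F : K -> superform) : superform :=
  \sum_(alpha : {ffun K -> 'I_#|coord|.+1})
    form0 (fun p => (\prod_k (alpha k)`!)%:R^-1 *
                    mderive (fun k => alpha k) g (fun k => body (F k) p)) *
    \prod_k soul (F k) ^+ alpha k.

Definition fun_form (f : R -> R) (F : superform) : superform :=
  \sum_(n < #|coord|.+1)
    form0 (fun p => n`!%:R^-1 * derive1n n f (body F p)) * soul F ^+ n.

(* The pairs [d_(eta_i) d_(xi_i)] commute: the order of [enum Lam] is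
   immaterial. *)
Definition berezin (F : grassmann R coord) : grassmann R coord :=
  foldr (fun i G => gder (inr i) (gder (inl i) G)) F (enum Lam).

Definition zform (i : Lam) : superform :=
  fun_form Num.sqrt
    (1 + xform i ^+ 2 + yform i ^+ 2 - 2%:R * xi i * eta i).

Definition udot (i j : Lam) : superform :=
  - (zform i * zform j) + xform i * xform j + yform i * yform j
  - xi i * eta j + eta i * xi j.

Definition superintegral (F : superform) : R :=
  (2 * pi) ^- #|Lam| *
  integral_Rn
    (fun p => gbody (berezin ((fun_form GRing.inv (\prod_i zform i) * F) p))).

Definition hamiltonian (beta : Lam -> Lam -> R) : superform :=
  2^-1 *: \sum_i \sum_j beta i j *: (- 1 - udot i j).

Definition superexp (beta : Lam -> Lam -> R) (F : superform) : R :=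
  superintegral (F * fun_form expR (- hamiltonian beta)).

End Forms.

Section VRJP.
Variables (R : realType) (Lam : finType).
Variables (d : measure_display) (Omega : measurableType d).
Implicit Types X : R -> Omega -> Lam.

Definition local_time (L0 : Lam -> R) X (i : Lam) (t : R) (w : Omega) : R :=
  L0 i + \int[lebesgue_measure]_(r in `[0, t]) (X r w == i)%:R.

Definition natural_filtration X (t : R) : set (set Omega) :=
  <<s [set A | exists r i,
         [/\ 0 <= r, r <= t & A = [set w | X r w = i]] ] >>.

(* [jump_rate] is
     P[X_(t+h) = j | (X_r)_(r <= t), X_t = i] = beta_ij L_t^j h + o(h)
   integrated over the events of the natural filtration at time t, with o(h)
   uniform over these events and over bounded sets of times t.  (Without
   uniformity in t, jumps at deterministic times would not be excluded.) *)
Record is_vrjp (beta : Lam -> Lam -> R) (v : Lam) (L0 : Lam -> R)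
    (P : probability Omega R) X : Prop := IsVRJP {
  vrjp_measurable : forall t i, 0 <= t -> measurable [set w | X t w = i] ;
  vrjp_right_continuous : forall w t, 0 <= t ->
    \forall r \near t^'+, X r w = X t w ;
  vrjp_left_limit : forall w t, 0 < t ->
    exists i, \forall r \near t^'-, X r w = i ;
  vrjp_start : P [set w | X 0 w = v] = 1%E ;
  jump_rate : forall (S : R) (i j : Lam), i != j ->
    forall e : R, 0 < e -> \forall h \near 0^'+,
    forall t, 0 <= t <= S -> forall A, natural_filtration X t A ->
      `| fine (P (A `&` [set w | X t w = i] `&` [set w | X (t + h) w = j]))
         - h * \int[P]_(w in A `&` [set w | X t w = i])
                 (beta i j * local_time L0 X j t w) | <= e * h }.

Variable V : R -> R.

Definition clock X (s : R) (w : Omega) : R :=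
  \int[lebesgue_measure]_(r in `[0, s])
    derive1 V (local_time (fun=> 1) X (X r w) r w).

Definition clock_inv X (t : R) (w : Omega) : R :=
  xget 0 [set s | 0 <= s /\ clock X s w = t].

Definition changed_local_time X (i : Lam) (t : R) (w : Omega) : R :=
  V (local_time (fun=> 1) X i (clock_inv X t w) w).

End VRJP.

(* Main.v *)
Require Import Defs.
From HB Require Import structures.
From mathcomp Require Import all_boot all_order all_algebra.

(** For smooth families [h = (h_b)] vanishing as soon as some local time exceeds a constant [M], put
    [mu1 h = E int_0^S h_(X_t)(L_t) dt] and [mu2 h = sum_b [x_a x_b h_b(z)]_beta].  With [G] the
    generator of [(X_t, L_t)], [(G f)_b = d_b f_b + sum_j beta_bj l_j (f_j - f_b)], both satisfy
    [mu (G f) = - f_a(1)].  For [mu1], with [S] so large that the process has left the support of [f],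
    this is Dynkin's formula.  For [mu2], the integral of the derivative in [x_b] of
    [x_a f_b(z) e^(-H) prod_(i <> b) 1/z_i] vanishes, and summing over [b] gives
    [mu2 (G f) = - [z_a f_a(z)]_beta]; by supersymmetry [H] is exact and may be removed, which leaves a
    product of planar fluxes equal to [f_a(1)].  Inverting [d_b] along the coordinate [l_b], the
    equation [mu (G f) = 0] becomes a fixed point equation for a contraction in an exponentially
    weighted norm, whence [mu1 = mu2].  For
    [h_b = V'(l_b) g(V(l) - T/N) delta_e(sum_j (V(l_j) - V(1)) - T)] the factor
    [V'(L_t^(X_t))] is the derivative of the clock [sum_j (V(L_t^j) - V(1))], so that the time integral
    of [h] concentrates at the time when the clock shows [T]. *)

Set Implicit Arguments.
Unset Strict Implicit.
Unset Printing Implicit Defensive.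

Import Order.TTheory GRing.Theory Num.Theory.

Local Open Scope ring_scope.

(** * Grassmann algebras and Berezin integrals *)

(** Everything is kept inside boxes. Since [delta_e] pins the clock near [T], and one local time
    above [M = W (V 1 + T + 2)] already pushes it to [T + 2], the test families vanish once a
    coordinate exceeds [M]; as [|x|, |y| <= z], the superintegrals run over a box too. There, local
    Lipschitz bounds on all derivatives do the work: Fubini, differentiation under the integral and
    the exchange of expectation and time integral reduce to one-dimensional calculus and Riemann
    sums. On the process side the obstacle is that paths are only right-continuous and that jump
    rates are given on events, uniformly in time; hence one-sided derivatives, and a slicing
    argument that passes from events to functions. On the form side the nilpotent part of [z_k]
    squares to zero, so a function of all the [z_k] sees only derivatives taken at most once in each
    coordinate. The norm of the uniqueness argument controls exactly these, and both functionals are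
    bounded by them. Its weight [exp (- lam * sum l)] is there because one integration along a
    coordinate gains [1 / lam], while the rates stay bounded by [l_j <= M] on the support. *)

Section GrassmannAlgebra.
Variables (R : comNzRingType) (I : finType).
Local Notation gr := (grassmann R I).
Implicit Types (F G : gr) (A B S : {set I}) (k l : I) (c : R).

Lemma gmulE F G S : (F * G) S = \sum_(A : {set I}) \sum_(B : {set I} | [disjoint A & B] && (A :|: B == S))
  (-1) ^+ inversions A B * (F A * G B).
Proof. by rewrite [LHS]ffunE. Qed.

Lemma gscaleE c F S : (c *: F) S = c * F S.
Proof. by rewrite ffunE. Qed.

Lemma gaddE F G S : (F + G) S = F S + G S.
Proof. by rewrite ffunE. Qed.

Lemma goppE F S : (- F) S = - F S.
Proof. by rewrite ffunE. Qed.

Lemma g0E S : (0 : gr) S = 0.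
Proof. by rewrite ffunE. Qed.

Lemma g1E S : (1 : gr) S = (S == set0)%:R.
Proof. by rewrite ffunE. Qed.

Lemma gsumE (T : Type) (r : seq T) (P : pred T) (F : T -> gr) S :
  (\sum_(i <- r | P i) F i) S = \sum_(i <- r | P i) F i S.
Proof.
elim/big_rec2 : _ => [|i x y _ <-]; first exact: g0E.
by rewrite gaddE.
Qed.

Lemma gscaleAl c F G : c *: F * G = c *: (F * G).
Proof.
apply/ffunP => S; rewrite gscaleE !gmulE mulr_sumr; apply: eq_bigr => A _.
rewrite mulr_sumr; apply: eq_bigr => B _.
by rewrite gscaleE -(mulrA c) mulrCA.
Qed.

Lemma gscaleAr c F G : F * (c *: G) = c *: (F * G).
Proof.
apply/ffunP => S; rewrite gscaleE !gmulE mulr_sumr; apply: eq_bigr => A _.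
rewrite mulr_sumr; apply: eq_bigr => B _.
rewrite gscaleE; move: (F A) (G B) ((-1) ^+ _) => u v w.
by rewrite (mulrCA u) (mulrCA w).
Qed.

Definition gmon A : gr := [ffun S : {set I} => (S == A)%:R].

Lemma gmonE A S : gmon A S = (S == A)%:R.
Proof. by rewrite ffunE. Qed.

Lemma gmon_decomp F : F = \sum_A F A *: gmon A.
Proof.
apply/ffunP => S; rewrite gsumE (bigD1 S)//= big1 => [|A AS].
  by rewrite gscaleE gmonE eqxx mulr1 addr0.
by rewrite gscaleE gmonE eq_sym (negPf AS) mulr0.
Qed.

Lemma gmonM A B : gmon A * gmon B =
  if [disjoint A & B] then (-1) ^+ inversions A B *: gmon (A :|: B) else 0.
Proof.
apply/ffunP => S; rewrite gmulE (bigD1 A)//= [X in _ + X]big1 ?addr0; last first.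
  by move=> A' /negPf nA; rewrite big1// => B' _; rewrite gmonE nA mul0r mulr0.
rewrite big_mkcond (bigD1 B)//= big1 ?addr0; last first.
  by move=> B' /negPf nB; rewrite [gmon B _]gmonE nB !mulr0 if_same.
rewrite !gmonE !eqxx !mulr1; case: ifP => [/andP[-> /eqP ->]|].
  by rewrite gscaleE gmonE eqxx mulr1.
by case: ifP => //= _ E; rewrite ?g0E// gscaleE gmonE eq_sym E mulr0.
Qed.

(** Reduction of bilinear identities to monomials. Only monomials with nonzero coefficient have to
    be compared, so that a parity assumption on [F] becomes one on the degree of [A]. *)
Lemma gbilinear (phi psi : gr -> gr -> gr) :
  (forall G, {morph phi^~ G : F F' / F + F'}) -> (forall F, {morph phi F : G G' / G + G'}) ->
  (forall c F G, phi (c *: F) G = c *: phi F G) -> (forall c F G, phi F (c *: G) = c *: phi F G) ->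
  (forall G, {morph psi^~ G : F F' / F + F'}) -> (forall F, {morph psi F : G G' / G + G'}) ->
  (forall c F G, psi (c *: F) G = c *: psi F G) -> (forall c F G, psi F (c *: G) = c *: psi F G) ->
  forall F G, (forall A B, F A != 0 -> G B != 0 -> phi (gmon A) (gmon B) = psi (gmon A) (gmon B)) -> phi F G = psi F G.
Proof.
move=> p1 p2 p3 p4 q1 q2 q3 q4 F G H.
have z (f : gr -> gr -> gr) : (forall c F G, f (c *: F) G = c *: f F G) ->
    (forall c F G, f F (c *: G) = c *: f F G) -> (forall G, f 0 G = 0) /\ (forall F, f F 0 = 0).
  by move=> f1 f2; split => X; [have := f1 0 0 X|have := f2 0 X 0]; rewrite !scale0r.
have [p01 p02] := z phi p3 p4; have [q01 q02] := z psi q3 q4.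
rewrite {1 2}(gmon_decomp F) (big_morph (phi^~ G) (p1 G) (p01 G)) (big_morph (psi^~ G) (q1 G) (q01 G)).
apply: eq_bigr => A _; rewrite p3 q3.
have [->|FA] := eqVneq (F A) 0; first by rewrite !scale0r.
congr (_ *: _).
rewrite (gmon_decomp G) (big_morph _ (p2 _) (p02 _)) (big_morph _ (q2 _) (q02 _)).
apply: eq_bigr => B _; rewrite p4 q4.
have [->|GB] := eqVneq (G B) 0; first by rewrite !scale0r.
by rewrite H.
Qed.

(** Each pair of [A x B] is inverted in exactly one of the two orders, ties being excluded by
    disjointness. *)
Lemma inversions_sym A B : [disjoint A & B] -> (inversions A B + inversions B A = #|A| * #|B|)%N.
Proof.
move=> dAB; rewrite -cardsX.
have -> : inversions B A = #|[set p in setX A B | (enum_rank p.1 < enum_rank p.2)%N]|.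
  rewrite /inversions -(card_imset _ (can_inj (g := fun p => (p.2, p.1)) (f := fun p => (p.2, p.1)) (fun p => esym (surjective_pairing p)))); apply: eq_card => -[a b].
  apply/imsetP/idP => [[[b' a'] + [-> ->]]|]; first by rewrite !inE /= => /andP[/andP[-> ->] ->].
  by rewrite !inE /= => /andP[/andP[aA bB] ab]; exists (b, a) => //; rewrite !inE /= aA bB.
rewrite /inversions -cardsUI [X in (_ + X)%N](_ : _ = 0%N) ?addn0.
  apply: eq_card => -[a b]; rewrite !inE /= -andb_orr.
  case: (boolP (a \in A)) => //= aA; case: (boolP (b \in B)) => //= bB.
  rewrite -neq_ltn; apply/negP => /eqP/val_inj/enum_rank_inj E.
  by move: (disjointFr dAB aA); rewrite -E bB.
apply/eqP; rewrite cards_eq0; apply/eqP/setP => -[a b]; rewrite !inE /=.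
by case: ltngtP; rewrite ?andbF.
Qed.

(** The grading automorphism. With it Leibniz' rule becomes one bilinear identity for arbitrary
    factors, of which the even and the odd case are specializations. *)
Definition gpar F : gr := [ffun S : {set I} => (-1) ^+ #|S| * F S].

Definition geven F : Prop := forall S : {set I}, odd #|S| -> F S = 0.
Definition godd F : Prop := forall S : {set I}, ~~ odd #|S| -> F S = 0.

Lemma gpar_even F : geven F -> gpar F = F.
Proof.
move=> eF; apply/ffunP => S; rewrite ffunE -signr_odd.
by case: (boolP (odd #|S|)) => oS; [rewrite eF// mulr0|rewrite mul1r].
Qed.

Lemma gpar_odd F : godd F -> gpar F = - F.
Proof.
move=> eF; apply/ffunP => S; rewrite ffunE -signr_odd goppE.
by case: (boolP (odd #|S|)) => oS; [rewrite mulN1r|rewrite eF// mulr0 oppr0].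
Qed.

Lemma geven_comm F G : geven F -> F * G = G * F.
Proof.
move=> eF; apply: (gbilinear (phi := fun F G => F * G) (psi := fun F G => G * F)).
- by move=> ? ? ?; rewrite mulrDl.
- by move=> ? ? ?; rewrite mulrDr.
- by move=> *; rewrite gscaleAl.
- by move=> *; rewrite gscaleAr.
- by move=> ? ? ?; rewrite mulrDr.
- by move=> ? ? ?; rewrite mulrDl.
- by move=> *; rewrite gscaleAr.
- by move=> *; rewrite gscaleAl.
- move=> A B FA GB; rewrite !gmonM disjoint_sym setUC.
  case: ifP => // dAB; congr (_ *: _).
  have oA : ~~ odd #|A| by apply: contra FA => /eF ->.
  rewrite -signr_odd -[RHS]signr_odd; congr (_ ^+ nat_of_bool _).
  have := inversions_sym dAB => /(congr1 odd); rewrite oddD oddM.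
  by case: (odd #|A|) (odd #|B|) oA => -[] // _; rewrite andbF; repeat (match goal with |- context [odd ?x] => generalize (odd x); case end).
Qed.

Lemma gevenD F G : geven F -> geven G -> geven (F + G).
Proof. by move=> eF eG S oS; rewrite gaddE eF// eG// addr0. Qed.

Lemma gevenN F : geven F -> geven (- F).
Proof. by move=> eF S oS; rewrite goppE eF// oppr0. Qed.

Lemma gevenZ c F : geven F -> geven (c *: F).
Proof. by move=> eF S oS; rewrite gscaleE eF// mulr0. Qed.

Lemma geven0 : geven 0. Proof. by move=> S _; rewrite g0E. Qed.

Lemma geven1 : geven 1.
Proof. by move=> S; rewrite g1E; case: eqP => // ->; rewrite cards0. Qed.

Lemma gevenM F G : geven F -> geven G -> geven (F * G).
Proof.
move=> eF eG S oS; rewrite gmulE big1// => A _; rewrite big1// => B /andP[dAB /eqP E].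
move: oS; rewrite -E cardsU disjoint_setI0// cards0 subn0 oddD.
case: (boolP (odd #|A|)) => oA; first by rewrite eF// mul0r mulr0.
by case: (boolP (odd #|B|)) => oB // _; rewrite eG// !mulr0.
Qed.

Lemma godd_oddM F G : godd F -> godd G -> geven (F * G).
Proof.
move=> eF eG S oS; rewrite gmulE big1// => A _; rewrite big1// => B /andP[dAB /eqP E].
move: oS; rewrite -E cardsU disjoint_setI0// cards0 subn0 oddD.
case: (boolP (odd #|A|)) => oA; last by rewrite eF// mul0r mulr0.
by case: (boolP (odd #|B|)) => oB // _; rewrite eG// !mulr0.
Qed.

Lemma godd_gen k : godd (ggen R k).
Proof. by move=> S; rewrite ffunE; case: eqP => // ->; rewrite cards1. Qed.

Lemma ggenE k : ggen R k = gmon [set k].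
Proof. by []. Qed.

Lemma ggen_sq k : ggen R k * ggen R k = 0.
Proof. by rewrite !ggenE gmonM -setI_eq0 setIid; case: eqP => // /setP/(_ k); rewrite !inE eqxx. Qed.

Lemma ggen_anti k l : ggen R k * ggen R l = - (ggen R l * ggen R k).
Proof.
have [->|kl] := eqVneq k l; first by rewrite ggen_sq oppr0.
rewrite !ggenE !gmonM.
have d : [disjoint [set k] & [set l]].
  by rewrite -setI_eq0; apply/eqP/setP => j; rewrite !inE; apply/negP => /andP[/eqP -> /eqP E]; rewrite E eqxx in kl.
have d' := d; rewrite disjoint_sym in d'.
rewrite d d' setUC -scaleNr; congr (_ *: _).
have := inversions_sym d; rewrite !cards1 muln1.
by case: (inversions [set k] [set l]) => [|[|]] //=; case: (inversions _ _) => [|[|]] //= _; rewrite ?opprK.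
Qed.

Lemma gderD k F G : gder k (F + G) = gder k F + gder k G.
Proof.
apply/ffunP => S; rewrite gaddE !ffunE; case: ifP => _; first by rewrite addr0.
by rewrite mulrDr.
Qed.

Lemma gderZ k c F : gder k (c *: F) = c *: gder k F.
Proof.
apply/ffunP => S; rewrite gscaleE !ffunE; case: ifP => _; first by rewrite mulr0.
by rewrite mulrCA.
Qed.

Lemma gder_mon k A : gder k (gmon A) =
  if k \in A then (-1) ^+ inversions [set k] (A :\ k) *: gmon (A :\ k) else 0.
Proof.
apply/ffunP => S; rewrite ffunE; case: ifP => kS.
  case: ifP => kA; rewrite ?g0E// gscaleE gmonE; case: eqP => [E|]; last by rewrite mulr0.
  by rewrite E !inE eqxx in kS.
rewrite gmonE; case: ifP => kA; last first.
  case: eqP => [E|]; last by rewrite mulr0 g0E.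
  by rewrite -E !inE eqxx in kA.
rewrite gscaleE gmonE; have -> : (k |: S == A) = (S == A :\ k).
  apply/eqP/eqP => [<-|->]; last by rewrite setD1K.
  by rewrite setU1K// kS.
by case: eqP => [->//|_]; rewrite !mulr0.
Qed.

Lemma gparD F G : gpar (F + G) = gpar F + gpar G.
Proof. by apply/ffunP => S; rewrite gaddE !ffunE mulrDr. Qed.

Lemma gparZ c F : gpar (c *: F) = c *: gpar F.
Proof. by apply/ffunP => S; rewrite gscaleE !ffunE mulrCA. Qed.

Lemma gpar_mon A : gpar (gmon A) = (-1) ^+ #|A| *: gmon A.
Proof.
by apply/ffunP => S; rewrite gscaleE !ffunE; case: eqP => [->//|_]; rewrite !mulr0.
Qed.

Lemma signr_eq m n : odd m = odd n -> (-1) ^+ m = (-1) ^+ n :> R.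
Proof. by move=> E; rewrite -signr_odd E signr_odd. Qed.

(** Both sides are bilinear, so monomials suffice; there the identity is a parity count of
    inversions. *)
Lemma gderM k F G : gder k (F * G) = gder k F * G + gpar F * gder k G.
Proof.
apply: (gbilinear (phi := fun F G => gder k (F * G)) (psi := fun F G => gder k F * G + gpar F * gder k G)).
- by move=> ? ? ?; rewrite mulrDl gderD.
- by move=> ? ? ?; rewrite mulrDr gderD.
- by move=> *; rewrite gscaleAl gderZ.
- by move=> *; rewrite gscaleAr gderZ.
- by move=> ? ? ?; rewrite gderD gparD !mulrDl addrACA.
- by move=> ? ? ?; rewrite gderD !mulrDr addrACA.
- by move=> *; rewrite gderZ gparZ !gscaleAl scalerDr.
- by move=> *; rewrite gderZ !gscaleAr scalerDr.
move=> A B _ _; rewrite !gder_mon gpar_mon !gmonM.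
have kd (C : {set I}) : k \notin C -> [disjoint [set k] & C].
  by move=> kC; rewrite disjoints1.
have sgn1 (C : {set I}) : k \in C -> C = [set k] :|: C :\ k by move=> kC; rewrite setD1K.
have kD (C : {set I}) : k \notin C :\ k by rewrite !inE eqxx.
have dinv (C : {set I}) : k \in C -> (inversions [set k] (C :\ k) + inversions (C :\ k) [set k] = #|C :\ k|)%N.
  by move=> kC; rewrite inversions_sym ?kd// cards1 mul1n.
case: (boolP [disjoint A & B]) => dAB.
  rewrite gderZ gder_mon inE; case: (boolP (k \in A)) => kA /=.
    have kB : k \notin B by rewrite (disjointFr dAB kA).
    rewrite (negPf kB) mulr0 addr0 gscaleAl gmonM.
    have d' : [disjoint A :\ k & B] by apply: disjointWl dAB; exact: subsetDl.
    have E : (A :|: B) :\ k = A :\ k :|: B by rewrite setDUl [B :\ k](_ : _ = B)//; apply/setDidPl; rewrite disjoint_sym kd.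
    rewrite d' E !scalerA -!exprD; congr (_ *: _); apply: signr_eq.
    rewrite {1}(sgn1 A kA) inversionsUl ?kd// inversionsUr//.
    by rewrite !oddD; repeat (match goal with |- context [odd ?x] => generalize (odd x); case end).
  rewrite mul0r add0r; case: (boolP (k \in B)) => kB; last by rewrite mulr0 scaler0.
  have d' : [disjoint A & B :\ k] by apply: disjointWr dAB; exact: subsetDl.
  have E : (A :|: B) :\ k = A :|: B :\ k by rewrite setDUl [A :\ k](_ : _ = A)//; apply/setDidPl; rewrite disjoint_sym kd.
  rewrite gscaleAl gscaleAr gmonM d' E !scalerA -!exprD; congr (_ *: _); apply: signr_eq.
  rewrite {1}(sgn1 B kB) inversionsUr ?kd// inversionsUr// !oddD.
  have := inversions_sym (kd A kA) => /(congr1 odd); rewrite cards1 mul1n oddD => <-.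
  by repeat (match goal with |- context [odd ?x] => generalize (odd x); case end).
(* The monomials share a generator, so the product vanishes. If they share one other than [k], both
   terms on the right vanish as well; if [A] and [B] meet exactly in [k], these terms are multiples
   of the same monomial with opposite signs. *)
have -> : gder k 0 = 0 :> gr by have := gderZ k 0 0; rewrite !scale0r.
have E : A :&: (B :\ k) = (A :\ k) :&: B by apply/setP => j; rewrite !inE; case: (j == k) (j \in A) => -[].
case: (boolP [disjoint A :\ k & B]) => d'; last first.
  have d'' : ~~ [disjoint A & B :\ k] by rewrite -setI_eq0 E setI_eq0.
  have -> : (if k \in A then (-1) ^+ inversions [set k] (A :\ k) *: gmon (A :\ k) else 0) * gmon B = 0 :> gr.
    by case: ifP => _; rewrite ?mul0r// gscaleAl gmonM (negPf d') scaler0.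
  rewrite add0r gscaleAl; case: ifP => _; first by rewrite gscaleAr gmonM (negPf d'') !scaler0.
  by rewrite mulr0 scaler0.
have d'' : [disjoint A & B :\ k] by rewrite -setI_eq0 E setI_eq0.
have kAB : k \in A :&: B.
  move: dAB; rewrite -setI_eq0 => /set0Pn[j jAB]; have [<-//|jk] := eqVneq j k.
  by move: d'; rewrite -setI_eq0 => /eqP/setP/(_ j); move: jAB; rewrite !inE jk /= => ->.
move: kAB; rewrite inE => /andP[kA kB].
rewrite kA kB gscaleAl gscaleAl gscaleAr !gmonM d' d''.
have -> : A :\ k :|: B = A :|: B.
  by apply/setP => j; rewrite !inE; case: eqP => //= ->; rewrite kB orbT.
have -> : A :|: B :\ k = A :|: B.
  by apply/setP => j; rewrite !inE; case: eqP => //= ->; rewrite kA.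
rewrite !scalerA -!exprD -scalerDl.
set m := (_ + _)%N; set n := (_ + _)%N.
suff E' : odd m = ~~ odd n.
  by rewrite -(signr_odd _ m) -(signr_odd _ n) E'; case: (odd n); rewrite ?expr1 ?expr0 ?addrN ?addNr scale0r.
have mE : m = (inversions [set k] (A :\ k) + (inversions (A :\ k) [set k] + inversions (A :\ k) (B :\ k)))%N.
  by rewrite /m {1}(sgn1 B kB) inversionsUr ?kd.
have nE : n = (#|A| + (inversions [set k] (B :\ k) + (inversions [set k] (B :\ k) + inversions (A :\ k) (B :\ k))))%N.
  by rewrite /n -addnA; congr (_ + (_ + _))%N; rewrite {1}(sgn1 A kA) inversionsUl ?kd.
rewrite mE nE addnA (dinv A kA) (cardsD1 k A) kA !oddD [odd true]/=.
by repeat (match goal with |- context [odd ?x] => generalize (odd x); case end).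
Qed.

Lemma gder0 k : gder k 0 = 0 :> gr.
Proof. by have := gderZ k 0 0; rewrite !scale0r. Qed.

Lemma gder1 k : gder k 1 = 0 :> gr.
Proof.
have := gder_mon k set0; rewrite inE; exact.
Qed.

Lemma gder_gen k l : gder k (ggen R l) = (k == l)%:R.
Proof.
rewrite ggenE gder_mon inE; case: eqP => [->|_] //=.
by rewrite setDv inversions0r expr0 scale1r.
Qed.

Lemma gder_top k F : gder k F setT = 0.
Proof. by rewrite ffunE inE. Qed.

Lemma gderM_even k F G : geven F -> gder k (F * G) = gder k F * G + F * gder k G.
Proof. by move=> eF; rewrite gderM gpar_even. Qed.

Lemma gderM_odd k F G : godd F -> gder k (F * G) = gder k F * G - F * gder k G.
Proof. by move=> eF; rewrite gderM gpar_odd// mulNr. Qed.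

(** The filtration by powers of the ideal of the generators; it is what bounds the nilpotency order
    of souls. *)
Definition lowdeg n F : Prop := forall S : {set I}, (#|S| < n)%N -> F S = 0.

Lemma lowdegM m n F G : lowdeg m F -> lowdeg n G -> lowdeg (m + n) (F * G).
Proof.
move=> lF lG S lS; rewrite gmulE big1// => A _; rewrite big1// => B /andP[dAB /eqP E].
have [Am|mA] := ltnP #|A| m; first by rewrite lF// mul0r mulr0.
rewrite lG ?mulr0//; move: lS; rewrite -E cardsU disjoint_setI0// cards0 subn0.
by move=> H; rewrite -(ltn_add2l #|A|) (leq_trans H)// leq_add2r.
Qed.

Lemma lowdegX n F : lowdeg 1 F -> lowdeg n (F ^+ n).
Proof.
move=> lF; elim: n => [|n ih]; first by move=> S.
by rewrite exprS -addn1 addnC; exact: lowdegM.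
Qed.

Lemma lowdeg_eq0 n F : (#|I| < n)%N -> lowdeg n F -> F = 0.
Proof.
move=> In lF; apply/ffunP => S; rewrite g0E lF//.
by apply: leq_ltn_trans In; exact: max_card.
Qed.

Lemma gbodyM F G : gbody (F * G) = gbody F * gbody G.
Proof.
rewrite /gbody gmulE (bigD1 set0)//= [X in _ + X]big1 ?addr0 => [|A nA]; last first.
  rewrite big1// => B /andP[_ /eqP E]; exfalso; move/eqP: nA; apply.
  by apply/eqP; rewrite -subset0 -E subsetUl.
rewrite (big_pred1 set0) => [|B]; first by rewrite inversions0l mul1r.
by rewrite set0U disjoints_subset sub0set.
Qed.

End GrassmannAlgebra.

Section Berezin.
Variables (R : comNzRingType) (Lam : finType).
Local Notation gr := (grassmann R (Defs.coord Lam)).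
Implicit Types (F G : gr) (i j : Lam) (s : seq Lam).

(** Integrates out the sites of [s] only, so that the full Berezin integral can be computed by
    induction on the sites. *)
Definition berezins s F : gr := foldr (fun i G => gder (inr i) (gder (inl i) G)) F s.

Lemma berezinsD s F G : berezins s (F + G) = berezins s F + berezins s G.
Proof. by elim: s => //= i s ->; rewrite !gderD. Qed.

Lemma berezinsZ s c F : berezins s (c *: F) = c *: berezins s F.
Proof. by elim: s => //= i s ->; rewrite !gderZ. Qed.

Definition gtop F : R := gbody (berezins (enum Lam) F).

Lemma gtopD F G : gtop (F + G) = gtop F + gtop G.
Proof. by rewrite /gtop berezinsD /gbody gaddE. Qed.

Lemma gtopZ c F : gtop (c *: F) = c * gtop F.
Proof. by rewrite /gtop berezinsZ /gbody gscaleE. Qed.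

Lemma gtop0 : gtop 0 = 0.
Proof. by have := gtopZ 0 0; rewrite scale0r mul0r. Qed.

Lemma gtop_sum (T : Type) (r : seq T) (P : pred T) (F : T -> gr) :
  gtop (\sum_(i <- r | P i) F i) = \sum_(i <- r | P i) gtop (F i).
Proof. exact: (big_morph _ gtopD gtop0). Qed.

(* Iterated derivatives kill a monomial or lower its degree, so only the top one survives. *)
Lemma gtopE F : gtop F = gtop (gmon R setT) * F setT.
Proof.
have H S : S != setT -> gtop (gmon R S) = 0.
  move=> ST; rewrite /gtop /gbody.
  (* A nonzero coefficient at [T] after differentiation at the sites of [s] traces back to the
     coefficient at [T] enlarged by both generators of each of these sites. *)
  have K s : uniq s -> forall T : {set Defs.coord Lam}, (berezins s (gmon R S)) T != 0 ->
     S = T :|: [set k   : Defs.coord Lam | match k with inl i => i \in s | inr i => i \in s end].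
    elim: s => [_ T|i s ih /= /andP[is_ us] T].
      rewrite /= gmonE; case: (T =P S) => [<- _|_]; last by rewrite eqxx.
      by apply/setP => -[j|j]; rewrite !inE orbF.
    rewrite ffunE; case: ifP => iT; first by rewrite eqxx.
    rewrite ffunE; case: ifP => iT'; first by rewrite mulr0 eqxx.
    have [->|nz _] := eqVneq (berezins s (gmon R S) (inl i |: (inr i |: T))) 0.
      by rewrite !mulr0 eqxx.
    by rewrite (ih us _ nz); apply/setP => -[j|j]; rewrite !inE;
      [change (inl j == inl i :> Defs.coord Lam) with (j == i)|change (inr j == inr i :> Defs.coord Lam) with (j == i)];
      case: (j == i); case: (_ \in T); rewrite ?orbT ?orbF.
  apply/eqP; apply: contraT => nz; move: ST; rewrite (K _ (enum_uniq _) _ nz).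
  by case/eqP; apply/setP => -[j|j]; rewrite !inE mem_enum.
rewrite {1}(gmon_decomp F) gtop_sum (bigD1 setT)//= big1 ?addr0 => [|S /H E].
  by rewrite gtopZ mulrC.
by rewrite gtopZ E mulr0.
Qed.

Lemma gtop_der k F : gtop (gder k F) = 0.
Proof. by rewrite gtopE gder_top mulr0. Qed.

End Berezin.

From mathcomp Require Import all_classical all_reals all_analysis.
From mathcomp Require Import measurable_realfun.
From mathcomp Require Import ring lra.

Import numFieldNormedType.Exports.

Local Open Scope classical_set_scope.
Local Open Scope ring_scope.

(** * One-sided calculus on an interval *)

Section OneVariable.
Variable R : realType.
Implicit Types (f F : R -> R) (a b t : R).
Local Notation mu := (@lebesgue_measure R).

(** One-sided notions, because a jump path is only right-continuous and its local times are only
    right-differentiable. Increments [h = 0] are included, which spares a case distinction in the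
    uses. *)
Definition rcont f t : Prop :=
  forall e : R, 0 < e ->
  exists2 d : R, 0 < d & forall h : R, 0 <= h < d -> `|f (t + h) - f t| <= e.

Definition econt f a b : Prop :=
  forall t, a <= t <= b -> forall e : R, 0 < e ->
  exists2 d : R, 0 < d & forall s, a <= s <= b -> `|s - t| < d -> `|f s - f t| <= e.

Definition rderiv F t (l : R) : Prop :=
  forall e : R, 0 < e ->
  exists2 d : R, 0 < d & forall h : R, 0 <= h < d -> `|F (t + h) - F t - h * l| <= e * h.

(** The class of integrands used throughout; it contains functions of a jump path and is closed
    under sums and products. *)
Definition rcb a b f : Prop :=
  (exists B : R, forall t, a <= t <= b -> `|f t| <= B) /\
  forall t, a <= t < b -> rcont f t.

(** Continuous induction: the times up to which [F] stays in the cone of slope [e] have a supremum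
    [m]. Continuity puts [m] itself in the cone, and the vanishing right derivative carries the cone
    past [m] unless [m = b]. *)
Lemma rderiv0_const F a b : a <= b -> econt F a b ->
  (forall t, a <= t < b -> rderiv F t 0) -> F b = F a.
Proof.
move=> ab cF dF.
suff H e : 0 < e -> `|F b - F a| <= e * (b - a).
  apply/eqP; rewrite -subr_eq0 -normr_le0; apply/ler_addgt0Pl => e e0.
  rewrite addr0; have d0 : 0 < b - a + 1 by lra.
  have := H (e / (b - a + 1)) ltac:(by rewrite divr_gt0).
  move=> /le_trans; apply; rewrite mulrAC ler_pdivrMr//; nra.
move=> e0.
pose A := [set t | a <= t <= b /\ forall s, a <= s <= t -> `|F s - F a| <= e * (s - a)].
have Aa : A a.
  split; first by rewrite lexx.
  by move=> s; rewrite -eq_le => /eqP <-; rewrite !subrr normr0 mulr0.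
have hA : has_sup A by split; [exists a|exists b => t [+ _]; lra].
set m := sup A.
have ma : a <= m by apply: sup_upper_bound.
have mb : m <= b by apply: ge_sup; [exists a|move=> t [+ _]; lra].
have lt_m s : a <= s -> s < m -> `|F s - F a| <= e * (s - a).
  move=> sa sm; have [t [At1 At2] st] := sup_gt (ex_intro _ a Aa) sm.
  by apply: At2; rewrite sa ltW.
have Fm : `|F m - F a| <= e * (m - a).
  have [->|neq] := eqVneq m a; first by rewrite !subrr normr0 mulr0.
  have am : a < m by rewrite lt_neqAle eq_sym neq.
  apply/ler_addgt0Pl => e' e'0.
  have [d d0 dP] := cF m ltac:(lra) e' e'0.
  pose s := Num.max a (m - d / 2).
  have sP : a <= s /\ m - d / 2 <= s by rewrite /s; split; rewrite le_max lexx ?orbT.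
  have sm : s < m by rewrite /s gt_max am/=; lra.
  have /= := dP s ltac:(lra) ltac:(rewrite ltr_norml; lra).
  have := lt_m s ltac:(lra) sm.
  move=> h1 h2.
  have -> : F m - F a = (F s - F a) - (F s - F m) by lra.
  apply: le_trans (ler_normB _ _) _; nra.
have [<-//|neq] := eqVneq m b.
have {}mb : m < b by rewrite lt_neqAle neq.
have [d d0 dP] := dF m ltac:(lra) e e0.
pose t := Num.min b (m + d / 2).
have tP : t <= b /\ t <= m + d / 2 by rewrite /t; split; rewrite ge_min lexx ?orbT.
have tm : m < t by rewrite /t lt_min mb/=; lra.
suff At : A t by have := sup_upper_bound hA At; rewrite -/m; lra.
split; first lra.
move=> s /andP[sa st]; have [sm|ms] := ltP s m; first exact: lt_m.
have /= := dP (s - m) ltac:(lra).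
rewrite mulr0 subr0 (addrC m) subrK => h1.
have -> : F s - F a = (F s - F m) + (F m - F a) by lra.
apply: le_trans (ler_normD _ _) _; nra.
Qed.

Lemma rcontD f g t : rcont f t -> rcont g t -> rcont (fun s => f s + g s) t.
Proof.
move=> cf cg e e0; have [d1 d10 H1] := cf (e / 2) ltac:(lra).
have [d2 d20 H2] := cg (e / 2) ltac:(lra).
exists (Num.min d1 d2); first by rewrite lt_min d10.
move=> h /andP[h0]; rewrite lt_min => /andP[h1 h2].
have := H1 h ltac:(by rewrite h0); have := H2 h ltac:(by rewrite h0).
by rewrite !ler_norml; lra.
Qed.

Lemma rcont_cst (c t : R) : rcont (fun=> c) t.
Proof. by move=> e e0; exists 1 => // h _; rewrite subrr normr0 ltW. Qed.

Lemma rcont_near_cst f t (d : R) : 0 < d ->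
  (forall h, 0 <= h < d -> f (t + h) = f t) -> rcont f t.
Proof.
move=> d0 dP e e0; exists d => // h hd.
by rewrite dP// subrr normr0 ltW.
Qed.

Lemma rcontM f g t : rcont f t -> rcont g t -> rcont (fun s => f s * g s) t.
Proof.
move=> cf cg e e0.
pose B := `|f t| + `|g t| + 2.
have B0 : 0 < B by rewrite /B; have := normr_ge0 (f t); have := normr_ge0 (g t); lra.
pose e' := Num.min 1 (e / (2 * B)).
have e'0 : 0 < e' by rewrite lt_min ltr01 divr_gt0// mulr_gt0.
have [d1 d10 H1] := cf e' e'0.
have [d2 d20 H2] := cg e' e'0.
exists (Num.min d1 d2); first by rewrite lt_min d10.
move=> h /andP[h0]; rewrite lt_min => /andP[h1 h2].
have {H1} H1 := H1 h ltac:(by rewrite h0); have {H2} H2 := H2 h ltac:(by rewrite h0).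
have -> : f (t + h) * g (t + h) - f t * g t =
   (f (t + h) - f t) * (g (t + h) - g t) + (f (t + h) - f t) * g t + f t * (g (t + h) - g t) by lra.
have e'1 : e' <= 1 by rewrite /e' ge_min lexx.
have e'2 : e' * (2 * B) <= e by rewrite -ler_pdivlMr ?mulr_gt0// /e' ge_min lexx orbT.
apply: le_trans (ler_normD _ _) _; rewrite normrM.
apply: le_trans (lerD (ler_normD _ _) (lexx _)) _; rewrite !normrM.
move: H1 H2 (normr_ge0 (f t)) (normr_ge0 (g t)) (normr_ge0 (f (t + h) - f t)) (normr_ge0 (g (t + h) - g t)).
rewrite /B in e'2 *; nra.
Qed.

(** Step function sampling [f] at the right end of each cell: the sample point lies to the right of
    [x], which is the side on which [f] is continuous. *)
Definition rstep a b f (n : nat) (x : R) : R :=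
  \sum_(k < n.+1) f (a + k.+1%:R * ((b - a) / n.+1%:R)) *
    \1_(`](a + k%:R * ((b - a) / n.+1%:R)), (a + k.+1%:R * ((b - a) / n.+1%:R))]%classic) x.

Lemma rstepE a b f n x : a < x <= b ->
  exists y, [/\ x <= y, y <= b, y <= x + (b - a) / n.+1%:R & rstep a b f n x = f y].
Proof.
move=> /andP[ax xb].
set w := (b - a) / n.+1%:R.
have n0 : 0 < n.+1%:R :> R by rewrite ltr0n.
have w0 : 0 < w by rewrite divr_gt0//; lra.
have wb : n.+1%:R * w = b - a by rewrite /w mulrC divfK// gt_eqF.
have exk : exists k, x <= a + k.+1%:R * w by exists n; rewrite wb; lra.
have [k kP kmin] := ex_minnP exk.
have kn : (k < n.+1)%N by rewrite ltnS; apply: kmin; rewrite wb; lra.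
have kx : a + k%:R * w < x.
  case: k kP kmin kn => [|k] kP kmin kn; first by rewrite mul0r addr0.
  by rewrite ltNge; apply/negP => /kmin; rewrite ltnn.
exists (a + k.+1%:R * w); split => //.
- have : k.+1%:R * w <= n.+1%:R * w by rewrite ler_pM2r// ler_nat.
  by rewrite wb; lra.
- by rewrite -natr1 mulrDl mul1r; lra.
- rewrite /rstep (bigD1 (Ordinal kn))//= -/w big1 ?addr0; last first.
    move=> i /eqP ik; rewrite indicE; case: (boolP (_ \in _)); last by rewrite mulr0.
    rewrite inE/= in_itv/= => /andP[i1 i2]; exfalso; apply: ik; apply/val_inj => /=.
    apply/eqP; rewrite eqn_leq; apply/andP; split.
      rewrite leqNgt; apply/negP => ki.
      have : k.+1%:R * w <= i%:R * w by rewrite ler_pM2r// ler_nat.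
      lra.
    exact: kmin.
  by rewrite indicE mem_set ?mulr1//= in_itv/= kx.
Qed.

Lemma rstep_cvg a b f x : a < x <= b -> (a <= x < b -> rcont f x) ->
  rstep a b f n x @[n --> \oo] --> f x.
Proof.
move=> axb cf; have [bx|xb] := leP b x.
  have xb : x = b by lra.
  rewrite (_ : rstep _ _ _ ^~ x = fun=> f x); first exact: cvg_cst.
  apply/funext => n; have [y [y1 y2 _ ->]] := rstepE f n axb.
  by congr f; lra.
apply/cvgrPdist_le => e e0.
have [d d0 dP] := cf ltac:(lra) e e0.
have := @cvg_harmonic R => /cvgrPdist_lt /(_ (d / (b - a)) ltac:(rewrite divr_gt0//; lra)).
apply: filterS => n; rewrite /harmonic/= sub0r normrN gtr0_norm ?invr_gt0//.
move=> nd; have [y [y1 y2 y3 ->]] := rstepE f n axb.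
have wd : (b - a) / n.+1%:R < d by rewrite mulrC -ltr_pdivlMr//; lra.
move: ((b - a) / n.+1%:R) y3 wd => w y3 wd.
have := dP (y - x) ltac:(lra).
by rewrite distrC (addrC x) subrK.
Qed.

Lemma measurable_rstep D a b f n : measurable D -> measurable_fun D (rstep a b f n).
Proof.
move=> mD; apply: (measurable_funS measurableT) => //.
rewrite /rstep; apply: measurable_sum => k.
by apply: measurable_funM => //; apply: measurable_indic.
Qed.

Lemma rcb_measurable a b f : rcb a b f -> measurable_fun `]a, b] f.
Proof.
move=> [_ cf]; apply: (@measurable_fun_cvg _ _ _ _ (fun n => rstep a b f n)).
  by move=> n; apply: measurable_rstep.
by move=> /= x; rewrite in_itv/= => xab; apply: rstep_cvg => // ?; exact: cf.
Qed.

Lemma mbd_integrable d (T : measurableType d) (m : {measure set T -> \bar R}) (D : set T)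
    (g : T -> R) (B : R) : measurable D -> (m D < +oo)%E -> measurable_fun D g ->
  (forall x, D x -> `|g x| <= B) -> m.-integrable D (EFin \o g).
Proof.
move=> mD finD mg gB; apply: measurable_bounded_integrable => //=.
by exists B; split; rewrite ?num_real// => x /ltW Bx t Dt; apply: le_trans Bx; exact: gB.
Qed.

Lemma cst_integrable d (T : measurableType d) (m : {measure set T -> \bar R}) (D : set T) (k : R) :
  measurable D -> (m D < +oo)%E -> m.-integrable D (EFin \o cst k).
Proof. by move=> mD finD; apply: (@mbd_integrable _ _ _ _ _ `|k|). Qed.

Lemma bnd_integrable a b f : measurable_fun `]a, b] f ->
  (exists B : R, forall t, a <= t <= b -> `|f t| <= B) -> mu.-integrable `[a, b] (EFin \o f).
Proof.
move=> mf [B fB].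
have [ba|ab] := leP b a.
  have [->|neq] := eqVneq a b.
    rewrite set_itv1; apply/integrableP; split; first exact: measurable_fun_set1.
    by rewrite integral_set1.
  by rewrite set_itv_ge ?bnd_simp -?ltNge ?lt_neqAle ?ba ?andbT 1?eq_sym//; exact: integrable_set0.
apply: measurable_bounded_integrable => //=.
- by rewrite lebesgue_measure_itv/= lte_fin ab -EFinD ltry.
- exact/measurable_fun_itv_obnd_cbndP.
- exists B; split; rewrite ?num_real// => x xB t /=; rewrite in_itv/= => tab.
  by apply: le_trans (ltW xB); apply: fB.
Qed.

Lemma rcb_integrable a b f : rcb a b f -> mu.-integrable `[a, b] (EFin \o f).
Proof. by move=> cf; apply: bnd_integrable; [exact: rcb_measurable|case: cf]. Qed.

Local Notation rint f a b := (\int[mu]_(x in `[a, b]) f x).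

Lemma rint_dist a b f (c e : R) : a <= b -> rcb a b f ->
  (forall t, a <= t <= b -> `|f t - c| <= e) -> `|rint f a b - (b - a) * c| <= e * (b - a).
Proof.
move=> ab cf fc.
have mab : fine (mu `[a, b]%classic) = b - a.
  rewrite lebesgue_measure_itv/= lte_fin; case: ltP => //= ba; lra.
have fin : (mu `[a, b]%classic < +oo)%E.
  by rewrite lebesgue_measure_itv/=; case: ifP => // _; rewrite -EFinD ltry.
have ic k : mu.-integrable `[a, b] (EFin \o cst k) by exact: cst_integrable.
have -> : (b - a) * c = \int[mu]_(x in `[a, b]) c by rewrite Rintegral_cst// mab mulrC.
have If := rcb_integrable cf.
have Ifc : mu.-integrable `[a, b] (EFin \o (fun t => f t - c)).
  case: cf => -[B fB] cf; apply: rcb_integrable; split.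
    exists (B + `|c|) => t /fB; have := ler_normB (f t) c; lra.
  by move=> t /cf H; apply: rcontD => //; exact: rcont_cst.
rewrite -RintegralB//; last exact: ic.
apply: le_trans (le_normr_Rintegral _ _) _ => //.
rewrite -[X in e * X]mab -Rintegral_cst//; apply: le_Rintegral => //.
- exact: (integrable_norm Ifc).
- exact: ic.
Qed.

Lemma rint_split a b c f : a <= b <= c -> rcb a c f -> rint f a c = rint f a b + rint f b c.
Proof.
move=> /andP[ab bc] cf.
have If := rcb_integrable cf.
have := @Rintegral_itvB R f (BLeft a) (BRight c) b If.
rewrite !bnd_simp => /(_ ab bc) => H.
rewrite -[LHS](subrK (rint f a b)) addrC H Rintegral_itv_obnd_cbnd//.
by apply: integrableS If => //; apply: subset_itvr; rewrite bnd_simp.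
Qed.

Lemma rcb_sub a b c d f : a <= c -> d <= b -> rcb a b f -> rcb c d f.
Proof.
move=> ac db [[B fB] cf]; split; first by exists B => t tcd; apply: fB; lra.
by move=> t tcd; apply: cf; lra.
Qed.

Lemma rint_pt a f : rint f a a = 0.
Proof. by rewrite set_itv1 Rintegral_set1. Qed.

Lemma rint_rderiv a b f t : rcb a b f -> a <= t < b -> rderiv (fun s => rint f a s) t (f t).
Proof.
move=> cf tab e e0; have [d d0 dP] := cf.2 t tab e e0.
exists (Num.min d (b - t)); first by rewrite lt_min d0; lra.
move=> h /andP[h0]; rewrite lt_min => /andP[hd hb].
rewrite (@rint_split a t); [|lra|apply: rcb_sub cf; lra].
rewrite (addrC (rint f a t)) addrK.
have -> : h * f t = (t + h - t) * f t by lra.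
have -> : e * h = e * (t + h - t) by lra.
apply: rint_dist; [lra|apply: rcb_sub cf; lra|].
move=> s st; have := dP (s - t) ltac:(lra).
by rewrite (addrC t) subrK.
Qed.

Lemma rint_econt a b f : rcb a b f -> econt (fun s => rint f a s) a b.
Proof.
move=> cf t tab e e0; have [[B fB] _] := cf.
have B0 : 0 <= B by apply: le_trans (fB t tab).
exists (e / (B + 1)); first by rewrite divr_gt0//; lra.
have H s1 s2 : a <= s1 <= b -> a <= s2 <= b -> s1 <= s2 -> s2 - s1 < e / (B + 1) -> `|rint f a s2 - rint f a s1| <= e.
  move=> s1ab s2ab s12 sd; rewrite (@rint_split a s1); [|lra|apply: rcb_sub cf; lra].
  rewrite (addrC (rint f a s1)) addrK.
  have := @rint_dist s1 s2 f 0 B s12 ltac:(apply: rcb_sub cf; lra).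
  rewrite mulr0 subr0 => /(_ _)/le_trans; apply.
    by move=> u us; rewrite subr0; apply: fB; lra.
  move: sd; rewrite ltr_pdivlMr; last lra.
  nra.
move=> s sab; case: (leP s t) => st; rewrite ltr_norml => std.
  by rewrite distrC; apply: H => //; lra.
by apply: H => //; lra.
Qed.

Lemma econtB F G a b : econt F a b -> econt G a b -> econt (fun t => F t - G t) a b.
Proof.
move=> cF cG t tab e e0.
have [d1 d10 H1] := cF t tab (e / 2) ltac:(lra).
have [d2 d20 H2] := cG t tab (e / 2) ltac:(lra).
exists (Num.min d1 d2); first by rewrite lt_min d10.
move=> s sab; rewrite lt_min => /andP[s1 s2].
have := H1 s sab s1; have := H2 s sab s2.
by rewrite !ler_norml; lra.
Qed.

(** The difference of [F] and the indefinite integral of [f] is continuous with right derivative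
    zero. *)
Lemma rderiv_FTC F f a b : a <= b -> econt F a b -> rcb a b f ->
  (forall t, a <= t < b -> rderiv F t (f t)) -> rint f a b = F b - F a.
Proof.
move=> ab cF cf dF.
have := @rderiv0_const (fun t => F t - rint f a t) a b ab.
rewrite rint_pt subr0 => /(_ _ _)/= H; apply: esym.
suff : F b - rint f a b = F a by lra.
apply: H; first exact: econtB (rint_econt cf).
move=> t tab e e0.
have [d1 d10 H1] := dF t tab (e / 2) ltac:(lra).
have [d2 d20 H2] := rint_rderiv cf tab (e := e / 2) ltac:(lra).
exists (Num.min d1 d2); first by rewrite lt_min d10.
move=> h /andP[h0]; rewrite lt_min => /andP[s1 s2].
have := H1 h ltac:(by rewrite h0); have := H2 h ltac:(by rewrite h0).
by rewrite !ler_norml; lra.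
Qed.

(** Dominated convergence of [rstep]. These sums later give measurability of time integrals in the
    path and their exchange with the expectation, from finitely many times at once. *)
Lemma rint_rstep_cvg a b f : a <= b -> rcb a b f ->
  (b - a) / n.+1%:R * (\sum_(k < n.+1) f (a + k.+1%:R * ((b - a) / n.+1%:R)))
   @[n --> \oo] --> rint f a b.
Proof.
move=> ab cf.
have [[B fB] rf] := cf.
have B0 : 0 <= B by apply: le_trans (fB a ltac:(lra)).
have If := rcb_integrable cf.
have fin : (mu `]a, b]%classic < +oo)%E.
  by rewrite lebesgue_measure_itv/=; case: ifP => // _; rewrite -EFinD ltry.
have ic k : mu.-integrable `]a, b] (EFin \o cst k) by exact: cst_integrable.
have nS n : 0 < n.+1%:R :> R by rewrite ltr0n.
have -> : (fun n => (b - a) / n.+1%:R * (\sum_(k < n.+1) f (a + k.+1%:R * ((b - a) / n.+1%:R)))) =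
  fun n => fine (\int[mu]_(x in `]a, b]) (rstep a b f n x)%:E).
  apply/funext => n; rewrite mulr_sumr.
  under eq_integral do rewrite /rstep -sumEFin.
  rewrite integral_sum//; last first.
    move=> k.
    apply/integrableP; split.
      by apply/measurable_EFinP/measurable_funM => //; apply: measurable_indic.
    apply: (@le_lt_trans _ _ (\int[mu]_(x in `]a, b]) (cst B%:E x))%E); last first.
      by rewrite integral_cst//= lte_mul_pinfty.
    apply: ge0_le_integral => //=.
      apply/measurable_EFinP/measurableT_comp => //.
      by apply: measurable_funM => //; apply: measurable_indic.
    move=> x _; rewrite lee_fin indicE normrM; case: (_ \in _); rewrite /= ?normr1 ?mulr1 ?normr0 ?mulr0//.
    apply: fB; have : k.+1%:R * ((b - a) / n.+1%:R) <= b - a.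
      by rewrite mulrA ler_pdivrMr// mulrC ler_wpM2l ?ler_nat//; lra.
    have : 0 <= k.+1%:R * ((b - a) / n.+1%:R) by rewrite mulr_ge0// divr_ge0//; lra.
    by move: (_ * _) => w; lra.
  transitivity (fine (\sum_(k < n.+1) (((b - a) / n.+1%:R) * f (a + k.+1%:R * ((b - a) / n.+1%:R)))%:E)%E).
    by rewrite sumEFin.
  congr fine; apply: eq_bigr => k _.
  under eq_integral do rewrite EFinM.
  set w := (b - a) / n.+1%:R; have w0 : 0 <= w by rewrite divr_ge0//; lra.
  rewrite integralZl//; last first.
    apply: (@mbd_integrable _ _ _ _ _ 1) => //.
    by move=> x _; rewrite indicE; case: (_ \in _); rewrite /= ?normr1 ?normr0.
  rewrite integral_indic// setIidl; last first.
    apply: subset_itv; rewrite bnd_simp.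
      by rewrite lerDl mulr_ge0.
    have : k.+1%:R * w <= b - a by rewrite /w mulrA ler_pdivrMr// mulrC ler_wpM2l ?ler_nat//; lra.
    lra.
  rewrite mulrC EFinM; congr (_ * _)%E; apply/esym.
  apply: (etrans (lebesgue_measure_itv _)); rewrite /= lte_fin ltrD2l.
  case: ltP => [_|wk].
    by rewrite -EFinD -natr1; congr EFin; ring.
  by congr EFin; move: wk; rewrite -natr1; lra.
rewrite -Rintegral_itv_obnd_cbnd; last first.
  by apply: integrableS If => //; apply: subset_itvr; rewrite bnd_simp.
apply: fine_cvg; rewrite fineK; last first.
  apply: integrable_fin_num => //.
  by apply: integrableS If => //; apply: subset_itvr; rewrite bnd_simp.
apply: (@dominated_cvg _ _ _ mu _ _ (fun n => EFin \o rstep a b f n) (EFin \o f) (cst B%:E)) => //.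
- by move=> n; apply/measurable_EFinP; apply: measurable_rstep.
- move=> x /=; rewrite in_itv/= => xab; apply/cvg_EFin; first by near=> n.
  by apply: rstep_cvg => // ?; exact: rf.
- exact: ic.
- move=> n x /=; rewrite in_itv/= => xab; rewrite lee_fin.
  by have [y [y1 y2 _ ->]] := rstepE f n xab; apply: fB; lra.
Unshelve. all: by end_near.
Qed.

End OneVariable.

Notation upd x k t := (fun_of_simpl [eta x with k |-> t]).

(** * Smooth functions of several variables *)

Section SeveralVariables.
Variables (R : realType) (K : finType).
Implicit Types (f g : (K -> R) -> R) (x y : K -> R) (k l : K) (s t M : R).

Lemma updE x k t j : upd x k t j = if j == k then t else x j.
Proof. by []. Qed.

Lemma upd_id x k : upd x k (x k) = x.
Proof. by apply/funext => j; rewrite updE; case: eqP => [->|]. Qed.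

Lemma updU x k s t : upd (upd x k s) k t = upd x k t.
Proof. by apply/funext => j; rewrite !updE; case: eqP. Qed.

Lemma updC x k l s t : k != l -> upd (upd x k s) l t = upd (upd x l t) k s.
Proof.
move=> kl; apply/funext => j; rewrite !updE; case: eqP => [->|//].
by rewrite eq_sym (negPf kl).
Qed.

Definition dist1 x y : R := \sum_k `|x k - y k|.

Definition box M x : Prop := forall k, `|x k| <= M.

Definition loclip f : Prop := forall M, exists2 C : R, 0 <= C &
  forall x y, box M x -> box M y -> `|f x - f y| <= C * dist1 x y.

Lemma dist1_ge0 x y : 0 <= dist1 x y.
Proof. exact: sumr_ge0. Qed.

Lemma dist1_upd x k s t : dist1 (upd x k s) (upd x k t) = `|s - t|.
Proof.
rewrite /dist1 (bigD1 k)//= eqxx big1 ?addr0// => j /negPf jk.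
by rewrite jk subrr normr0.
Qed.

Lemma dist1_updl x k t : dist1 (upd x k t) x = `|t - x k|.
Proof. by rewrite -[X in dist1 _ X](upd_id x k) dist1_upd. Qed.

Lemma dist1_upd2 x y k t : dist1 (upd x k t) (upd y k t) <= dist1 x y.
Proof.
by apply: ler_sum => j _; rewrite !updE; case: eqP => // _; rewrite subrr normr0.
Qed.

Lemma box_upd M x k t : box M x -> `|t| <= M -> box M (upd x k t).
Proof. by move=> bx tM j; rewrite updE; case: eqP. Qed.

Lemma box_le M M' x : M <= M' -> box M x -> box M' x.
Proof. by move=> MM bx k; apply: le_trans MM. Qed.

Lemma boxS x : exists M, box M x.
Proof.
exists (\sum_k `|x k|) => k; rewrite (bigD1 k)//= lerDl; exact: sumr_ge0.
Qed.

Lemma loclip_bnd f M : loclip f -> exists2 B : R, 0 <= B & forall x, box M x -> `|f x| <= B.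
Proof.
move=> /(_ `|M|)[C C0 H]; exists (`|f (fun=> 0)| + C * (#|K|%:R * `|M|)).
  by rewrite addr_ge0// mulr_ge0// mulr_ge0// ler0n.
move=> x bx; have {}bx : box `|M| x by apply: box_le bx; rewrite ler_norm.
have := H x (fun=> 0) bx ltac:(by move=> k; rewrite normr0).
have : dist1 x (fun=> 0) <= #|K|%:R * `|M|.
  rewrite /dist1; under eq_bigr do rewrite subr0.
  apply: le_trans (ler_sum _ (fun k _ => bx k)) _.
  by rewrite sumr_const mulr_natl.
move=> h1 h2; rewrite -[f x](subrK (f (fun=> 0))) addrC.
apply: le_trans (ler_normD _ _) _; rewrite lerD2l; apply: le_trans h2 _.
exact: ler_wpM2l.
Qed.

Lemma loclip_cst (c : R) : loclip (fun=> c).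
Proof.
by move=> M; exists 0 => // x y _ _; rewrite subrr normr0 mul0r.
Qed.

Lemma loclip_coord k : loclip (fun x => x k).
Proof.
move=> M; exists 1 => // x y _ _; rewrite mul1r /dist1 (bigD1 k)//= lerDl.
exact: sumr_ge0.
Qed.

Lemma loclipD f g : loclip f -> loclip g -> loclip (fun x => f x + g x).
Proof.
move=> cf cg M; have [C C0 H] := cf M; have [D D0 H'] := cg M.
exists (C + D) => [|x y bx by_]; first exact: addr_ge0.
rewrite opprD addrACA mulrDl; apply: le_trans (ler_normD _ _) _.
by apply: lerD; [exact: H|exact: H'].
Qed.

Lemma loclipN f : loclip f -> loclip (fun x => - f x).
Proof.
move=> cf M; have [C C0 H] := cf M; exists C => // x y bx by_.
by rewrite -opprD normrN H.
Qed.

Lemma loclipM f g : loclip f -> loclip g -> loclip (fun x => f x * g x).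
Proof.
move=> cf cg M; have [C C0 H] := cf M; have [D D0 H'] := cg M.
have [A A0 fA] := loclip_bnd M cf; have [B B0 gB] := loclip_bnd M cg.
exists (A * D + B * C) => [|x y bx by_]; first by rewrite addr_ge0// mulr_ge0.
have -> : f x * g x - f y * g y = f x * (g x - g y) + g y * (f x - f y) by lra.
rewrite mulrDl; apply: le_trans (ler_normD _ _) _; rewrite !normrM -!mulrA.
by apply: lerD; apply: ler_pM => //; auto.
Qed.

Definition pder k f (df : (K -> R) -> R) : Prop :=
  forall x, is_derive (x k) 1 (fun t : R => f (upd x k t)) (df x).

Lemma pder_partial k f df : pder k f df -> partial k f = df.
Proof.
by move=> H; apply/funext => x; rewrite /partial derive1E; have [_ ->] := H x.
Qed.

Lemma pder_at k f df x t : pder k f df ->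
  is_derive t 1 (fun t : R => f (upd x k t)) (df (upd x k t)).
Proof.
move=> /(_ (upd x k t)); rewrite updE eqxx.
by under eq_fun do rewrite updU.
Qed.

(** Smoothness with locally Lipschitz, rather than continuous, partial derivatives: this passes
    through products, compositions and parameter integrals by plain estimates, and gives uniform
    constants on boxes. *)
Fixpoint Csm (n : nat) f : Prop :=
  loclip f /\
  (if n is n'.+1 then forall k, pder k f (partial k f) /\ Csm n' (partial k f) else True).

Definition Cinf f : Prop := forall n, Csm n f.

Lemma Csm_lip n f : Csm n f -> loclip f.
Proof. by case: n => [|n] []. Qed.

Lemma CsmS n f (df : K -> (K -> R) -> R) : loclip f -> (forall k, pder k f (df k)) ->
  (forall k, Csm n (df k)) -> Csm n.+1 f.
Proof.
move=> lf pf cf; split => // k; rewrite (pder_partial (pf k)).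
by split.
Qed.

Lemma CsmW n f : Csm n.+1 f -> Csm n f.
Proof.
elim: n f => [|n ih] f [lf H]; first by split.
by split => // k; have [p1 p2] := H k; split => //; exact: ih.
Qed.

Lemma Cinf_pder f k : Cinf f -> pder k f (partial k f).
Proof. by move=> /(_ 1%N)[_ /(_ k)[]]. Qed.

Lemma Cinf_lip f : Cinf f -> loclip f.
Proof. by move=> /(_ 0%N)[]. Qed.

Lemma Cinf_partial f k : Cinf f -> Cinf (partial k f).
Proof. by move=> H n; have [_ /(_ k)[]] := H n.+1. Qed.

Lemma Cinf_partials f r : Cinf f -> Cinf (partials r f).
Proof. by move=> H; elim: r => //= k r; exact: Cinf_partial. Qed.

Lemma pder_cst k (c : R) : pder k (fun=> c) (fun=> 0).
Proof. by move=> x; exact: is_derive_cst. Qed.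

Lemma Csm_cst n (c : R) : Csm n (fun=> c).
Proof.
elim: n c => [|n ih] c; first by split => //; exact: loclip_cst.
by apply: (@CsmS _ _ (fun=> fun=> 0)) => // [|k]; [exact: loclip_cst|exact: pder_cst].
Qed.

Lemma pder_coord k l : pder k (fun x => x l) (fun=> (l == k)%:R).
Proof.
move=> x /=; case: eqP => _; first exact: is_derive_id.
exact: is_derive_cst.
Qed.

Lemma Csm_coord n k : Csm n (fun x => x k).
Proof.
case: n => [|n]; first by split => //; exact: loclip_coord.
apply: (@CsmS _ _ (fun l => fun=> (k == l)%:R)) => [|l|l]; first exact: loclip_coord.
  exact: pder_coord.
exact: Csm_cst.
Qed.

Lemma pderD k f g df dg : pder k f df -> pder k g dg ->
  pder k (fun x => f x + g x) (fun x => df x + dg x).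
Proof. by move=> Hf Hg x; have := is_deriveD (Hf x) (Hg x). Qed.

Lemma pderN k f df : pder k f df -> pder k (fun x => - f x) (fun x => - df x).
Proof. by move=> Hf x; have := is_deriveN (Hf x). Qed.

Lemma pderM k f g df dg : pder k f df -> pder k g dg ->
  pder k (fun x => f x * g x) (fun x => df x * g x + f x * dg x).
Proof.
move=> Hf Hg x; have := is_deriveM (Hf x) (Hg x).
by rewrite !upd_id => H; apply: (is_derive_eq H); rewrite /GRing.scale/= addrC mulrC.
Qed.

Lemma CsmD n f g : Csm n f -> Csm n g -> Csm n (fun x => f x + g x).
Proof.
elim: n f g => [|n ih] f g [lf cf] [lg cg]; first by split => //; exact: loclipD.
apply: (@CsmS _ _ (fun k x => partial k f x + partial k g x)) => [|k|k].
- exact: loclipD.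
- by apply: pderD; [have [] := cf k|have [] := cg k].
- by apply: ih; [have [] := cf k|have [] := cg k].
Qed.

Lemma CsmN n f : Csm n f -> Csm n (fun x => - f x).
Proof.
elim: n f => [|n ih] f [lf cf]; first by split => //; exact: loclipN.
apply: (@CsmS _ _ (fun k x => - partial k f x)) => [|k|k].
- exact: loclipN.
- by apply: pderN; have [] := cf k.
- by apply: ih; have [] := cf k.
Qed.

Lemma CsmM n f g : Csm n f -> Csm n g -> Csm n (fun x => f x * g x).
Proof.
elim: n f g => [|n ih] f g cf cg.
  by split => //; apply: loclipM; exact: (Csm_lip (n := 0)).
have [cf1 cg1] := (CsmW cf, CsmW cg).
have [[lf cf2] [lg cg2]] := (cf, cg).
apply: (@CsmS _ _ (fun k x => partial k f x * g x + f x * partial k g x)) => [|k|k].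
- exact: loclipM.
- by apply: pderM; [have [] := cf2 k|have [] := cg2 k].
- by apply: CsmD; apply: ih => //; [have [] := cf2 k|have [] := cg2 k].
Qed.

Lemma Cinf_cst (c : R) : Cinf (fun=> c). Proof. by move=> n; exact: Csm_cst. Qed.
Lemma Cinf_coord k : Cinf (fun x => x k). Proof. by move=> n; exact: Csm_coord. Qed.
Lemma CinfD f g : Cinf f -> Cinf g -> Cinf (fun x => f x + g x).
Proof. by move=> cf cg n; exact: CsmD. Qed.
Lemma CinfN f : Cinf f -> Cinf (fun x => - f x).
Proof. by move=> cf n; exact: CsmN. Qed.
Lemma CinfM f g : Cinf f -> Cinf g -> Cinf (fun x => f x * g x).
Proof. by move=> cf cg n; exact: CsmM. Qed.

Lemma Cinf_sum (I : Type) (r : seq I) (P : pred I) (F : I -> (K -> R) -> R) :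
  (forall i, P i -> Cinf (F i)) -> Cinf (fun x => \sum_(i <- r | P i) F i x).
Proof.
move=> H; elim: r => [|i r ih].
  by under eq_fun do rewrite big_nil; exact: Cinf_cst.
under eq_fun do rewrite big_cons.
by case: (boolP (P i)) => // Pi; apply: CinfD => //; exact: H.
Qed.

Lemma partial_cst k (c : R) : partial k (fun=> c) = fun=> 0.
Proof. exact/pder_partial/pder_cst. Qed.

Lemma partial_coord k l : partial k (fun x => x l) = fun=> (l == k)%:R.
Proof. exact/pder_partial/pder_coord. Qed.

Lemma partialD k f g : Cinf f -> Cinf g ->
  partial k (fun x => f x + g x) = fun x => partial k f x + partial k g x.
Proof. by move=> cf cg; apply: pder_partial; apply: pderD; exact: Cinf_pder. Qed.

Lemma partialN k f : Cinf f -> partial k (fun x => - f x) = fun x => - partial k f x.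
Proof. by move=> cf; apply: pder_partial; apply: pderN; exact: Cinf_pder. Qed.

Lemma partialM k f g : Cinf f -> Cinf g ->
  partial k (fun x => f x * g x) = fun x => partial k f x * g x + f x * partial k g x.
Proof. by move=> cf cg; apply: pder_partial; apply: pderM; exact: Cinf_pder. Qed.

Lemma partial_sum (I : Type) (r : seq I) (P : pred I) (F : I -> (K -> R) -> R) k :
  (forall i, P i -> Cinf (F i)) ->
  partial k (fun x => \sum_(i <- r | P i) F i x) = fun x => \sum_(i <- r | P i) partial k (F i) x.
Proof.
move=> H; elim: r => [|i r ih].
  under eq_fun do rewrite big_nil.
  by rewrite partial_cst; apply/funext => x; rewrite big_nil.
under eq_fun do rewrite big_cons; under [RHS]eq_fun do rewrite big_cons.
case: (boolP (P i)) => // Pi; rewrite partialD ?ih//; first exact: H.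
exact: Cinf_sum.
Qed.

Lemma pder_MVT k f df x s t : pder k f df -> exists2 c, Num.min s t <= c <= Num.max s t &
  f (upd x k t) - f (upd x k s) = df (upd x k c) * (t - s).
Proof.
wlog st : s t / s <= t => [H|] pf.
  have [st|ts] := orP (le_total s t); first exact: (H s t).
  have [c cts E] := H t s ts pf; exists c; first by rewrite minC maxC.
  by rewrite -opprB E -mulrN opprB.
have [||c] := @MVT_segment _ (fun t => f (upd x k t)) (fun t => df (upd x k t)) s t st.
- by move=> u _; exact: pder_at.
- apply: continuous_subspaceT => u.
  have [H _] := pder_at x u pf.
  by apply: differentiable_continuous; exact/derivable1_diffP.
- by rewrite in_itv/= => cst E; exists c => //; rewrite (min_idPl st) (max_idPr st).
Qed.

Lemma pder_MVT_id k f df x t : pder k f df -> exists2 c, Num.min (x k) t <= c <= Num.max (x k) t &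
  f (upd x k t) - f x = df (upd x k c) * (t - x k).
Proof.
by move=> pf; have := pder_MVT x (x k) t pf; rewrite upd_id.
Qed.

(** Coordinates are switched from [x] to [y] one at a time, each switch estimated by the mean value
    theorem; the intermediate points [mix r] do not leave the box. *)
Lemma loclip_pder f (df : K -> (K -> R) -> R) : (forall k, pder k f (df k)) ->
  (forall M, exists2 C : R, 0 <= C & forall k x, box M x -> `|df k x| <= C) -> loclip f.
Proof.
move=> pf H M; have [C C0 HC] := H M; exists C => // x y bx by_.
pose mix (r : seq K) := fun k => if k \in r then y k else x k.
suff S r : uniq r -> `|f (mix r) - f x| <= C * \sum_(k <- r) `|x k - y k|.
  have := S (enum K) (enum_uniq _); rewrite distrC /dist1 big_enum/=.
  by congr (`|f x - f _| <= _); apply/funext => k; rewrite /mix mem_enum.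
elim: r => [_|k r ih /= /andP[kr ur]].
  by rewrite (_ : mix _ = x)// subrr normr0 big_nil mulr0.
have -> : mix (k :: r) = upd (mix r) k (y k).
  by apply/funext => j; rewrite /mix updE inE; case: eqP => [->|].
have bm : box M (mix r) by move=> j; rewrite /mix; case: ifP.
have mk : mix r k = x k by rewrite /mix (negPf kr).
rewrite big_cons mulrDr -[f (upd _ _ _)](subrK (f (mix r))) -addrA.
apply: le_trans (ler_normD _ _) _; apply: lerD; last exact: ih.
have [c cst ->] := pder_MVT_id (mix r) (y k) (pf k).
rewrite normrM mk distrC ler_wpM2r//; apply: HC; apply: box_upd => //.
have := bx k; have := by_ k; move: cst; rewrite mk !ler_norml /Num.min /Num.max.
by case: ifP => _; lra.
Qed.

End SeveralVariables.

(** * Two-sided derivatives and smoothness on an interval *)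

Section OneVariableMore.
Variable R : realType.
Implicit Types (f F phi : R -> R) (a b s t : R).
Local Notation mu := (@lebesgue_measure R).
Local Notation rint f a b := (\int[mu]_(x in `[a, b]) f x).

(** A quadratic remainder is the form of differentiability that survives integration over a
    parameter; see [pder_Gint]. *)
Lemma is_derive_quad phi t (d : R) :
  (exists2 C : R, 0 <= C & forall h, `|h| <= 1 -> `|phi (t + h) - phi t - h * d| <= C * h ^+ 2) ->
  is_derive t 1 phi d.
Proof.
move=> [C C0 H].
suff : h^-1 *: (phi (h + t) - phi t) @[h --> 0^'] --> d.
  move=> cv; have [H1 H2] : derivable phi t 1 /\ 'D_1 phi t = d; last by split.
  rewrite /derivable /derive.
  have E : (fun h : R => h^-1 *: ((phi \o shift t) (h *: (1 : R)) - phi t)) =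
      (fun h => h^-1 *: (phi (h + t) - phi t)).
    by apply/funext => h; rewrite /= [h *: 1]mulr1.
  by rewrite E; split; [apply/cvg_ex; exists d|exact: cvg_lim].
apply/cvgrPdist_le => e e0.
have d0 : 0 < Num.min 1 (e / (C + 1)) by rewrite lt_min ltr01/= divr_gt0//; lra.
apply/nbhs_ballP; exists (Num.min 1 (e / (C + 1))) => //= h.
rewrite /ball/= sub0r normrN lt_min => /andP[h1 he] h0.
have hn : 0 < `|h| by rewrite normr_gt0.
have -> : d - h^-1 *: (phi (h + t) - phi t) = - (h^-1 * (phi (t + h) - phi t - h * d)).
  by rewrite /GRing.scale/= (addrC h); field.
rewrite normrN normrM normfV ler_pdivrMl//; apply: le_trans (H h (ltW h1)) _.
rewrite -real_normK ?num_real// expr2 mulrA (mulrC _ e) ler_wpM2r//.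
by move: he; rewrite ltr_pdivlMr; [nra|lra].
Qed.

Lemma is_derive_rderiv F t (l : R) : is_derive t 1 F l -> rderiv F t l.
Proof.
move=> [dF <-] e e0; have := dF => /cvg_ex[l' cv].
have E : 'D_1 F t = l' by exact: cvg_lim.
move/cvgrPdist_le : cv => /(_ e e0)/nbhs_ballP[r r0 rP].
exists r => // h /andP[h0 hr]; have [->|hn] := eqVneq h 0.
  by rewrite addr0 subrr mul0r subrr normr0 mulr0.
have hp : 0 < h by rewrite lt_neqAle eq_sym hn.
have := rP h; rewrite /ball/= sub0r normrN gtr0_norm// => /(_ hr hn).
rewrite [h *: 1]mulr1 E => H.
have -> : F (t + h) - F t - h * l' = - (h * (l' - h^-1 *: (F (h + t) - F t))).
  by rewrite /GRing.scale/= (addrC t); field.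
by rewrite normrN normrM gtr0_norm// mulrC ler_wpM2r// ltW.
Qed.

Lemma continuous_econt F a b : (forall t, a <= t <= b -> {for t, continuous F}) -> econt F a b.
Proof.
move=> cF t tab e e0; have /cvgrPdist_le/(_ e e0)/nbhs_ballP[r r0 rP] := cF t tab.
exists r => // s _ sr; rewrite distrC; apply: rP.
by rewrite /ball/= distrC.
Qed.

Lemma econt_rcont F a b t : econt F a b -> a <= t < b -> rcont F t.
Proof.
move=> cF tab e e0; have [d d0 H] := cF t ltac:(lra) e e0.
exists (Num.min d (b - t)); first by rewrite lt_min d0; lra.
move=> h /andP[h0]; rewrite lt_min => /andP[hd hb].
by apply: H; [lra|rewrite addrC addKr ger0_norm].
Qed.

Lemma econt_rcb F a b : econt F a b -> (exists B : R, forall t, a <= t <= b -> `|F t| <= B) -> rcb a b F.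
Proof. by move=> cF BF; split => // t; exact: econt_rcont. Qed.

Definition lip_on a b f (C : R) : Prop :=
  forall s t, a <= s <= b -> a <= t <= b -> `|f s - f t| <= C * `|s - t|.

Lemma lip_econt a b f (C : R) : 0 <= C -> lip_on a b f C -> econt f a b.
Proof.
move=> C0 H t tab e e0; exists (e / (C + 1)); first by rewrite divr_gt0//; lra.
move=> s sab; rewrite ltr_pdivlMr; last lra.
move=> st; apply: le_trans (H _ _ sab tab) _; have := normr_ge0 (s - t); nra.
Qed.

Lemma lip_rcb a b f (C : R) : 0 <= C -> lip_on a b f C -> rcb a b f.
Proof.
move=> C0 H; apply: econt_rcb; first exact: lip_econt H.
exists (`|f a| + C * (b - a)) => t tab.
have := H t a tab ltac:(lra); rewrite (ger0_norm (x := t - a)); last lra.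
have -> : f t = f a + (f t - f a) by lra.
have := ler_normD (f a) (f t - f a); rewrite addrA (addrC (f a)) addrK; nra.
Qed.

Lemma rcbD a b f F : rcb a b f -> rcb a b F -> rcb a b (fun t => f t + F t).
Proof.
move=> [[B fB] cf] [[D FD] cF]; split => [|t tab]; last by apply: rcontD; auto.
exists (B + D) => t tab; apply: le_trans (ler_normD _ _) _; apply: lerD; auto.
Qed.

Lemma rcbM a b f F : rcb a b f -> rcb a b F -> rcb a b (fun t => f t * F t).
Proof.
move=> [[B fB] cf] [[D FD] cF]; split => [|t tab]; last by apply: rcontM; auto.
by exists (B * D) => t tab; rewrite normrM; apply: ler_pM; auto.
Qed.

Lemma rcb_cst a b (c : R) : rcb a b (fun=> c).
Proof. by split; [exists `|c| |move=> *; exact: rcont_cst]. Qed.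

Lemma rintD a b f F : rcb a b f -> rcb a b F ->
  rint (fun t => f t + F t) a b = rint f a b + rint F a b.
Proof. by move=> cf cF; rewrite RintegralD//; exact: rcb_integrable. Qed.

Lemma rintZ a b f (c : R) : rcb a b f -> rint (fun t => c * f t) a b = c * rint f a b.
Proof. by move=> cf; rewrite RintegralZl//; exact: rcb_integrable. Qed.

Lemma rintB a b f F : rcb a b f -> rcb a b F ->
  rint (fun t => f t - F t) a b = rint f a b - rint F a b.
Proof. by move=> cf cF; rewrite RintegralB//; exact: rcb_integrable. Qed.

Lemma rint_le a b f (B : R) : a <= b -> rcb a b f -> (forall t, a <= t <= b -> `|f t| <= B) ->
  `|rint f a b| <= B * (b - a).
Proof.
move=> ab cf fB; have := @rint_dist _ a b f 0 B ab cf.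
by rewrite mulr0 subr0; apply => t tab; rewrite subr0; exact: fB.
Qed.

Lemma eq_rint a b f F : (forall t, a <= t <= b -> f t = F t) -> rint f a b = rint F a b.
Proof. by move=> H; apply: eq_Rintegral => t; rewrite inE/= in_itv/=; exact: H. Qed.

Lemma rint_FTC F f a b : a <= b -> (forall t, a <= t <= b -> is_derive t 1 F (f t)) ->
  rcb a b f -> rint f a b = F b - F a.
Proof.
move=> ab dF cf; apply: rderiv_FTC => //.
  apply: continuous_econt => t tab; have [H _] := dF t tab.
  by apply: differentiable_continuous; exact/derivable1_diffP.
by move=> t tab; apply: is_derive_rderiv; apply: dF; lra.
Qed.

Definition smooth_on a b phi : Prop :=
  forall m t, a <= t <= b -> derivable (derive1n m phi) t 1.

Lemma smooth_on_derive1 a b phi : smooth_on a b phi -> smooth_on a b (derive1 phi).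
Proof. by move=> H m t tab; rewrite -derive1Sn; exact: H. Qed.

Lemma smooth_on_is_derive a b phi t : smooth_on a b phi -> a <= t <= b ->
  is_derive t 1 phi ((derive1 phi) t).
Proof.
by move=> H tab; apply: DeriveDef; [exact: (H 0%N)|rewrite derive1E].
Qed.

Lemma smooth_on_continuous a b phi t : smooth_on a b phi -> a <= t <= b -> {for t, continuous phi}.
Proof.
move=> H tab; apply: differentiable_continuous; apply/derivable1_diffP.
exact: (H 0%N).
Qed.

Lemma smooth_on_bounded a b phi : smooth_on a b phi ->
  exists2 B : R, 0 <= B & forall t, a <= t <= b -> `|phi t| <= B.
Proof.
move=> H; have [ba|ab] := ltP b a; first by exists 0 => // t; lra.
have [c _ cmax] : exists2 c, c \in `[a, b]%R & forall t, t \in `[a, b]%R -> `|phi t| <= `|phi c|.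
  apply: (@EVT_max _ (fun t => `|phi t|)) => //.
  apply: continuous_in_subspaceT => t; rewrite inE/= in_itv/= => tab.
  by apply: continuous_comp; [exact: smooth_on_continuous tab|exact: norm_continuous].
by exists `|phi c| => // t tab; apply: cmax; rewrite in_itv.
Qed.

Lemma smooth_on_lip a b phi : smooth_on a b phi -> exists2 C : R, 0 <= C & lip_on a b phi C.
Proof.
move=> H; have [C C0 HC] := smooth_on_bounded (smooth_on_derive1 H).
exists C => //.
have L s t : s <= t -> a <= s <= b -> a <= t <= b -> `|phi t - phi s| <= C * `|t - s|.
  move=> st sab tab; have [||c] := @MVT_segment _ phi (derive1 phi) s t st.
  - by move=> u; rewrite in_itv/= => ust; apply: smooth_on_is_derive H _; lra.
  - apply: continuous_in_subspaceT => u; rewrite inE/= in_itv/= => ust.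
    by apply: smooth_on_continuous H _; lra.
  - rewrite in_itv/= => cst ->; rewrite normrM ler_wpM2r//; apply: HC; lra.
move=> s t sab tab; have [st|ts] := orP (le_total s t); last exact: L.
by rewrite distrC [`|s - t|]distrC; exact: L.
Qed.

Lemma smooth1_on a b phi : smooth1 phi -> smooth_on a b phi.
Proof. by move=> H m t _; exact: H. Qed.

End OneVariableMore.

(** * Composition, mixed partial derivatives, antiderivatives *)

Section SmoothCalculus.
Variables (R : realType) (K : finType).
Implicit Types (f g : (K -> R) -> R) (x y : K -> R) (k l : K) (s t M : R).
Local Notation mu := (@lebesgue_measure R).
Local Notation rint f a b := (\int[mu]_(x in `[a, b]) f x).

Lemma pder_comp1 phi k f df (dphi : R -> R) : pder k f df ->
  (forall x, is_derive (f x) 1 phi (dphi (f x))) ->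
  pder k (fun x => phi (f x)) (fun x => dphi (f x) * df x).
Proof.
move=> pf pphi x.
have H1 : is_derive ((fun t => f (upd x k t)) (x k)) 1 phi (dphi (f x)).
  by rewrite upd_id.
exact: (is_derive1_comp H1 (pf x)).
Qed.

(** Smoothness of [phi] is asked only on an interval containing the values of [f] on each box; this
    admits the square root and the inverse, which are smooth on positive numbers only. *)
Definition maps_smooth (phi : R -> R) f : Prop := forall M, exists a b : R,
  (forall x, box M x -> a <= f x <= b) /\ smooth_on a b phi.

Lemma maps_smooth_is_derive phi f x : maps_smooth phi f -> is_derive (f x) 1 phi ((derive1 phi) (f x)).
Proof.
have [M bx] := boxS x.
by move=> /(_ M)[a [b [fab H]]]; apply: smooth_on_is_derive H _; exact: fab.
Qed.

Lemma Csm_comp1 n phi f : Csm n f -> maps_smooth phi f -> Csm n (fun x => phi (f x)).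
Proof.
elim: n phi f => [|n ih] phi f cf H.
all: have lf : loclip (fun x => phi (f x)).
1, 3: move=> M; have [a [b [fab sphi]]] := H M; have [C C0 HC] := smooth_on_lip sphi;
  have [D D0 HD] := Csm_lip cf M; exists (C * D); [exact: mulr_ge0|];
  move=> x y bx by_; apply: le_trans (HC _ _ (fab x bx) (fab y by_)) _;
  by rewrite -mulrA ler_wpM2l//; exact: HD.
  by split.
have [_ cf2] := cf.
apply: (@CsmS _ _ _ _ (fun k x => derive1 phi (f x) * partial k f x)) => // k.
  apply: pder_comp1; first by have [] := cf2 k.
  by move=> x; exact: maps_smooth_is_derive.
apply: CsmM; last by have [] := cf2 k.
apply: ih; first exact: CsmW.
by move=> M; have [a [b [fab sphi]]] := H M; exists a, b; split; [exact: fab|exact: smooth_on_derive1].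
Qed.

Lemma smooth1_maps phi f : smooth1 phi -> loclip f -> maps_smooth phi f.
Proof.
move=> sphi lf M; have [B B0 fB] := loclip_bnd M lf; exists (- B), B.
by split=> [x /fB|]; [rewrite ler_norml|exact: smooth1_on].
Qed.

Lemma Cinf_comp1 phi f : Cinf f -> maps_smooth phi f -> Cinf (fun x => phi (f x)).
Proof. by move=> cf H n; exact: Csm_comp1. Qed.

Lemma partial_comp1 phi f k : Cinf f -> maps_smooth phi f ->
  partial k (fun x => phi (f x)) = fun x => (derive1 phi) (f x) * partial k f x.
Proof.
move=> cf H; apply: pder_partial; apply: pder_comp1; first exact: Cinf_pder.
by move=> x; exact: maps_smooth_is_derive.
Qed.

Lemma pder_taylor k f df M : pder k f df -> loclip df -> exists2 C : R, 0 <= C &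
  forall x h, box M x -> `|h| <= 1 ->
    `|f (upd x k (x k + h)) - f x - h * df x| <= C * h ^+ 2.
Proof.
move=> pf /(_ (M + 1))[C C0 HC]; exists C => // x h bx h1.
have [c cP ->] := pder_MVT_id x (x k + h) pf.
have M0 : 0 <= M by apply: le_trans (bx k).
have ch : `|c - x k| <= `|h|.
  by move: cP; rewrite /Num.min /Num.max; case: ifP => _; [|]; rewrite ler_norml;
    have := ler_norm h; have := ler_norm (- h); rewrite normrN; lra.
have -> : df (upd x k c) * (x k + h - x k) - h * df x = (df (upd x k c) - df x) * h by ring.
rewrite normrM -real_normK ?num_real// expr2 mulrA ler_wpM2r//.
have B1 : box (M + 1) x by apply: box_le bx; lra.
apply: le_trans (HC _ _ _ B1) _; last first.
  by rewrite dist1_updl ler_wpM2l.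
apply: box_upd => //; have := bx k; move: (le_trans ch h1); rewrite !ler_norml; lra.
Qed.

Lemma quadratic_coef_uniq (D : R -> R) (A B C1 C2 : R) : 0 <= C1 -> 0 <= C2 ->
  (forall h, 0 < h <= 1 -> `|D h - h ^+ 2 * A| <= C1 * h ^+ 3) ->
  (forall h, 0 < h <= 1 -> `|D h - h ^+ 2 * B| <= C2 * h ^+ 3) -> A = B.
Proof.
move=> C10 C20 H1 H2.
apply/eqP; rewrite -subr_eq0 -normr_le0; apply/ler_addgt0Pl => e e0; rewrite addr0.
pose h := Num.min 1 (e / (C1 + C2 + 1)).
have h0 : 0 < h by rewrite lt_min ltr01/= divr_gt0//; lra.
have h1 : h <= 1 by rewrite ge_min lexx.
have he : h * (C1 + C2 + 1) <= e.
  by rewrite -ler_pdivlMr; [rewrite ge_min lexx orbT|lra].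
have h01 : 0 < h <= 1 by rewrite h0.
have {H1 H2} T : `|(D h - h ^+ 2 * B) - (D h - h ^+ 2 * A)| <= C2 * h ^+ 3 + C1 * h ^+ 3.
  by apply: le_trans (ler_normB _ _) _; apply: lerD; auto.
have hh : 0 < h ^+ 2 by rewrite exprn_gt0.
move: T; have -> : D h - h ^+ 2 * B - (D h - h ^+ 2 * A) = h ^+ 2 * (A - B) by ring.
have -> : C2 * h ^+ 3 + C1 * h ^+ 3 = h ^+ 2 * (h * (C1 + C2)) by ring.
rewrite normrM (gtr0_norm hh) (ler_pM2l hh) => /le_trans; apply.
by apply: le_trans he; rewrite (ler_pM2l h0) lerDl.
Qed.

(** Both mixed derivatives are the coefficient of [h ^+ 2] in the same second difference [Delta h],
    up to an error of order three. *)
Lemma partial_comm f k l : Cinf f -> partial k (partial l f) = partial l (partial k f).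
Proof.
move=> cf; have [->//|kl] := eqVneq k l; apply/funext => x.
pose Delta h := f (upd (upd x k (x k + h)) l (x l + h)) - f (upd x k (x k + h))
   - f (upd x l (x l + h)) + f x.
have [M bx] := boxS x.
have key (i j : K) (D : R -> R) : i != j ->
    (forall h, D h = f (upd (upd x i (x i + h)) j (x j + h)) - f (upd x i (x i + h))
   - f (upd x j (x j + h)) + f x) ->
   exists2 C : R, 0 <= C & forall h, 0 < h <= 1 ->
     `|D h - h ^+ 2 * partial j (partial i f) x| <= C * h ^+ 3.
  move=> ij DE.
  have ci := Cinf_partial i cf; have cij := Cinf_partial j ci.
  have [C1 C10 H1] := pder_taylor (M + 1) (Cinf_pder j ci) (Cinf_lip cij).
  have [C2 C20 H2] := Cinf_lip cij (M + 1).
  exists (C1 + C2) => [|h /andP[h0 h1]]; first exact: addr_ge0.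
  (* The mean value theorem in direction [i], applied to the difference in direction [j], gives an
     intermediate point [y]. Taylor's formula in [j] at [y] and the Lipschitz bound that moves the
     mixed derivative from [y] to [x] each cost [O(h^3)]. *)
  have pF : pder i (fun y => f (upd y j (x j + h)) - f (upd y j (x j)))
     (fun y => partial i f (upd y j (x j + h)) - partial i f (upd y j (x j))).
    have P u : pder i (fun y => f (upd y j u)) (fun y => partial i f (upd y j u)).
      move=> y; under eq_fun do rewrite (updC _ _ _ ij).
      by have := Cinf_pder i cf (upd y j u); rewrite [upd y j u i]updE (negPf ij).
    by apply: pderD => //; exact: pderN.
  have [c cP /esym E] := pder_MVT x (x i) (x i + h) pF.
  have cx : x i <= c <= x i + h.
    by move: cP; rewrite /Num.min /Num.max; case: ifP; lra.
  set y := upd x i c in E.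
  have yj : y j = x j by rewrite /y updE eq_sym (negPf ij).
  have by_ : box (M + 1) y.
    apply: box_upd; first by apply: box_le bx; lra.
    by have := bx i; rewrite !ler_norml; lra.
  have h1' : `|h| <= 1 by rewrite gtr0_norm.
  have := H1 y h by_ h1'; rewrite yj => T1.
  have := H2 y x by_ ltac:(by apply: box_le bx; lra).
  rewrite [dist1 y x]dist1_updl (ger0_norm (x := c - x i)); last lra.
  move=> T2.
  have -> : D h = (partial i f (upd y j (x j + h)) - partial i f y) * h.
    have e1 : upd y j (x j) = y by rewrite -yj upd_id.
    have e2 : upd (upd x i (x i + h)) j (x j) = upd x i (x i + h).
      have -> : x j = upd x i (x i + h) j by rewrite updE eq_sym (negPf ij).
      by rewrite upd_id.
    rewrite DE; move: E; rewrite e1 e2 !upd_id (addrC (x i)) addrK => ->; ring.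
  have T3 : `|partial j (partial i f) y - partial j (partial i f) x| <= C2 * h.
    by apply: le_trans T2 _; rewrite ler_wpM2l//; lra.
  move: (partial j (partial i f) x) (partial j (partial i f) y)
    (partial i f (upd y j (x j + h))) (partial i f y) T1 T3 => Dx Dy A B T1 T3.
  have -> : (A - B) * h - h ^+ 2 * Dx = h * (A - B - h * Dy) + h ^+ 2 * (Dy - Dx) by ring.
  have hh : 0 <= h ^+ 2 by rewrite exprn_ge0// ltW.
  apply: le_trans (ler_normD _ _) _.
  rewrite normrM [X in _ + X]normrM (gtr0_norm h0) (ger0_norm hh).
  rewrite mulrDl exprS; apply: lerD.
    by rewrite mulrCA ler_wpM2l// ltW.
  by rewrite [X in _ <= X](_ : _ = h ^+ 2 * (C2 * h)); [exact: ler_wpM2l|ring].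
have [C1 C10 H1] := key k l Delta kl (fun=> erefl).
have [|C2 C20 H2] := key l k Delta ltac:(by rewrite eq_sym).
  by move=> h; rewrite /Delta (updC _ _ _ kl); ring.
exact: quadratic_coef_uniq C20 C10 H2 H1.
Qed.

Lemma partials_partial f r k : Cinf f -> partials r (partial k f) = partial k (partials r f).
Proof.
move=> cf; elim: r => //= j r ->; apply: partial_comm; exact: Cinf_partials.
Qed.

(* A map [Z] each coordinate [x_k] of whose argument enters only [Z (o k)]. *)
Section SeparateComposition.
Variables (K' : finType) (Z : K' -> (K -> R) -> R) (o : K -> K').
Hypothesis sepZ : forall k j x t, j != o k -> Z j (upd x k t) = Z j x.

Lemma pder_sep (u du : (K' -> R) -> R) k (dZ : (K -> R) -> R) :
  pder (o k) u du -> pder k (Z (o k)) dZ ->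
  pder k (fun x => u (fun j => Z j x)) (fun x => du (fun j => Z j x) * dZ x).
Proof.
move=> pu pZ x.
have -> : (fun t => u (fun j => Z j (upd x k t))) =
  (fun s => u (upd (fun j => Z j x) (o k) s)) \o (fun t => Z (o k) (upd x k t)).
  apply/funext => t /=; congr u; apply/funext => j; rewrite updE.
  by case: eqP => [->//|/eqP jo]; exact: sepZ.
apply: is_derive1_comp; last exact: pZ.
by have := pu (fun j => Z j x); rewrite upd_id.
Qed.

Lemma loclip_sep (u : (K' -> R) -> R) : loclip u -> (forall j, loclip (Z j)) ->
  loclip (fun x => u (fun j => Z j x)).
Proof.
move=> lu lZ M.
have /fin_all_exists[B BP] : forall j, exists B : R, 0 <= B /\ forall x, box M x -> `|Z j x| <= B.
  by move=> j; have [B] := loclip_bnd M (lZ j); exists B.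
have /fin_all_exists[C CP] : forall j, exists C : R, 0 <= C /\
    forall x y, box M x -> box M y -> `|Z j x - Z j y| <= C * dist1 x y.
  by move=> j; have [C] := lZ j M; exists C.
have [D D0 HD] := lu (\sum_j B j).
exists (D * \sum_j C j); first by rewrite mulr_ge0// sumr_ge0// => j _; have [] := CP j.
move=> x y bx by_.
have bZ z : box M z -> box (\sum_j B j) (fun j => Z j z).
  move=> bz j; apply: le_trans ((BP j).2 z bz) _.
  by rewrite (bigD1 j)//= lerDl sumr_ge0// => i _; have [] := BP i.
apply: le_trans (HD _ _ (bZ x bx) (bZ y by_)) _.
rewrite -mulrA ler_wpM2l// mulr_suml; apply: ler_sum => j _.
by apply: (CP j).2.
Qed.

Lemma Csm_sep n (u : (K' -> R) -> R) : Csm n u -> (forall j, Csm n (Z j)) ->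
  Csm n (fun x => u (fun j => Z j x)).
Proof.
elim: n u => [|n ih] u cu cZ.
  by split => //; apply: loclip_sep; [exact: Csm_lip cu|move=> j; exact: Csm_lip (cZ j)].
have lu := Csm_lip cu; have lZ j := Csm_lip (cZ j).
apply: (@CsmS _ _ _ _ (fun k x => partial (o k) u (fun j => Z j x) * partial k (Z (o k)) x)).
- exact: loclip_sep.
- by move=> k; apply: pder_sep; [case: cu => _ /(_ (o k))[]|case: (cZ (o k)) => _ /(_ k)[]].
- move=> k; apply: CsmM; last by case: (cZ (o k)) => _ /(_ k)[].
  by apply: ih; [case: cu => _ /(_ (o k))[]|move=> j; exact: CsmW].
Qed.

Lemma Cinf_sep (u : (K' -> R) -> R) : Cinf u -> (forall j, Cinf (Z j)) ->
  Cinf (fun x => u (fun j => Z j x)).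
Proof. by move=> cu cZ n; apply: Csm_sep => // j; exact: cZ. Qed.

Lemma partial_sep (u : (K' -> R) -> R) k : Cinf u -> (forall j, Cinf (Z j)) ->
  partial k (fun x => u (fun j => Z j x)) =
  fun x => partial (o k) u (fun j => Z j x) * partial k (Z (o k)) x.
Proof. by move=> cu cZ; apply/pder_partial/pder_sep; exact: Cinf_pder. Qed.

End SeparateComposition.

(** Bounds on the derivatives of the next order make those of a given order Lipschitz, by
    [loclip_pder]. *)
Lemma smooth_bounded_Cinf f : smooth f ->
  (forall s : seq K, exists C : R, forall x, `|partials s f x| <= C) -> Cinf f.
Proof.
move=> sf bf.
have pp (s : seq K) k : pder k (partials s f) (partials (k :: s) f).
  move=> x; have [_ /(_ k x) H] := sf s.
  by apply: DeriveDef => //; rewrite /= /partial derive1E.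
have ll (s : seq K) : loclip (partials s f).
  apply: loclip_pder (pp s) _ => M.
  have /fin_all_exists[C CP] : forall k, exists C : R, forall x, `|partials (k :: s) f x| <= C.
    by move=> k; exact: bf.
  exists (\sum_k `|C k|) => [|k x _]; first exact: sumr_ge0.
  apply: le_trans (CP k x) _; apply: le_trans (ler_norm _) _.
  by rewrite (bigD1 k)//= lerDl sumr_ge0.
suff H n (s : seq K) : Csm n (partials s f) by move=> n; exact: (H n [::]).
elim: n s => [|n ih] s; first by split.
by apply: (@CsmS _ _ _ _ (fun k => partials (k :: s) f)) => // k; exact: ih.
Qed.

Definition shiftc k r x : K -> R := upd x k (x k + r).

Lemma shiftc_upd k l r h x :
  shiftc k r (upd x l (x l + h)) = upd (shiftc k r x) l (shiftc k r x l + h).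
Proof.
rewrite /shiftc; have [->|kl] := eqVneq l k.
  by rewrite !updU !updE eqxx addrAC.
by rewrite [upd x l _ k]updE eq_sym (negPf kl) updC ?updE ?(negPf kl)// eq_sym.
Qed.

Lemma box_shiftc M M' k r x : box M x -> `|r| <= M' -> box (M + M') (shiftc k r x).
Proof.
move=> bx rM j; rewrite /shiftc updE; case: eqP => [_|_].
  by apply: le_trans (ler_normD _ _) _; apply: lerD.
by apply: le_trans (bx j) _; rewrite lerDl (le_trans _ rM).
Qed.

Lemma dist1_shiftc k r x y : dist1 (shiftc k r x) (shiftc k r y) = dist1 x y.
Proof.
apply: eq_bigr => j _; rewrite /shiftc !updE; case: eqP => [->|//].
by congr `|_|; ring.
Qed.

Lemma dist1_shiftc2 k r s x : dist1 (shiftc k r x) (shiftc k s x) = `|r - s|.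
Proof. by rewrite /shiftc dist1_upd; congr `|_|; ring. Qed.

(** An antiderivative from the far end: where [f] vanishes beyond distance [L] in direction [k],
    [- Gint k L f] inverts [partial k], by [Gint_partial]. *)
Definition Gint k L f x : R := rint (fun r => f (shiftc k r x)) 0 L.

Lemma rcb_shiftc k L f x : loclip f -> rcb 0 L (fun r => f (shiftc k r x)).
Proof.
move=> lf; have [M bx] := boxS x.
have [C C0 HC] := lf (M + `|L|).
apply: (@lip_rcb _ _ _ _ C) => // r s r0 s0.
have := HC (shiftc k r x) (shiftc k s x); rewrite dist1_shiftc2; apply; apply: box_shiftc => //.
  by rewrite ger0_norm; [apply: le_trans (ler_norm L)|]; lra.
by rewrite ger0_norm; [apply: le_trans (ler_norm L)|]; lra.
Qed.

Lemma loclip_Gint k L f : 0 <= L -> loclip f -> loclip (Gint k L f).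
Proof.
move=> L0 lf M; have [C C0 HC] := lf (M + L).
exists (C * L) => [|x y bx by_]; first exact: mulr_ge0.
rewrite /Gint -rintB; try exact: rcb_shiftc.
rewrite mulrAC -[X in _ * X](subr0 L); apply: rint_le => //.
  by apply: rcbD; [|under eq_fun do rewrite -mulN1r; apply: rcbM; [exact: rcb_cst|]]; exact: rcb_shiftc.
move=> r r0; rewrite -(dist1_shiftc k r); apply: HC; apply: box_shiftc => //.
  by rewrite ger0_norm; lra.
by rewrite ger0_norm; lra.
Qed.

Lemma pder_Gint k l L f df : 0 <= L -> loclip f -> pder l f df -> loclip df ->
  pder l (Gint k L f) (Gint k L df).
Proof.
move=> L0 lf pf ldf x; apply: is_derive_quad.
have [M bx] := boxS x.
have [C C0 HC] := pder_taylor (M + L) pf ldf.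
exists (C * L) => [|h h1]; first exact: mulr_ge0.
rewrite upd_id /Gint -rintZ; last exact: rcb_shiftc.
have rN (F : (K -> R) -> R) y : loclip F -> rcb 0 L (fun r => - F (shiftc k r y)).
  by move=> lF; under eq_fun do rewrite -mulN1r; apply: rcbM; [exact: rcb_cst|exact: rcb_shiftc].
rewrite -!rintB; last 4 first.
- by apply: rcbD; [exact: rcb_shiftc|exact: rN].
- by apply: rcbM; [exact: rcb_cst|exact: rcb_shiftc].
- exact: rcb_shiftc.
- exact: rcb_shiftc.
rewrite mulrAC -[X in _ * X](subr0 L); apply: rint_le => //.
  apply: rcbD; first by apply: rcbD; [exact: rcb_shiftc|exact: rN].
  under eq_fun do rewrite -mulNr.
  by apply: rcbM; [exact: rcb_cst|exact: rcb_shiftc].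
move=> r r0; rewrite shiftc_upd; apply: HC => //; apply: box_shiftc => //.
by rewrite ger0_norm; lra.
Qed.

Lemma Csm_Gint n k L f : 0 <= L -> Csm n f -> Csm n (Gint k L f).
Proof.
move=> L0; elim: n f => [|n ih] f cf.
  by split => //; apply: loclip_Gint => //; exact: Csm_lip cf.
have lf := Csm_lip cf; have [_ H] := cf.
apply: (@CsmS _ _ _ _ (fun l => Gint k L (partial l f))) => [|l|l].
- exact: loclip_Gint.
- by have [p c] := H l; apply: pder_Gint => //; exact: Csm_lip c.
- by apply: ih; have [] := H l.
Qed.

Lemma Cinf_Gint k L f : 0 <= L -> Cinf f -> Cinf (Gint k L f).
Proof. by move=> L0 cf n; exact: Csm_Gint. Qed.

Lemma partial_Gint k l L f : 0 <= L -> Cinf f -> partial l (Gint k L f) = Gint k L (partial l f).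
Proof.
move=> L0 cf; apply/pder_partial/pder_Gint => //; first exact: Cinf_lip.
  exact: Cinf_pder.
by apply: Cinf_lip; exact: Cinf_partial.
Qed.

Lemma partials_Gint k r L f : 0 <= L -> Cinf f -> partials r (Gint k L f) = Gint k L (partials r f).
Proof.
move=> L0 cf; elim: r => //= l r ->; rewrite partial_Gint//.
exact: Cinf_partials.
Qed.

Lemma Gint_partial k L f x : 0 <= L -> Cinf f ->
  Gint k L (partial k f) x = f (shiftc k L x) - f x.
Proof.
move=> L0 cf; have -> : f (shiftc k L x) - f x = f (shiftc k L x) - f (shiftc k 0 x).
  by rewrite {3}/shiftc addr0 upd_id.
apply: (@rint_FTC _ (fun r => f (shiftc k r x)) (fun r => partial k f (shiftc k r x)) 0 L L0).
- move=> r _; rewrite /shiftc.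
  have H1 := pder_at x (x k + r) (Cinf_pder k cf).
  have H2 : is_derive r 1 (fun r : R => x k + r) 1.
    by have := is_deriveD (is_derive_cst (x k) r 1) (is_derive_id r (1 : R)); rewrite add0r.
  by have := is_derive1_comp H1 H2; rewrite mulr1.
- by apply: rcb_shiftc; apply: Cinf_lip; exact: Cinf_partial.
Qed.

End SmoothCalculus.

(** * Iterated integrals of compactly supported functions *)

Section IteratedIntegral.
Variables (R : realType).
Local Notation mu := (@lebesgue_measure R).
Local Notation rint f a b := (\int[mu]_(x in `[a, b]) f x).

Lemma rderiv_uniq (F : R -> R) (t l l' : R) : rderiv F t l -> rderiv F t l' -> l = l'.
Proof.
move=> H H'; apply/eqP; rewrite -subr_eq0 -normr_le0; apply/ler_addgt0Pl => e e0; rewrite addr0.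
have [d d0 dP] := H (e / 2) ltac:(lra); have [d' d'0 dP'] := H' (e / 2) ltac:(lra).
pose h := Num.min d d' / 2.
have m0 : 0 < Num.min d d' by rewrite lt_min d0.
have h0 : 0 < h by rewrite /h; lra.
have hm : h < Num.min d d' by rewrite /h; lra.
move: hm; rewrite lt_min => /andP[hd hd'].
have {}dP := dP h ltac:(by rewrite ltW). have {}dP' := dP' h ltac:(by rewrite ltW).
rewrite -(ler_pM2l h0) -[X in X * _ <= _](gtr0_norm h0) -normrM.
have -> : h * (l - l') = (F (t + h) - F t - h * l') - (F (t + h) - F t - h * l) by ring.
by apply: le_trans (ler_normB _ _) _; lra.
Qed.

Lemma rderiv_eq (F G : R -> R) (t l : R) (d : R) : 0 < d ->
  (forall h, 0 <= h < d -> F (t + h) = G (t + h)) -> rderiv F t l -> rderiv G t l.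
Proof.
move=> d0 E H e e0; have [d' d'0 dP] := H e e0.
exists (Num.min d d'); first by rewrite lt_min d0.
move=> h /andP[h0]; rewrite lt_min => /andP[hd hd'].
have E0 : F t = G t by have := E 0; rewrite addr0 lexx => /(_ d0).
by rewrite -E ?h0// -E0; apply: dP; rewrite h0.
Qed.

Lemma rderiv_cst (c t : R) : rderiv (fun=> c) t 0.
Proof.
move=> e e0; exists 1 => // h /andP[h0 _].
by rewrite subrr mulr0 subrr normr0 mulr_ge0// ltW.
Qed.

Lemma rcbB (a b : R) (p q : R -> R) : rcb a b p -> rcb a b q -> rcb a b (fun t => p t - q t).
Proof.
move=> cf cg; apply: rcbD => //; under eq_fun do rewrite -mulN1r.
by apply: rcbM => //; exact: rcb_cst.
Qed.

Lemma rint0 (a b : R) : rint (fun=> 0) a b = 0.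
Proof. by rewrite Rintegral_cst// mul0r. Qed.

(** Fubini by one-dimensional calculus. With the [t]-integral cut at [s], the integral [Q s] over
    [u] has right derivative [p s], the [u]-integral of [F s]; the fundamental theorem then gives
    the equality at [s = b]. *)
Lemma rint_swap (F : R -> R -> R) (a b C : R) : a <= b -> 0 <= C ->
  (forall t t' u u', a <= t <= b -> a <= t' <= b -> a <= u <= b -> a <= u' <= b ->
     `|F t u - F t' u'| <= C * (`|t - t'| + `|u - u'|)) ->
  rint (fun t => rint (fun u => F t u) a b) a b = rint (fun u => rint (fun t => F t u) a b) a b.
Proof.
move=> ab C0 H.
have ba : 0 <= b - a by lra.
have L1 t : a <= t <= b -> rcb a b (F t).
  move=> tab; apply: (lip_rcb C0) => u u' uab u'ab.
  by have := H t t u u' tab tab uab u'ab; rewrite subrr normr0 add0r.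
have L2 u s : a <= u <= b -> a <= s <= b -> rcb a s (fun t => F t u).
  move=> uab sab; apply: (lip_rcb C0) => t t' tab t'ab.
  by have := H t t' u u ltac:(lra) ltac:(lra) uab uab; rewrite subrr normr0 addr0.
pose p t := rint (F t) a b.
have Lp : lip_on a b p (C * (b - a)).
  move=> t t' tab t'ab; rewrite /p -rintB//; [|exact: L1|exact: L1].
  rewrite mulrAC; apply: rint_le => //; first by apply: rcbB; exact: L1.
  by move=> u uab; have := H t t' u u tab t'ab uab uab; rewrite subrr normr0 addr0.
have cp : rcb a b p by apply: lip_rcb Lp; rewrite mulr_ge0.
pose q s u := rint (fun t => F t u) a s.
have Lq s : a <= s <= b -> lip_on a b (q s) (C * (s - a)).
  move=> sab u u' uab u'ab; rewrite /q -rintB//; [|exact: L2|exact: L2].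
  rewrite mulrAC; apply: rint_le; [lra|by apply: rcbB; exact: L2|].
  by move=> t tab; have := H t t u u' ltac:(lra) ltac:(lra) uab u'ab; rewrite subrr normr0 add0r.
have cq s : a <= s <= b -> rcb a b (q s).
  by move=> sab; apply: lip_rcb (Lq s sab); rewrite mulr_ge0//; lra.
pose Q s := rint (q s) a b.
have [B0 HB] : exists B : R, forall t u, a <= t <= b -> a <= u <= b -> `|F t u| <= B.
  exists (`|F a a| + C * ((b - a) + (b - a))) => t u tab uab.
  have {1}-> : F t u = F a a + (F t u - F a a) by ring.
  apply: le_trans (ler_normD _ _) _; rewrite lerD2l.
  have aab : a <= a <= b by rewrite lexx.
  apply: le_trans (H _ _ _ _ tab aab uab aab) _.
  by rewrite ler_wpM2l// lerD// ger0_norm; lra.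
have B00 : 0 <= B0 by apply: le_trans (HB a a _ _); rewrite ?lexx.
have qS s s' u : a <= s -> s <= s' -> s' <= b -> a <= u <= b -> q s' u - q s u = rint (fun t => F t u) s s'.
  move=> as_ ss sb uab; rewrite /q (@rint_split _ a s s'); [ring|lra|].
  by apply: L2 => //; lra.
have LQ : lip_on a b Q (B0 * (b - a)).
  have L s s' : a <= s <= b -> a <= s' <= b -> s <= s' -> `|Q s' - Q s| <= B0 * (b - a) * `|s' - s|.
    move=> sab s'ab ss; rewrite /Q -rintB; [|exact: cq|exact: cq].
    rewrite mulrAC; apply: rint_le => //; first by apply: rcbB; exact: cq.
    move=> u uab; rewrite qS//; [|lra|lra].
    rewrite (ger0_norm (x := s' - s)); last lra.
    apply: rint_le => //; first by apply: rcb_sub (L2 u b uab ltac:(lra)); lra.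
    by move=> t tab; apply: HB => //; lra.
  move=> s s' sab s'ab; have [ss|ss] := orP (le_total s s'); last exact: L.
  by rewrite distrC [`|s - s'|]distrC; exact: L.
have dQ s : a <= s < b -> rderiv Q s (p s).
  have Cb := mulr_ge0 C0 ba.
  move=> sab e e0; exists (Num.min (b - s) (e / (C * (b - a) + 1))).
    rewrite lt_min; apply/andP; split; first lra.
    by rewrite divr_gt0//; lra.
  move=> h /andP[h0]; rewrite lt_min => /andP[hb he].
  have {}he : h * (C * (b - a) + 1) <= e by rewrite -ler_pdivlMr ?ltW//; lra.
  have sab' : a <= s <= b by lra.
  have shab : a <= s + h <= b by lra.
  rewrite /Q /p -rintZ; last exact: L1.
  have chF : rcb a b (fun u => h * F s u) by apply: rcbM; [exact: rcb_cst|exact: L1].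
  rewrite -rintB; [|exact: cq|exact: cq].
  rewrite -rintB //; last by apply: rcbB; exact: cq.
  apply: (@le_trans _ _ ((C * h * h) * (b - a))).
    apply: rint_le => //; first by apply: rcbB => //; apply: rcbB; exact: cq.
    move=> u uab; rewrite qS//; [|lra|lra|lra].
    have := @rint_dist _ s (s + h) (fun t => F t u) (F s u) (C * h) ltac:(lra).
    have -> : s + h - s = h by ring.
    apply; first by apply: rcb_sub (L2 u b uab ltac:(lra)); lra.
    move=> t tsh; have := H t s u u ltac:(lra) sab' uab uab.
    rewrite subrr normr0 addr0 => /le_trans; apply.
    by rewrite ler_wpM2l// ger0_norm; lra.
  have -> : C * h * h * (b - a) = h * (C * (b - a)) * h by ring.
  rewrite ler_wpM2r//; apply: le_trans he.
  by rewrite ler_wpM2l// lerDl.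
have E := @rderiv_FTC _ Q p a b ab (lip_econt (mulr_ge0 B00 ba) LQ) cp dQ.
rewrite E (_ : Q a = 0) ?subr0//.
rewrite /Q (_ : q a = fun=> 0) ?rint0//.
by apply/funext => u; rewrite /q rint_pt.
Qed.

Variable K : finType.
Implicit Types (f g : (K -> R) -> R) (x y : K -> R) (k l : K) (r s : seq K).

Definition csup r (M : R) f : Prop :=
  loclip f /\ forall x k, k \in r -> M < `|x k| -> f x = 0.

Definition Ik k f x : R := \int[mu]_t f (upd x k t).

Lemma csup_le r M M' f : M <= M' -> csup r M f -> csup r M' f.
Proof. by move=> MM [lf sf]; split => // x k kr /(le_lt_trans MM); exact: sf. Qed.

Lemma csup_sub r s M f : {subset s <= r} -> csup r M f -> csup s M f.
Proof. by move=> sr [lf sf]; split => // x k /sr; exact: sf. Qed.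

Lemma Ik_rint r M f k x : csup r M f -> k \in r ->
  Ik k f x = rint (fun t => f (upd x k t)) (- M) M.
Proof.
move=> [_ sf] kr; rewrite [RHS]Rintegral_mkcond; apply: eq_Rintegral => t _.
rewrite patchE; case: ifP => // /negbT tM; apply: (sf _ k) => //.
by rewrite updE eqxx ltNge ler_norml; apply: contra tM; rewrite inE/= in_itv.
Qed.

Lemma rcb_upd f k x (a b : R) : loclip f -> rcb a b (fun t => f (upd x k t)).
Proof.
move=> lf; have [M bx] := boxS x.
have [C C0 HC] := lf (M + (`|a| + `|b|)).
have M0 : 0 <= M by apply: le_trans (bx k).
have nt u : a <= u <= b -> `|u| <= M + (`|a| + `|b|).
  move=> uab; have := ler_norm b; have := ler_norm (- a); rewrite normrN ler_norml.
  have := normr_ge0 a; have := normr_ge0 b; lra.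
have bx' : box (M + (`|a| + `|b|)) x by apply: box_le bx; rewrite lerDl addr_ge0.
apply: (lip_rcb C0) => u v uab vab.
have := HC (upd x k u) (upd x k v); rewrite dist1_upd; apply; apply: box_upd; auto.
Qed.

Lemma csup_Ik r M f k : 0 <= M -> csup r M f -> k \in r ->
  csup [seq j <- r | j != k] M (Ik k f).
Proof.
move=> M0 cf kr; have [lf sf] := cf; split => [N|x j]; last first.
  rewrite mem_filter => /andP[jk jr] xj.
  rewrite (Ik_rint _ cf kr) (_ : (fun t => _) = fun=> 0); first exact: rint0.
  by apply/funext => t; apply: (sf _ j jr); rewrite updE (negPf jk).
have [C C0 HC] := lf (Num.max M N).
exists (C * (2 * M)) => [|x y bx by_]; first by rewrite mulr_ge0// mulr_ge0.
rewrite !(Ik_rint _ cf kr) -rintB; [|exact: rcb_upd|exact: rcb_upd].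
rewrite mulrAC (_ : 2 * M = M - - M); last by ring.
apply: rint_le; first lra.
  by apply: rcbB; exact: rcb_upd.
move=> t tM; apply: le_trans (HC _ _ _ _) _.
- apply: box_upd; first by apply: box_le bx; rewrite le_max lexx orbT.
  by rewrite le_max ler_norml; apply/orP; left.
- apply: box_upd; first by apply: box_le by_; rewrite le_max lexx orbT.
  by rewrite le_max ler_norml; apply/orP; left.
- by apply: ler_wpM2l => //; exact: dist1_upd2.
Qed.

Lemma Ik_comm r M f k l : 0 <= M -> csup r M f -> k \in r -> l \in r -> Ik k (Ik l f) = Ik l (Ik k f).
Proof.
move=> M0 cf kr lr; have [->//|kl] := eqVneq k l.
have ck := csup_Ik M0 cf kr; have cl := csup_Ik M0 cf lr.
apply/funext => x.
have lr' : l \in [seq j <- r | j != k] by rewrite mem_filter eq_sym kl.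
have kr' : k \in [seq j <- r | j != l] by rewrite mem_filter kl.
rewrite (Ik_rint _ ck lr') (Ik_rint _ cl kr').
under eq_Rintegral do rewrite (Ik_rint _ cf lr).
under [RHS]eq_Rintegral do rewrite (Ik_rint _ cf kr).
have [N bx] := boxS x; have [lf _] := cf; have [C C0 HC] := lf (Num.max M N).
apply: (etrans (@rint_swap (fun t u => f (upd (upd x k t) l u)) (- M) M C _ C0 _)).
- by lra.
- move=> t t' u u' tM t'M uM u'M.
  have bb v w : - M <= v <= M -> - M <= w <= M -> box (Num.max M N) (upd (upd x k v) l w).
    move=> vM wM; apply: box_upd; last by rewrite le_max ler_norml wM.
    apply: box_upd; last by rewrite le_max ler_norml vM.
    by apply: box_le bx; rewrite le_max lexx orbT.
  apply: le_trans (HC _ _ (bb t u tM uM) (bb t' u' t'M u'M)) _.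
  apply: ler_wpM2l => //; rewrite /dist1 (bigD1 k)//= (bigD1 l)/=; last by rewrite eq_sym.
  rewrite !eqxx (negPf kl) big1 ?addr0// => j /andP[jk jl].
  by rewrite (negPf jk) (negPf jl) subrr normr0.
- by apply: eq_Rintegral => u _; apply: eq_Rintegral => t _; rewrite updC.
Qed.

Lemma iterated_cons k s f : iterated_integral (k :: s) f = Ik k (iterated_integral s f).
Proof. by []. Qed.

Lemma subset_behead k s r : {subset k :: s <= r} -> {subset s <= r}.
Proof. by move=> sr j js; apply: sr; rewrite inE js orbT. Qed.

Lemma csup_iter r s M f : 0 <= M -> csup r M f -> uniq s -> {subset s <= r} ->
  csup [seq j <- r | j \notin s] M (iterated_integral s f).
Proof.
move=> M0 cf; elim: s => [_ _|k s ih].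
  by apply: csup_sub cf => j; rewrite mem_filter => /andP[].
rewrite cons_uniq iterated_cons => /andP[ks us] sr.
have := csup_Ik (k := k) M0 (ih us (subset_behead sr)).
rewrite mem_filter ks sr ?mem_head// => /(_ isT); apply: csup_sub.
by move=> j; rewrite !mem_filter inE negb_or -!andbA.
Qed.

(** The coordinate [k] commutes outwards past each one of [s]. The integral inside is still
    compactly supported in the two coordinates being exchanged, as [Ik_comm] asks. *)
Lemma iter_rotate r s s' M f k : 0 <= M -> csup r M f -> uniq (s ++ k :: s') -> {subset s ++ k :: s' <= r} ->
  iterated_integral (s ++ k :: s') f = iterated_integral (k :: s ++ s') f.
Proof.
move=> M0 cf; elim: s => [//|j s ih].
rewrite !cat_cons cons_uniq => /andP[js us] sr.
have sr' := subset_behead sr.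
rewrite iterated_cons (ih us sr').
have us' : uniq (s ++ s') by move: us; rewrite !cat_uniq /= negb_or -!andbA => /and5P[-> _ -> _ ->].
have ss' : {subset s ++ s' <= r}.
  by move=> i; rewrite mem_cat => /orP[it|it]; apply: sr'; rewrite mem_cat ?inE it ?orbT.
have c := csup_iter M0 cf us' ss'.
rewrite !iterated_cons; apply: (Ik_comm M0 c).
  rewrite mem_filter sr ?mem_head// andbT.
  by move: js; rewrite !mem_cat !inE !negb_or => /and3P[-> _ ->].
rewrite mem_filter sr' ?andbT; last by rewrite mem_cat mem_head orbT.
by move: us; rewrite cat_uniq /= !mem_cat !negb_or => /and3P[_ /andP[-> _] /andP[-> _]].
Qed.

Lemma iter_perm r s s' M f : 0 <= M -> csup r M f -> uniq s -> {subset s <= r} -> perm_eq s s' ->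
  iterated_integral s f = iterated_integral s' f.
Proof.
move=> M0 cf; elim: s s' => [|k s ih] s' us sr pss'.
  by move: pss'; rewrite perm_sym => /perm_nilP ->.
have ks' : k \in s' by rewrite -(perm_mem pss') mem_head.
have [r1 [r2 E]] : exists r1 r2, s' = r1 ++ k :: r2.
  by case/splitPr: ks' => r1 r2; exists r1, r2.
have p12 : perm_eq s (r1 ++ r2).
  by rewrite -(perm_cons k) (permPl pss') E perm_catC /= perm_cons perm_catC.
rewrite E (iter_rotate M0 cf).
- by rewrite !iterated_cons (ih (r1 ++ r2))//; [case/andP: us|move=> j js; apply: sr; rewrite inE js orbT].
- by rewrite -E -(perm_uniq pss').
- by move=> j; rewrite -E -(perm_mem pss'); exact: sr.
Qed.

Lemma csupD r M f g : csup r M f -> csup r M g -> csup r M (fun x => f x + g x).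
Proof.
move=> [lf sf] [lg sg]; split; first exact: loclipD.
by move=> x k kr xk; rewrite (sf _ k)// (sg _ k)// addr0.
Qed.

Lemma csupM r M f g : csup r M f -> loclip g -> csup r M (fun x => f x * g x).
Proof.
move=> [lf sf] lg; split; first exact: loclipM.
by move=> x k kr xk; rewrite (sf _ k)// mul0r.
Qed.

Lemma iterD r s M f g : 0 <= M -> csup r M f -> csup r M g -> uniq s -> {subset s <= r} ->
  iterated_integral s (fun x => f x + g x) =
  fun x => iterated_integral s f x + iterated_integral s g x.
Proof.
move=> M0 cf cg; elim: s => [//|k s ih]; rewrite cons_uniq => /andP[ks us] sr.
have sr' := subset_behead sr.
rewrite !iterated_cons ih//.
have c1 := csup_iter M0 cf us sr'; have c2 := csup_iter M0 cg us sr'.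
have kr : k \in [seq j <- r | j \notin s] by rewrite mem_filter ks sr// mem_head.
apply/funext => x.
rewrite (Ik_rint _ c1 kr) (Ik_rint _ c2 kr) (Ik_rint _ (csupD c1 c2) kr).
by rewrite rintD//; apply: rcb_upd; [case: c1|case: c2].
Qed.

Lemma iterZ r s M f (c : R) : 0 <= M -> csup r M f -> uniq s -> {subset s <= r} ->
  iterated_integral s (fun x => c * f x) = fun x => c * iterated_integral s f x.
Proof.
move=> M0 cf; elim: s => [//|k s ih]; rewrite cons_uniq => /andP[ks us] sr.
have sr' := subset_behead sr.
rewrite !iterated_cons ih//.
have c1 := csup_iter M0 cf us sr'.
have c2 : csup [seq j <- r | j \notin s] M (fun x => c * iterated_integral s f x).
  rewrite (_ : (fun x => _) = fun x => iterated_integral s f x * c); last first.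
    by apply/funext => x; rewrite mulrC.
  by apply: csupM => //; exact: loclip_cst.
have kr : k \in [seq j <- r | j \notin s] by rewrite mem_filter ks sr// mem_head.
apply/funext => x.
rewrite (Ik_rint _ c1 kr) (Ik_rint _ c2 kr).
by rewrite rintZ//; apply: rcb_upd; case: c1.
Qed.

Lemma iter0 s : iterated_integral s (fun=> 0) = fun=> 0 :> R.
Proof.
elim: s => [//|k s ih]; rewrite iterated_cons ih.
by apply/funext => x; rewrite /Ik /Rintegral integral0.
Qed.

Lemma iter_le r s M f (B : R) : 0 <= M -> csup r M f -> uniq s -> {subset s <= r} ->
  (forall x, `|f x| <= B) -> forall x, `|iterated_integral s f x| <= B * (2 * M) ^+ size s.
Proof.
move=> M0 cf + + fB; elim: s => [_ _ x|k s ih]; first by rewrite mulr1.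
rewrite cons_uniq => /andP[ks us] sr x.
have sr' := subset_behead sr.
have c1 := csup_iter M0 cf us sr'.
have kr : k \in [seq j <- r | j \notin s] by rewrite mem_filter ks sr// mem_head.
rewrite iterated_cons (Ik_rint _ c1 kr).
have -> : B * (2 * M) ^+ size (k :: s) = B * (2 * M) ^+ size s * (M - - M) by rewrite /= exprSr; ring.
apply: rint_le; first lra.
  by apply: rcb_upd; case: c1.
by move=> t _; exact: ih.
Qed.

(** A right derivative alone determines [df x]. Hence vanishing conditions known only on a set
    stable under increasing coordinates, such as [1 <= l j], pass to derivatives even on its
    boundary. *)
Lemma pder_vanish k f df x : pder k f df ->
  (exists2 d : R, 0 < d & forall h, 0 <= h < d -> f (upd x k (x k + h)) = 0) -> df x = 0.
Proof.
move=> pf [d d0 dP]; have := is_derive_rderiv (pf x) => H.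
apply: rderiv_uniq H _; apply: (rderiv_eq (F := fun=> 0) d0); last exact: rderiv_cst.
by move=> h hd; rewrite dP.
Qed.

Lemma csup_partial r M f df k : pder k f df -> loclip df -> csup r M f -> csup r M df.
Proof.
move=> pf ldf [lf sf]; split => // x j jr xj; apply: (pder_vanish pf).
have [jk|jk] := eqVneq j k; last first.
  by exists 1 => // h _; apply: (sf _ j jr); rewrite updE (negPf jk).
rewrite jk in xj jr; have [x0|x0] := leP 0 (x k).
  exists 1 => // h /andP[h0 _]; apply: (sf _ k jr); rewrite updE eqxx.
  by move: xj; rewrite !ger0_norm//; lra.
exists (- x k - M); first by move: xj; rewrite ltr0_norm//; lra.
move=> h /andP[h0 hd]; apply: (sf _ k jr); rewrite updE eqxx.
by have := ler_norm (- (x k + h)); rewrite normrN; lra.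
Qed.

Lemma integral_Rn_partial M f df k : 0 <= M -> pder k f df -> loclip df ->
  csup (enum K) M f -> integral_Rn df = 0.
Proof.
move=> M0 pf ldf cf.
(* The box is enlarged because [f] is known to vanish only strictly beyond [M]; the boundary terms
   are taken at distance [M + 1]. *)
have cdf : csup (enum K) (M + 1) df by apply: (@csup_le _ M); [lra|exact: csup_partial pf ldf cf].
have M10 : 0 <= M + 1 by lra.
have kK : k \in enum K by rewrite mem_enum.
have pE : perm_eq (enum K) (rem k (enum K) ++ [:: k]).
  by rewrite (permPl (perm_to_rem kK)) -cat1s perm_catC.
rewrite /integral_Rn (iter_perm M10 cdf (enum_uniq _) _ pE)//.
rewrite /iterated_integral foldr_cat -!/(iterated_integral _ _) /= -/(Ik k df).
rewrite (_ : Ik k df = fun=> 0); first by rewrite iter0.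
apply/funext => x; rewrite (Ik_rint x cdf kK).
have [_ sf] := cf.
apply: (etrans (@rint_FTC _ (fun t => f (upd x k t)) (fun t => df (upd x k t)) _ _ _ _ _)).
- lra.
- by move=> t _; exact: pder_at.
- by apply: rcb_upd.
rewrite !(sf _ k kK) ?subrr// updE eqxx ?normrN; rewrite ger0_norm; lra.
Qed.

Lemma integral_RnD M f g : 0 <= M -> csup (enum K) M f -> csup (enum K) M g ->
  integral_Rn (fun x => f x + g x) = integral_Rn f + integral_Rn g.
Proof. by move=> M0 cf cg; rewrite /integral_Rn (iterD M0 cf cg) ?enum_uniq. Qed.

Lemma integral_RnZ M f (c : R) : 0 <= M -> csup (enum K) M f ->
  integral_Rn (fun x => c * f x) = c * integral_Rn f.
Proof. by move=> M0 cf; rewrite /integral_Rn (iterZ _ M0 cf) ?enum_uniq. Qed.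

Lemma integral_Rn_le M f (B : R) : 0 <= M -> csup (enum K) M f -> (forall x, `|f x| <= B) ->
  `|integral_Rn f| <= B * (2 * M) ^+ #|K|.
Proof. by move=> M0 cf fB; rewrite cardE; apply: iter_le M0 cf _ _ fB _; rewrite ?enum_uniq. Qed.

End IteratedIntegral.

(** * Division by the variable *)

Section Hadamard.
Variable R : realType.

Lemma smooth1_line (K : finType) (G : (K -> R) -> R) k x : Cinf G -> smooth1 (fun t => G (upd x k t)).
Proof.
move=> cG.
have E n : derive1n n (fun t => G (upd x k t)) = fun t => partials (nseq n k) G (upd x k t).
  elim: n => [//|n ih]; rewrite derive1nS ih; apply/funext => t.
  rewrite (_ : partials (nseq n.+1 k) G = partial k (partials (nseq n k) G)) //.
  apply: (etrans (y := derive1 (fun u => partials (nseq n k) G (upd (upd x k t) k u)) t)).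
    by apply: (congr1 (fun h => derive1 h t)); apply/funext => u; rewrite updU.
  by rewrite /partial updE eqxx.
move=> n t; rewrite E.
have := Cinf_pder k (Cinf_partials (nseq n k) cG) (upd x k t); rewrite updE eqxx => H.
suff -> : (fun t => partials (nseq n k) G (upd x k t)) =
  fun u => partials (nseq n k) G (upd (upd x k t) k u) by have [] := H.
by apply/funext => u; rewrite updU.
Qed.

(** The quotient is the integral of [psi'(t s)] for [s] from 0 to 1, written as a [Gint] in the
    second of two variables whose product is the argument; its smoothness is then that of [Gint]. *)
Lemma hadamard (psi : R -> R) : smooth1 psi ->
  exists2 phi : R -> R, smooth1 phi & forall t, psi t = psi 0 + t * phi t.
Proof.
move=> spsi.
pose q (x : bool -> R) := x true * x false.
have cc (k : bool) := @Cinf_coord R bool k.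
have cq : Cinf q by exact: CinfM.
have ms := smooth1_maps spsi (Cinf_lip cq).
have ms' : maps_smooth (derive1 psi) q.
  apply: smooth1_maps (Cinf_lip cq) => n t; rewrite -derive1Sn; exact: spsi.
have cF := Cinf_comp1 cq ms'.
pose F (x : bool -> R) := derive1 psi (q x).
exists (fun t => Gint false 1 F (upd (fun=> 0) true t)).
  by apply: smooth1_line; exact: Cinf_Gint.
move=> t; set x := upd _ _ _.
have xt r : (shiftc false r x) true = t by rewrite /shiftc /x !updE.
have xf r : (shiftc false r x) false = r by rewrite /shiftc /x !updE /= add0r.
have H := @Gint_partial R bool false 1 (fun x => psi (q x)) x ler01 (Cinf_comp1 cq ms).
have E1 : psi (q (shiftc false 1 x)) = psi t by rewrite /q xt xf mulr1.
have E0 : psi (q x) = psi 0 by rewrite /q /x !updE /= mulr0.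
move: H; rewrite E1 E0 => /eqP; rewrite eq_sym subr_eq => /eqP ->.
rewrite (partial_comp1 _ cq ms).
have -> : partial false q = fun x => x true.
  rewrite /q (partialM _ (cc true) (cc false)) !partial_coord; apply/funext => y.
  by rewrite mul0r add0r mulr1.
rewrite /Gint -rintZ; last exact: (rcb_shiftc _ _ _ (Cinf_lip cF)).
rewrite addrC; congr (_ + _).
by apply: eq_rint => r _; rewrite xt mulrC.
Qed.

End Hadamard.

(** * Superforms *)

Section Superforms.
Variables (R : realType) (Lam : finType).
Local Notation crd := (Defs.coord Lam).
Local Notation sf := (superform R Lam).
Local Notation xi_ := (@Defs.xi R Lam).
Local Notation eta_ := (@Defs.eta R Lam).
Local Notation xform_ := (@Defs.xform R Lam).
Local Notation yform_ := (@Defs.yform R Lam).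
Implicit Types (F G A B : sf) (f g : (crd -> R) -> R) (p q : crd -> R) (k : crd) (i j : Lam).

Lemma sfM F G p : (F * G) p = F p * G p. Proof. by []. Qed.
Lemma sfD F G p : (F + G) p = F p + G p. Proof. by []. Qed.
Lemma sfN F p : (- F) p = - F p. Proof. by []. Qed.
Lemma sf0 p : (0 : sf) p = 0. Proof. by []. Qed.
Lemma sfZ (c : R) F p : (c *: F) p = c *: F p. Proof. by []. Qed.

Lemma sfX F n p : (F ^+ n) p = F p ^+ n.
Proof. by elim: n => // n ih; rewrite !exprS sfM ih. Qed.

Lemma sfP F G : (forall p, F p = G p) -> F = G.
Proof. by move=> H; apply/funext. Qed.

Definition seven F : Prop := forall p, geven (F p).
Definition sodd F : Prop := forall p, godd (F p).
Definition ssmooth F : Prop := forall S, Cinf (fun p => F p S).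

Lemma seven_comm F G : seven F -> F * G = G * F.
Proof. by move=> eF; apply: sfP => p; exact: geven_comm. Qed.

Lemma sevenD F G : seven F -> seven G -> seven (F + G).
Proof. by move=> eF eG p; exact: gevenD. Qed.
Lemma sevenN F : seven F -> seven (- F).
Proof. by move=> eF p; exact: gevenN. Qed.
Lemma sevenM F G : seven F -> seven G -> seven (F * G).
Proof. by move=> eF eG p; exact: gevenM. Qed.
Lemma sevenZ (c : R) F : seven F -> seven (c *: F).
Proof. by move=> eF p; exact: gevenZ. Qed.
Lemma seven0 : seven 0. Proof. by move=> p; exact: geven0. Qed.
Lemma seven1 : seven 1. Proof. by move=> p; exact: geven1. Qed.
Lemma sevenX F n : seven F -> seven (F ^+ n).
Proof. by move=> eF; elim: n => [|n ih]; rewrite ?exprS; [exact: seven1|exact: sevenM]. Qed.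
Lemma seven_form0 f : seven (form0 f).
Proof. by move=> p; apply: gevenZ; exact: geven1. Qed.
Lemma seven_sum (T : Type) (r : seq T) (P : pred T) (F : T -> sf) :
  (forall t, P t -> seven (F t)) -> seven (\sum_(t <- r | P t) F t).
Proof.
move=> H; elim/big_ind : _ => //; first exact: seven0.
by move=> ? ?; exact: sevenD.
Qed.
Lemma seven_prod (T : Type) (r : seq T) (P : pred T) (F : T -> sf) :
  (forall t, P t -> seven (F t)) -> seven (\prod_(t <- r | P t) F t).
Proof.
move=> H; elim/big_ind : _ => //; first exact: seven1.
by move=> ? ?; exact: sevenM.
Qed.

Lemma ssmoothD F G : ssmooth F -> ssmooth G -> ssmooth (F + G).
Proof.
move=> sF sG S; under eq_fun do rewrite sfD gaddE.
by apply: CinfD; [exact: sF|exact: sG].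
Qed.
Lemma ssmoothN F : ssmooth F -> ssmooth (- F).
Proof. by move=> sF S; under eq_fun do rewrite sfN goppE; apply: CinfN; exact: sF. Qed.
Lemma ssmooth_cst (c : grassmann R crd) : ssmooth (fun=> c).
Proof. by move=> S; exact: Cinf_cst. Qed.
Lemma ssmoothM F G : ssmooth F -> ssmooth G -> ssmooth (F * G).
Proof.
move=> sF sG S; under eq_fun do rewrite sfM gmulE.
apply: Cinf_sum => A _; apply: Cinf_sum => B _; apply: CinfM; first exact: Cinf_cst.
by apply: CinfM; [exact: sF|exact: sG].
Qed.
Lemma ssmoothX F n : ssmooth F -> ssmooth (F ^+ n).
Proof.
move=> sF; elim: n => [|n ih]; first exact: (ssmooth_cst 1).
by rewrite exprS; exact: ssmoothM.
Qed.
Lemma ssmoothZ (c : R) F : ssmooth F -> ssmooth (c *: F).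
Proof.
move=> sF S; under eq_fun do rewrite sfZ gscaleE.
by apply: CinfM; [exact: Cinf_cst|exact: sF].
Qed.
Lemma ssmooth_form0 f : Cinf f -> ssmooth (form0 f).
Proof.
move=> cf S; rewrite /form0; under eq_fun do rewrite gscaleE.
by apply: CinfM => //; exact: Cinf_cst.
Qed.
Lemma ssmooth_sum (T : Type) (r : seq T) (P : pred T) (F : T -> sf) :
  (forall t, P t -> ssmooth (F t)) -> ssmooth (\sum_(t <- r | P t) F t).
Proof.
move=> H; elim/big_ind : _ => //; first exact: (ssmooth_cst 0).
by move=> ? ?; exact: ssmoothD.
Qed.
Lemma ssmooth_prod (T : Type) (r : seq T) (P : pred T) (F : T -> sf) :
  (forall t, P t -> ssmooth (F t)) -> ssmooth (\prod_(t <- r | P t) F t).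
Proof.
move=> H; elim/big_ind : _ => //; first exact: (ssmooth_cst 1).
by move=> ? ?; exact: ssmoothM.
Qed.

Lemma form0_mulE f F p : (form0 f * F) p = f p *: F p.
Proof. by rewrite sfM /form0 gscaleAl mul1r. Qed.

Lemma form0M f g : form0 f * form0 g = form0 (fun p => f p * g p) :> sf.
Proof. by apply: sfP => p; rewrite form0_mulE /form0 scalerA. Qed.

Lemma form0D f g : form0 f + form0 g = form0 (fun p => f p + g p) :> sf.
Proof. by apply: sfP => p; rewrite sfD /form0 scalerDl. Qed.

Lemma form0N f : - form0 f = form0 (fun p => - f p) :> sf.
Proof. by apply: sfP => p; rewrite sfN /form0 scaleNr. Qed.

Lemma form01 : form0 (fun=> 1) = 1 :> sf.
Proof. by apply: sfP => p; rewrite /form0 scale1r. Qed.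

Lemma form00 : form0 (fun=> 0) = 0 :> sf.
Proof. by apply: sfP => p; rewrite /form0 scale0r. Qed.

Lemma scale_form0 (c : R) F : c *: F = form0 (fun=> c) * F.
Proof. by apply: sfP => p; rewrite form0_mulE. Qed.

Lemma sfscaleAl (c : R) F G : c *: F * G = c *: (F * G).
Proof. by apply: sfP => p; exact: gscaleAl. Qed.
Lemma sfscaleAr (c : R) F G : F * (c *: G) = c *: (F * G).
Proof. by apply: sfP => p; exact: gscaleAr. Qed.

Definition dX k F : sf := fun p => [ffun S => partial k (fun q => F q S) p].
Definition dG k F : sf := fun p => gder k (F p).

Lemma dXE k F p S : dX k F p S = partial k (fun q => F q S) p.
Proof. by rewrite ffunE. Qed.

Lemma ssmooth_dX k F : ssmooth F -> ssmooth (dX k F).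
Proof. by move=> sF S; under eq_fun do rewrite dXE; apply: Cinf_partial; exact: sF. Qed.

Lemma dXD k F G : ssmooth F -> ssmooth G -> dX k (F + G) = dX k F + dX k G.
Proof.
move=> sF sG; apply: sfP => p; apply/ffunP => S; rewrite sfD gaddE !dXE.
rewrite (_ : (fun q => _) = fun q => F q S + G q S); last by apply/funext => q; rewrite sfD gaddE.
by rewrite partialD.
Qed.

Lemma dXM k F G : ssmooth F -> ssmooth G -> dX k (F * G) = dX k F * G + F * dX k G.
Proof.
move=> sF sG; apply: sfP => p; apply/ffunP => S; rewrite dXE sfD gaddE !sfM !gmulE.
rewrite (_ : (fun q => _) = fun q => \sum_(A : {set crd}) \sum_(B : {set crd} | [disjoint A & B] && (finset.setU A B == S))
  (-1) ^+ inversions A B * (F q A * G q B)); last by apply/funext => q; rewrite sfM gmulE.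
have cFG (A B : {set crd}) : Cinf (fun q => (-1) ^+ inversions A B * (F q A * G q B)).
  by apply: CinfM; [exact: Cinf_cst|apply: CinfM; [exact: sF|exact: sG]].
rewrite partial_sum; last by move=> A _; apply: Cinf_sum.
rewrite -big_split; apply: eq_bigr => A _ /=.
rewrite partial_sum // -big_split; apply: eq_bigr => B _ /=.
rewrite partialM; [|exact: Cinf_cst|by apply: CinfM; [exact: sF|exact: sG]].
rewrite partial_cst mul0r add0r partialM; [|exact: sF|exact: sG].
by rewrite !dXE mulrDr.
Qed.

Lemma dX_cst k (c : grassmann R crd) : dX k (fun=> c) = 0.
Proof. by apply: sfP => p; apply/ffunP => S; rewrite dXE partial_cst g0E. Qed.

Lemma dX_form0 k f : Cinf f -> dX k (form0 f) = form0 (partial k f) :> sf.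
Proof.
move=> cf; apply: sfP => p; apply/ffunP => S; rewrite dXE /form0 gscaleE.
rewrite (_ : (fun q => _) = fun q => f q * (1 : grassmann R crd) S); last first.
  by apply/funext => q; rewrite gscaleE.
by rewrite partialM ?partial_cst ?mulr0 ?addr0//; exact: Cinf_cst.
Qed.

Lemma dGD k F G : dG k (F + G) = dG k F + dG k G.
Proof. by apply: sfP => p; exact: gderD. Qed.

Lemma dGM k F G : seven F -> dG k (F * G) = dG k F * G + F * dG k G.
Proof. by move=> eF; apply: sfP => p; exact: gderM_even. Qed.

Lemma dG_form0 k f : dG k (form0 f) = 0 :> sf.
Proof. by apply: sfP => p; rewrite /dG /form0 gderZ gder1 scaler0. Qed.

Lemma ssmooth_dG k F : ssmooth F -> ssmooth (dG k F).
Proof.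
move=> sF S; rewrite /dG; under eq_fun do rewrite ffunE.
have [_|_] := boolP (k \in S); first exact: Cinf_cst.
by apply: CinfM; [exact: Cinf_cst|exact: sF].
Qed.

Lemma xi_odd i : sodd (xi_ i). Proof. by move=> p; exact: godd_gen. Qed.
Lemma eta_odd i : sodd (eta_ i). Proof. by move=> p; exact: godd_gen. Qed.

Lemma ssmooth_xform i : ssmooth (xform_ i). Proof. by apply: ssmooth_form0; exact: Cinf_coord. Qed.
Lemma ssmooth_yform i : ssmooth (yform_ i). Proof. by apply: ssmooth_form0; exact: Cinf_coord. Qed.
Lemma ssmooth_xi i : ssmooth (xi_ i). Proof. exact: ssmooth_cst. Qed.
Lemma ssmooth_eta i : ssmooth (eta_ i). Proof. exact: ssmooth_cst. Qed.
Lemma seven_xform i : seven (xform_ i). Proof. exact: seven_form0. Qed.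
Lemma seven_yform i : seven (yform_ i). Proof. exact: seven_form0. Qed.

(* The supersymmetry generator. *)
Definition Qop F : sf := \sum_i (xi_ i * dX (inl i) F + eta_ i * dX (inr i) F
  - xform_ i * dG (inr i) F + yform_ i * dG (inl i) F).

(* What is used of [d/dx_k] and of [Qop]: additivity, Leibniz' rule for an even left factor
   (there is then no sign), and the chain rule on coefficients. *)
Record superder (D : sf -> sf) : Prop := Superder {
  sderD : forall F G, ssmooth F -> ssmooth G -> D (F + G) = D F + D G ;
  sderM : forall F G, seven F -> ssmooth F -> ssmooth G -> D (F * G) = D F * G + F * D G ;
  sder_form0 : forall f, Cinf f ->
    D (form0 f) = \sum_k form0 (partial k f) * D (form0 (fun p => p k)) ;
  sder_smooth : forall F, ssmooth F -> ssmooth (D F)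
}.

Lemma superder_dX k : superder (dX k).
Proof.
split.
- exact: dXD.
- by move=> F G _; exact: dXM.
- move=> f cf; rewrite dX_form0// (bigD1 k)//= big1 ?addr0 => [|j jk].
    by rewrite dX_form0 ?partial_coord ?eqxx ?form01 ?mulr1//; exact: Cinf_coord.
  rewrite dX_form0; last exact: Cinf_coord.
  by rewrite partial_coord (negPf jk) form00 mulr0.
- exact: ssmooth_dX.
Qed.

Lemma superder_dG k : superder (dG k).
Proof.
split.
- by move=> F G _ _; exact: dGD.
- by move=> F G eF _ _; exact: dGM.
- by move=> f cf; rewrite dG_form0 big1// => j _; rewrite dG_form0 mulr0.
- exact: ssmooth_dG.
Qed.

Lemma superder_add D D' : superder D -> superder D' -> superder (fun F => D F + D' F).
Proof.
move=> [a1 m1 f1 s1] [a2 m2 f2 s2]; split.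
- by move=> F G sF sG; rewrite a1// a2// addrACA.
- by move=> F G eF sF sG; rewrite m1// m2// mulrDl mulrDr addrACA.
- move=> f cf; rewrite f1// f2// -big_split; apply: eq_bigr => j _ /=.
  by rewrite mulrDr.
- by move=> F sF; apply: ssmoothD; [exact: s1|exact: s2].
Qed.

Lemma superder_lmul C D : ssmooth C -> superder D -> superder (fun F => C * D F).
Proof.
move=> sC [a1 m1 f1 s1]; split.
- by move=> F G sF sG; rewrite a1// mulrDr.
- move=> F G eF sF sG; rewrite m1// mulrDr -mulrA; congr (_ + _).
  by rewrite mulrA -(seven_comm C eF) -mulrA.
- move=> f cf; rewrite f1// mulr_sumr; apply: eq_bigr => j _ /=.
  by rewrite !mulrA (seven_comm C (seven_form0 _)).
- by move=> F sF; apply: ssmoothM => //; exact: s1.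
Qed.

Lemma superder0 : superder (fun=> 0).
Proof.
split => [F G _ _|F G _ _ _|f _|F _]; rewrite ?addr0 ?mul0r ?mulr0 ?addr0//.
- by rewrite big1// => j _; rewrite mulr0.
- exact: (ssmooth_cst 0).
Qed.

Lemma superder_sum (T : Type) (r : seq T) (D : T -> sf -> sf) :
  (forall t, superder (D t)) -> superder (fun F => \sum_(t <- r) D t F).
Proof.
move=> H; elim: r => [|t r ih]; first by under eq_fun do rewrite big_nil; exact: superder0.
by under eq_fun do rewrite big_cons; apply: superder_add.
Qed.

Lemma superder_Q : superder Qop.
Proof.
apply: superder_sum => i; apply: superder_add; [apply: superder_add; [apply: superder_add|]|].
- by apply: superder_lmul; [exact: ssmooth_xi|exact: superder_dX].
- by apply: superder_lmul; [exact: ssmooth_eta|exact: superder_dX].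
- under eq_fun do rewrite -mulNr.
  apply: superder_lmul; last exact: superder_dG.
  by apply: ssmoothN; exact: ssmooth_xform.
- by apply: superder_lmul; [exact: ssmooth_yform|exact: superder_dG].
Qed.

Section Derivations.
Variable D : sf -> sf.
Hypothesis dD : superder D.

Lemma sder0 : D 0 = 0.
Proof.
have := sderD dD (ssmooth_cst 0) (ssmooth_cst 0).
by rewrite -[X in D X]/(0 + 0 : sf) addr0 -[X in X = _ -> _]addr0 => /addrI.
Qed.

Lemma sderN F : ssmooth F -> D (- F) = - D F.
Proof.
move=> sF; apply/eqP; rewrite -subr_eq0 opprK -(sderD dD)//; last exact: ssmoothN.
by rewrite addNr sder0.
Qed.

Lemma sder1 : D 1 = 0.
Proof.
rewrite -form01 (sder_form0 dD); last exact: Cinf_cst.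
by rewrite big1// => k _; rewrite partial_cst form00 mul0r.
Qed.

Lemma sder_form0_cst (c : R) : D (form0 (fun=> c)) = 0.
Proof.
rewrite (sder_form0 dD); last exact: Cinf_cst.
by rewrite big1// => k _; rewrite partial_cst form00 mul0r.
Qed.

Lemma sderZ (c : R) F : ssmooth F -> D (c *: F) = c *: D F.
Proof.
move=> sF; rewrite !scale_form0 (sderM dD) ?sder_form0_cst ?mul0r ?add0r//.
- exact: seven_form0.
- by apply: ssmooth_form0; exact: Cinf_cst.
Qed.

Lemma sder_bigsum (T : Type) (r : seq T) (F : T -> sf) : (forall t, ssmooth (F t)) ->
  D (\sum_(t <- r) F t) = \sum_(t <- r) D (F t).
Proof.
move=> sF; elim: r => [|t r ih]; first by rewrite !big_nil sder0.
by rewrite !big_cons (sderD dD) ?ih//; exact: ssmooth_sum.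
Qed.

Lemma sderX F n : seven F -> ssmooth F -> D (F ^+ n) = (F ^+ n.-1 * D F) *+ n.
Proof.
move=> eF sF; elim: n => [|n ih]; first by rewrite mulr0n sder1.
rewrite exprS (sderM dD)//; last exact: ssmoothX.
rewrite ih; case: n ih => [|n] ih; first by rewrite expr0 mulr1 mulr0n mulr0 addr0 mul1r mulr1n.
rewrite [n.+1.-1]/= -mulrnAr mulrA -exprS mulrnAr [RHS]mulrS; congr (_ + _).
by rewrite (seven_comm (D F) (sevenX n.+1 eF)).
Qed.

Lemma sder_comp1 (phi : R -> R) f : Cinf f -> maps_smooth phi f ->
  D (form0 (fun p => phi (f p))) = form0 (fun p => derive1 phi (f p)) * D (form0 f).
Proof.
move=> cf H; rewrite !(sder_form0 dD)//; last exact: Cinf_comp1.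
rewrite mulr_sumr; apply: eq_bigr => k _.
by rewrite mulrA form0M partial_comp1.
Qed.

End Derivations.

Lemma bodyE F p : body F p = F p finset.set0. Proof. by []. Qed.

Lemma soulE F p : soul F p = F p - body F p *: (1 : grassmann R crd).
Proof. by []. Qed.

Lemma body_soul F p : soul F p finset.set0 = 0.
Proof. by rewrite soulE gaddE goppE gscaleE g1E eqxx mulr1 subrr. Qed.

Lemma soul_lowdeg F p : lowdeg 1 (soul F p).
Proof. by move=> S; rewrite ltnS leqn0 cards_eq0 => /eqP ->; exact: body_soul. Qed.

Lemma lowdeg_nil F n : (forall p, lowdeg 1 (F p)) -> (#|crd| < n)%N -> F ^+ n = 0.
Proof.
move=> lF Hn; apply: sfP => p; rewrite sfX; apply: lowdeg_eq0 Hn _.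
exact: lowdegX.
Qed.

Lemma seven_soul F : seven F -> seven (soul F).
Proof. by move=> eF; apply: sevenD => //; apply: sevenN; exact: seven_form0. Qed.

Lemma Cinf_body F : ssmooth F -> Cinf (body F).
Proof. by move=> sF; exact: sF. Qed.

Lemma ssmooth_soul F : ssmooth F -> ssmooth (soul F).
Proof.
by move=> sF; apply: ssmoothD => //; apply: ssmoothN; apply: ssmooth_form0; exact: Cinf_body.
Qed.

Lemma body_soulK F : F = form0 (body F) + soul F.
Proof. by rewrite /soul addrC subrK. Qed.

Lemma bodyD F G p : body (F + G) p = body F p + body G p.
Proof. by rewrite /body /gbody sfD gaddE. Qed.
Lemma bodyM F G p : body (F * G) p = body F p * body G p.
Proof. exact: gbodyM. Qed.
Lemma bodyN F p : body (- F) p = - body F p.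
Proof. by rewrite /body /gbody sfN goppE. Qed.
Lemma body_form0 f : body (form0 f : sf) = f.
Proof. by apply/funext => p; rewrite bodyE /form0 gscaleE g1E eqxx mulr1. Qed.
Lemma body1 p : body (1 : sf) p = 1.
Proof. by rewrite -form01 body_form0. Qed.

Definition ffterm (phi : R -> R) F (n : nat) : sf :=
  form0 (fun p => n`!%:R^-1 * derive1n n phi (body F p)) * soul F ^+ n.

Lemma fun_formE phi F : fun_form phi F = \sum_(n < #|crd|.+1) ffterm phi F n.
Proof. by []. Qed.

Lemma seven_ffterm phi F n : seven F -> seven (ffterm phi F n).
Proof.
by move=> eF; apply: sevenM; [exact: seven_form0|apply: sevenX; exact: seven_soul].
Qed.

Lemma seven_fun_form phi F : seven F -> seven (fun_form phi F).
Proof. by move=> eF; apply: seven_sum => n _; exact: seven_ffterm. Qed.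

Lemma maps_smooth_derive1n phi f n : maps_smooth phi f -> maps_smooth (derive1n n phi) f.
Proof.
move=> H; elim: n => [//|n ih] M; have [a [b [fab sp]]] := ih M; exists a, b; split; first exact: fab.
by have := smooth_on_derive1 sp; rewrite -derive1nS.
Qed.

Lemma ssmooth_ffterm phi F n : ssmooth F -> maps_smooth phi (body F) -> ssmooth (ffterm phi F n).
Proof.
move=> sF H; apply: ssmoothM; last by apply: ssmoothX; exact: ssmooth_soul.
apply: ssmooth_form0; apply: CinfM; first exact: Cinf_cst.
by apply: Cinf_comp1; [exact: Cinf_body|exact: maps_smooth_derive1n].
Qed.

Lemma ssmooth_fun_form phi F : ssmooth F -> maps_smooth phi (body F) -> ssmooth (fun_form phi F).
Proof. by move=> sF H; apply: ssmooth_sum => n _; exact: ssmooth_ffterm. Qed.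

(** Termwise Leibniz. The derivative falling on the power of the soul produces the Taylor term of
    [derive1 phi] with index one lower, so the sums match after a shift, up to one top term. *)
Lemma sder_fun_form D phi F : superder D -> seven F -> ssmooth F -> maps_smooth phi (body F) ->
  D (fun_form phi F) = fun_form (derive1 phi) F * D F.
Proof.
move=> dD eF sF H.
have sb : ssmooth (form0 (body F)) by apply: ssmooth_form0; exact: Cinf_body.
have es := seven_soul eF; have ss := ssmooth_soul sF.
have DF : D F = D (form0 (body F)) + D (soul F) by rewrite {1}(body_soulK F) (sderD dD).
have cn n : Cinf (fun p => n`!%:R^-1 * derive1n n phi (body F p)).
  apply: CinfM; first exact: Cinf_cst.
  by apply: Cinf_comp1; [exact: Cinf_body|exact: maps_smooth_derive1n].
have Dn n : D (ffterm phi F n) = ffterm (derive1 phi) F n * D (form0 (body F)) +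
   form0 (fun p => n`!%:R^-1 * derive1n n phi (body F p)) * (soul F ^+ n.-1 * D (soul F)) *+ n.
  rewrite /ffterm (sderM dD); [|exact: seven_form0|exact: ssmooth_form0|exact: ssmoothX].
  congr (_ + _); last by rewrite (sderX dD)// mulrnAr.
  have -> : form0 (fun p => n`!%:R^-1 * derive1n n phi (body F p)) =
      n`!%:R^-1 *: form0 (fun p => derive1n n phi (body F p)) :> sf.
    by rewrite scale_form0 form0M.
  rewrite (sderZ dD); last first.
    by apply: ssmooth_form0; apply: Cinf_comp1; [exact: Cinf_body|exact: maps_smooth_derive1n].
  rewrite (sder_comp1 dD); [|exact: Cinf_body|exact: maps_smooth_derive1n].
  rewrite -derive1nS derive1Sn scale_form0 !mulrA form0M -!mulrA.
  by rewrite (seven_comm (D _) (sevenX n es)).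
(* This is the top term left by the shift. Degree counting kills only the next power of the soul;
   applying [D] to that vanishing power and dividing by the exponent gives the claim. *)
have nil : soul F ^+ #|crd| * D (soul F) = 0.
  have : soul F ^+ #|crd|.+1 = 0 by apply: lowdeg_nil => // p; exact: soul_lowdeg.
  move=> /(congr1 D); rewrite (sder0 dD) (sderX dD)//= => E; apply: sfP => p; apply/ffunP => S.
  have := congr1 (fun X : sf => X p S) E; rewrite -scaler_nat sfZ gscaleE !sf0 !g0E => /eqP.
  by rewrite mulf_eq0 pnatr_eq0 /= => /eqP.
rewrite !fun_formE (sder_bigsum dD); last by move=> n; exact: ssmooth_ffterm.
under eq_bigr do rewrite Dn.
rewrite big_split /= DF mulrDr mulr_suml; congr (_ + _).
rewrite big_ord_recl mulr0n add0r mulr_suml big_ord_recr /= {2}/ffterm -mulrA nil mulr0 addr0.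
apply: eq_bigr => n _; rewrite /ffterm /bump leq0n add1n add0n -mulrnAl -[RHS]mulrA; congr (_ * _).
rewrite -scaler_nat scale_form0 form0M; congr form0; apply/funext => p.
rewrite -derive1Sn derive1nS mulrA factS natrM invfM; congr (_ * _).
by rewrite mulrA mulfV ?mul1r// pnatr_eq0.
Qed.

End Superforms.

(** * Derivatives of the inverse, the square root and the exponential *)

Section Germs.
Variable R : realType.
Implicit Types (phi : R -> R) (t c : R).

Lemma is_derive_near (f g : R -> R) t (l : R) : (\forall s \near t, f s = g s) ->
  is_derive t 1 f l -> is_derive t 1 g l.
Proof.
move=> fg [df <-]; apply: DeriveDef; first exact: near_eq_derivable df.
by rewrite -(near_eq_derive _ fg)// oner_neq0.
Qed.

Lemma derive1n_germ phi (psi : nat -> R -> R) c : (forall t, c < t -> phi t = psi 0%N t) ->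
  (forall n t, c < t -> is_derive t 1 (psi n) (psi n.+1 t)) ->
  forall n t, c < t -> derive1n n phi t = psi n t /\ derivable (derive1n n phi) t 1.
Proof.
move=> E D.
suff H n : forall t, c < t -> derive1n n phi t = psi n t.
  move=> n t ct; split; first exact: H.
  have [] // : is_derive t 1 (derive1n n phi) (psi n.+1 t).
  apply: is_derive_near (D n t ct).
  near=> s; rewrite H//; near: s; exact: lt_nbhsr.
elim: n => [//|n ih] t ct; rewrite derive1nS derive1E.
have [_ ->] // : is_derive t 1 (derive1n n phi) (psi n.+1 t).
apply: is_derive_near (D n t ct).
near=> s; rewrite ih//; near: s; exact: lt_nbhsr.
Unshelve. all: by end_near.
Qed.

Lemma is_derive_pow n t : is_derive t 1 (fun s : R => s ^+ n) (n%:R * t ^+ n.-1).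
Proof.
elim: n => [|n ih]; first by rewrite mul0r; exact: is_derive_cst.
have := is_deriveM (is_derive_id t (1 : R)) ih => H.
rewrite (_ : (fun s : R => s ^+ n.+1) = id * (fun s : R => s ^+ n)); last first.
  by apply/funext => s; rewrite exprS.
apply: (is_derive_eq H); rewrite /GRing.scale /= mulr1 -natr1 mulrDl mul1r; congr (_ + _).
by case: n {ih H} => [|n]; rewrite ?mul0r ?mulr0// mulrCA -exprS.
Qed.

Lemma derive1n_inv n t : 0 < t ->
  derive1n n (@GRing.inv R) t = (-1) ^+ n * n`!%:R * t ^- n.+1 /\
  derivable (derive1n n (@GRing.inv R)) t 1.
Proof.
apply: (@derive1n_germ _ (fun n t => (-1) ^+ n * n`!%:R * t ^- n.+1)) => {n t} [t t0|n t t0].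
  by rewrite expr0 fact0 !mul1r expr1.
have H := is_derive_pow n.+1 t.
have tn : t ^+ n.+1 != 0 by rewrite expf_neq0// gt_eqF.
have := is_deriveZ ((-1) ^+ n * n`!%:R) (is_deriveV (f := fun s => s ^+ n.+1) tn H) => H2.
apply: (is_derive_eq H2); rewrite /GRing.scale /=.
have t0' : t != 0 by rewrite gt_eqF.
have un : t ^+ n != 0 by rewrite expf_neq0.
rewrite factS natrM !(exprS t) (exprS (-1)).
by move: (t ^+ n) un n`!%:R ((-1) ^+ n) => u un v w; field; rewrite un t0'.
Qed.

Lemma derive1n_sqrt n t : 0 < t ->
  derive1n n (@Num.sqrt R) t = (\prod_(k < n) (2^-1 - k%:R)) * (Num.sqrt t * t ^- n) /\
  derivable (derive1n n (@Num.sqrt R)) t 1.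
Proof.
apply: (@derive1n_germ _ (fun n t => (\prod_(k < n) (2^-1 - k%:R)) * (Num.sqrt t * t ^- n))) => {n t} [t t0|n t t0].
  by rewrite big_ord0 mul1r expr0 invr1 mulr1.
have t0' : t != 0 by rewrite gt_eqF.
have un : t ^+ n != 0 by rewrite expf_neq0.
have H := is_derive_pow n t.
have := is_deriveZ (\prod_(k < n) (2^-1 - k%:R)) (is_deriveM (is_derive1_sqrt t0) (is_deriveV (f := fun s => s ^+ n) un H)) => H2.
apply: (is_derive_eq H2); rewrite /GRing.scale /= big_ord_recr /= -[RHS]mulrA; congr (_ * _).
have s0 : Num.sqrt t != 0 by rewrite gt_eqF// sqrtr_gt0.
have -> : (2 * Num.sqrt t)^-1 = Num.sqrt t / (2 * t).
  by rewrite -[X in _ = _ / (2 * X)](sqr_sqrtr (ltW t0)); field.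
have -> : n%:R * t ^+ n.-1 = n%:R * t ^+ n / t.
  by case: (n) => [|m]; rewrite ?mul0r// exprS /=; field.
rewrite (exprS t n); move: (t ^+ n) un (Num.sqrt t) (n%:R : R) => u un v w; field.
by rewrite un t0'.
Qed.

Lemma smooth1_expR : smooth1 (@expR R).
Proof.
move=> n; have -> : derive1n n (@expR R) = expR.
  elim: n => [//|n ih]; rewrite derive1nS ih; apply/funext => t.
  by rewrite derive1E; have [_ ->] := is_derive_expR t.
exact: derivable_expR.
Qed.

Lemma derive1_expR : derive1 (@expR R) = expR.
Proof. by apply/funext => t; rewrite derive1E; have [_ ->] := is_derive_expR t. Qed.

Lemma maps_smooth_pos (K : finType) phi (f : (K -> R) -> R) c : 0 < c ->
  (forall n t, 0 < t -> derivable (derive1n n phi) t 1) -> loclip f -> (forall x, c <= f x) ->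
  maps_smooth phi f.
Proof.
move=> c0 H lf fc M; have [B B0 fB] := loclip_bnd M lf; exists c, B; split.
  by move=> x bx; rewrite fc/= (le_trans (ler_norm _))// fB.
by move=> m t ct; apply: H; apply: lt_le_trans c0 _; lra.
Qed.

End Germs.

(** * The coordinate z and its nilpotent part *)

Section HyperbolicForms.
Variables (R : realType) (Lam : finType).
Local Notation crd := (Defs.coord Lam).
Local Notation sf := (superform R Lam).
Local Notation xi_ := (@Defs.xi R Lam).
Local Notation eta_ := (@Defs.eta R Lam).
Local Notation xform_ := (@Defs.xform R Lam).
Local Notation yform_ := (@Defs.yform R Lam).
Local Notation z_ := (@Defs.zform R Lam).
Implicit Types (F G A B : sf) (f g : (crd -> R) -> R) (p q : crd -> R) (k : crd) (i j : Lam).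

Definition z0 i p : R := Num.sqrt (1 + p (inl i) ^+ 2 + p (inr i) ^+ 2).

Lemma z0sq_ge1 i p : 1 <= 1 + p (inl i) ^+ 2 + p (inr i) ^+ 2.
Proof. by have := sqr_ge0 (p (inl i)); have := sqr_ge0 (p (inr i)); lra. Qed.

Lemma z0_ge1 i p : 1 <= z0 i p.
Proof. by rewrite -[1]sqrtr1; apply: ler_wsqrtr; exact: z0sq_ge1. Qed.

Lemma z0_gt0 i p : 0 < z0 i p.
Proof. by apply: lt_le_trans (z0_ge1 i p). Qed.

Lemma z0_neq0 i p : z0 i p != 0. Proof. by rewrite gt_eqF// z0_gt0. Qed.

Lemma z0_sqr i p : z0 i p ^+ 2 = 1 + p (inl i) ^+ 2 + p (inr i) ^+ 2.
Proof. by rewrite sqr_sqrtr//; apply: le_trans (z0sq_ge1 i p). Qed.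

Lemma CinfX (K : finType) (f : (K -> R) -> R) n : Cinf f -> Cinf (fun x => f x ^+ n).
Proof.
move=> cf; elim: n => [|n ih]; first exact: Cinf_cst.
by under eq_fun do rewrite exprS; exact: CinfM.
Qed.

Lemma Cinf_z0sq i : Cinf (fun p => 1 + p (inl i) ^+ 2 + p (inr i) ^+ 2 : R).
Proof.
by apply: CinfD; [apply: CinfD; [exact: Cinf_cst|]|]; apply: CinfX; exact: Cinf_coord.
Qed.

Lemma maps_sqrt_z0sq i : maps_smooth (@Num.sqrt R) (fun p => 1 + p (inl i) ^+ 2 + p (inr i) ^+ 2).
Proof.
apply: (@maps_smooth_pos _ _ _ _ 1) => //; last by move=> p; exact: z0sq_ge1.
  by move=> n t t0; have [] := derive1n_sqrt n t0.
by apply: Cinf_lip; exact: Cinf_z0sq.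
Qed.

Lemma Cinf_z0 i : Cinf (z0 i).
Proof. by apply: Cinf_comp1; [exact: Cinf_z0sq|exact: maps_sqrt_z0sq]. Qed.

Lemma Cinf_inv (K : finType) (f : (K -> R) -> R) (c : R) : 0 < c -> Cinf f -> (forall x, c <= f x) ->
  Cinf (fun x => (f x)^-1).
Proof.
move=> c0 cf fc; apply: Cinf_comp1 => //; apply: maps_smooth_pos c0 _ _ fc.
  by move=> n t t0; have [] := derive1n_inv n t0.
exact: Cinf_lip.
Qed.

Definition owner k : Lam := match k with inl i => i | inr i => i end.

Lemma z0_sep k j p (t : R) : j != owner k -> z0 j (upd p k t) = z0 j p.
Proof.
move=> jk; rewrite /z0 !updE; case: k jk => i /= ji.
  by case: eqP => [[E]|_]; [rewrite E eqxx in ji|].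
by case: eqP => [[E]|//]; rewrite E eqxx in ji.
Qed.

(** Locked so that rewriting treats the pair as one central element of square zero. *)
Definition xe i : sf := locked (xi_ i * eta_ i).

Lemma xeE i : xe i = xi_ i * eta_ i. Proof. by rewrite /xe -lock. Qed.

Lemma xe_even i : seven (xe i).
Proof. by rewrite xeE => p; apply: godd_oddM; [exact: xi_odd|exact: eta_odd]. Qed.

Lemma eta_sq i : eta_ i * eta_ i = 0.
Proof. by apply: sfP => p; exact: ggen_sq. Qed.
Lemma eta_xi i j : eta_ i * xi_ j = - (xi_ j * eta_ i).
Proof. by apply: sfP => p; exact: ggen_anti. Qed.
Lemma eta_xe i : eta_ i * xe i = 0.
Proof. by rewrite -(seven_comm _ (xe_even i)) xeE -mulrA eta_sq mulr0. Qed.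

Lemma xe_sq i : xe i * xe i = 0.
Proof. by rewrite {1}xeE -mulrA eta_xe mulr0. Qed.

Lemma body_xe i p : body (xe i) p = 0.
Proof. by rewrite xeE bodyM bodyE ffunE; case: eqP => [/setP/(_ (inl i))|]; rewrite ?inE ?eqxx// mul0r. Qed.

(** The nilpotent part of [z_i]: the square of [z0 - xi eta / z0] is [z0 ^+ 2 - 2 xi eta], because
    the pair squares to zero. *)
Definition th i : sf := locked (form0 (fun p => - (z0 i p)^-1) * xe i).

Lemma thE i : th i = form0 (fun p => - (z0 i p)^-1) * xe i. Proof. by rewrite /th -lock. Qed.

Lemma th_even i : seven (th i).
Proof. by rewrite thE; apply: sevenM; [exact: seven_form0|exact: xe_even]. Qed.

Lemma th_sq i : th i * th i = 0.
Proof. by rewrite thE mulrA -(mulrA _ (xe i)) (seven_comm _ (xe_even i)) -!mulrA xe_sq !mulr0. Qed.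

Lemma body_th i p : body (th i) p = 0.
Proof. by rewrite thE bodyM body_xe mulr0. Qed.

Lemma Cinf_z0inv i : Cinf (fun p => (z0 i p)^-1).
Proof. by apply: (Cinf_inv (c := 1)) => //; [exact: Cinf_z0|move=> p; exact: z0_ge1]. Qed.

Lemma ssmooth_xe i : ssmooth (xe i).
Proof. by rewrite xeE; apply: ssmoothM; [exact: ssmooth_xi|exact: ssmooth_eta]. Qed.

Lemma ssmooth_th i : ssmooth (th i).
Proof.
rewrite thE; apply: ssmoothM; last exact: ssmooth_xe.
by apply: ssmooth_form0; apply: CinfN; exact: Cinf_z0inv.
Qed.

Lemma fun_form_nil2 (phi : R -> R) F : (0 < #|crd|)%N -> soul F ^+ 2 = 0 ->
  fun_form phi F = form0 (fun p => phi (body F p)) + form0 (fun p => derive1 phi (body F p)) * soul F.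
Proof.
move=> c0 s2; rewrite fun_formE; case: #|_| c0 => // m _.
rewrite !big_ord_recl big1 ?addr0 => [|n _].
  congr (_ + _); rewrite /ffterm /=.
    by rewrite fact0 expr0 mulr1; congr form0; apply/funext => p; rewrite invr1 mul1r.
  by rewrite expr1; congr (form0 _ * _); apply/funext => p; rewrite invr1 mul1r.
by rewrite /ffterm (_ : nat_of_ord _ = (2 + n)%N)// exprD s2 mul0r mulr0.
Qed.

Lemma card_crd_gt0 i : (0 < #|crd|)%N.
Proof. by apply/card_gt0P; exists (inl i). Qed.

Definition zb i : sf := 1 + xform_ i ^+ 2 + yform_ i ^+ 2 - 2%:R * xi_ i * eta_ i.

Lemma zbE i : zb i = form0 (fun p => 1 + p (inl i) ^+ 2 + p (inr i) ^+ 2) - xe i *+ 2.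
Proof.
rewrite /zb -mulrA mulr_natl -xeE; congr (_ - _).
by rewrite -form01 !expr2 /xform /yform !form0M !form0D.
Qed.

Lemma body_zb i : body (zb i) = fun p => 1 + p (inl i) ^+ 2 + p (inr i) ^+ 2.
Proof.
apply/funext => p; rewrite zbE mulr2n bodyD bodyN bodyD body_form0 body_xe.
by rewrite addr0 subr0.
Qed.

Lemma soul_zb i : soul (zb i) = form0 (fun=> - 2) * xe i.
Proof. by rewrite /soul body_zb {1}zbE addrC addKr -scale_form0 scaleNr scaler_nat. Qed.

Lemma zformE i : z_ i = form0 (z0 i) + th i.
Proof.
rewrite -[z_ i]/(fun_form Num.sqrt (zb i)) fun_form_nil2 ?(card_crd_gt0 i)//; last first.
  by rewrite soul_zb expr2 mulrA -(mulrA _ (xe i)) (seven_comm _ (xe_even i)) -!mulrA xe_sq !mulr0.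
rewrite body_zb soul_zb thE mulrA form0M; apply: (f_equal (fun f => form0 (z0 i) + form0 f * xe i)); apply/funext => p.
have := z0_neq0 i p; rewrite /z0.
set t := 1 + _ + _ => t0; have tp : 0 < t by apply: lt_le_trans (z0sq_ge1 i p).
have [_ ] := is_derive1_sqrt tp; rewrite -derive1E => ->; by field.
Qed.

Lemma z_even i : seven (z_ i).
Proof. by rewrite zformE; apply: sevenD; [exact: seven_form0|exact: th_even]. Qed.

Lemma ssmooth_z i : ssmooth (z_ i).
Proof.
rewrite zformE; apply: ssmoothD; last exact: ssmooth_th.
by apply: ssmooth_form0; exact: Cinf_z0.
Qed.

Lemma body_z i p : body (z_ i) p = z0 i p.
Proof. by rewrite zformE bodyD body_th body_form0 addr0. Qed.

Lemma form0_th (f : (crd -> R) -> R) i : form0 f * th i = form0 (fun p => - f p / z0 i p) * xe i.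
Proof.
rewrite thE mulrA form0M; congr (form0 _ * _); apply/funext => p.
by rewrite mulrN mulNr.
Qed.

Lemma z_sqr i : z_ i * z_ i = zb i.
Proof.
rewrite zformE mulrDl !mulrDr th_sq addr0 -(seven_comm _ (th_even i)) -addrA.
rewrite (seven_comm _ (th_even i)) form0_th form0M zbE; congr (_ + _).
  by congr form0; apply/funext => p; rewrite -z0_sqr expr2.
rewrite -scaler_nat -scaleNr scale_form0 -mulrDl form0D; congr (form0 _ * _); apply/funext => p.
by have := z0_neq0 i p => z0n; field.
Qed.

(* The inverse of [z_i + c]. *)
Definition zinv (c : R) i : sf :=
  form0 (fun p => (z0 i p + c)^-1) - form0 (fun p => (z0 i p + c) ^- 2) * th i.

Lemma zinv_even c i : seven (zinv c i).
Proof.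
apply: sevenD; first exact: seven_form0.
by apply: sevenN; apply: sevenM; [exact: seven_form0|exact: th_even].
Qed.

Lemma ssmooth_zinv c i : 0 <= c -> ssmooth (zinv c i).
Proof.
move=> c0.
have cz : Cinf (fun p => (z0 i p + c)^-1).
  apply: (Cinf_inv (c := 1)) => //; last by move=> p; have := z0_ge1 i p; lra.
  by apply: CinfD; [exact: Cinf_z0|exact: Cinf_cst].
apply: ssmoothD; first exact: ssmooth_form0.
apply: ssmoothN; apply: ssmoothM; last exact: ssmooth_th.
by apply: ssmooth_form0; under eq_fun do rewrite -exprVn; exact: CinfX.
Qed.

Lemma zinvM c i : 0 <= c -> zinv c i * (z_ i + form0 (fun=> c)) = 1.
Proof.
move=> c0.
have nz p : z0 i p + c != 0 by rewrite gt_eqF//; have := z0_gt0 i p; lra.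
rewrite zformE addrAC form0D /zinv mulrDr !mulrBl form0M -(mulrA _ (th i) (th i)) th_sq mulr0 subr0.
rewrite -(mulrA _ (th i)) (seven_comm _ (th_even i)) mulrA form0M -addrA -mulNr -mulrDl form0N form0D.
rewrite -[RHS]addr0; congr (_ + _).
  by rewrite -form01; congr form0; apply/funext => p; rewrite mulVf.
rewrite (_ : form0 _ = 0) ?mul0r// -form00; congr form0; apply/funext => p.
by have := nz p => nzp; field.
Qed.

Lemma zinv0M i : zinv 0 i * z_ i = 1.
Proof. by have := @zinvM 0 i (lexx 0); rewrite form00 addr0. Qed.

End HyperbolicForms.

(** * A planar divergence computation *)

Section RadialFlux.
Variable R : realType.
Local Notation mu := (@lebesgue_measure R).
Local Notation rint f a b := (\int[mu]_(x in `[a, b]) f x).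
Variables (v : R -> R) (M : R).
Hypotheses (sv : smooth1 v) (M1 : 1 <= M) (v0 : forall t, M < t -> v t = 0).

(** The coordinate [ks] scales the point, with [ar] equal to 1 plus the squared norm of
    [(s x, s y)]. Integrating an [s]-derivative from 0 to 1 divides by [x^2 + y^2] without a
    singularity at the origin. *)
Local Notation K := (option bool).
Local Notation kx := (Some true : K).
Local Notation ky := (Some false : K).
Local Notation ks := (None : K).
Implicit Types (p : K -> R) (x y : R).

Local Notation ar := (fun p : K -> R => 1 + p ks * p ks * (p kx * p kx + p ky * p ky)).

Let cc (k : K) : Cinf (fun p : K -> R => p k). Proof. exact: Cinf_coord. Qed.
Let c1 : Cinf (fun _ : K -> R => 1 : R). Proof. exact: Cinf_cst. Qed.
Let css : Cinf (fun p : K -> R => p ks * p ks). Proof. exact: CinfM. Qed.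
Let cxx : Cinf (fun p : K -> R => p kx * p kx). Proof. exact: CinfM. Qed.
Let cyy : Cinf (fun p : K -> R => p ky * p ky). Proof. exact: CinfM. Qed.
Let cxy : Cinf (fun p : K -> R => p kx * p kx + p ky * p ky). Proof. exact: CinfD. Qed.
Let cm : Cinf (fun p : K -> R => p ks * p ks * (p kx * p kx + p ky * p ky)). Proof. exact: CinfM. Qed.
Let car : Cinf ar. Proof. exact: CinfD. Qed.

Let ar_ge1 p : 1 <= ar p.
Proof. by rewrite lerDl mulr_ge0 ?addr_ge0 ?sqr_ge0// -expr2 sqr_ge0. Qed.

Let ze p : R := Num.sqrt (ar p).

Let ze_sqr p : ze p * ze p = ar p.
Proof. by rewrite -expr2 sqr_sqrtr//; apply: le_trans (ar_ge1 p). Qed.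

Let ze_ge1 p : 1 <= ze p.
Proof. by rewrite -[leLHS]sqrtr1 ler_wsqrtr. Qed.

Let ze_neq0 p : ze p != 0.
Proof. by rewrite gt_eqF//; apply: lt_le_trans (ze_ge1 p). Qed.

Let cze : Cinf ze.
Proof.
apply: (Cinf_comp1 car); apply: (maps_smooth_pos ltr01 _ (Cinf_lip car) ar_ge1) => n t t0.
by have [] := derive1n_sqrt n t0.
Qed.

Let ciz : Cinf (fun p => (ze p)^-1).
Proof. by apply: (Cinf_inv ltr01 cze); exact: ze_ge1. Qed.

Let par k p : partial k ar p = ((ks == k)%:R * p ks + p ks * (ks == k)%:R) * (p kx * p kx + p ky * p ky) +
  p ks * p ks * (((kx == k)%:R * p kx + p kx * (kx == k)%:R) + ((ky == k)%:R * p ky + p ky * (ky == k)%:R)).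
Proof.
rewrite (partialD _ c1 cm) partial_cst add0r (partialM _ css cxy) (partialD _ cxx cyy).
by rewrite !(partialM _ (cc _) (cc _)) !partial_coord.
Qed.

Let pze k p : partial k ze p = partial k ar p / 2 / ze p.
Proof.
have E : partial k ar p = partial k ze p * ze p + ze p * partial k ze p.
  have -> : ar = fun q => ze q * ze q by apply/funext => q; rewrite ze_sqr.
  by rewrite (partialM _ cze cze).
rewrite E; have := ze_neq0 p; move: (ze p) (partial k ze p) => z d nz.
by field.
Qed.

Let pze_s p : partial ks ze p = p ks * (p kx * p kx + p ky * p ky) / ze p.
Proof.
rewrite pze par /= !mul0r !mulr0 !addr0 mulr0 mul1r mulr1 addr0.
by move: (p ks) (p kx) (p ky) ((ze p)^-1) => s x y z; field.
Qed.

Let pze_x p : partial kx ze p = p ks * p ks * p kx / ze p.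
Proof.
rewrite pze par /= !mul0r !mulr0 !addr0 mul0r add0r mul1r mulr1.
by move: (p ks) (p kx) ((ze p)^-1) => s x z; field.
Qed.

Let pze_y p : partial ky ze p = p ks * p ks * p ky / ze p.
Proof.
rewrite pze par /= !mul0r !mulr0 !addr0 mul0r add0r mul1r mulr1 add0r.
by move: (p ks) (p ky) ((ze p)^-1) => s x z; field.
Qed.

Let dv p : R := derive1 v (ze p).
Let G p : R := v (ze p) / ze p.

Let sv' : smooth1 (derive1 v).
Proof. by move=> n t; rewrite -derive1Sn; exact: sv. Qed.

Let cvv : Cinf (fun p => v (ze p)).
Proof. by apply: (Cinf_comp1 cze); exact: smooth1_maps (Cinf_lip cze). Qed.

Let cdv : Cinf dv.
Proof. by apply: (Cinf_comp1 cze); apply: (smooth1_maps sv' (Cinf_lip cze)). Qed.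

Let cG : Cinf G. Proof. exact: CinfM. Qed.

Let pG k p : partial k G p = (dv p - G p) * partial k ze p / ze p.
Proof.
have E : dv p * partial k ze p = partial k G p * ze p + G p * partial k ze p.
  rewrite -[LHS](congr1 (fun h => h p) (partial_comp1 k cze (smooth1_maps sv (Cinf_lip cze)))).
  have -> : (fun q => v (ze q)) = fun q => G q * ze q.
    by apply/funext => q; rewrite /G mulfVK// ze_neq0.
  by rewrite (partialM _ cG cze).
rewrite mulrBl E addrK mulfK//; exact: ze_neq0.
Qed.

Let W p : R := (dv p - G p) * ((ze p)^-1 * (ze p)^-1).

Let cW : Cinf W.
Proof.
by apply: CinfM; [apply: CinfD => //; exact: CinfN|exact: CinfM].
Qed.

Let sW p : R := W p * p ks.
Let csW : Cinf sW. Proof. exact: CinfM. Qed.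

(** At [ks = 0] this is the quotient of [v 1 - v z / z] by [x^2 + y^2], extended smoothly across the
    origin: the [s]-derivative of [G] is [W] times [s (x^2 + y^2)]. *)
Let w p : R := - Gint ks 1 sW p.
Let cw : Cinf w. Proof. by apply: CinfN; exact: Cinf_Gint. Qed.

Let P x y : K -> R := fun k => match k with Some true => x | Some false => y | None => 0 end.
Let P1 x y : K -> R := upd (P x y) ks 1.

Let updPx x y t : upd (P x y) kx t = P t y.
Proof. by apply/funext => -[[]|]; rewrite updE. Qed.
Let updPy x y t : upd (P x y) ky t = P x t.
Proof. by apply/funext => -[[]|]; rewrite updE. Qed.

Let zeP x y : ze (P x y) = 1.
Proof. by rewrite /ze /= !mul0r addr0 sqrtr1. Qed.

Let P1x x y : P1 x y kx = x. Proof. by rewrite /P1 updE. Qed.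
Let P1y x y : P1 x y ky = y. Proof. by rewrite /P1 updE. Qed.
Let P1s x y : P1 x y ks = 1. Proof. by rewrite /P1 updE. Qed.

Let r2w x y : (x * x + y * y) * w (P x y) = v 1 - G (P1 x y).
Proof.
have -> : v 1 = G (P x y) by rewrite /G zeP divr1.
rewrite /w mulrN -[RHS]opprB; congr (- _).
have := @Gint_partial R K ks 1 G (P x y) ler01 cG.
have -> : shiftc ks 1 (P x y) = P1 x y by rewrite /shiftc /= add0r.
move=> <-; rewrite /Gint -rintZ; last exact: (rcb_shiftc _ _ _ (Cinf_lip csW)).
apply: eq_rint => r _; rewrite pG pze_s /sW /W.
have -> : shiftc ks r (P x y) kx = x by rewrite /shiftc updE.
have -> : shiftc ks r (P x y) ky = y by rewrite /shiftc updE.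
set q := shiftc ks r (P x y); move: (dv q - G q) (q ks) ((ze q)^-1) => a s z.
by ring.
Qed.

Let dPx f x y : Cinf f -> is_derive x 1 (fun t => f (P t y)) (partial kx f (P x y)).
Proof.
move=> cf; have := Cinf_pder kx cf (P x y).
by rewrite (_ : (fun t => _) = fun t => f (P t y))//; apply/funext => t; rewrite updPx.
Qed.

Let dPy f x y : Cinf f -> is_derive y 1 (fun t => f (P x t)) (partial ky f (P x y)).
Proof.
move=> cf; have := Cinf_pder ky cf (P x y).
by rewrite (_ : (fun t => _) = fun t => f (P x t))//; apply/funext => t; rewrite updPy.
Qed.

Let dP1x f x y : Cinf f -> is_derive x 1 (fun t => f (P1 t y)) (partial kx f (P1 x y)).
Proof.
move=> cf; have := Cinf_pder kx cf (P1 x y); rewrite P1x.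
rewrite (_ : (fun t => _) = fun t => f (P1 t y))//; apply/funext => t.
by rewrite /P1 -[in RHS](updPx x) updC.
Qed.

Let dP1y f x y : Cinf f -> is_derive y 1 (fun t => f (P1 x t)) (partial ky f (P1 x y)).
Proof.
move=> cf; have := Cinf_pder ky cf (P1 x y); rewrite P1y.
rewrite (_ : (fun t => _) = fun t => f (P1 x t))//; apply/funext => t.
by rewrite /P1 -[in RHS](updPy x y) updC.
Qed.

Let dsq x y : is_derive x 1 (fun t : R => t * t + y) (2 * x).
Proof.
have := is_deriveD (is_deriveM (is_derive_id x (1 : R)) (is_derive_id x (1 : R))) (is_derive_cst y x 1).
by move=> H; apply: (is_derive_eq H); rewrite /GRing.scale /= !mulr1 addr0 mulr_natl mulr2n.
Qed.

Let wx x y : 2 * x * w (P x y) + (x * x + y * y) * partial kx w (P x y) = - (x * W (P1 x y)).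
Proof.
have H1 := is_deriveM (dsq x (y * y)) (dPx x y cw).
have H2 := is_deriveB (is_derive_cst (v 1) x 1) (dP1x x y cG).
have E : (fun t => t * t + y * y) * (fun t => w (P t y)) = cst (v 1) - (fun t => G (P1 t y)).
  by apply/funext => t; exact: r2w.
move: H1 H2; rewrite E => -[_ E1] [_]; rewrite E1 sub0r pG pze_x P1x P1s /W /GRing.scale /= => H.
rewrite [LHS]addrC (mulrC (2 * x)) H; congr (- _).
by move: (dv _ - G _) ((ze _)^-1) => b z; ring.
Qed.

Let wy x y : 2 * y * w (P x y) + (x * x + y * y) * partial ky w (P x y) = - (y * W (P1 x y)).
Proof.
have H1 := is_deriveM (dsq y (x * x)) (dPy x y cw).
have H2 := is_deriveB (is_derive_cst (v 1) y 1) (dP1y x y cG).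
have E : (fun t => t * t + x * x) * (fun t => w (P x t)) = cst (v 1) - (fun t => G (P1 x t)).
  by apply/funext => t; rewrite -[RHS]r2w addrC.
move: H1 H2; rewrite E => -[_ E1] [_]; rewrite E1 sub0r pG pze_y P1y P1s /W /GRing.scale /= => H.
rewrite [LHS]addrC (mulrC (2 * y)) [x * x + _]addrC H; congr (- _).
by move: (dv _ - G _) ((ze _)^-1) => b z; ring.
Qed.

(** The factor [t] is cancelled at [t = 0] by differentiating both products there. *)
Let mul_id_inj (a b : R -> R) (da db : R) : is_derive (0 : R) 1 a da -> is_derive (0 : R) 1 b db ->
  (forall t, t * a t = t * b t) -> a 0 = b 0.
Proof.
move=> ha hb E.
have Ha := is_deriveM (is_derive_id (0 : R) (1 : R)) ha.
have Hb := is_deriveM (is_derive_id (0 : R) (1 : R)) hb.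
have EE : (id : R -> R) * a = (id : R -> R) * b by apply/funext => t; exact: E.
move: Ha Hb; rewrite EE /GRing.scale /= => -[_ Ea] [_ Eb].
by move: Ea; rewrite Eb !mul0r !add0r !mulr1.
Qed.

(** Away from the origin, [x] times [wx] plus [y] times [wy] is the claim multiplied by [x^2 + y^2].
    At the origin [wx] is read along the axis [y = 0] and its factor [x] is cancelled by
    [mul_id_inj]. *)
Let div_w x y : 2 * w (P x y) + x * partial kx w (P x y) + y * partial ky w (P x y) = - W (P1 x y).
Proof.
have [r0|r0] := eqVneq (x * x + y * y) 0.
  have [-> ->] : x = 0 /\ y = 0.
    move/eqP: r0; rewrite paddr_eq0 -?expr2 ?sqr_ge0// !sqrf_eq0.
    by move=> /andP[/eqP -> /eqP ->].
  apply: (etrans (y := 2 * w (P 0 0) + 0 * partial kx w (P 0 0))).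
    by move: (w _) (partial kx _ _) (partial ky _ _) => a b c; ring.
  have da := is_deriveD (is_deriveM (is_derive_cst (2 : R) (0 : R) (1 : R)) (dPx 0 0 cw))
    (is_deriveM (is_derive_id (0 : R) (1 : R)) (dPx 0 0 (Cinf_partial kx cw))).
  apply: (mul_id_inj da (is_deriveN (dP1x 0 0 cW))) => t.
  have := wx t 0; rewrite mul0r addr0 -mulrN => E; apply: etrans E.
  rewrite /= [LHS]/GRing.mul /= -[LHS]/(t * (2 * w (P t 0) + t * partial kx w (P t 0))).
  by move: (w _) (partial kx _ _) => b c; ring.
apply: (mulfI r0).
have := wx x y; have := wy x y; move: (w _) (partial kx _ _) (partial ky _ _) (W _) => a b c d Ey Ex.
have -> : (x * x + y * y) * (2 * a + x * b + y * c) = x * (2 * x * a + (x * x + y * y) * b) +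
   y * (2 * y * a + (x * x + y * y) * c) by ring.
by rewrite Ex Ey; ring.
Qed.

Let dist_P x y x' y' : dist1 (P x y) (P x' y') = `|x - x'| + `|y - y'|.
Proof.
rewrite /dist1 (bigD1 kx)//= (bigD1 ky)//= (bigD1 ks)//= big1 ?addr0 => [|[[]|]]//.
by rewrite subrr normr0 addr0.
Qed.

Variable r : R.
Hypothesis Mr : M <= r.

Let r0 : 0 < r. Proof. by apply: lt_le_trans Mr; apply: lt_le_trans M1. Qed.

Let box_P x y : - r <= x <= r -> - r <= y <= r -> box r (P x y).
Proof. by move=> xr yr [[]|] /=; rewrite ler_norml//; have := r0; lra. Qed.

Let lipP f : Cinf f -> exists2 C : R, 0 <= C & forall x x' y y', - r <= x <= r -> - r <= x' <= r ->
  - r <= y <= r -> - r <= y' <= r -> `|f (P x y) - f (P x' y')| <= C * (`|x - x'| + `|y - y'|).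
Proof.
move=> cf; have [C C0 HC] := Cinf_lip cf r; exists C => // x x' y y' xr x'r yr y'r.
by rewrite -dist_P; apply: HC; exact: box_P.
Qed.

Let rcbx f y : Cinf f -> - r <= y <= r -> rcb (- r) r (fun x => f (P x y)).
Proof.
move=> cf yr; have [C C0 HC] := lipP cf; apply: (lip_rcb C0) => s t sr tr.
by apply: le_trans (HC _ _ _ _ sr tr yr yr) _; rewrite subrr normr0 addr0.
Qed.

Let rcby f x : Cinf f -> - r <= x <= r -> rcb (- r) r (fun y => f (P x y)).
Proof.
move=> cf yr; have [C C0 HC] := lipP cf; apply: (lip_rcb C0) => s t sr tr.
by apply: le_trans (HC _ _ _ _ yr yr sr tr) _; rewrite subrr normr0 add0r.
Qed.

Let rcb_int f : Cinf f -> rcb (- r) r (fun x => rint (fun y => f (P x y)) (- r) r).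
Proof.
move=> cf; have [C C0 HC] := lipP cf.
have Cr : 0 <= C * (r - - r) by apply: mulr_ge0 => //; have := r0; lra.
apply: (lip_rcb Cr) => s t sr tr.
rewrite -rintB; [|exact: rcby|exact: rcby].
have rr : - r <= r by have := r0; lra.
apply: le_trans (rint_le (B := C * `|s - t|) rr _ _) _.
- by apply: rcbB; exact: rcby.
- by move=> y yr; apply: le_trans (HC _ _ _ _ sr tr yr yr) _; rewrite subrr normr0 addr0.
- by rewrite mulrAC.
Qed.

Let nr : - r <= r. Proof. by have := r0; lra. Qed.
Let rr : - r <= r <= r. Proof. by have := r0; lra. Qed.
Let rnr : - r <= - r <= r. Proof. by have := r0; lra. Qed.

Let A p : R := w p + p kx * partial kx w p.
Let B p : R := w p + p ky * partial ky w p.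
Let cA : Cinf A.
Proof. by apply: CinfD => //; apply: CinfM => //; exact: Cinf_partial. Qed.
Let cB : Cinf B.
Proof. by apply: CinfD => //; apply: CinfM => //; exact: Cinf_partial. Qed.

Let w_far x y : r * r <= x * x + y * y -> w (P x y) = v 1 / (x * x + y * y).
Proof.
move=> H; have n0 : x * x + y * y != 0.
  by rewrite gt_eqF//; apply: lt_le_trans H; apply: mulr_gt0; exact: r0.
have G0 : G (P1 x y) = 0.
  rewrite /G v0 ?mul0r//; rewrite -(@ltr_pXn2r _ 2) ?nnegrE//; last 2 first.
  - by have := M1; lra.
  - exact: le_trans (ze_ge1 _).
  rewrite !expr2 ze_sqr P1x P1y P1s mulr1 mul1r.
  have : M * M <= r * r by apply: ler_pM => //; have := M1; lra.
  lra.
by apply: (mulfI n0); rewrite r2w G0 subr0 mulrCA mulfV// mulr1.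
Qed.

Let intA y : - r <= y <= r -> rint (fun x => A (P x y)) (- r) r = v 1 * (2 * r / (r * r + y * y)).
Proof.
move=> yr; have H t : - r <= t <= r -> is_derive t 1 (fun x => x * w (P x y)) (A (P t y)).
  have H := is_deriveM (is_derive_id t (1 : R)) (dPx t y cw).
  by move=> _; apply: (is_derive_eq H); rewrite /GRing.scale /= mulr1 addrC.
rewrite (rint_FTC nr H); last exact: rcbx.
rewrite !w_far; [|rewrite mulrNN|]; try by rewrite lerDl -expr2 sqr_ge0.
by rewrite mulrNN mulNr opprK; move: (_^-1) => b; ring.
Qed.

Let intB x : - r <= x <= r -> rint (fun y => B (P x y)) (- r) r = v 1 * (2 * r / (r * r + x * x)).
Proof.
move=> xr; have H t : - r <= t <= r -> is_derive t 1 (fun y => y * w (P x y)) (B (P x t)).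
  have H := is_deriveM (is_derive_id t (1 : R)) (dPy x t cw).
  by move=> _; apply: (is_derive_eq H); rewrite /GRing.scale /= mulr1 addrC.
rewrite (rint_FTC nr H); last exact: rcby.
rewrite !w_far; [|rewrite mulrNN|]; try by rewrite lerDr -expr2 sqr_ge0.
by rewrite mulrNN mulNr opprK (addrC (x * x)); move: (_^-1) => b; ring.
Qed.

Let rcb_q : rcb (- r) r (fun t => v 1 * (2 * r / (r * r + t * t))).
Proof.
have -> : (fun t => v 1 * (2 * r / (r * r + t * t))) = fun t => 2 * r * w (P r t).
  apply/funext => t; rewrite w_far ?lerDl -?expr2 ?sqr_ge0//.
  by move: (_^-1) (v 1) => a b; ring.
by apply: rcbM; [exact: rcb_cst|exact: rcby].
Qed.

(** Flux of [v 1 (x, y) / (x^2 + y^2)] through two opposite sides of the square: each side is seen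
    from the origin under the angle [pi / 2], whence the arctangent. *)
Let int_q : rint (fun t => v 1 * (2 * r / (r * r + t * t))) (- r) r = pi * v 1.
Proof.
have rn : r != 0 by rewrite gt_eqF//; exact: r0.
have H t : - r <= t <= r -> is_derive t 1 (fun t => v 1 * 2 * atan (t / r)) (v 1 * (2 * r / (r * r + t * t))).
  have h1 : is_derive t 1 (fun s : R => s / r) r^-1.
    have := is_deriveM (is_derive_id t (1 : R)) (is_derive_cst (r^-1) t 1).
    by move=> H; apply: (is_derive_eq H); rewrite /GRing.scale /= mulr0 add0r mulr1.
  have h2 := is_derive1_comp (f := @atan R) (g := fun s : R => s / r) (is_derive1_atan (t / r)) h1.
  have h3 := is_deriveM (is_derive_cst (v 1 * 2) t 1) h2.
  move=> _; apply: (is_derive_eq h3); rewrite /GRing.scale /= mulr0 addr0.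
  have q0 : r * r + t * t != 0.
    rewrite gt_eqF// ltr_pwDl//; first by apply: mulr_gt0; exact: r0.
    by rewrite -expr2 sqr_ge0.
  have -> : 1 + (t / r) ^+ 2 = (r * r + t * t) / (r * r) by move: rn; move: r => q qn; field.
  rewrite invf_div; move: (r * r + t * t) q0 => q q0; move: rn; move: r (v 1) => c d cn.
  by field; rewrite q0 cn.
rewrite (rint_FTC nr H); last exact: rcb_q.
rewrite mulNr mulfV// atanN atan1.
by move: (v 1) (pi : R) => a b; field.
Qed.

Let flux : rint (fun x => rint (fun y => - W (P1 x y)) (- r) r) (- r) r = 2 * pi * v 1.
Proof.
have E x : - r <= x <= r -> rint (fun y => - W (P1 x y)) (- r) r =
   rint (fun y => A (P x y)) (- r) r + v 1 * (2 * r / (r * r + x * x)).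
  move=> xr; rewrite -(intB xr) -rintD; [|exact: rcby|exact: rcby].
  apply: eq_rint => y yr; rewrite -div_w /A /B /=.
  by move: (w _) (partial kx _ _) (partial ky _ _) => a b c; ring.
rewrite (eq_rint E) rintD; [|exact: rcb_int|exact: rcb_q].
have [C C0 HC] := lipP cA.
rewrite (rint_swap nr C0) => [|t t' u u' tr t'r ur u'r]; last exact: HC.
rewrite (eq_rint intA) int_q.
by move: (pi : R) (v 1) => a b; ring.
Qed.

(* The integrand is minus the divergence of [(x, y) w], where
   [w = (v 1 - v z / z) / (x^2 + y^2)] equals [v 1 / (x^2 + y^2)] far from the origin. *)
Lemma radial_flux : rint (fun x => rint (fun y =>
    v (Num.sqrt (1 + x ^+ 2 + y ^+ 2)) / Num.sqrt (1 + x ^+ 2 + y ^+ 2) ^+ 3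
    - derive1 v (Num.sqrt (1 + x ^+ 2 + y ^+ 2)) / Num.sqrt (1 + x ^+ 2 + y ^+ 2) ^+ 2)
    (- r) r) (- r) r = 2 * pi * v 1.
Proof.
rewrite -flux; apply: eq_rint => x xr; apply: eq_rint => y yr.
rewrite /W /G /dv; have := ze_neq0 (P1 x y).
have -> : ze (P1 x y) = Num.sqrt (1 + x ^+ 2 + y ^+ 2).
  by rewrite /ze P1x P1y P1s !mul1r !expr2 addrA.
by move: (Num.sqrt _) => z; move: (v z) (derive1 v z) => a b zn; field.
Qed.

End RadialFlux.

(** * Functions of the coordinates z *)

Section Lifting.
Variables (R : realType) (Lam : finType).
Local Notation crd := (Defs.coord Lam).
Local Notation sf := (superform R Lam).
Local Notation xi_ := (@Defs.xi R Lam).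
Local Notation eta_ := (@Defs.eta R Lam).
Local Notation xform_ := (@Defs.xform R Lam).
Local Notation yform_ := (@Defs.yform R Lam).
Local Notation z_ := (@Defs.zform R Lam).
Local Notation th_ := (@th R Lam).
Local Notation zb_ := (@zb R Lam).
Local Notation zz := (@z0 R Lam).
Implicit Types (F G A B : sf) (f g : (crd -> R) -> R) (p q : crd -> R) (k : crd) (i j : Lam).
Implicit Types (u v : (Lam -> R) -> R) (s : seq Lam).

Definition at_z u : (crd -> R) -> R := fun p => u (fun i => zz i p).

Lemma Cinf_at_z u : Cinf u -> Cinf (at_z u).
Proof.
move=> cu; apply: (Cinf_sep (o := @owner Lam)) => // [k j x t|j]; first exact: z0_sep.
exact: Cinf_z0.
Qed.

Lemma partial_at_z k u : Cinf u ->
  partial k (at_z u) = fun p => at_z (partial (owner k) u) p * partial k (zz (owner k)) p.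
Proof.
move=> cu; apply: (partial_sep (o := @owner Lam)) => // [l j x t|j]; first exact: z0_sep.
exact: Cinf_z0.
Qed.

(* [J s u] is [u(z)] with only the nilpotent parts of the [z_k], [k] in [s], taken into account:
   the Taylor expansion is of first order in each variable because [th k] squares to zero. *)
Fixpoint J s u : sf :=
  if s is k :: s' then J s' u + J s' (partial k u) * th_ k else form0 (at_z u).

Lemma J_even s u : seven (J s u).
Proof.
elim: s u => [|k s ih] u /=; first exact: seven_form0.
by apply: sevenD => //; apply: sevenM => //; exact: th_even.
Qed.

Lemma ssmooth_J s u : Cinf u -> ssmooth (J s u).
Proof.
elim: s u => [|k s ih] u cu /=; first by apply: ssmooth_form0; exact: Cinf_at_z.
apply: ssmoothD; first exact: ih.
by apply: ssmoothM; [apply: ih; exact: Cinf_partial|exact: ssmooth_th].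
Qed.

Lemma JD s u v : Cinf u -> Cinf v -> J s (fun l => u l + v l) = J s u + J s v.
Proof.
elim: s u v => [|k s ih] u v cu cv /=; first by rewrite form0D.
rewrite ih// partialD// ih; [|exact: Cinf_partial|exact: Cinf_partial].
by rewrite mulrDl addrACA.
Qed.

Lemma th_mulAC A B (k : Lam) : A * th_ k * B = A * B * th_ k.
Proof. by rewrite -mulrA (seven_comm _ (th_even k)) mulrA. Qed.

Lemma th_mul2 A B (k : Lam) : A * th_ k * (B * th_ k) = 0.
Proof. by rewrite mulrA th_mulAC -mulrA th_sq mulr0. Qed.

Lemma JM s u v : Cinf u -> Cinf v -> J s (fun l => u l * v l) = J s u * J s v.
Proof.
elim: s u v => [|k s ih] u v cu cv /=; first by rewrite form0M.
have cu' := Cinf_partial k cu; have cv' := Cinf_partial k cv.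
rewrite ih// partialM// JD; [|exact: CinfM|exact: CinfM].
rewrite (ih _ _ cu' cv) (ih _ _ cu cv') !mulrDl !mulrDr th_mul2 addr0 th_mulAC -addrA.
by congr (_ + _); rewrite addrC mulrA.
Qed.

Lemma J0 s : J s (fun=> 0) = 0.
Proof.
elim: s => [|k s ih] /=; first exact: form00.
by rewrite partial_cst ih mul0r addr0.
Qed.

Lemma J_local s u i : uniq s -> Cinf u -> (forall k : Lam, k != i -> partial k u = fun=> 0) ->
  J s u = form0 (at_z u) + (if i \in s then form0 (at_z (partial i u)) * th_ i else 0).
Proof.
elim: s u => [|k s ih] u us cu H /=; first by rewrite addr0.
move: us => /= /andP[ks us]; rewrite ih// inE.
have [ik|ik] := eqVneq i k; last first.
  by rewrite (H k) 1?eq_sym// J0 mul0r addr0.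
rewrite -ik in ks *; rewrite (negPf ks) addr0 /= ih ?(negPf ks) ?addr0//; first exact: Cinf_partial.
move=> l li; rewrite partial_comm// H// partial_cst//.
Qed.

Lemma J_cst s (c : R) : J s (fun=> c) = form0 (fun=> c).
Proof.
elim: s => [//|k s ih] /=.
by rewrite partial_cst J0 mul0r addr0 ih.
Qed.

(** The coordinate [z_j] as [J s] sees it, that is with its nilpotent part for the sites of [s]
    only; it is the inner function in the chain rule for [J s]. *)
Definition zpart s j : sf := if j \in s then z_ j else form0 (zz j).

Lemma J_coord s i : uniq s -> J s (fun l => l i) = zpart s i.
Proof.
move=> us; rewrite (@J_local s _ i) //; last 2 first.
- exact: Cinf_coord.
- by move=> k ki; rewrite partial_coord eq_sym (negPf ki).
rewrite /zpart zformE; case: ifP => // _; last by rewrite addr0.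
by rewrite partial_coord eqxx /at_z form01 mul1r.
Qed.

Lemma J_comp1 s i (phi : R -> R) : uniq s -> smooth1 phi ->
  J s (fun l => phi (l i)) = form0 (fun p => phi (zz i p)) +
     (if i \in s then form0 (fun p => derive1 phi (zz i p)) * th_ i else 0).
Proof.
move=> us sphi.
have cc := @Cinf_coord R Lam i; have ms := smooth1_maps sphi (Cinf_lip cc).
have pE (k : Lam) : partial k (fun l => phi (l i)) = fun l => derive1 phi (l i) * (i == k)%:R.
  by rewrite (partial_comp1 k cc ms) partial_coord.
have H (k : Lam) : k != i -> partial k (fun l => phi (l i)) = fun=> 0.
  by move=> ki; rewrite pE eq_sym (negPf ki); apply/funext => x; rewrite mulr0.
rewrite (J_local us (Cinf_comp1 cc ms) H); congr (_ + _); case: (i \in s); last by [].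
by rewrite pE eqxx; congr (form0 _ * _); apply/funext => p; rewrite /at_z mulr1.
Qed.

Section JDerivation.
Variable D : sf -> sf.
Hypothesis dD : superder D.

Lemma th_sder i : th_ i * D (th_ i) = 0.
Proof.
have := congr1 D (th_sq R i); rewrite (sder0 dD) (sderM dD); [|exact: th_even|exact: ssmooth_th|exact: ssmooth_th].
rewrite -(seven_comm _ (th_even i)) -mulr2n => E; apply: sfP => p; apply/ffunP => S.
have := congr1 (fun X : sf => X p S) E; rewrite -scaler_nat sfZ gscaleE !sf0 !g0E => /eqP.
by rewrite mulf_eq0 pnatr_eq0 /= => /eqP.
Qed.

Lemma sder_z i : D (z_ i) = D (form0 (zz i)) + D (th_ i).
Proof.
by rewrite zformE (sderD dD)//; [apply: ssmooth_form0; exact: Cinf_z0|exact: ssmooth_th].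
Qed.

Lemma sder_J s u : uniq s -> Cinf u -> D (J s u) = \sum_j J s (partial j u) * D (zpart s j).
Proof.
elim: s u => [|k s ih] u us cu.
  rewrite /= (sder_form0 dD); last exact: Cinf_at_z.
  under [RHS]eq_bigr do rewrite /zpart /= (sder_form0 dD (@Cinf_z0 R Lam _)) mulr_sumr.
  rewrite exchange_big; apply: eq_bigr => l _ /=.
  rewrite (bigD1 (owner l))//= big1 ?addr0 => [|j jl].
    by rewrite mulrA form0M partial_at_z.
  rewrite (_ : partial l (zz j) = fun=> 0) ?form00 ?mul0r ?mulr0//.
  apply: pder_partial => p; rewrite (_ : (fun t => _) = fun=> zz j p); first exact: is_derive_cst.
  by apply/funext => t; rewrite z0_sep.
move: us => /= /andP[ks us]; have cu' := Cinf_partial k cu.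
rewrite (sderD dD); [|exact: ssmooth_J|by apply: ssmoothM; [exact: ssmooth_J|exact: ssmooth_th]].
rewrite (sderM dD); [|exact: J_even|exact: ssmooth_J|exact: ssmooth_th].
rewrite !ih// mulr_suml addrA -big_split /=.
have E j : J s (partial j u) * D (zpart s j) + J s (partial j (partial k u)) * D (zpart s j) * th_ k =
   (J s (partial j u) + J s (partial k (partial j u)) * th_ k) * D (zpart s j).
  by rewrite mulrDl partial_comm// -!mulrA (seven_comm _ (th_even k)).
under eq_bigr do rewrite E.
rewrite (bigD1 k)//= [RHS](bigD1 k)//= addrAC; congr (_ + _); last first.
  by apply: eq_bigr => j jk; rewrite /zpart inE (negPf jk).
rewrite /zpart mem_head (negPf ks) sder_z mulrDr; congr (_ + _).
by rewrite mulrDl -mulrA th_sder mulr0 addr0.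
Qed.

End JDerivation.

Lemma sf_half F G : F *+ 2 = G *+ 2 -> F = G.
Proof.
move=> E; apply: sfP => p; apply/ffunP => S.
have := congr1 (fun X : sf => X p S) E.
rewrite -(scaler_nat 2 F) -(scaler_nat 2 G) (sfZ _ F) (sfZ _ G) !gscaleE.
by apply: mulfI; rewrite pnatr_eq0.
Qed.

(** Derivatives of [z_i] are always read off from its square, a polynomial form; the factor [z_i] on
    the left is removed with [zinv] when needed. *)
Lemma z_sder D i : superder D -> (z_ i * D (z_ i)) *+ 2 = D (zb_ i).
Proof.
move=> dD; rewrite -z_sqr (sderM dD); [|exact: z_even|exact: ssmooth_z|exact: ssmooth_z].
by rewrite mulr2n -[in D _ * _](seven_comm _ (z_even i)).
Qed.

Lemma zK i F : zinv 0 i * (z_ i * F) = F.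
Proof. by rewrite mulrA zinv0M mul1r. Qed.

Lemma dX_xe k i : dX k (xe i : sf) = 0.
Proof. by rewrite xeE; exact: (dX_cst k (ggen R (inl i) * ggen R (inr i) : grassmann R crd)). Qed.

Lemma z_dXl b i : z_ i * dX (inl b) (z_ i) = if i == b then xform_ b else 0.
Proof.
apply: sf_half; rewrite (z_sder i (superder_dX R (inl b))) zbE dXD; last 2 first.
- by apply: ssmooth_form0; exact: Cinf_z0sq.
- by apply: ssmoothN; rewrite -scaler_nat; apply: ssmoothZ; exact: ssmooth_xe.
rewrite (sderN (superder_dX R _)); last by rewrite -scaler_nat; apply: ssmoothZ; exact: ssmooth_xe.
rewrite -scaler_nat (sderZ (superder_dX R _)); last exact: ssmooth_xe.
rewrite dX_xe scaler0 subr0 dX_form0; last exact: Cinf_z0sq.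
have cc (l : crd) := @Cinf_coord R crd l.
have -> : partial (inl b) (fun p : crd -> R => 1 + p (inl i) ^+ 2 + p (inr i) ^+ 2) =
  fun p => (i == b)%:R * p (inl i) + p (inl i) * (i == b)%:R.
  have -> : (fun p : crd -> R => 1 + p (inl i) ^+ 2 + p (inr i) ^+ 2) =
    fun p => 1 + p (inl i) * p (inl i) + p (inr i) * p (inr i) by apply/funext => p; rewrite !expr2.
  rewrite partialD; [|by apply: CinfD; [exact: Cinf_cst|exact: CinfM]|exact: CinfM].
  rewrite partialD; [|exact: Cinf_cst|exact: CinfM].
  rewrite partial_cst !partialM// !partial_coord; apply/funext => p.
  by rewrite add0r /= !(mul0r, mulr0) !addr0.
have [->|ib] := eqVneq i b.
  rewrite mulr2n /xform form0D; congr form0; apply/funext => p.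
  by rewrite mul1r mulr1.
by rewrite mul0rn -form00; congr form0; apply/funext => p; rewrite mul0r mulr0 addr0.
Qed.

End Lifting.

(** * Flat superintegrals and total derivatives *)

Section SuperIntegral.
Variables (R : realType) (Lam : finType).
Local Notation crd := (Defs.coord Lam).
Local Notation sf := (superform R Lam).
Local Notation xi_ := (@Defs.xi R Lam).
Local Notation eta_ := (@Defs.eta R Lam).
Local Notation xform_ := (@Defs.xform R Lam).
Local Notation yform_ := (@Defs.yform R Lam).
Local Notation z_ := (@Defs.zform R Lam).
Local Notation zb_ := (@zb R Lam).
Implicit Types (F G A B : sf) (f g : (crd -> R) -> R) (p q : crd -> R) (k : crd) (i j : Lam).

(** The flat superintegral; the densities [1 / z_i] and the power of [2 pi] are kept outside, so
    that plain derivatives integrate to zero. *)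
Definition sint F : R := integral_Rn (fun p => gtop (F p)).

Definition sbox (M : R) F : Prop := ssmooth F /\ forall p k, M < `|p k| -> F p = 0.

Lemma sboxMr M F G : sbox M F -> ssmooth G -> sbox M (F * G).
Proof.
move=> [sF H] sG; split; first exact: ssmoothM.
by move=> p k pk; rewrite sfM (H p k pk) mul0r.
Qed.

Lemma sboxMl M F G : ssmooth G -> sbox M F -> sbox M (G * F).
Proof.
move=> sG [sF H]; split; first exact: ssmoothM.
by move=> p k pk; rewrite sfM (H p k pk) mulr0.
Qed.

Lemma sboxD M F G : sbox M F -> sbox M G -> sbox M (F + G).
Proof.
move=> [sF H] [sG H']; split; first exact: ssmoothD.
by move=> p k pk; rewrite sfD (H p k pk) (H' p k pk) addr0.
Qed.

Lemma sboxZ M (c : R) F : sbox M F -> sbox M (c *: F).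
Proof.
by move=> [sF H]; split; [exact: ssmoothZ|move=> p k pk; rewrite sfZ (H p k pk) scaler0].
Qed.

Lemma sboxN M F : sbox M F -> sbox M (- F).
Proof.
by move=> [sF H]; split; [exact: ssmoothN|move=> p k pk; rewrite sfN (H p k pk) oppr0].
Qed.

Lemma sbox0 M : sbox M 0.
Proof. by split => //; exact: (ssmooth_cst 0). Qed.

Lemma sbox_sum M (T : Type) (r : seq T) (P : pred T) (F : T -> sf) :
  (forall t, P t -> sbox M (F t)) -> sbox M (\sum_(t <- r | P t) F t).
Proof.
move=> H; elim: r => [|t r ih]; first by rewrite big_nil; exact: sbox0.
by rewrite big_cons; case: ifP => // Pt; apply: sboxD => //; exact: H.
Qed.

Lemma csup_coef M F S : sbox M F -> csup (enum crd) M (fun p => F p S).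
Proof.
by move=> [sF H]; split; [exact: Cinf_lip|move=> p k _ pk; rewrite (H p k pk) g0E].
Qed.

Lemma csup_gtop M F : sbox M F -> csup (enum crd) M (fun p => gtop (F p)).
Proof.
move=> bF; under eq_fun do rewrite gtopE mulrC.
by apply: csupM; [exact: csup_coef|exact: loclip_cst].
Qed.

Section Bounded.
Variable M : R.
Hypothesis M0 : 0 <= M.

Lemma sintD F G : sbox M F -> sbox M G -> sint (F + G) = sint F + sint G.
Proof.
move=> bF bG; rewrite -(integral_RnD M0) /sint; [|exact: csup_gtop|exact: csup_gtop].
by congr integral_Rn; apply/funext => p; rewrite -gtopD.
Qed.

Lemma sintZ (c : R) F : sbox M F -> sint (c *: F) = c * sint F.
Proof.
move=> bF; rewrite -(integral_RnZ _ M0) /sint; last exact: csup_gtop.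
by congr integral_Rn; apply/funext => p; rewrite -gtopZ.
Qed.

Lemma sintN F : sbox M F -> sint (- F) = - sint F.
Proof. by move=> bF; rewrite -scaleN1r sintZ// mulN1r. Qed.

Lemma sint0 : sint 0 = 0.
Proof. by rewrite -(scale0r (0 : sf)) sintZ ?mul0r//; exact: sbox0. Qed.

Lemma sint_sum (T : Type) (r : seq T) (P : pred T) (F : T -> sf) :
  (forall t, P t -> sbox M (F t)) -> sint (\sum_(t <- r | P t) F t) = \sum_(t <- r | P t) sint (F t).
Proof.
move=> H; elim: r => [|t r ih]; first by rewrite !big_nil sint0.
rewrite !big_cons; case: ifP => // Pt; rewrite sintD ?ih//; first exact: H.
exact: sbox_sum.
Qed.

Lemma sint_dX k F : sbox M F -> sint (dX k F) = 0.
Proof.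
move=> bF; rewrite /sint.
have cF := bF.1 finset.setT.
have bd := csup_partial (Cinf_pder k cF) (Cinf_lip (Cinf_partial k cF)) (csup_coef finset.setT bF).
have -> : (fun p => gtop (dX k F p)) = fun p => @gtop R Lam (gmon R finset.setT) * partial k (fun q => F q finset.setT) p.
  by apply/funext => p; rewrite gtopE dXE.
rewrite (integral_RnZ _ M0 bd).
by rewrite (integral_Rn_partial M0 (Cinf_pder k cF) (Cinf_lip (Cinf_partial k cF)) (csup_coef _ bF)) mulr0.
Qed.

Lemma sint_dG k F : sint (dG k F) = 0.
Proof.
apply: etrans sint0; rewrite /sint; congr integral_Rn; apply/funext => p.
by rewrite /dG gtop_der gtop0.
Qed.

Lemma sbox_dX k F : sbox M F -> sbox M (dX k F).
Proof.
move=> bF; split; first exact: ssmooth_dX bF.1.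
move=> p l pl; apply/ffunP => S; rewrite dXE g0E.
have cF := bF.1 S.
have [_ H] := csup_partial (Cinf_pder k cF) (Cinf_lip (Cinf_partial k cF)) (csup_coef S bF).
by apply: (H p l) => //; rewrite mem_enum.
Qed.

Lemma sbox_dG k F : sbox M F -> sbox M (dG k F).
Proof.
by move=> [sF H]; split; [exact: ssmooth_dG|move=> p l pl; rewrite /dG (H p l pl) gder0].
Qed.

Lemma sint_Q F : sbox M F -> sint (Qop F) = 0.
Proof.
move=> bF; have sF := bF.1.
have sb1 i : sbox M (xi_ i * dX (inl i) F) by apply: sboxMl; [exact: ssmooth_xi|exact: sbox_dX].
have sb2 i : sbox M (eta_ i * dX (inr i) F) by apply: sboxMl; [exact: ssmooth_eta|exact: sbox_dX].
have sb3 i : sbox M (xform_ i * dG (inr i) F) by apply: sboxMl; [exact: ssmooth_xform|exact: sbox_dG].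
have sb4 i : sbox M (yform_ i * dG (inl i) F) by apply: sboxMl; [exact: ssmooth_yform|exact: sbox_dG].
have E1 i k : xi_ i * dX k F = dX k (xi_ i * F).
  by rewrite dXM//; [rewrite dX_cst mul0r add0r|exact: ssmooth_xi].
have E2 i k : eta_ i * dX k F = dX k (eta_ i * F).
  by rewrite dXM//; [rewrite dX_cst mul0r add0r|exact: ssmooth_eta].
have E3 f k : form0 f * dG k F = dG k (form0 f * F).
  by rewrite dGM; [rewrite dG_form0 mul0r add0r|exact: seven_form0].
rewrite /Qop sint_sum; last first.
  by move=> i _; apply: sboxD => //; apply: sboxD; [exact: sboxD|exact: sboxN].
rewrite big1// => i _; rewrite sintD//; last by apply: sboxD; [exact: sboxD|exact: sboxN].
rewrite sintD//; [|exact: sboxD|exact: sboxN].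
rewrite sintD// sintN// E1 E2 E3 [yform_ _ * _]E3 !sint_dG.
rewrite !sint_dX ?oppr0 ?addr0//.
- by apply: sboxMl => //; exact: ssmooth_eta.
- by apply: sboxMl => //; exact: ssmooth_xi.
Qed.

End Bounded.

Lemma dG_gen k l : dG k (fun=> ggen R l : grassmann R crd) = form0 (fun=> (k == l)%:R).
Proof.
apply: sfP => p; rewrite /dG gder_gen /form0.
by case: eqP => _; rewrite ?scale1r ?scale0r.
Qed.

Lemma Q_cst (c : grassmann R crd) : Qop (fun=> c) =
  \sum_i (yform_ i * dG (inl i) (fun=> c) - xform_ i * dG (inr i) (fun=> c)).
Proof.
apply: eq_bigr => i _; rewrite !dX_cst !mulr0 addr0 add0r addrC //.
Qed.

Lemma Q_xi i : Qop (xi_ i) = yform_ i.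
Proof.
rewrite [LHS]Q_cst (bigD1 i)//= big1 ?addr0 => [|j ji].
  by rewrite !dG_gen eqxx form01 mulr1 form00 mulr0 subr0.
have -> : dG (inl j) (fun=> ggen R (inl i) : grassmann R crd) = 0.
  by rewrite dG_gen (_ : inl j == inl i = false) ?form00//; apply/negbTE.
by rewrite dG_gen form00 !mulr0 subr0.
Qed.

Lemma Q_eta i : Qop (eta_ i) = - xform_ i.
Proof.
rewrite [LHS]Q_cst (bigD1 i)//= big1 ?addr0 => [|j ji].
  by rewrite !dG_gen eqxx form01 mulr1 form00 mulr0 sub0r.
have -> : dG (inr j) (fun=> ggen R (inr i) : grassmann R crd) = 0.
  by rewrite dG_gen (_ : inr j == inr i = false) ?form00//; apply/negbTE.
by rewrite dG_gen form00 !mulr0 subr0.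
Qed.

Lemma Q_coord k : Qop (form0 (fun p => p k)) = match k with inl i => xi_ i | inr i => eta_ i end.
Proof.
have E i : xi_ i * dX (inl i) (form0 (fun p => p k)) + eta_ i * dX (inr i) (form0 (fun p => p k))
  - xform_ i * dG (inr i) (form0 (fun p => p k)) + yform_ i * dG (inl i) (form0 (fun p => p k)) =
  (k == inl i)%:R *: xi_ i + (k == inr i)%:R *: eta_ i.
  rewrite !dG_form0 !mulr0 subr0 addr0 !dX_form0; [|exact: Cinf_coord|exact: Cinf_coord].
  rewrite !partial_coord !scale_form0.
  by rewrite -(seven_comm _ (seven_form0 _)) -(seven_comm (eta_ i) (seven_form0 _)).
rewrite /Qop; under eq_bigr do rewrite E.
case: k {E} => i; rewrite (bigD1 i)//= big1 ?addr0.
- by rewrite eqxx scale1r scale0r addr0.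
- by move=> j ji; rewrite scale0r addr0 (_ : inl i == inl j = false) ?scale0r//; rewrite eq_sym; apply/negbTE.
- by rewrite eqxx scale1r scale0r add0r.
- by move=> j ji; rewrite scale0r add0r (_ : inr i == inr j = false) ?scale0r//; rewrite eq_sym; apply/negbTE.
Qed.

Lemma Q_xieta i j : Qop (xi_ i * eta_ j) = xform_ j * xi_ i + yform_ i * eta_ j.
Proof.
apply: (etrans (Q_cst (ggen R (inl i) * ggen R (inr j) : grassmann R crd))).
have E k : dG k (fun=> ggen R (inl i) * ggen R (inr j) : grassmann R crd) =
   (k == inl i)%:R *: eta_ j - (k == inr j)%:R *: xi_ i.
  apply: sfP => p; apply: (etrans (gderM_odd _ _ (godd_gen _ _))).
  rewrite !gder_gen; congr (_ - _).
    by case: (k == inl i); [rewrite mul1r scale1r|rewrite mul0r scale0r].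
  by case: (k == inr j); [rewrite mulr1 scale1r|rewrite mulr0 scale0r].
under eq_bigr do rewrite !E /= !scale0r subr0 sub0r mulrN opprK !sfscaleAr.
rewrite big_split /= addrC; congr (_ + _).
  rewrite (bigD1 j)//= big1 ?addr0 ?eqxx ?scale1r// => k kj.
  by rewrite (_ : inr k == inr j = false) ?scale0r//; apply/negbTE.
rewrite (bigD1 i)//= big1 ?addr0 ?eqxx ?scale1r// => k ki.
by rewrite (_ : inl k == inl i = false) ?scale0r//; apply/negbTE.
Qed.

End SuperIntegral.

(** * Localization *)

Section ClosedForms.
Variables (R : realType) (Lam : finType).
Local Notation crd := (Defs.coord Lam).
Local Notation sf := (superform R Lam).
Local Notation xi_ := (@Defs.xi R Lam).
Local Notation eta_ := (@Defs.eta R Lam).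
Local Notation xform_ := (@Defs.xform R Lam).
Local Notation yform_ := (@Defs.yform R Lam).
Local Notation z_ := (@Defs.zform R Lam).
Local Notation zb_ := (@zb R Lam).
Local Notation udot_ := (@udot R Lam).
Implicit Types (F G A B : sf) (f g : (crd -> R) -> R) (p q : crd -> R) (k : crd) (i j : Lam).

Local Notation dQ := (@superder_Q R Lam).

Definition closed_form A : Prop := [/\ seven A, ssmooth A & Qop A = 0].

Lemma closed_formM A B : closed_form A -> closed_form B -> closed_form (A * B).
Proof.
move=> [eA sA qA] [eB sB qB]; split; [exact: sevenM|exact: ssmoothM|].
by rewrite (sderM dQ eA sA sB) qA qB mul0r mulr0 addr0.
Qed.

Lemma closed_formD A B : closed_form A -> closed_form B -> closed_form (A + B).
Proof.
move=> [eA sA qA] [eB sB qB]; split; [exact: sevenD|exact: ssmoothD|].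
by rewrite (sderD dQ sA sB) qA qB addr0.
Qed.

Lemma closed_formZ (c : R) A : closed_form A -> closed_form (c *: A).
Proof.
move=> [eA sA qA]; split; [exact: sevenZ|exact: ssmoothZ|].
by rewrite (sderZ dQ c sA) qA scaler0.
Qed.

Lemma closed_formN A : closed_form A -> closed_form (- A).
Proof. by move=> cA; rewrite -scaleN1r; exact: closed_formZ. Qed.

Lemma closed_cst (c : R) : closed_form (form0 (fun=> c)).
Proof.
split; [exact: seven_form0|apply: ssmooth_form0; exact: Cinf_cst|].
exact: (sder_form0_cst dQ).
Qed.

Lemma closed_form1 : closed_form 1.
Proof. by have := closed_cst 1; rewrite form01. Qed.

Lemma closed_sum (T : Type) (r : seq T) (P : pred T) (F : T -> sf) :
  (forall t, P t -> closed_form (F t)) -> closed_form (\sum_(t <- r | P t) F t).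
Proof.
move=> H; elim: r => [|t r ih].
  by rewrite big_nil; have := closed_cst 0; rewrite form00.
by rewrite big_cons; case: ifP => // Pt; apply: closed_formD => //; exact: H.
Qed.

Lemma closed_prod (T : Type) (r : seq T) (P : pred T) (F : T -> sf) :
  (forall t, P t -> closed_form (F t)) -> closed_form (\prod_(t <- r | P t) F t).
Proof.
move=> H; elim: r => [|t r ih]; first by rewrite big_nil; exact: closed_form1.
by rewrite big_cons; case: ifP => // Pt; apply: closed_formM => //; exact: H.
Qed.

Lemma closed_fun_form phi A : closed_form A -> maps_smooth phi (body A) -> closed_form (fun_form phi A).
Proof.
move=> [eA sA qA] H; split; [exact: seven_fun_form|exact: ssmooth_fun_form|].
by rewrite (sder_fun_form dQ)// qA mulr0.
Qed.

Lemma Q_closedM A B : closed_form A -> ssmooth B -> Qop (A * B) = A * Qop B.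
Proof. by move=> [eA sA qA] sB; rewrite (sderM dQ eA sA sB) qA mul0r add0r. Qed.

(** A primitive under [Qop] of the flat inner product [rdot], the part of [udot] without the product
    of the [z]. *)
Definition lform i j : sf := yform_ i * xi_ j - xform_ i * eta_ j.
Definition rdot i j : sf :=
  xform_ i * xform_ j + yform_ i * yform_ j - xi_ i * eta_ j + eta_ i * xi_ j.

Lemma udotE i j : udot_ i j = rdot i j - z_ i * z_ j.
Proof. by rewrite /udot /rdot [RHS]addrC !addrA. Qed.

Lemma ssmooth_lform i j : ssmooth (lform i j).
Proof.
apply: ssmoothD; first by apply: ssmoothM; [exact: ssmooth_yform|exact: ssmooth_xi].
by apply: ssmoothN; apply: ssmoothM; [exact: ssmooth_xform|exact: ssmooth_eta].
Qed.

Lemma Q_xform i : Qop (xform_ i) = xi_ i. Proof. exact: (Q_coord R (inl i)). Qed.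
Lemma Q_yform i : Qop (yform_ i) = eta_ i. Proof. exact: (Q_coord R (inr i)). Qed.

Lemma Q_lform i j : Qop (lform i j) = rdot i j.
Proof.
have [[[sx sy] sxi] se] := (@ssmooth_xform R Lam, @ssmooth_yform R Lam, @ssmooth_xi R Lam, @ssmooth_eta R Lam).
have sm1 : ssmooth (yform_ i * xi_ j) by exact: ssmoothM.
have sm2 : ssmooth (xform_ i * eta_ j) by exact: ssmoothM.
rewrite /lform (sderD dQ sm1 (ssmoothN sm2)) (sderN dQ sm2).
rewrite (sderM dQ (@seven_yform R Lam i) (sy i) (sxi j)) (sderM dQ (@seven_xform R Lam i) (sx i) (se j)).
rewrite Q_xform Q_yform Q_xi Q_eta mulrN.
have abel (a b c d : sf) : a + b - (c - d) = d + b - c + a.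
  by rewrite [RHS]addrC (addrC d b) opprB -!addrA (addrC d).
exact: abel.
Qed.

Lemma rdot_even i j : seven (rdot i j).
Proof.
have H k l : seven ((fun=> ggen R k * ggen R l) : sf).
  by move=> p; apply: godd_oddM; exact: godd_gen.
apply: sevenD; last exact: H.
apply: sevenD; last by apply: sevenN; exact: H.
by apply: sevenD; apply: sevenM; exact: seven_form0.
Qed.

Lemma ssmooth_rdot i j : ssmooth (rdot i j).
Proof. by rewrite -Q_lform; apply: (sder_smooth dQ); exact: ssmooth_lform. Qed.

Lemma Q_rdot i j : Qop (rdot i j) = 0.
Proof.
have [[[sx sy] sxi] se] := (@ssmooth_xform R Lam, @ssmooth_yform R Lam, @ssmooth_xi R Lam, @ssmooth_eta R Lam).
have [ex ey] := (@seven_xform R Lam, @seven_yform R Lam).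
have sxx : ssmooth (xform_ i * xform_ j) by exact: ssmoothM.
have syy : ssmooth (yform_ i * yform_ j) by exact: ssmoothM.
have sxe : ssmooth (xi_ i * eta_ j) by exact: ssmoothM.
have sex : ssmooth (xi_ j * eta_ i) by exact: ssmoothM.
rewrite /rdot (eta_xi _ i j) (sderD dQ) ?(sderD dQ) ?(sderN dQ)//; last 4 first.
- exact: ssmoothD.
- exact: ssmoothN.
- by apply: ssmoothD; [exact: ssmoothD|exact: ssmoothN].
- exact: ssmoothN.
rewrite (sderM dQ (ex i) (sx i) (sx j)) (sderM dQ (ey i) (sy i) (sy j)) !Q_xieta !Q_xform !Q_yform.
rewrite (seven_comm (xi_ i) (ex j)) (seven_comm (eta_ i) (ey j)).
have abel (a b c d : sf) : a + b + (c + d) - (a + d) - (b + c) = 0.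
  by rewrite -addrA -opprD [in X in _ - X]addrACA (addrC d) subrr.
exact: abel.
Qed.

Lemma closed_rdot i j : closed_form (rdot i j).
Proof. by split; [exact: rdot_even|exact: ssmooth_rdot|exact: Q_rdot]. Qed.

Lemma z_sqr_rdot i : z_ i * z_ i = 1 + rdot i i.
Proof.
rewrite z_sqr /zb /rdot eta_xi !expr2 !addrA -!addrA; do 3!congr (_ + _).
by rewrite -opprD -mulrA mulr_natl mulr2n.
Qed.

(** The square [1 + rdot i i] is closed, so [2 z_i Q(z_i) = 0], and [z_i] is invertible. *)
Lemma closed_z i : closed_form (z_ i).
Proof.
split; [exact: z_even|exact: ssmooth_z|].
rewrite -[LHS](zK i); have : z_ i * Qop (z_ i) = 0.
  apply: sf_half; rewrite (z_sder i dQ) -z_sqr z_sqr_rdot mul0rn.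
  by have [_ _] := closed_formD closed_form1 (closed_rdot i i).
by move=> ->; rewrite mulr0.
Qed.

(** Apply [Qop] to the equation that defines the inverse. *)
Lemma closed_zinv (c : R) i : 0 <= c -> closed_form (zinv c i).
Proof.
move=> c0; have [ez sz qz] := closed_formD (closed_z i) (closed_cst c).
have ei := zinv_even c i; have si := @ssmooth_zinv R Lam c i c0; split => //.
have := congr1 (@Qop R Lam) (zinvM i c0); rewrite (sderM dQ ei si sz) (sder1 dQ) qz mulr0 addr0 => E.
rewrite -[LHS]mul1r -(zinvM i c0) -mulrA (seven_comm _ ez) E.
by rewrite mulr0.
Qed.

(** Since [rdot i i = z_i^2 - 1], the form [lform i i / (z_i + 1)] has image [z_i - 1]. The three
    summands are thus sent to [z_j (z_i - 1)], [z_j - 1] and [- rdot i j], whose sum is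
    [- 1 - udot i j]. *)
Definition hpot i j : sf :=
  zinv 1 i * z_ j * lform i i + zinv 1 j * lform j j - lform i j.

Lemma ssmooth_hpot i j : ssmooth (hpot i j).
Proof.
have si (k : Lam) := @ssmooth_zinv R Lam 1 k ler01.
apply: ssmoothD; last by apply: ssmoothN; exact: ssmooth_lform.
apply: ssmoothD; apply: ssmoothM; try exact: ssmooth_lform; last exact: si.
by apply: ssmoothM; [exact: si|exact: ssmooth_z].
Qed.

Lemma zinv1_rdot i : zinv 1 i * rdot i i = z_ i - 1.
Proof.
have -> : rdot i i = (z_ i + form0 (fun=> 1)) * (z_ i - 1).
  by rewrite form01 mulrDl mul1r mulrBr mulr1 z_sqr_rdot addrA subrK addrC addKr.
by rewrite mulrA zinvM// mul1r.
Qed.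

Lemma Q_hpot i j : Qop (hpot i j) = - 1 - udot_ i j.
Proof.
have si (k : Lam) := @ssmooth_zinv R Lam 1 k ler01.
have ci (k : Lam) := @closed_zinv 1 k ler01.
have sl := ssmooth_lform.
have s1 : ssmooth (zinv 1 i * z_ j * lform i i) by apply: ssmoothM => //; apply: ssmoothM => //; exact: ssmooth_z.
have s2 : ssmooth (zinv 1 j * lform j j) by exact: ssmoothM.
have E1 : Qop (zinv 1 i * z_ j * lform i i) = z_ i * z_ j - z_ j.
  have alg (A : pzRingType) (w z z' r : A) : w * z' = z' * w -> w * r = z - 1 -> z' * z = z * z' ->
      w * z' * r = z * z' - z'.
    by move=> E wr E'; rewrite E -mulrA wr mulrBr mulr1 E'.
  apply: (etrans (Q_closedM (closed_formM (ci i) (closed_z j)) (sl i i))).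
  apply: (etrans (congr1 (fun A => zinv 1 i * z_ j * A) (Q_lform i i))).
  apply: alg; first exact: (esym (seven_comm (zinv 1 i) (@z_even R Lam j))).
    exact: zinv1_rdot.
  exact: (seven_comm (z_ i) (@z_even R Lam j)).
have E2 : Qop (zinv 1 j * lform j j) = z_ j - 1.
  by apply: (etrans (Q_closedM (ci j) (sl j j))); rewrite Q_lform; exact: zinv1_rdot.
have E3 : Qop (- lform i j) = - rdot i j by rewrite (sderN dQ (sl i j)) Q_lform.
apply: (etrans (sderD dQ (ssmoothD s1 s2) (ssmoothN (sl i j)))).
rewrite E3 (sderD dQ s1 s2) E1 E2 udotE opprB.
by rewrite addrA subrK addrA; congr (_ - _); rewrite addrC.
Qed.

Variable beta : Lam -> Lam -> R.
Local Notation H := (hamiltonian beta : sf).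

Definition Hpot : sf := 2^-1 *: \sum_i \sum_j beta i j *: hpot i j.

Lemma ssmooth_Hpot : ssmooth Hpot.
Proof.
apply: ssmoothZ; apply: ssmooth_sum => i _; apply: ssmooth_sum => j _.
by apply: ssmoothZ; exact: ssmooth_hpot.
Qed.

Lemma Q_Hpot : Qop Hpot = H.
Proof.
have s0 i j : ssmooth (beta i j *: hpot i j) by apply: ssmoothZ; exact: ssmooth_hpot.
have s1 i : ssmooth (\sum_j beta i j *: hpot i j) by apply: ssmooth_sum.
have s2 : ssmooth (\sum_i \sum_j beta i j *: hpot i j) by apply: ssmooth_sum.
rewrite /Hpot (sderZ dQ _ s2) (sder_bigsum dQ _ s1); congr (_ *: _).
apply: eq_bigr => i _; rewrite (sder_bigsum dQ _ (s0 i)); apply: eq_bigr => j _.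
by rewrite (sderZ dQ _ (ssmooth_hpot i j)) Q_hpot.
Qed.

Lemma closed_H : closed_form H.
Proof.
apply: closed_formZ; apply: closed_sum => i _; apply: closed_sum => j _.
apply: closed_formZ; rewrite udotE; apply: closed_formD; first by apply: closed_formN; exact: closed_form1.
apply: closed_formN; apply: closed_formD; first exact: closed_rdot.
by apply: closed_formN; apply: closed_formM; exact: closed_z.
Qed.

End ClosedForms.

(** * Functional identities for an even form *)

Section Localization.
Variables (R : realType) (Lam : finType).
Local Notation crd := (Defs.coord Lam).
Local Notation sf := (superform R Lam).
Local Notation z_ := (@Defs.zform R Lam).
Implicit Types (F G A B : sf) (f g : (crd -> R) -> R) (p q : crd -> R) (k : crd) (i j : Lam).

Lemma form0_comm f F : F * form0 f = form0 f * F.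
Proof. exact: (esym (seven_comm F (seven_form0 f))). Qed.

(** The hypothesis says that [psi t = c + t * phi t] holds to all orders at the body of [F].
    Splitting [F] into body and soul matches the Taylor terms; the one overflowing term contains a
    power of the soul beyond the number of generators. *)
Lemma fun_form_mull (c : R) psi phi F :
  (forall n p, derive1n n psi (body F p) = (if n is 0%N then c else 0) +
     (body F p * derive1n n phi (body F p) + n%:R * derive1n n.-1 phi (body F p))) ->
  fun_form psi F = form0 (fun=> c) + F * fun_form phi F.
Proof.
move=> H; rewrite !fun_formE.
have nil : soul F ^+ #|crd|.+1 = 0 by apply: lowdeg_nil => // p; exact: soul_lowdeg.
have E n : ffterm psi F n = (if n is 0%N then form0 (fun=> c) else 0) +
     (form0 (body F) * ffterm phi F n + (if n is m.+1 then soul F * ffterm phi F m else 0)).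
  have E1 : ffterm psi F n = form0 (fun=> if n is 0%N then c else 0) * soul F ^+ n +
     (form0 (body F) * ffterm phi F n +
     form0 (fun p => n`!%:R^-1 * (n%:R * derive1n n.-1 phi (body F p))) * soul F ^+ n).
    rewrite /ffterm mulrA form0M -mulrDl form0D -mulrDl form0D; congr (form0 _ * _); apply/funext => p.
    rewrite H !mulrDr (mulrCA (body F p)); congr (_ + _).
    by case: n => [|n]; rewrite ?mulr0// fact0 invr1 mul1r.
  rewrite E1; case: n {E1} => [|n].
    rewrite expr0 mulr1; congr (_ + (_ + _)).
    by rewrite mulr1 -form00; congr form0; apply/funext => p; rewrite mul0r mulr0.
  congr (_ + (_ + _)); first by rewrite form00 mul0r.
  rewrite /ffterm mulrA form0_comm -mulrA -exprS; congr (form0 _ * _); apply/funext => p.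
  rewrite mulrA; congr (_ * _); rewrite factS natrM invfM mulrAC mulVf ?mul1r//.
apply: (etrans (eq_bigr _ (fun (n : 'I_#|crd|.+1) _ => E n))); rewrite !big_split /=; congr (_ + _).
  by rewrite big_ord_recl /= big1 ?addr0.
rewrite [X in _ = X * _](body_soulK F) mulrDl mulr_sumr; congr (_ + _).
rewrite big_ord_recl /= add0r mulr_sumr [RHS]big_ord_recr /=.
rewrite [X in _ = _ + X](_ : _ = 0) ?addr0//.
by rewrite /ffterm mulrA form0_comm -mulrA -exprS nil mulr0.
Qed.

Lemma derive1n_cst (c : R) n : derive1n n (fun=> c) = fun=> (if n is 0%N then c else 0).
Proof.
elim: n => [//|n ih]; rewrite derive1nS ih; apply/funext => t.
by rewrite derive1_cst.
Qed.

Lemma fun_form_cst (c : R) F : fun_form (fun=> c) F = form0 (fun=> c).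
Proof.
rewrite (@fun_form_mull c _ (fun=> 0)) => [|n p]; last first.
  by rewrite !derive1n_cst; case: n => [|[|n]]; rewrite /= ?mulr0 ?addr0.
rewrite fun_formE big1 ?mulr0 ?addr0// => n _.
rewrite /ffterm (_ : form0 _ = 0) ?mul0r// -form00; congr form0; apply/funext => p.
by rewrite derive1n_cst; case: (n : nat) => [|m]; rewrite mulr0.
Qed.

(** The identity [0 = -1 + t * t^-1], fed to [fun_form_mull] with [psi = 0]; positivity of the body
    supplies the derivatives of the inverse. *)
Lemma fun_form_invM F : (forall p, 0 < body F p) -> F * fun_form GRing.inv F = 1.
Proof.
move=> F0; have := @fun_form_mull (-1) (fun=> 0) GRing.inv F _.
rewrite fun_form_cst form00 => H; apply/esym/eqP; rewrite -subr_eq0 -oppr_eq0 opprB addrC; apply/eqP.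
rewrite -form01 form0N -H// => n p; have b0 := F0 p.
have nz : body F p != 0 by rewrite gt_eqF.
rewrite derive1n_cst; case: n => [|n]; first by rewrite /= mul0r addr0 mulfV// addNr.
have [-> _] := derive1n_inv n.+1 b0; have [-> _] := derive1n_inv n b0.
rewrite add0r; move: (body F p) nz => b nz.
rewrite factS natrM [b ^+ n.+2]exprSr invfM [(-1) ^+ n.+1]exprS.
move: ((-1) ^+ n) (b ^- n.+1) (n`!%:R) (n.+1%:R) => s v m r.
rewrite (_ : b * _ = - (r * (s * m * v)) * (b * b^-1)); first by rewrite mulfV// mulr1 addNr.
by ring.
Qed.

Lemma fun_form_hadamard psi phi F : smooth1 phi -> (forall t, psi t = psi 0 + t * phi t) ->
  fun_form psi F = form0 (fun=> psi 0) + F * fun_form phi F.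
Proof.
move=> sphi H; apply: fun_form_mull => n p.
suff E : derive1n n psi = fun t => (if n is 0%N then psi 0 else 0) + (t * derive1n n phi t + n%:R * derive1n n.-1 phi t).
  by rewrite E.
elim: n => [|n ih]; first by apply/funext => t; rewrite mul0r addr0; exact: H.
rewrite derive1nS ih; apply/funext => t; rewrite add0r.
have d1 m : is_derive t 1 (derive1n m phi) (derive1n m.+1 phi t).
  by rewrite derive1nS derive1E; apply: DeriveDef; [exact: sphi|].
have d2 := is_deriveM (is_derive_id t (1 : R)) (d1 n).
have d3 : is_derive t 1 (fun s => n%:R * derive1n n.-1 phi s) (n%:R * derive1n n phi t).
  have := is_deriveM (is_derive_cst (n%:R : R) t 1) (d1 n.-1).
  by case: n {ih d1 d2} => [|n] H'; apply: (is_derive_eq H'); rewrite /= ?mul0r ?scale0r ?scaler0 ?addr0.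
have := is_deriveD (is_derive_cst (if n is 0%N then psi 0 else 0) t 1) (is_deriveD d2 d3).
rewrite derive1E => -[_ ->]; rewrite add0r /GRing.scale /= mulr1.
by rewrite -addrA -natr1 mulrDl mul1r [in RHS](addrC (n%:R * _)).
Qed.

Lemma expR_hadamard : exists2 phi : R -> R, smooth1 phi & forall F, fun_form expR F = 1 + F * fun_form phi F.
Proof.
have [phi sphi H] := hadamard (@smooth1_expR R); exists phi => // F.
by rewrite (fun_form_hadamard _ sphi H) expR0 form01.
Qed.

Definition zinvs s : sf := \prod_(i <- s) zinv 0 i.

Lemma closed_zinvs s : closed_form (zinvs s).
Proof. by apply: closed_prod => i _; exact: closed_zinv. Qed.

Lemma zinvsM s : \prod_(i <- s) z_ i * zinvs s = 1.
Proof.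
rewrite /zinvs; elim: s => [|i s ih]; first by rewrite !big_nil mulr1.
rewrite !big_cons mulrA -[z_ i * _ * _]mulrA -(seven_comm (\prod_(j <- s) z_ j) (zinv_even 0 i)).
have zV : z_ i * zinv 0 i = 1 by rewrite (seven_comm (zinv 0 i) (z_even i)) zinv0M.
by rewrite mulrA zV mul1r.
Qed.

Lemma body_prod (s : seq Lam) (G : Lam -> sf) p : body (\prod_(i <- s) G i) p = \prod_(i <- s) body (G i) p.
Proof. by elim: s => [|i s ih]; rewrite ?big_nil ?body1// !big_cons bodyM ih. Qed.

(** The definition inverts the whole product at once; it agrees with the product of the sitewise
    inverses by uniqueness of inverses. *)
Lemma fun_form_inv_prod : fun_form GRing.inv (\prod_i z_ i) = zinvs (enum Lam).
Proof.
have E : \prod_i z_ i = \prod_(i <- enum Lam) z_ i by rewrite [index_enum _]unlock -enumT.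
rewrite E; set P := \prod_(i <- _) _.
have ez : seven P by apply: seven_prod => i _; exact: z_even.
have inv1 : P * fun_form GRing.inv P = 1.
  by apply: fun_form_invM => p; rewrite body_prod; apply: prodr_gt0 => i _; rewrite body_z z0_gt0.
rewrite -[LHS]mulr1 -(zinvsM (enum Lam)) -/P mulrA -(seven_comm _ ez) inv1 mul1r //.
Qed.

End Localization.

(** * Berezin integration and planar fluxes, site by site *)

Section FreeLocalization.
Variables (R : realType) (Lam : finType).
Local Notation crd := (Defs.coord Lam).
Local Notation sf := (superform R Lam).
Local Notation z_ := (@Defs.zform R Lam).
Local Notation zz := (@z0 R Lam).
Local Notation mu := (@lebesgue_measure R).
Local Notation rint f a b := (\int[mu]_(x in `[a, b]) f x).
Implicit Types (F G A B : sf) (f g : (crd -> R) -> R) (p q : crd -> R) (k : Lam) (i j : Lam).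
Implicit Types (u : (Lam -> R) -> R) (s : seq Lam).

(** What the sites of [s] leave after Berezin integration of [J s u] against the densities. At one
    site, [(u - u' xe / z0) (1 / z0 + xe / z0^3)] has [xe]-coefficient [u / z0^3 - u' / z0^2]. *)
Fixpoint Kz s u p : R :=
  if s is k :: s' then Kz s' u p / zz k p ^+ 3 - Kz s' (partial k u) p / zz k p ^+ 2
  else at_z u p.

Lemma gderM_der0 (l : crd) (F G : grassmann R crd) : gder l G = 0 -> gder l (F * G) = gder l F * G.
Proof. by move=> G0; rewrite gderM G0 mulr0 addr0. Qed.

Lemma gder_xe (l : crd) k p : gder l (xe k p) =
  (l == inl k)%:R *: ggen R (inr k) - (l == inr k)%:R *: ggen R (inl k).
Proof.
rewrite xeE; apply: (etrans (gderM_odd _ _ (godd_gen _ _))); rewrite !gder_gen; congr (_ - _).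
  by case: (_ == _); [rewrite mul1r scale1r|rewrite mul0r scale0r].
by case: (_ == _); [rewrite mulr1 scale1r|rewrite mulr0 scale0r].
Qed.

Lemma berezinsM_xe s k p (F : grassmann R crd) : k \notin s -> berezins s (F * xe k p) = berezins s F * xe k p.
Proof.
have H (l : crd) : owner l != k -> gder l (xe k p) = 0.
  move=> lk; rewrite gder_xe.
  have -> : l == inl k = false by apply/negbTE; apply: contra lk => /eqP ->.
  have -> : l == inr k = false by apply/negbTE; apply: contra lk => /eqP ->.
  by rewrite !scale0r subr0.
elim: s => [//|i s ih]; rewrite inE negb_or eq_sym => /andP[ik ks] /=.
by rewrite ih// !gderM_der0//; exact: H.
Qed.

Lemma gder_gder_xe k p : gder (inr k) (gder (inl k) (xe k p)) = 1.
Proof.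
rewrite gder_xe eqxx (_ : inl k == inr k = false)// scale1r scale0r subr0 gder_gen.
by rewrite eqxx.
Qed.

Lemma gder_cst l (c : R) : gder l (c *: (1 : grassmann R crd)) = 0.
Proof. by rewrite gderZ gder1 scaler0. Qed.

Local Notation zinvs_ := (@zinvs R Lam).

Lemma J_zinvs_cons k s u p : (J (k :: s) u * zinvs_ (k :: s)) p =
  (zz k p)^-1 *: (J s u * zinvs_ s) p +
  ((zz k p)^-1 ^+ 3 *: (J s u * zinvs_ s) p - (zz k p)^-1 ^+ 2 *: (J s (partial k u) * zinvs_ s) p) * xe k p.
Proof.
have [ez _ _] := @closed_zinvs R Lam s.
have cx : xe k p * zinvs_ s p = zinvs_ s p * xe k p := esym (geven_comm _ (ez p)).
have xs : xe k p * xe k p = 0 :> grassmann R crd.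
  exact: (congr1 (fun X : sf => X p) (xe_sq R k)).
set h := (zz k p)^-1.
have Eth : th k p = - h *: xe k p by rewrite thE; exact: form0_mulE.
have EJ : J (k :: s) u p = J s u p - h *: (J s (partial k u) p * xe k p).
  by rewrite /= sfD sfM Eth gscaleAr scaleNr.
have Ei : zinv 0 k p = h *: (1 : grassmann R crd) + h ^+ 3 *: (xe k p : grassmann R crd).
  rewrite /zinv sfD sfN form0_mulE Eth scalerA mulrN scaleNr opprK /form0 !addr0.
  by rewrite -exprVn -/h -exprSr.
have Ez : zinvs_ (k :: s) p = h *: zinvs_ s p + h ^+ 3 *: (zinvs_ s p * xe k p).
  by rewrite /zinvs big_cons -/(zinvs_ s) sfM Ei mulrDl !gscaleAl mul1r cx.
rewrite sfM EJ Ez !sfM.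
move: (J s u p) (J s (partial k u) p) (zinvs_ s p) (xe k p) cx xs => a b z e cx xs.
have E0 : b * e * (z * e) = 0 by rewrite -cx -mulrA (mulrA e e) xs mul0r mulr0.
have E1 : b * e * z = b * z * e by rewrite -mulrA cx mulrA.
rewrite [X in _ = _ + X]mulrBl mulrBl !mulrDr !gscaleAl !gscaleAr E0 E1 !scaler0 addr0 !scalerA -expr2.
by rewrite mulrA addrA.
Qed.

Lemma berezins_J s u p : uniq s -> berezins s ((J s u * zinvs_ s) p) = Kz s u p *: (1 : grassmann R crd).
Proof.
elim: s u => [|k s ih] u; first by move=> _; rewrite /zinvs big_nil /= mulr1.
rewrite cons_uniq => /andP[ks us]; rewrite J_zinvs_cons /= berezinsD berezinsZ ih//.
rewrite berezinsM_xe// berezinsD -scaleNr !berezinsZ !ih//.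
rewrite scalerA !gderD gder_cst gder0 add0r !scalerA -scalerDl gscaleAl mul1r !gderZ gder_gder_xe.
congr (_ *: _); rewrite /= -!exprVn mulrC mulNr; congr (_ - _).
by rewrite mulrC.
Qed.

(** Tested only where all coordinates are at least 1: this is where both the [z_i] and the local
    times live, and [V] is controlled only there. *)
Definition usupp (M : R) u : Prop := forall l k, (forall j, 1 <= l j) -> M < l k -> u l = 0.

Lemma usupp_partial M u k : Cinf u -> usupp M u -> usupp M (partial k u).
Proof.
move=> cu H l j l1 lj; apply: (pder_vanish (Cinf_pder k cu)).
exists 1 => // h /andP[h0 _]; apply: (H _ j) => [i|].
- by rewrite updE; case: eqP => [_|_]//; have := l1 k; lra.
- by rewrite updE; case: eqP => [jk|_]//; move: lj; rewrite jk; lra.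
Qed.

Lemma coord_le_z0 l p : `|p l| <= zz (owner l) p.
Proof.
rewrite -(@ler_pXn2r _ 2) ?nnegrE ?normr_ge0//; last exact: ltW (z0_gt0 _ _).
rewrite z0_sqr real_normK ?num_real//.
by case: l => i /=; have := sqr_ge0 (p (inl i)); have := sqr_ge0 (p (inr i)); lra.
Qed.

Lemma csup_at_z M u : Cinf u -> usupp M u -> csup (enum crd) M (at_z u).
Proof.
move=> cu H; split; first exact/Cinf_lip/Cinf_at_z.
move=> p l _ Mp; apply: (H _ (owner l)) => [j|]; first exact: z0_ge1.
exact: lt_le_trans (coord_le_z0 l p).
Qed.

Lemma Cinf_z0inv' k n : Cinf (fun p => (zz k p ^+ n)^-1).
Proof. by under eq_fun do rewrite -exprVn; apply: CinfX; exact: Cinf_z0inv. Qed.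

Lemma csupN r M (f : (crd -> R) -> R) : csup r M f -> csup r M (fun x => - f x).
Proof.
move=> [lf H]; split; first exact: loclipN.
by move=> x k kr xk; rewrite (H x k kr xk) oppr0.
Qed.

Lemma csup_Kz M s u : Cinf u -> usupp M u -> csup (enum crd) M (Kz s u).
Proof.
elim: s u => [|k s ih] u cu uM /=; first exact: csup_at_z.
apply: csupD; first by apply: csupM; [exact: ih|exact/Cinf_lip/Cinf_z0inv'].
apply: csupN; apply: csupM; last exact/Cinf_lip/Cinf_z0inv'.
by apply: ih; [exact: Cinf_partial|exact: usupp_partial].
Qed.

(** The order of integration that keeps the two coordinates of a site together, so that each site
    contributes one planar integral. *)
Fixpoint prs s : seq crd := if s is k :: s' then inl k :: inr k :: prs s' else [::].

Lemma mem_prs s (l : crd) : l \in prs s = (owner l \in s).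
Proof.
elim: s => [//|k s ih]; rewrite /= !inE ih orbA; congr (_ || _).
case: l {ih} => i /=.
  by rewrite (_ : inl i == inr k = false)// orbF; apply/eqP/eqP => [[]|->].
by apply/eqP/eqP => [[]|->].
Qed.

Lemma uniq_prs s : uniq s -> uniq (prs s).
Proof.
elim: s => [//|k s ih] /= /andP[ks us]; rewrite inE !mem_prs /= (negPf ks) ih// orbF.
Qed.

Lemma iter_mulr (r s : seq crd) M (f c : (crd -> R) -> R) : 0 <= M -> csup r M f -> uniq s -> {subset (s : seq crd) <= r} ->
  (forall (l : crd) p t, l \in s -> c (upd p l t) = c p) ->
  iterated_integral s (fun p => f p * c p) = fun p => iterated_integral s f p * c p.
Proof.
move=> M0 cf; elim: s => [//|l s ih]; rewrite cons_uniq => /andP[ks us] sr Hc.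
have sr' := subset_behead sr.
rewrite !iterated_cons ih//; last by move=> j p t js; apply: Hc; rewrite inE js orbT.
have c1 := csup_iter M0 cf us sr'.
have ll : l \in [seq j <- r | j \notin s] by rewrite mem_filter ks sr// mem_head.
apply/funext => p; rewrite /Ik; under eq_Rintegral do rewrite Hc ?mem_head// mulrC.
rewrite mulrC -[X in _ = _ * X]/(Ik l (iterated_integral s f) p) (Ik_rint _ c1 ll).
rewrite -rintZ; last by apply: rcb_upd; exact: c1.1.
rewrite [RHS]Rintegral_mkcond; apply: eq_Rintegral => t _; rewrite patchE; case: ifP => // /negbT tM.
rewrite (c1.2 _ l) ?mulr0// updE eqxx ltNge ler_norml; apply: contra tM.
by rewrite inE/= in_itv.
Qed.

(** Sites already integrated out sit at 1, the value of [z] at the origin, to which the flux formula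
    reduces them. *)
Definition fill s p : Lam -> R := fun i => if i \in s then 1 else zz i p.

Lemma fill_cons k s p : k \notin s -> fill (k :: s) p = upd (fill s p) k 1.
Proof. by move=> ks; apply/funext => i; rewrite updE /fill inE; case: eqP => [->|]. Qed.

Lemma fill_upd k s p l (t : R) : owner l = k -> fill s (upd p l t) =
  if k \in s then fill s p else upd (fill s p) k (zz k (upd p l t)).
Proof.
move=> lk; case: ifP => ks; apply/funext => i; rewrite ?updE /fill.
  by case: ifP => // si; rewrite z0_sep// lk; apply: contraFN si => /eqP ->.
case: eqP => [->|ik]; first by rewrite ks.
by case: ifP => // _; rewrite z0_sep// lk; apply/eqP.
Qed.

(** Once the sites of [s] are integrated out, site [k] carries [v / z^3 - v' / z^2] with [v] the
    restriction of [u] to coordinate [k]; [radial_flux] turns it into [2 pi] times the value at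
    1. *)
Lemma iter_Kz M s u : 1 <= M -> uniq s -> Cinf u -> usupp M u ->
  iterated_integral (prs s) (Kz s u) = fun p => (2 * pi) ^+ size s * u (fill s p).
Proof.
move=> M1; elim: s u => [|k s ih] u.
  by move=> _ _ _; apply/funext => p; rewrite /= mul1r; congr u; apply/funext => i.
rewrite cons_uniq => /andP[ks us] cu uM; have M0 : 0 <= M by lra.
have cu' := Cinf_partial k cu; have uM' := usupp_partial k cu uM.
have cK := csup_Kz s cu uM; have cK' := csup_Kz s cu' uM'.
have up := uniq_prs us.
have sub : {subset prs s <= enum crd} by move=> l _; rewrite mem_enum.
have cz (n : nat) (l : crd) p t : l \in prs s -> (zz k (upd p l t) ^+ n)^-1 = (zz k p ^+ n)^-1.
  by rewrite mem_prs => ls; rewrite z0_sep//; apply: contraNneq ks => ->.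
have L n := Cinf_lip (Cinf_z0inv' k n).
pose h p := (2 * pi) ^+ size s * (u (fill s p) / zz k p ^+ 3 - partial k u (fill s p) / zz k p ^+ 2).
have Eh : iterated_integral (prs s) (Kz (k :: s) u) = h.
  have -> : Kz (k :: s) u = fun p => Kz s u p * (zz k p ^+ 3)^-1 + (Kz s (partial k u) p * (zz k p ^+ 2)^-1) * (-1).
    by apply/funext => p; rewrite /= mulrN1.
  rewrite (iterD M0 (csupM cK (L 3%N)) (csupM (csupM cK' (L 2%N)) (@loclip_cst R crd (-1))) up sub).
  rewrite (iter_mulr M0 (csupM cK' (L 2%N)) up sub) //.
  rewrite (iter_mulr M0 cK up sub); last by move=> l p t; exact: cz.
  rewrite (iter_mulr M0 cK' up sub); last by move=> l p t; exact: cz.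
  rewrite !ih//; apply/funext => p; rewrite /h.
  by move: (_ ^+ size s) (u _) (partial k u _) (_^-1) (_^-1) => a b c d e; ring.
have Kc := csup_Kz (k :: s) cu uM.
have c1 := csup_iter M0 Kc up sub; rewrite Eh in c1.
have in1 : inr k \in [seq l <- enum crd | l \notin prs s] by rewrite mem_filter mem_prs /= ks mem_enum.
have c2 := csup_Ik M0 c1 in1.
have in2 : inl k \in [seq j <- [seq l <- enum crd | l \notin prs s] | j != inr k].
  by rewrite mem_filter andTb mem_filter mem_prs ks mem_enum.
rewrite [prs (k :: s)]/= !iterated_cons Eh; apply/funext => p.
rewrite (Ik_rint _ c2 in2).
under eq_Rintegral do rewrite (Ik_rint _ c1 in1).
pose v t := u (upd (fill s p) k t).
have sv : smooth1 v by exact: smooth1_line.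
have dv t : derive1 v t = partial k u (upd (fill s p) k t).
  have EE : v = fun r => u (upd (upd (fill s p) k t) k r) by apply/funext => r; rewrite updU.
  by rewrite EE /partial updE eqxx.
have fill1 i : 1 <= fill s p i by rewrite /fill; case: ifP => // _; exact: z0_ge1.
have v0 t : M < t -> v t = 0.
  move=> Mt; apply: (uM _ k) => [j|]; rewrite updE ?eqxx//.
  by case: eqP => // _; lra.
have := radial_flux sv M1 v0 (lexx M) => F.
rewrite /= (fill_cons _ ks) -/(v 1) exprSr -mulrA -F.
have rcb_h x : rcb (- M) M (fun y => h (upd (upd p (inl k) x) (inr k) y)).
  exact: rcb_upd c1.1.
have rcb_Ih : rcb (- M) M (fun x => Ik (inr k) h (upd p (inl k) x)) := rcb_upd _ _ _ _ c2.1.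
have E x y : h (upd (upd p (inl k) x) (inr k) y) = (2 * pi) ^+ size s *
   (v (Num.sqrt (1 + x ^+ 2 + y ^+ 2)) / Num.sqrt (1 + x ^+ 2 + y ^+ 2) ^+ 3 -
    derive1 v (Num.sqrt (1 + x ^+ 2 + y ^+ 2)) / Num.sqrt (1 + x ^+ 2 + y ^+ 2) ^+ 2).
  have ez : zz k (upd (upd p (inl k) x) (inr k) y) = Num.sqrt (1 + x ^+ 2 + y ^+ 2).
    by rewrite /z0 !updE /= !eqxx.
  rewrite /h dv /v ez; have -> : fill s (upd (upd p (inl k) x) (inr k) y) = upd (fill s p) k (Num.sqrt (1 + x ^+ 2 + y ^+ 2)).
    by rewrite (@fill_upd k) // (negPf ks) ez (@fill_upd k) // (negPf ks) updU.
  by [].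
have n0 : (2 * pi) ^+ size s != 0 :> R by rewrite expf_neq0// mulf_neq0// gt_eqF// pi_gt0.
have E' x y : v (Num.sqrt (1 + x ^+ 2 + y ^+ 2)) / Num.sqrt (1 + x ^+ 2 + y ^+ 2) ^+ 3 -
    derive1 v (Num.sqrt (1 + x ^+ 2 + y ^+ 2)) / Num.sqrt (1 + x ^+ 2 + y ^+ 2) ^+ 2 =
    ((2 * pi) ^+ size s)^-1 * h (upd (upd p (inl k) x) (inr k) y).
  by rewrite E mulKf.
apply: (mulfI (invr_neq0 n0)); rewrite mulKf//.
rewrite -rintZ.
  apply: eq_rint => x _; rewrite -rintZ//.
  by apply: eq_rint => y _; rewrite E'.
by have := rcb_Ih; under eq_fun do rewrite (Ik_rint _ c1 in1).
Qed.

Lemma sint_zinvs_J M u : 1 <= M -> Cinf u -> usupp M u ->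
  sint (zinvs_ (enum Lam) * J (enum Lam) u) = (2 * pi) ^+ #|Lam| * u (fun=> 1).
Proof.
move=> M1 cu uM; have M0 : 0 <= M by lra.
have -> : zinvs_ (enum Lam) * J (enum Lam) u = J (enum Lam) u * zinvs_ (enum Lam).
  by apply: seven_comm; have [] := @closed_zinvs R Lam (enum Lam).
have -> : sint (J (enum Lam) u * zinvs_ (enum Lam)) = integral_Rn (Kz (enum Lam) u).
  congr integral_Rn; apply/funext => p.
  by rewrite /gtop berezins_J ?enum_uniq// /gbody gscaleE g1E eqxx mulr1.
have cK := csup_Kz (enum Lam) cu uM.
have pe : perm_eq (enum crd) (prs (enum Lam)).
  apply: uniq_perm; rewrite ?enum_uniq ?uniq_prs ?enum_uniq// => l.
  by rewrite mem_prs !mem_enum.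
rewrite /integral_Rn (iter_perm M0 cK (enum_uniq _) (fun l h => h) pe).
rewrite (iter_Kz M1 (enum_uniq _) cu uM) -cardE; congr (_ * u _).
by apply/funext => i; rewrite /fill mem_enum.
Qed.

End FreeLocalization.

(** * Removal of the exact weight, and integration by parts *)

Section SuperExpectation.
Variables (R : realType) (Lam : finType).
Local Notation crd := (Defs.coord Lam).
Local Notation sf := (superform R Lam).
Local Notation xform_ := (@Defs.xform R Lam).
Local Notation z_ := (@Defs.zform R Lam).
Local Notation zz := (@z0 R Lam).
Implicit Types (F G A B : sf) (f g : (crd -> R) -> R) (p q : crd -> R) (i j b : Lam).
Implicit Types (u : (Lam -> R) -> R) (s : seq Lam).
Variable beta : Lam -> Lam -> R.
Local Notation H := (hamiltonian beta : sf).
Local Notation eH := (fun_form expR (- H)).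
Local Notation P := (@zinvs R Lam (enum Lam)).
Local Notation JJ := (@J R Lam (enum Lam)).

Lemma closed_eH : closed_form eH.
Proof.
have cH := closed_formN (closed_H beta); apply: closed_fun_form => //.
by apply: smooth1_maps; [exact: smooth1_expR|apply: Cinf_lip; apply: Cinf_body; have [] := cH].
Qed.

(** Hadamard's lemma gives [exp (- H) = 1 - H B] with [B] closed. As [H] is the image of [Hpot], the
    product [E H B] is [Qop (E * B * Hpot)], which integrates to zero. *)
Lemma sint_exp M E : 0 <= M -> sbox M E -> closed_form E -> sint (E * eH) = sint E.
Proof.
move=> M0 bE cE; have [phi sphi ->] := @expR_hadamard R Lam.
have cH := closed_formN (closed_H beta).
have cp : closed_form (fun_form phi (- H)).
  apply: closed_fun_form => //.
  by apply: smooth1_maps => //; apply: Cinf_lip; apply: Cinf_body; have [] := cH.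
set B := fun_form phi _ in cp *.
have sB : ssmooth (B * Hpot beta) by apply: ssmoothM; [have [] := cp|exact: ssmooth_Hpot].
have E1 : E * (1 + - H * B) = E - Qop (E * B * Hpot beta).
  rewrite (Q_closedM (closed_formM cE cp) (ssmooth_Hpot beta)) Q_Hpot.
  have alg (A : pzRingType) (e h c : A) : h * c = c * h -> e * (1 + - h * c) = e - e * c * h.
    by move=> hc; rewrite mulrDr mulr1 mulNr mulrN hc mulrA.
  by apply: alg; apply: seven_comm; have [] := closed_H beta.
have bEB : sbox M (E * B * Hpot beta).
  by apply: sboxMr; [apply: sboxMr => //; have [] := cp|exact: ssmooth_Hpot].
have bQ : sbox M (Qop (E * B * Hpot beta)).
  rewrite (Q_closedM (closed_formM cE cp) (ssmooth_Hpot beta)) Q_Hpot.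
  apply: sboxMr; first by apply: sboxMr => //; have [] := cp.
  by have [] := closed_H beta.
rewrite E1 (sintD M0 bE (sboxN bQ)) (sintN M0 bQ) (sint_Q M0 bEB).
by rewrite subr0.
Qed.

Lemma J_far M s u p (l : crd) : Cinf u -> usupp M u -> M < `|p l| -> J s u p = 0.
Proof.
elim: s u => [|k s ih] u cu uM pl /=.
  have [_ h] := csup_at_z cu uM.
  by rewrite /form0 (h p l) ?mem_enum// scale0r.
rewrite sfD sfM ih// ih//; last 2 first.
- exact: Cinf_partial.
- exact: usupp_partial.
by rewrite mul0r addr0.
Qed.

Lemma sbox_J M s u : Cinf u -> usupp M u -> sbox M (J s u).
Proof. by move=> cu uM; split; [exact: ssmooth_J|move=> p l; exact: J_far]. Qed.

Lemma closed_J s u : uniq s -> Cinf u -> (forall j, j \in s) -> closed_form (J s u).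
Proof.
move=> us cu ss; split; [exact: J_even|exact: ssmooth_J|].
rewrite (sder_J (superder_Q R Lam) us cu) big1// => j _.
by rewrite /zpart ss; have [_ _ ->] := closed_z R j; rewrite mulr0.
Qed.

Lemma closed_JJ u : Cinf u -> closed_form (JJ u).
Proof. by move=> cu; apply: closed_J => //; [exact: enum_uniq|move=> j; rewrite mem_enum]. Qed.

Lemma JJ_coord i : JJ (fun l => l i) = z_ i.
Proof. by rewrite J_coord ?enum_uniq// /zpart mem_enum. Qed.

Lemma superexpE F : superexp beta F = (2 * pi) ^- #|Lam| * sint (P * (F * eH)).
Proof. by rewrite /superexp /superintegral fun_form_inv_prod. Qed.

Lemma sint_J M u : 1 <= M -> Cinf u -> usupp M u -> sint (P * (JJ u * eH)) = (2 * pi) ^+ #|Lam| * u (fun=> 1).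
Proof.
move=> M1 cu uM; have M0 : 0 <= M by lra.
have cP := @closed_zinvs R Lam (enum Lam).
have -> : P * (JJ u * eH) = P * JJ u * eH by exact: mulrA.
rewrite (sint_exp M0); last 2 first.
- by apply: sboxMl; [have [] := cP|exact: sbox_J].
- by apply: closed_formM => //; exact: closed_JJ.
exact: sint_zinvs_J M1 cu uM.
Qed.

Hypothesis beta_sym : forall i j, beta i j = beta j i.

Lemma prod_zinv_skip b (s : seq Lam) : b \in s -> uniq s ->
  z_ b * zinvs s = \prod_(i <- s | i != b) zinv 0 i.
Proof.
elim: s => [//|k s ih]; rewrite inE => /orP[/eqP <-|bs] /= /andP[ks us].
  rewrite /zinvs !big_cons eqxx /=.
  have -> : z_ b * (zinv 0 b * \prod_(j <- s) zinv 0 j) = \prod_(j <- s) zinv 0 j.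
    have alg (A : pzRingType) (z w x : A) : z * w = 1 -> z * (w * x) = x by move=> e; rewrite mulrA e mul1r.
    by apply: alg; rewrite (seven_comm _ (@z_even R Lam b)) zinv0M.
  rewrite [RHS]big_mkcond /=; apply: eq_big_seq => i si; rewrite ifT//.
  by apply: contraNneq ks => <-.
rewrite /zinvs !big_cons ifT; last by apply: contraNneq ks => ->.
rewrite -ih// /zinvs.
have alg (A : pzRingType) (z w x : A) : z * w = w * z -> z * (w * x) = w * (z * x) by move=> e; rewrite !mulrA e.
by apply: alg; apply: seven_comm; exact: z_even.
Qed.

Lemma z_dX b j : z_ b * dX (inl b) (z_ j) = if j == b then xform_ b else 0.
Proof.
have [->|jb] := eqVneq j b; first by rewrite z_dXl eqxx.
have H0 : dX (inl b) (z_ j) = 0.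
  by rewrite -[LHS](zK j) z_dXl (negPf jb) mulr0.
by rewrite H0 mulr0.
Qed.

Lemma dX_zinv b j : j != b -> dX (inl b) (zinv 0 j : sf) = 0.
Proof.
move=> jb; have dD := superder_dX R (inl b).
have H0 : dX (inl b) (z_ j) = 0.
  by rewrite -[LHS](zK j) z_dXl (negPf jb) mulr0.
have si := @ssmooth_zinv R Lam 0 j (lexx 0).
have := congr1 (dX (inl b)) (zinv0M R j); rewrite (sderM dD (zinv_even 0 j) si (ssmooth_z R j)) H0 mulr0 addr0.
rewrite (sder1 dD) => E.
have alg (A : pzRingType) (d z w : A) : d * z = 0 -> z * w = 1 -> d = 0.
  by move=> dz zw; rewrite -[d]mulr1 -zw mulrA dz mul0r.
by apply: (alg _ _ (z_ j) (zinv 0 j)) => //; rewrite (seven_comm _ (@z_even R Lam j)) zinv0M.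
Qed.

(** The factor [z_b] cancels the only density that depends on [x_b]. This is why the integration by
    parts starts from a product containing [z_b]. *)
Lemma dX_zP b : dX (inl b) (z_ b * P) = 0.
Proof.
rewrite prod_zinv_skip ?mem_enum ?enum_uniq//; have dD := superder_dX R (inl b).
elim: (enum Lam) => [|k s ih]; first by rewrite big_nil (sder1 dD).
rewrite big_cons; case: ifP => // kb.
have si k' := @ssmooth_zinv R Lam 0 k' (lexx 0).
have sp : ssmooth (\prod_(j <- s | j != b) zinv 0 j : sf) by apply: ssmooth_prod.
by rewrite (sderM dD (zinv_even 0 k) (si k) sp) ih dX_zinv// mul0r mulr0 addr0.
Qed.

Lemma dX_rdot b i j : dX (inl b) (rdot i j) =
  (i == b)%:R *: xform_ j + (j == b)%:R *: xform_ i.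
Proof.
have dc k l : dX (inl b) ((fun=> ggen R k * ggen R l) : sf) = 0 by exact: dX_cst.
have sc k l : ssmooth ((fun=> ggen R k * ggen R l) : sf) by exact: ssmooth_cst.
have dD := superder_dX R (inl b).
have cc (l : crd) := @Cinf_coord R crd l.
have pE (k l : crd) : dX (inl b) (form0 (fun p => p k) * form0 (fun p => p l)) =
    (k == inl b)%:R *: form0 (fun p => p l) + (l == inl b)%:R *: form0 (fun p => p k) :> sf.
  rewrite form0M dX_form0; last exact: CinfM.
  rewrite partialM// !partial_coord !scale_form0 !form0M form0D; congr form0; apply/funext => p.
  by congr (_ + _); rewrite mulrC.
have sxx : ssmooth (xform_ i * xform_ j) by apply: ssmoothM; exact: ssmooth_xform.
have syy : ssmooth (@yform R Lam i * @yform R Lam j) by apply: ssmoothM; exact: ssmooth_yform.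
have dxx : dX (inl b) (xform_ i * xform_ j) = (i == b)%:R *: xform_ j + (j == b)%:R *: xform_ i by exact: pE.
have dyy : dX (inl b) (@yform R Lam i * @yform R Lam j) = 0.
  by rewrite pE !scale0r addr0.
have se1 := sc (inl i) (inr j); have se2 := sc (inr i) (inl j).
apply: (etrans (sderD dD (ssmoothD (ssmoothD sxx syy) (ssmoothN se1)) se2)).
apply: (etrans (congr1 (fun X => X + _) (sderD dD (ssmoothD sxx syy) (ssmoothN se1)))).
apply: (etrans (congr1 (fun X => X + _ + _) (sderD dD sxx syy))).
rewrite dxx dyy (sderN dD se1) dc dc.
have alg (A : zmodType) (x : A) : x + 0 - 0 + 0 = x by rewrite subr0 !addr0.
exact: alg.
Qed.

Lemma z_dX_udot b i j : z_ b * dX (inl b) (- 1 - udot i j) =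
  (i == b)%:R *: (xform_ b * z_ j - z_ b * xform_ j) + (j == b)%:R *: (xform_ b * z_ i - z_ b * xform_ i).
Proof.
have dD := superder_dX R (inl b).
have [[er sr _] [e1 s1 _]] := (closed_rdot R i j, closed_form1 R Lam).
have sz k := @ssmooth_z R Lam k; have ez k := @z_even R Lam k.
have szz : ssmooth (z_ i * z_ j) by exact: ssmoothM.
have E : dX (inl b) (- 1 - udot i j) = (dX (inl b) (z_ i) * z_ j + z_ i * dX (inl b) (z_ j)) - dX (inl b) (rdot i j).
  rewrite udotE opprB.
  apply: (etrans (sderD dD (ssmoothN s1) (ssmoothD szz (ssmoothN sr)))).
  rewrite (sderN dD s1) (sder1 dD) oppr0 add0r.
  apply: (etrans (sderD dD szz (ssmoothN sr))); rewrite (sderN dD sr); congr (_ - _).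
  exact: (sderM dD (ez i) (sz i) (sz j)).
rewrite E dX_rdot.
have zd k : z_ b * dX (inl b) (z_ k) = (k == b)%:R *: xform_ b.
  by rewrite z_dX; case: eqP => _; rewrite ?scale1r ?scale0r.
have t1 : z_ b * (dX (inl b) (z_ i) * z_ j) = (i == b)%:R *: (xform_ b * z_ j).
  by rewrite mulrA zd sfscaleAl.
have t2 : z_ b * (z_ i * dX (inl b) (z_ j)) = (j == b)%:R *: (xform_ b * z_ i).
  have alg2 (B : pzRingType) (x y w r : B) : x * y = y * x -> x * w = r -> y * r = r * y -> x * (y * w) = r * y.
    by move=> xy xw yr; rewrite mulrA xy -mulrA xw yr.
  rewrite -sfscaleAl; apply: alg2; [exact: seven_comm|exact: zd|exact: seven_comm].
have t3 : z_ b * ((i == b)%:R *: xform_ j + (j == b)%:R *: xform_ i) =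
    (i == b)%:R *: (z_ b * xform_ j) + (j == b)%:R *: (z_ b * xform_ i).
  by apply: (etrans (mulrDr _ _ _)); congr (_ + _); exact: sfscaleAr.
have alg4 (B : pzRingType) (z p q r : B) : z * (p + q - r) = z * p + z * q - z * r.
  by rewrite mulrBr mulrDr.
apply: (etrans (alg4 _ _ _ _ _)); apply: (etrans (congr2 (fun X Y => X - Y) (congr2 +%R t1 t2) t3)).
have alg3 (V : lmodType R) (c d : R) (x y x' y' : V) : c *: x + d *: y - (c *: x' + d *: y') = c *: (x - x') + d *: (y - y').
  by rewrite opprD addrACA !scalerBr.
exact: alg3.
Qed.

(** Site [b] occurs as first and as second index of the double sum; symmetry of [beta] makes the two
    contributions equal, which absorbs the factor one half. *)
Lemma z_dX_H b : z_ b * dX (inl b) H = \sum_j beta b j *: (xform_ b * z_ j - z_ b * xform_ j).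
Proof.
have dD := superder_dX R (inl b).
have su i j : ssmooth (- 1 - udot i j : sf).
  have [_ s1 _] := closed_form1 R Lam.
  apply: ssmoothD; first exact: ssmoothN.
  apply: ssmoothN; rewrite udotE; apply: ssmoothD; first exact: ssmooth_rdot.
  by apply: ssmoothN; apply: ssmoothM; exact: ssmooth_z.
have s0 i j : ssmooth (beta i j *: (- 1 - udot i j) : sf) by apply: ssmoothZ.
have s1 i : ssmooth (\sum_j beta i j *: (- 1 - udot i j) : sf) by apply: ssmooth_sum.
have s2 : ssmooth (\sum_i \sum_j beta i j *: (- 1 - udot i j) : sf) by apply: ssmooth_sum.
rewrite /hamiltonian (sderZ dD _ s2) (sder_bigsum dD _ s1) sfscaleAr mulr_sumr.
have delta (V : lmodType R) (G : Lam -> V) : \sum_i (i == b)%:R *: G i = G b.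
  rewrite (bigD1 b)//= eqxx scale1r big1 ?addr0// => i ib.
  by rewrite (negPf ib) scale0r.
pose W j := xform_ b * z_ j - z_ b * xform_ j.
have E i : z_ b * dX (inl b) (\sum_j beta i j *: (- 1 - udot i j)) =
    (i == b)%:R *: (\sum_j beta i j *: W j) + beta i b *: W i.
  rewrite (sder_bigsum dD _ (s0 i)) mulr_sumr.
  have E1 j : z_ b * dX (inl b) (beta i j *: (- 1 - udot i j)) =
      (i == b)%:R *: (beta i j *: W j) + (j == b)%:R *: (beta i j *: W i).
    apply: (etrans (congr1 (fun X => z_ b * X) (sderZ dD (beta i j) (su i j)))).
    apply: (etrans (sfscaleAr _ _ _)); apply: (etrans (congr1 (fun X => beta i j *: X) (z_dX_udot b i j))).
    have alg (V : lmodType R) (c d e : R) (x y : V) : c *: (d *: x + e *: y) = d *: (c *: x) + e *: (c *: y).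
      by rewrite scalerDr !scalerA mulrC (mulrC c e).
    exact: alg.
  have alg (V : lmodType R) (w : Lam -> V) : \sum_j ((i == b)%:R *: (beta i j *: w j) +
      (j == b)%:R *: (beta i j *: w i)) = (i == b)%:R *: (\sum_j beta i j *: w j) + beta i b *: w i.
    by rewrite big_split /= -scaler_sumr delta.
  apply: (etrans (eq_bigr _ (fun j _ => E1 j))); exact: alg.
apply: (etrans (congr1 (fun X => 2^-1 *: X) (eq_bigr _ (fun i _ => E i)))); rewrite big_split /= delta.
have -> : \sum_i beta i b *: W i = \sum_j beta b j *: W j by apply: eq_bigr => j _; rewrite beta_sym.
have alg (V : lmodType R) (x : V) : 2^-1 *: (x + x) = x.
  have h : (2^-1 : R) * (1 + 1) = 1 by field.
  by rewrite -{1}[x]scale1r -{2}[x]scale1r -scalerDl scalerA h scale1r.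
exact: alg.
Qed.

Variable a : Lam.

Definition twopt b u : R := sint (P * (xform_ a * xform_ b * JJ u * eH)).

Lemma usuppM M u v : usupp M u -> usupp M (fun l => u l * v l).
Proof. by move=> uM l k l1 lk; rewrite (uM l k l1 lk) mul0r. Qed.

Lemma usuppD M u v : usupp M u -> usupp M v -> usupp M (fun l => u l + v l).
Proof. by move=> uM vM l k l1 lk; rewrite (uM l k l1 lk) (vM l k l1 lk) addr0. Qed.

Lemma JJ_coordM u j : Cinf u -> JJ (fun l => u l * l j) = JJ u * z_ j.
Proof. by move=> cu; rewrite -JJ_coord -JM//; exact: Cinf_coord. Qed.

Lemma z_dX_J b u : Cinf u -> z_ b * dX (inl b) (JJ u) = JJ (partial b u) * xform_ b.
Proof.
move=> cu; rewrite (sder_J (superder_dX R (inl b)) (enum_uniq _) cu) mulr_sumr (bigD1 b)//= big1 ?addr0.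
  rewrite /zpart mem_enum.
  have alg (A : pzRingType) (z w d x : A) : z * w = w * z -> z * d = x -> z * (w * d) = w * x.
    by move=> c e; rewrite mulrA c -mulrA e.
  by apply: alg; [apply: seven_comm; exact: z_even|rewrite z_dX eqxx].
move=> j jb; rewrite /zpart mem_enum.
have alg (A : pzRingType) (z w d : A) : z * w = w * z -> z * d = 0 -> z * (w * d) = 0.
  by move=> c e; rewrite mulrA c -mulrA e mulr0.
by apply: alg; [apply: seven_comm; exact: z_even|rewrite z_dX (negPf jb)].
Qed.

Section Bounded.
Variable M : R.
Hypothesis M1 : 1 <= M.
Let M0 : 0 <= M. Proof. by have := M1; lra. Qed.

Lemma sbox_PJe X u : ssmooth X -> Cinf u -> usupp M u -> sbox M (P * (X * JJ u * eH)).
Proof.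
move=> sX cu uM; have [_ sP _] := @closed_zinvs R Lam (enum Lam); have [_ se _] := closed_eH.
exact: (sboxMl sP (sboxMr (sboxMl sX (sbox_J _ cu uM)) se)).
Qed.

Lemma sbox_Je u : Cinf u -> usupp M u -> sbox M (P * (JJ u * eH)).
Proof.
move=> cu uM; have [_ sP _] := @closed_zinvs R Lam (enum Lam); have [_ se _] := closed_eH.
exact: (sboxMl sP (sboxMr (sbox_J _ cu uM) se)).
Qed.

Lemma ssmooth_xx i j : ssmooth (xform_ i * xform_ j).
Proof. by apply: ssmoothM; exact: ssmooth_xform. Qed.

(** Leibniz for the integrand of the integration by parts. The factor [z] stays with the density [p]
    until their product has been killed, and is then moved onto the other derivatives, where [z]
    times a derivative is explicit. *)
Lemma sder_product D (z p x h j e : sf) : superder D -> seven z -> seven p -> seven x -> seven j -> seven e ->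
  ssmooth z -> ssmooth p -> ssmooth x -> ssmooth j -> ssmooth e -> D (z * p) = 0 -> D e = e * (- D h) ->
  D (z * p * (x * (j * e))) = p * (D x * (j * z) * e) + p * (x * (z * D j) * e) - p * (x * j * (z * D h) * e).
Proof.
move=> dD ez ep ex ej ee sz sp sx sj se zp De.
have sje := ssmoothM sj se.
rewrite (sderM dD (sevenM ez ep) (ssmoothM sz sp) (ssmoothM sx sje)) zp mul0r add0r.
rewrite (sderM dD ex sx sje) (sderM dD ej sj se) De.
have alg (A : pzRingType) (z' p' x' dx j' dj e' dh : A) : (forall X, z' * X = X * z') -> (forall X, e' * X = X * e') ->
    z' * p' * (dx * (j' * e') + x' * (dj * e' + j' * (e' * - dh))) =
    p' * (dx * (j' * z') * e') + p' * (x' * (z' * dj) * e') - p' * (x' * j' * (z' * dh) * e').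
  move=> zc ec; have cz X Y : z' * (X * Y) = X * (z' * Y) by rewrite mulrA zc -mulrA.
  rewrite (mulrDr x') !mulrDr addrA !mulrN; congr (_ + _ - _).
  - by rewrite (zc p') -!mulrA !cz.
  - by rewrite (zc p') -!mulrA cz.
  - by rewrite (zc p') -!mulrA cz cz (ec dh).
by apply: alg => X; apply: seven_comm.
Qed.

Lemma sint_sub F G : sbox M F -> sbox M G -> sint (F - G) = sint F - sint G.
Proof. by move=> bF bG; rewrite (sintD M0 bF (sboxN bG)) (sintN M0 bG). Qed.

Lemma dX_eH b : dX (inl b) eH = eH * (- dX (inl b) H).
Proof.
have dD := superder_dX R (inl b).
have [eN sN _] := closed_formN (closed_H beta); have [_ sH _] := closed_H beta.
have ms : maps_smooth (@expR R) (body (- H)).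
  by apply: smooth1_maps; [exact: smooth1_expR|apply: Cinf_lip; exact: Cinf_body].
by rewrite (sder_fun_form dD eN sN ms) derive1_expR (sderN dD sH).
Qed.

Lemma dX_xform b : dX (inl b) (xform_ a) = (a == b)%:R *: (1 : sf).
Proof.
rewrite /xform dX_form0; last exact: Cinf_coord.
by rewrite partial_coord scale_form0 mulr1.
Qed.

(** The integral of the [x_b]-derivative of [z_b P x_a u(z) exp (- H)] vanishes. The three terms
    come from [x_a], from [u] (giving a factor [x_b]) and from [H] (giving [x_b z_j - z_b x_j]). *)
Lemma twopt_by_parts b u : Cinf u -> usupp M u ->
  (a == b)%:R * sint (P * (JJ (fun l => u l * l b) * eH)) + twopt b (partial b u) =
  \sum_j beta b j * (twopt b (fun l => u l * l j) - twopt j (fun l => u l * l b)).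
Proof.
move=> cu uM; have dD := superder_dX R (inl b).
have [eP sP _] := @closed_zinvs R Lam (enum Lam); have [ee se _] := closed_eH.
have [eJ sJ _] := closed_JJ cu.
have [sz ez] := (@ssmooth_z R Lam b, @z_even R Lam b).
have [sx ex] := (@ssmooth_xform R Lam a, @seven_xform R Lam a).
pose t1 := (a == b)%:R *: (P * (JJ (fun l => u l * l b) * eH)).
pose t2 := P * (xform_ a * xform_ b * JJ (partial b u) * eH).
pose w j := P * (xform_ a * xform_ b * JJ (fun l => u l * l j) * eH) -
  P * (xform_ a * xform_ j * JJ (fun l => u l * l b) * eH).
have cu' := Cinf_partial b cu; have uM' := usupp_partial b cu uM.
have cul j : Cinf (fun l => u l * l j) by apply: CinfM => //; exact: Cinf_coord.
have uMl j : usupp M (fun l => u l * l j) by exact: usuppM.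
have b1 : sbox M t1 := sboxZ _ (sbox_Je (cul b) (uMl b)).
have b2 : sbox M t2 := sbox_PJe (ssmooth_xx a b) cu' uM'.
have bw1 i k : sbox M (P * (xform_ a * xform_ i * JJ (fun l => u l * l k) * eH)).
  exact: (sbox_PJe (ssmooth_xx a i) (cul k) (uMl k)).
have bw j : sbox M (w j) := sboxD (bw1 b j) (sboxN (bw1 j b)).
have bs : sbox M (\sum_j beta b j *: w j) by apply: sbox_sum => j _; exact: sboxZ.
have E : dX (inl b) (z_ b * P * (xform_ a * (JJ u * eH))) = t1 + t2 - \sum_j beta b j *: w j.
  apply: (etrans (sder_product dD ez eP ex eJ ee sz sP sx sJ se (dX_zP b) (dX_eH b))).
  rewrite dX_xform -(JJ_coordM b cu) (z_dX_J b cu) (z_dX_H b).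
  have e1 : P * ((a == b)%:R *: (1 : sf) * JJ (fun l => u l * l b) * eH) = t1.
    rewrite /t1; move: (JJ _) P eH => x y z; rewrite !sfscaleAl mul1r sfscaleAr //.
  have e2 : P * (xform_ a * (JJ (partial b u) * xform_ b) * eH) = t2.
    rewrite /t2 -(seven_comm _ (@seven_xform R Lam b)).
    by move: P (xform_ a) (xform_ b) (JJ _) eH => p x y z t; rewrite !mulrA.
  have e3 : P * (xform_ a * JJ u * (\sum_j beta b j *: (xform_ b * z_ j - z_ b * xform_ j)) * eH) =
      \sum_j beta b j *: w j.
    have dist (A : pzRingType) (p q e : A) (G : Lam -> A) : p * (q * (\sum_j G j) * e) = \sum_j p * (q * G j * e).
      by rewrite mulr_sumr mulr_suml mulr_sumr.
    apply: (etrans (dist _ _ _ _ _)); apply: eq_bigr => j _.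
    have sc (c : R) (p q y e : sf) : p * (q * (c *: y) * e) = c *: (p * (q * y * e)).
      by rewrite sfscaleAr sfscaleAl sfscaleAr.
    apply: (etrans (sc _ _ _ _ _)); apply: (congr1 (fun X => beta b j *: X)).
    rewrite /w (JJ_coordM j cu) (JJ_coordM b cu).
    have alg (A : pzRingType) (p x t y zj zb xj e : A) : y * t = t * y -> (forall X, xj * X = X * xj) ->
        p * (x * t * (y * zj - zb * xj) * e) = p * (x * y * (t * zj) * e) - p * (x * xj * (t * zb) * e).
      move=> yt xc; rewrite mulrBr mulrBl mulrBr; congr (_ - _).
        by rewrite -!mulrA (mulrA t) -yt !mulrA.
      by rewrite -(mulrA x xj) xc !mulrA.
    apply: alg; first by apply: seven_comm; exact: seven_xform.
    by move=> X; apply: seven_comm; exact: seven_xform.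
  by rewrite e1 e2 e3.
have bY : sbox M (z_ b * P * (xform_ a * (JJ u * eH))).
  exact: (sboxMl (ssmoothM sz sP) (sboxMl sx (sboxMr (sbox_J _ cu uM) se))).
have := sint_dX M0 (inl b) bY; rewrite E (sint_sub (sboxD b1 b2) bs) (sintD M0 b1 b2).
rewrite (sintZ M0 _ (sbox_Je (cul b) (uMl b))) => /eqP; rewrite subr_eq0 => /eqP ->.
rewrite (sint_sum M0); last by move=> j _; exact: sboxZ.
apply: eq_bigr => j _; rewrite (sintZ M0 _ (bw j)) (sint_sub (bw1 b j) (bw1 j b)) //.
Qed.

End Bounded.

End SuperExpectation.

(** * The two-point functional *)

Section TwoPoint.
Variables (R : realType) (Lam : finType).
Local Notation crd := (Defs.coord Lam).
Local Notation sf := (superform R Lam).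
Local Notation xform_ := (@Defs.xform R Lam).
Implicit Types (F G A B : sf) (f g : (crd -> R) -> R) (p q : crd -> R) (i j b : Lam).
Implicit Types (u v : (Lam -> R) -> R) (s : seq Lam).

Definition sbnd M F (C : R) : Prop := forall p, box M p -> forall S, `|F p S| <= C.

Lemma sbnd_ex M F : ssmooth F -> exists2 C : R, 0 <= C & sbnd M F C.
Proof.
move=> sF.
have H S : exists C : R, 0 <= C /\ forall p, box M p -> `|F p S| <= C.
  by have [C C0 HC] := loclip_bnd M (Cinf_lip (sF S)); exists C.
have [C HC] := choice H.
exists (\sum_S C S); first by apply: sumr_ge0 => S _; have [] := HC S.
move=> p bp S; rewrite (bigD1 S)//= ler_wpDr//; last by have [_ ->] := HC S.
by apply: sumr_ge0 => T _; have [] := HC T.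
Qed.

Lemma sbndD M F G C D : sbnd M F C -> sbnd M G D -> sbnd M (F + G) (C + D).
Proof.
move=> bF bG p bp S; rewrite sfD gaddE; apply: le_trans (ler_normD _ _) _.
by apply: lerD; [exact: bF|exact: bG].
Qed.

Definition nset2 : R := #|{set crd}|%:R * #|{set crd}|%:R.

Lemma nset2_ge0 : 0 <= nset2. Proof. by rewrite mulr_ge0. Qed.

Lemma sbndM M F G C D : 0 <= C -> 0 <= D -> sbnd M F C -> sbnd M G D -> sbnd M (F * G) (nset2 * (C * D)).
Proof.
move=> C0 D0 bF bG p bp S; rewrite sfM gmulE; apply: le_trans (ler_norm_sum _ _ _) _.
have CD : 0 <= C * D by exact: mulr_ge0.
have H (A : {set crd}) : `|\sum_(B : {set crd} | [disjoint A & B] && (finset.setU A B == S)) (-1) ^+ inversions A B * (F p A * G p B)| <= #|{set crd}|%:R * (C * D).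
  apply: le_trans (ler_norm_sum _ _ _) _.
  apply: (@le_trans _ _ (\sum_(B : {set crd}) C * D)); last by rewrite sumr_const mulr_natl.
  rewrite big_mkcond; apply: ler_sum => B _; case: ifP => // _.
  rewrite normrM normrX normrN1 expr1n mul1r normrM; apply: ler_pM => //; [exact: bF|exact: bG].
apply: (@le_trans _ _ (\sum_(A : {set crd}) #|{set crd}|%:R * (C * D))); first by apply: ler_sum => A _; exact: H.
by rewrite sumr_const /nset2 -mulrA -[leLHS]mulr_natl.
Qed.

(** Only derivatives taken at most once in each coordinate are bounded: no others occur in [J], as
    the [th k] square to zero. *)
Definition dbnd (T : seq Lam) (c : R) u : Prop := forall r, {subset r <= T} -> uniq r ->
  forall l, (forall j, 1 <= l j) -> `|partials r u l| <= c.

Lemma J_bnd M s : uniq s -> exists2 C : R, 0 <= C & forall u c, 0 <= c -> Cinf u -> dbnd s c u -> sbnd M (J s u) (C * c).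
Proof.
elim: s => [_|k s ih].
  exists 1 => // u c c0 cu bu p _ S; rewrite /= /form0 gscaleE g1E mul1r.
  case: (S == _); last by rewrite mulr0 normr0.
  by rewrite mulr1; apply: (bu [::]) => // j; exact: z0_ge1.
rewrite cons_uniq => /andP[ks us]; have [C C0 HC] := ih us.
have [D D0 HD] := sbnd_ex M (@ssmooth_th R Lam k).
exists (C + nset2 * (C * D)); first by rewrite addr_ge0// !mulr_ge0.
move=> u c c0 cu bu.
have b1 : dbnd s c u by move=> r rs; apply: bu => j /rs js; rewrite inE js orbT.
have b2 : dbnd s c (partial k u).
  move=> r rs ur; have := bu (rcons r k); rewrite /partials foldr_rcons; apply.
  - by move=> j; rewrite mem_rcons !inE => /orP[->//|/rs ->]; rewrite orbT.
  - by rewrite rcons_uniq ur andbT; apply: contra ks => /rs.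
rewrite mulrDl; apply: sbndD; first exact: HC.
have := sbndM (mulr_ge0 C0 c0) D0 (HC _ _ c0 (Cinf_partial k cu) b2) HD.
by rewrite (_ : nset2 * (C * c * D) = nset2 * (C * D) * c); [|ring].
Qed.

Lemma sint_le M F C : 0 <= M -> 0 <= C -> sbox M F -> sbnd M F C ->
  `|sint F| <= `|gtop (gmon R [set: crd]%SET)| * C * (2 * M) ^+ #|crd|.
Proof.
move=> M0 C0 bF cF; apply: (integral_Rn_le M0 (csup_gtop bF)) => p.
rewrite gtopE normrM; apply: ler_wpM2l => //.
have [[k kp]|H] := pselect (exists k, M < `|p k|).
  by rewrite (bF.2 p k kp) g0E normr0.
by apply: cF => k; rewrite leNgt; apply/negP => h; apply: H; exists k.
Qed.

Variable beta : Lam -> Lam -> R.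
Hypothesis beta_sym : forall i j, beta i j = beta j i.
Variable a : Lam.
Local Notation eH := (fun_form expR (- hamiltonian beta) : sf).
Local Notation P := (@zinvs R Lam (enum Lam)).
Local Notation JJ := (@J R Lam (enum Lam)).

(* The generator of the process [(X_t, L_t)]. *)
Definition gen (f : Lam -> (Lam -> R) -> R) b : (Lam -> R) -> R :=
  fun l => partial b (f b) l + \sum_j beta b j * (l j * (f j l - f b l)).

Definition mu2 (h : Lam -> (Lam -> R) -> R) : R :=
  \sum_b superexp beta (xform_ a * xform_ b * JJ (h b)).

Section Bounded.
Variable M : R.
Hypothesis M1 : 1 <= M.
Let M0 : 0 <= M. Proof. by have := M1; lra. Qed.

Lemma mu2_twopt h : mu2 h = (2 * pi) ^- #|Lam| * \sum_b twopt beta a b (h b).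
Proof. by rewrite /mu2 mulr_sumr; apply: eq_bigr => b _; rewrite superexpE. Qed.

Lemma twoptD b u v : Cinf u -> Cinf v -> usupp M u -> usupp M v ->
  twopt beta a b (fun l => u l + v l) = twopt beta a b u + twopt beta a b v.
Proof.
move=> cu cv uM vM; have sxx := @ssmooth_xx R Lam a b.
rewrite /twopt JD// -(sintD M0 (sbox_PJe beta sxx cu uM) (sbox_PJe beta sxx cv vM)).
have alg (A : pzRingType) (p x y z e : A) : p * (x * (y + z) * e) = p * (x * y * e) + p * (x * z * e).
  by rewrite mulrDr mulrDl mulrDr.
by rewrite (alg sf).
Qed.

Lemma twoptZ b (c : R) u : Cinf u -> usupp M u ->
  twopt beta a b (fun l => c * u l) = c * twopt beta a b u.
Proof.
move=> cu uM; have sxx := @ssmooth_xx R Lam a b.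
rewrite /twopt -(sintZ M0 _ (sbox_PJe beta sxx cu uM)); congr sint.
rewrite JM//; last exact: Cinf_cst.
rewrite J_cst -scale_form0.
have sc (p q y e : sf) : p * (q * (c *: y) * e) = c *: (p * (q * y * e)).
  by rewrite sfscaleAr sfscaleAl sfscaleAr.
exact: sc.
Qed.

Lemma twopt0 b : twopt beta a b (fun=> 0) = 0.
Proof.
have E : (fun l : Lam -> R => 0 * (0 : R)) = fun=> 0 by apply/funext => l; rewrite mulr0.
have := @twoptZ b 0 (fun=> 0) (Cinf_cst _ _) (fun _ _ _ _ => erefl).
by rewrite E mul0r.
Qed.

Lemma usupp_sum (I : Type) (r : seq I) (u : I -> (Lam -> R) -> R) :
  (forall t : I, usupp M (u t)) -> usupp M (fun l => \sum_(t <- r) u t l).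
Proof. by move=> H l k l1 lk; rewrite big1// => t _; exact: H lk. Qed.

Lemma twopt_sum b (r : seq Lam) (u : Lam -> (Lam -> R) -> R) :
  (forall i, Cinf (u i)) -> (forall i, usupp M (u i)) ->
  twopt beta a b (fun l => \sum_(i <- r) u i l) = \sum_(i <- r) twopt beta a b (u i).
Proof.
move=> cu uM; elim: r => [|i r ih].
  rewrite big_nil; under eq_fun do rewrite big_nil.
  exact: twopt0.
rewrite big_cons -ih -twoptD//; [|exact: Cinf_sum|exact: usupp_sum].
by under eq_fun do rewrite big_cons.
Qed.

(** Sum the integration by parts with [u = f b] over [b]. Exchanging the two summation indices in
    the terms with [f j], by symmetry of [beta], turns its right side into minus the jump part of
    the generator; the diagonal term at [a] is evaluated by localization, with [z_a = 1]. *)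
Lemma mu2_gen (f : Lam -> (Lam -> R) -> R) : (forall b, Cinf (f b)) -> (forall b, usupp M (f b)) ->
  mu2 (gen f) = - f a (fun=> 1).
Proof.
move=> cf uf; rewrite mu2_twopt.
have cc (k : Lam) := @Cinf_coord R Lam k.
have cfl i j : Cinf (fun l => f i l * l j) by exact: CinfM.
have ufl i j : usupp M (fun l => f i l * l j) by exact: usuppM.
have cp b := Cinf_partial b (cf b); have up b := usupp_partial b (cf b) (uf b).
have E b : twopt beta a b (gen f b) = twopt beta a b (partial b (f b)) +
   \sum_j beta b j * (twopt beta a b (fun l => f j l * l j) - twopt beta a b (fun l => f b l * l j)).
  have cd j : Cinf (fun l => f j l * l j + (-1) * (f b l * l j)).
    by apply: CinfD => //; apply: CinfM => //; exact: Cinf_cst.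
  have ud j : usupp M (fun l => f j l * l j + (-1) * (f b l * l j)).
    by apply: usuppD => // l k l1 lk; rewrite (ufl b j l k l1 lk) mulr0.
  have cb j : Cinf (fun l => beta b j * (f j l * l j + (-1) * (f b l * l j))).
    by apply: CinfM => //; exact: Cinf_cst.
  have ub j : usupp M (fun l => beta b j * (f j l * l j + (-1) * (f b l * l j))).
    by move=> l k l1 lk; rewrite (ud j l k l1 lk) mulr0.
  rewrite (_ : gen f b = fun l => partial b (f b) l + \sum_j beta b j * (f j l * l j + (-1) * (f b l * l j))).
    rewrite twoptD//; [|exact: Cinf_sum|exact: usupp_sum]; congr (_ + _).
    rewrite twopt_sum//; apply: eq_bigr => j _; rewrite twoptZ//; congr (_ * _).
    rewrite twoptD//; [|by apply: CinfM => //; exact: Cinf_cst|by move=> l k l1 lk; rewrite (ufl b j l k l1 lk) mulr0].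
    by rewrite twoptZ// mulN1r.
  apply/funext => l; rewrite /gen; congr (_ + _); apply: eq_bigr => j _; congr (_ * _).
  by rewrite mulrBr mulN1r ![l j * _]mulrC.
pose S b := sint (P * (JJ (fun l => f b l * l b) * eH)).
have ibp b := twopt_by_parts beta_sym a M1 b (cf b) (uf b).
have Z : \sum_b twopt beta a b (gen f b) = - S a.
  have : \sum_b ((a == b)%:R * S b + twopt beta a b (partial b (f b))) = \sum_b \sum_j
     beta b j * (twopt beta a b (fun l => f b l * l j) - twopt beta a j (fun l => f b l * l b)).
    by apply: eq_bigr => b _; exact: ibp.
  rewrite big_split /= (bigD1 a)//= eqxx mul1r big1 ?addr0; last by move=> b ba; rewrite eq_sym (negPf ba) mul0r.
  move=> H; rewrite (eq_bigr _ (fun b _ => E b)) big_split /=.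
  have -> : \sum_b \sum_j beta b j * (twopt beta a b (fun l => f j l * l j) - twopt beta a b (fun l => f b l * l j)) =
     - \sum_b \sum_j beta b j * (twopt beta a b (fun l => f b l * l j) - twopt beta a j (fun l => f b l * l b)).
    have sw : \sum_b \sum_j beta b j * twopt beta a b (fun l => f j l * l j) =
        \sum_b \sum_j beta b j * twopt beta a j (fun l => f b l * l b).
      rewrite exchange_big; apply: eq_bigr => b _; apply: eq_bigr => j _.
      by rewrite beta_sym.
    have sp (x y : Lam -> Lam -> R) : \sum_b \sum_j beta b j * (x b j - y b j) =
        \sum_b \sum_j beta b j * x b j - \sum_b \sum_j beta b j * y b j.
      rewrite -sumrB; apply: eq_bigr => b _; rewrite -sumrB; apply: eq_bigr => j _.
      by rewrite mulrBr.
    by rewrite !sp sw opprB.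
  by rewrite -H opprD addrC -addrA addNr addr0.
rewrite Z /S (sint_J beta M1 (cfl a a) (ufl a a)) mulr1 mulrN mulKf//.
by rewrite expf_neq0// mulf_neq0// gt_eqF// pi_gt0.
Qed.

Lemma mu2D h h' : (forall b, Cinf (h b)) -> (forall b, usupp M (h b)) ->
  (forall b, Cinf (h' b)) -> (forall b, usupp M (h' b)) ->
  mu2 (fun b l => h b l + h' b l) = mu2 h + mu2 h'.
Proof.
move=> ch uh ch' uh'; rewrite !mu2_twopt -mulrDr; congr (_ * _); rewrite -big_split /=.
by apply: eq_bigr => b _; rewrite twoptD.
Qed.

(** Continuity of [mu2] in the norm of the uniqueness argument; the constant collects the sizes of
    all other factors on the box of radius [M]. *)
Lemma mu2_bnd : exists2 C : R, 0 <= C & forall h c, 0 <= c -> (forall b, Cinf (h b)) ->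
  (forall b, usupp M (h b)) -> (forall b, dbnd (enum Lam) c (h b)) -> `|mu2 h| <= C * c.
Proof.
have [C C0 HC] := J_bnd M (enum_uniq Lam).
have [_ sP _] := @closed_zinvs R Lam (enum Lam).
have [_ se _] := closed_eH beta.
have [D D0 HD] := sbnd_ex M sP; have [E E0 HE] := sbnd_ex M se.
have H b : exists K : R, 0 <= K /\ sbnd M (xform_ a * xform_ b) K.
  by have [K K0 HK] := sbnd_ex M (@ssmooth_xx R Lam a b); exists K.
have [K HK] := choice H.
pose Cb b := `|gtop (gmon R [set: crd]%SET)| * (nset2 * (D * (nset2 * (nset2 * (K b * C) * E)))) * (2 * M) ^+ #|crd|.
have n0 := nset2_ge0.
exists ((2 * pi) ^- #|Lam| * \sum_b Cb b).
  have Cb0 b : 0 <= Cb b.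
    have [Kb _] := HK b; have M20 : 0 <= (2 * M) ^+ #|crd| by apply: exprn_ge0; apply: mulr_ge0.
    by apply: mulr_ge0 => //; apply: mulr_ge0 => //; do 3!(apply: mulr_ge0 => //; apply: mulr_ge0 => //).
  apply: mulr_ge0; last by apply: sumr_ge0.
  by rewrite invr_ge0 exprn_ge0// mulr_ge0// pi_ge0.
move=> h c c0 ch uh bh; rewrite mu2_twopt normrM ger0_norm; last by rewrite invr_ge0 exprn_ge0// mulr_ge0// pi_ge0.
rewrite -mulrA; apply: ler_wpM2l; first by rewrite invr_ge0 exprn_ge0// mulr_ge0// pi_ge0.
rewrite mulr_suml; apply: le_trans (ler_norm_sum _ _ _) _; apply: ler_sum => b _.
have [K0 Kb] := HK b.
have bJ := HC _ _ c0 (ch b) (bh b).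
have Cc0 := mulr_ge0 C0 c0.
have b1 := sbndM K0 Cc0 Kb bJ.
have n1 : 0 <= nset2 * (K b * (C * c)) by do 2!(apply: mulr_ge0 => //).
have b2 := sbndM n1 E0 b1 HE.
have n2 : 0 <= nset2 * (nset2 * (K b * (C * c)) * E) by do 2!(apply: mulr_ge0 => //).
have b3 := sbndM D0 n2 HD b2.
have n3 : 0 <= nset2 * (D * (nset2 * (nset2 * (K b * (C * c)) * E))) by do 2!(apply: mulr_ge0 => //).
apply: le_trans (sint_le M0 n3 (sbox_PJe beta (@ssmooth_xx R Lam a b) (ch b) (uh b)) b3) _.
rewrite /Cb; move: (gtop _) (nset2) (K b) ((2 * M) ^+ _) => g n k m.
by rewrite le_eqVlt; apply/orP; left; apply/eqP; ring.
Qed.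

End Bounded.
End TwoPoint.

(** * Uniqueness *)

Section Uniqueness.
Variables (R : realType) (Lam : finType) (beta : Lam -> Lam -> R).
Hypothesis beta_ge0 : forall i j, 0 <= beta i j.
Local Notation mu := (@lebesgue_measure R).
Local Notation rint f a b := (\int[mu]_(x in `[a, b]) f x).
Implicit Types (u v : (Lam -> R) -> R) (l : Lam -> R) (i j b k : Lam) (r : seq Lam).

Lemma rint_le_fun (f g : R -> R) (a b : R) : rcb a b f -> rcb a b g ->
  (forall t, a <= t <= b -> `|f t| <= g t) -> `|rint f a b| <= rint g a b.
Proof.
move=> cf cg H; rewrite ler_norml; apply/andP; split.
  rewrite -[leLHS]mulN1r -rintZ//; apply: le_Rintegral => //.
  - by apply: rcb_integrable; apply: rcbM => //; exact: rcb_cst.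
  - exact: rcb_integrable.
  - by move=> t /=; rewrite in_itv => /H; rewrite ler_norml mulN1r => /andP[].
apply: le_Rintegral => //; [exact: rcb_integrable|exact: rcb_integrable|].
by move=> t /=; rewrite in_itv => /H; rewrite ler_norml => /andP[].
Qed.

Lemma usupp_partials M r u : Cinf u -> usupp M u -> usupp M (partials r u).
Proof.
move=> cu uM; elim: r => [//|k r ih] /=.
by apply: usupp_partial => //; exact: Cinf_partials.
Qed.

(** At most one derivative can fall on the factor [l j], since [r] has no repetition. *)
Lemma partials_coordM j r u : Cinf u -> uniq r -> partials r (fun l => l j * u l) =
  fun l => l j * partials r u l + (if j \in r then partials (rem j r) u l else 0).
Proof.
move=> cu; elim: r => [_|k r ih]; first by apply/funext => l /=; rewrite addr0.
rewrite cons_uniq => /andP[kr ur]; rewrite /= ih//.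
have cr := Cinf_partials r cu; have cj := @Cinf_coord R Lam j.
have cm : Cinf (fun l => l j * partials r u l) by exact: CinfM.
have cq : Cinf (fun l => if j \in r then partials (rem j r) u l else 0).
  by case: (j \in r); [exact: Cinf_partials|exact: Cinf_cst].
rewrite partialD// partialM// partial_coord; apply/funext => l; rewrite inE.
have [jk|jk] := eqVneq j k.
  rewrite jk (negPf kr) /= partial_cst addr0 mul1r addrC.
  by congr (_ + _); rewrite eqxx.
rewrite /= mulr0n mul0r add0r ?(eq_sym k) ?(negPf jk) /=; congr (_ + _); case: (j \in r) => //=.
by rewrite partial_cst.
Qed.

Variable M : R.
Hypothesis M1 : 1 <= M.
Let M0 : 0 <= M. Proof. by have := M1; lra. Qed.

Definition adm (h : Lam -> (Lam -> R) -> R) : Prop := forall b, Cinf (h b) /\ usupp M (h b).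

Definition wbnd (lam c : R) (h : Lam -> (Lam -> R) -> R) : Prop :=
  forall b r, uniq r -> forall l, (forall j, 1 <= l j) ->
    `|partials r (h b) l| <= c * expR (- (lam * \sum_j l j)).

Lemma partials_bnd n u : Cinf u -> exists2 C : R, 0 <= C &
  forall r, (size r <= n)%N -> forall l, box M l -> `|partials r u l| <= C.
Proof.
elim: n u => [|n ih] u cu.
  have [C C0 HC] := loclip_bnd M (Cinf_lip cu); exists C => // r.
  by rewrite leqn0 => /nilP ->.
have [C C0 HC] := loclip_bnd M (Cinf_lip cu).
have H k : exists D : R, 0 <= D /\ forall r, (size r <= n)%N -> forall l, box M l -> `|partials r (partial k u) l| <= D.
  by have [D D0 HD] := ih _ (Cinf_partial k cu); exists D.
have [D HD] := choice H; exists (C + \sum_k D k).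
  by rewrite addr_ge0// sumr_ge0// => k _; have [] := HD k.
have S0 : 0 <= \sum_k D k by apply: sumr_ge0 => k _; have [] := HD k.
case/lastP => [_ l bl|r k]; first by apply: le_trans (HC _ bl) _; rewrite lerDl.
rewrite size_rcons ltnS => rn l bl; rewrite /partials foldr_rcons.
have [_ h] := HD k; apply: le_trans (h r rn l bl) _.
rewrite (bigD1 k)//= addrCA lerDl addr_ge0// sumr_ge0// => j _.
by have [] := HD j.
Qed.

(** On the support all coordinates are at most [M], so the weight is bounded below by the inverse of
    [e]. *)
Lemma wbnd_ex (lam : R) h : 0 <= lam -> adm h -> exists2 c : R, 0 <= c & wbnd lam c h.
Proof.
move=> lam0 ah.
have H b : exists D : R, 0 <= D /\ forall r, (size r <= #|Lam|)%N -> forall l, box M l -> `|partials r (h b) l| <= D.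
  by have [D D0 HD] := partials_bnd #|Lam| (ah b).1; exists D.
have [D HD] := choice H.
pose e := expR (lam * \sum_(j : Lam) M).
have S0 : 0 <= \sum_k D k by apply: sumr_ge0 => k _; have [] := HD k.
exists (\sum_k D k * e); first by apply: sumr_ge0 => k _; rewrite mulr_ge0 ?expR_ge0//; have [] := HD k.
move=> b r ur l l1; have [_ Db] := HD b.
have [[k kl]|nk] := pselect (exists k, M < l k).
  rewrite (usupp_partials _ (ah b).1 (ah b).2 l1 kl) normr0 mulr_ge0 ?expR_ge0//.
  by apply: sumr_ge0 => i _; rewrite mulr_ge0 ?expR_ge0//; have [] := HD i.
have lM j : l j <= M by rewrite leNgt; apply/negP => h1; apply: nk; exists j.
have bl : box M l by move=> j; rewrite ger0_norm//; apply: le_trans (l1 j).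
have sr : (size r <= #|Lam|)%N by rewrite -(card_uniqP ur) max_card.
apply: le_trans (Db r sr l bl) _; rewrite -mulr_suml -mulrA -expRD.
have S1 : D b <= \sum_k D k.
  by rewrite (bigD1 b)//= lerDl sumr_ge0// => i _; have [] := HD i.
apply: le_trans S1 _; rewrite -[leLHS]mulr1; apply: ler_wpM2l => //.
rewrite -expR0 ler_expR subr_ge0; apply: ler_wpM2l => //.
by apply: ler_sum => j _.
Qed.

Lemma wbnd_dbnd (lam c : R) h b : 0 <= lam -> 0 <= c -> wbnd lam c h -> dbnd (enum Lam) c (h b).
Proof.
move=> lam0 c0 H r _ ur l l1; apply: le_trans (H b r ur l l1) _.
rewrite -[leRHS]mulr1; apply: ler_wpM2l => //; rewrite -expR0 ler_expR oppr_le0.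
by apply: mulr_ge0 => //; apply: sumr_ge0 => j _; apply: le_trans (l1 j).
Qed.

Lemma usupp_Gint k u : usupp M u -> usupp M (Gint k M u).
Proof.
move=> uM l j l1 lj; rewrite /Gint (@eq_rint _ _ _ _ (fun=> 0)); first exact: rint0.
move=> t /andP[t0 _]; apply: (uM _ j) => [i|]; rewrite /shiftc updE; case: eqP => [ik|_] //.
- by have := l1 k; lra.
- by rewrite -ik; lra.
Qed.

(** Derivatives commute with [Gint], and shifting one coordinate by [t] multiplies the weight by
    [exp (- lam t)], whose integral is at most [1 / lam]. *)
Lemma wbnd_Gint (lam c : R) h b r l : 0 < lam -> 0 <= c -> adm h -> wbnd lam c h -> uniq r -> (forall j, 1 <= l j) ->
  `|partials r (Gint b M (h b)) l| <= c / lam * expR (- (lam * \sum_j l j)).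
Proof.
move=> lam0 c0 ah H ur l1; have cu := (ah b).1.
rewrite (partials_Gint _ _ M0 cu) /Gint.
pose S := \sum_j l j.
pose g t := c * expR (- (lam * S) - lam * t).
have h2 (t : R) : is_derive t 1 (fun s => expR (- (lam * S) - lam * s)) (- lam * expR (- (lam * S) - lam * t)).
  have h1 : is_derive t 1 (fun t : R => - (lam * S) - lam * t) (- lam).
    have := is_deriveB (is_derive_cst (- (lam * S)) t 1) (is_deriveZ lam (is_derive_id t (1 : R))).
    by move=> h1; apply: (is_derive_eq h1); rewrite /GRing.scale /= mulr1 sub0r.
  have := is_derive1_comp (f := @expR R) (g := fun t : R => - (lam * S) - lam * t) (is_derive_expR _) h1.
  by move=> h3; apply: (is_derive_eq h3); rewrite mulrC.
have dg (t : R) : is_derive t 1 (fun t => - (c / lam) * expR (- (lam * S) - lam * t)) (g t).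
  have h3 := is_deriveZ (- (c / lam)) (h2 t).
  apply: (is_derive_eq h3); rewrite /GRing.scale /= /g.
  have lamn : lam != 0 by rewrite gt_eqF.
  by move: (expR _) => e; field.
have rg : rcb 0 M g.
  apply: rcbM; first exact: rcb_cst.
  apply: econt_rcb.
    apply: continuous_econt => t _; apply: differentiable_continuous; apply/derivable1_diffP.
    by have [] := h2 t.
  exists 1 => t /andP[t0 _]; rewrite ger0_norm ?expR_ge0// -expR0 ler_expR.
  have : 0 <= lam * S.
    by apply: mulr_ge0; [exact: ltW|apply: sumr_ge0 => j _; apply: le_trans (l1 j)].
  have : 0 <= lam * t by apply: mulr_ge0 => //; exact: ltW.
  lra.
have cr := Cinf_partials r cu.
apply: le_trans (rint_le_fun (rcb_shiftc _ _ _ (Cinf_lip cr)) rg _) _.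
  move=> t /andP[t0 tM]; apply: le_trans (H b r ur (shiftc b t l) _) _.
    by move=> j; rewrite /shiftc updE; case: eqP => [_|_]//; have := l1 b; lra.
  rewrite /g le_eqVlt; apply/orP; left; apply/eqP; congr (_ * expR _).
  have -> : \sum_j shiftc b t l j = S + t.
    rewrite /S (bigD1 b)//= [in RHS](bigD1 b)//= /shiftc updE eqxx addrAC; congr (_ + _ + _).
    by apply: eq_bigr => j jb; rewrite updE (negPf jb).
  by rewrite mulrDr opprD.
rewrite (rint_FTC M0 (fun t _ => dg t) rg) mulr0 subr0 !mulNr opprK addrC gerBl.
by apply: mulr_ge0 (expR_ge0 _); apply: divr_ge0 => //; exact: ltW.
Qed.

(** The error of inverting the drift alone: for [f b = - Gint b M (h b)], the generator gives
    [h - Tstep h] on [1 <= l j]. *)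
Definition Tstep (h : Lam -> (Lam -> R) -> R) : Lam -> (Lam -> R) -> R :=
  fun b l => \sum_j beta b j * (l j * (Gint j M (h j) l - Gint b M (h b) l)).

Let cG h j : adm h -> Cinf (Gint j M (h j)).
Proof. by move=> ah; exact: (Cinf_Gint _ M0 (ah j).1). Qed.

Let cGd h i j : adm h -> Cinf (fun l => Gint j M (h j) l - Gint i M (h i) l).
Proof. by move=> ah; apply: CinfD; [|apply: CinfN]; exact: cG. Qed.

Let cGl h i j : adm h -> Cinf (fun l => l j * (Gint j M (h j) l - Gint i M (h i) l)).
Proof. by move=> ah; apply: CinfM; [exact: Cinf_coord|exact: cGd]. Qed.

Let uGd h i j : adm h -> usupp M (fun l => Gint j M (h j) l - Gint i M (h i) l).
Proof.
move=> ah l k l1 lk; rewrite (@usupp_Gint j _ (ah j).2 l k l1 lk) (@usupp_Gint i _ (ah i).2 l k l1 lk).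
by rewrite subr0.
Qed.

Lemma adm_Tstep h : adm h -> adm (Tstep h).
Proof.
move=> ah b; split.
  by apply: Cinf_sum => j _; apply: CinfM; [exact: Cinf_cst|exact: cGl].
by move=> l k l1 lk; rewrite /Tstep big1// => j _; rewrite (uGd b j ah l1 lk) !mulr0.
Qed.

(** The factor 2 is for the difference of two antiderivatives, [M + 1] for [l_j <= M] on the support
    together with the derivative that may fall on [l_j], and the full sum of rates dominates each
    row. *)
Let Kb : R := 2 * (M + 1) * \sum_i \sum_j beta i j.

Let sb_ge0 i : 0 <= \sum_j beta i j. Proof. exact: sumr_ge0. Qed.

Lemma partials_sum (I : Type) (t : seq I) (F : I -> (Lam -> R) -> R) r : (forall z : I, Cinf (F z)) ->
  partials r (fun l => \sum_(z <- t) F z l) = fun l => \sum_(z <- t) partials r (F z) l.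
Proof.
move=> cF; elim: r => [//|k r ih] /=; rewrite ih partial_sum// => i _.
exact: Cinf_partials.
Qed.

Lemma partialsZ (c : R) u r : Cinf u -> partials r (fun l => c * u l) = fun l => c * partials r u l.
Proof.
move=> cu; elim: r => [//|k r ih] /=; rewrite ih partialM; [|exact: Cinf_cst|exact: Cinf_partials].
by rewrite partial_cst; apply/funext => l; rewrite mul0r add0r.
Qed.

Lemma partialsB u v r : Cinf u -> Cinf v -> partials r (fun l => u l - v l) = fun l => partials r u l - partials r v l.
Proof.
move=> cu cv; elim: r => [//|k r ih] /=; rewrite ih partialD; [|exact: Cinf_partials|apply: CinfN; exact: Cinf_partials].
by rewrite partialN//; exact: Cinf_partials.
Qed.

Lemma wbnd_Tstep (lam c : R) h : 0 < lam -> 0 <= c -> adm h -> wbnd lam c h -> wbnd lam (Kb / lam * c) (Tstep h).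
Proof.
move=> lam0 c0 ah H b r ur l l1.
set e := expR _; have e0 : 0 <= e by exact: expR_ge0.
rewrite /Tstep partials_sum; last by move=> j; apply: CinfM; [exact: Cinf_cst|exact: cGl].
have Hd j r' : uniq r' -> `|partials r' (fun l => Gint j M (h j) l - Gint b M (h b) l) l| <= 2 * (c / lam * e).
  move=> ur'; rewrite partialsB; [|exact: cG|exact: cG].
  apply: le_trans (ler_normB _ _) _.
  by rewrite mulr_natl mulr2n; apply: lerD; exact: wbnd_Gint.
have q0 : 0 <= 2 * (c / lam * e).
  by apply: mulr_ge0 => //; apply: mulr_ge0 => //; apply: divr_ge0 => //; exact: ltW.
have Hj j : `|partials r (fun l => beta b j * (l j * (Gint j M (h j) l - Gint b M (h b) l))) l| <=
   beta b j * ((M + 1) * (2 * (c / lam * e))).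
  rewrite partialsZ; last exact: cGl.
  rewrite normrM ger0_norm//; apply: ler_wpM2l => //.
  rewrite partials_coordM//; last exact: cGd.
  apply: le_trans (ler_normD _ _) _; rewrite mulrDl mul1r; apply: lerD.
    have [[k kl]|nk] := pselect (exists k, M < l k).
      by rewrite (usupp_partials _ (cGd b j ah) (uGd b j ah) l1 kl) mulr0 normr0 mulr_ge0.
    rewrite normrM; apply: ler_pM => //; last exact: Hd.
    rewrite ger0_norm; last by apply: le_trans (l1 j).
    by rewrite leNgt; apply/negP => h1; apply: nk; exists j.
  by case: ifP => _; [apply: Hd; exact: rem_uniq|rewrite normr0].
apply: le_trans (ler_norm_sum _ _ _) _; apply: (le_trans (ler_sum _ (fun j _ => Hj j))).
rewrite -mulr_suml /Kb; have : \sum_j beta b j <= \sum_i \sum_j beta i j.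
  by rewrite [leRHS](bigD1 b)//= lerDl sumr_ge0.
have M10 : 0 <= (M + 1) * (2 * (c / lam * e)) by apply: mulr_ge0 => //; have := M0; lra.
move=> /(ler_wpM2r M10) /le_trans; apply.
by move: (\sum_i _) (lam^-1) => x y; rewrite le_eqVlt; apply/orP; left; apply/eqP; ring.
Qed.

Section Null.
(** Stands for the difference of the two functionals. Additivity, vanishing on generators and the
    bound by squarefree derivatives on [1 <= l j] are all that the argument uses. *)
Variable nu : (Lam -> (Lam -> R) -> R) -> R.
Hypothesis nuD : forall h h', adm h -> adm h' -> nu (fun b l => h b l + h' b l) = nu h + nu h'.
Hypothesis nu_gen : forall f, adm f -> nu (gen beta f) = 0.
Variable C : R.
Hypothesis C0 : 0 <= C.
Hypothesis nu_bnd : forall h c, 0 <= c -> adm h -> (forall b, dbnd (enum Lam) c (h b)) -> `|nu h| <= C * c.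

(** The difference vanishes on [1 <= l j] with all its derivatives, taken from the right on the
    boundary, so that the bound on [nu] applies with [c = 0]. *)
Lemma nu_eq h h' : adm h -> adm h' -> (forall b l, (forall j, 1 <= l j) -> h b l = h' b l) -> nu h = nu h'.
Proof.
move=> ah ah' E.
pose d b l := h' b l + (-1) * h b l.
have ad : adm d.
  move=> b; split; first by apply: CinfD; [exact: (ah' b).1|apply: CinfM; [exact: Cinf_cst|exact: (ah b).1]].
  by move=> l k l1 lk; rewrite /d ((ah b).2 l k l1 lk) ((ah' b).2 l k l1 lk) mulr0 addr0.
have nd : nu d = 0.
  have db b : dbnd (enum Lam) 0 (d b).
    move=> r _ _ l l1.
    suff -> : partials r (d b) l = 0 by rewrite normr0.
    elim: r l l1 => [|k r ih] l l1 /=; first by rewrite /d E// mulN1r subrr.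
    apply: (pder_vanish (Cinf_pder k (Cinf_partials r (ad b).1))).
    exists 1 => // t /andP[t0 _]; apply: ih => j; rewrite updE; case: eqP => [_|_]//.
    by have := l1 k; lra.
  by have := nu_bnd (lexx 0) ad db; rewrite mulr0 normr_le0 => /eqP.
have -> : h' = fun b l => h b l + d b l.
  by apply/funext => b; apply/funext => l; rewrite /d mulN1r addrC subrK.
by rewrite nuD// nd addr0.
Qed.

Lemma nuN h : adm h -> nu (fun b l => - h b l) = - nu h.
Proof.
move=> ah; have aN : adm (fun b l => - h b l).
  move=> b; split; first by apply: CinfN; exact: (ah b).1.
  by move=> l k l1 lk; rewrite ((ah b).2 l k l1 lk) oppr0.
have a0 : adm (fun _ _ => 0) by move=> b; split => //; exact: Cinf_cst.
have n0 : nu (fun _ _ => 0) = 0.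
  have : nu (fun _ _ => 0 + 0) = nu (fun _ _ => 0) + nu (fun _ _ => 0) := nuD a0 a0.
  by rewrite addr0 => /eqP; rewrite -subr_eq0 opprD addrA subrr sub0r oppr_eq0 => /eqP.
apply/eqP; rewrite -addr_eq0 addrC -nuD//; apply/eqP; rewrite -n0; apply: nu_eq => //.
  by move=> b; split; [apply: CinfD; [exact: (ah b).1|exact: (aN b).1]|apply: usuppD; [exact: (ah b).2|exact: (aN b).2]].
by move=> b l _; rewrite subrr.
Qed.

(** Vanishing on the generator of [- Gint] gives [nu h = nu (Tstep h)], stated with signs because
    only additivity is available. The value at [l_b + M] left by the antiderivative lies beyond the
    support. *)
Lemma nu_Tstep h : adm h -> nu h = - nu (fun b l => - Tstep h b l).
Proof.
move=> ah.
pose f b l := - Gint b M (h b) l.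
have af : adm f.
  move=> b; split; first by apply: CinfN; exact: cG.
  by move=> l k l1 lk; rewrite /f (@usupp_Gint b _ (ah b).2 l k l1 lk) oppr0.
have aT : adm (fun b l => - Tstep h b l).
  move=> b; have [cT uT] := adm_Tstep ah b; split; first exact: CinfN.
  by move=> l k l1 lk; rewrite (uT l k l1 lk) oppr0.
have aS : adm (fun b l => h b l + - Tstep h b l).
  move=> b; have [cT uT] := aT b; have [ch uh] := ah b; split; first exact: CinfD.
  exact: usuppD.
have ag : adm (gen beta f).
  move=> b; split.
    apply: CinfD; first by apply: Cinf_partial; exact: (af b).1.
    apply: Cinf_sum => j _; apply: CinfM; [exact: Cinf_cst|apply: CinfM; first exact: Cinf_coord].
    by apply: CinfD; [exact: (af j).1|apply: CinfN; exact: (af b).1].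
  move=> l k l1 lk; rewrite /gen (usupp_partial b (af b).1 (af b).2 l1 lk) add0r big1// => j _.
  by rewrite ((af j).2 l k l1 lk) ((af b).2 l k l1 lk) subr0 !mulr0.
have E : nu (gen beta f) = nu (fun b l => h b l + - Tstep h b l).
  apply: nu_eq => // b l l1; rewrite /gen /Tstep -sumrN; congr (_ + _); last first.
    by apply: eq_bigr => j _; rewrite /f; ring.
  rewrite /f partialN; last exact: cG.
  rewrite (partial_Gint _ _ M0 (ah b).1) (Gint_partial _ _ M0 (ah b).1) opprB.
  rewrite ((ah b).2 (shiftc b M l) b) ?subr0// => [j|]; rewrite /shiftc updE ?eqxx//.
    by case: eqP => [_|_]//; have := l1 b; have := M0; lra.
  by have := l1 b; lra.
by move: (nu_gen af); rewrite E nuD// => /eqP; rewrite addr_eq0 => /eqP.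
Qed.

(** With [lam = 2 * (Kb + 1)] each [Tstep] at least halves the weighted norm; since [nu h] equals
    [nu] of every iterate, it is below [C * c / 2^n] for all [n]. *)
Lemma nu_null h : adm h -> nu h = 0.
Proof.
move=> ah; pose lam := 2 * (Kb + 1).
have Kb0 : 0 <= Kb.
  apply: mulr_ge0; last by apply: sumr_ge0 => i _.
  by have := M0; lra.
have lam0 : 0 < lam by rewrite /lam; lra.
have [c c0 Hc] := wbnd_ex (ltW lam0) ah.
have half : Kb / lam <= 2^-1.
  by rewrite ler_pdivrMr// /lam; lra.
have K n : forall h c, 0 <= c -> adm h -> wbnd lam c h -> `|nu h| <= C * c * 2^-1 ^+ n.
  elim: n => [|n ih] h' c' c'0 ah' Hc'.
    by rewrite mulr1; apply: nu_bnd => // b; exact: wbnd_dbnd (ltW lam0) c'0 Hc'.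
  have q0 : 0 <= Kb / lam by apply: divr_ge0 => //; exact: ltW.
  rewrite nu_Tstep// (nuN (adm_Tstep ah')) opprK.
  have H := wbnd_Tstep lam0 c'0 ah' Hc'.
  apply: le_trans (ih _ _ (mulr_ge0 q0 c'0) (adm_Tstep ah') H) _.
  rewrite exprS [leRHS]mulrA; apply: ler_wpM2r; first by apply: exprn_ge0; lra.
  by rewrite -mulrA; apply: ler_wpM2l => //; rewrite mulrC; apply: ler_wpM2l.
have D0 : 0 <= C * c by exact: mulr_ge0.
apply/eqP; rewrite -normr_le0; apply/ler_addgt0Pl => e e0; rewrite addr0.
have cv : (fun n => C * c * 2^-1 ^+ n) @ \oo --> (0 : R).
  by rewrite -[X in _ --> X](mulr0 (C * c)); apply: cvgMr; apply: cvg_expr; rewrite ger0_norm; lra.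
move/cvgrPdist_le : cv => /(_ e e0)[n _ /(_ n (leqnn n))] /=.
rewrite sub0r normrN ger0_norm; last by apply: mulr_ge0 => //; apply: exprn_ge0; lra.
exact: le_trans (K n h c c0 ah Hc).
Qed.

End Null.

End Uniqueness.

(** * The superexpectation of the theorem *)

Section Matching.
Variables (R : realType) (Lam : finType).
Local Notation crd := (Defs.coord Lam).
Local Notation sf := (superform R Lam).
Local Notation z_ := (@Defs.zform R Lam).
Local Notation zz := (@z0 R Lam).
Local Notation cform_ := (@Defs.cform R Lam).
Local Notation xform_ := (@Defs.xform R Lam).
Implicit Types (F G A B : sf) (f : (crd -> R) -> R) (p q : crd -> R) (i j k : Lam).
Implicit Types (u v g : (Lam -> R) -> R) (s : seq Lam).
Local Notation JJ := (@J R Lam (enum Lam)).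

Lemma soul_body0 t p : body t p = 0 -> soul t p = t p.
Proof. by move=> b0; rewrite soulE b0 scale0r subr0. Qed.

(** The binomial expansion of [(soul F + t) ^+ n] has two terms because [t] squares to zero. The
    second ones form the Taylor series of [derive1 phi], except for a top term that vanishes by
    degree. *)
Lemma fun_form_nilsq (phi : R -> R) F (t : sf) : seven F -> seven t -> t * t = 0 -> (forall p, body t p = 0) ->
  fun_form phi (F + t) = fun_form phi F + fun_form (derive1 phi) F * t.
Proof.
move=> eF et t2 bt.
have bE : body (F + t) = body F by apply/funext => p; rewrite bodyD bt addr0.
have st : soul (F + t) = soul F + t.
  apply: sfP => p; rewrite soulE bE sfD [in RHS]sfD soulE.
  by rewrite addrAC.
have es := seven_soul eF.
have pw n : (soul F + t) ^+ n = soul F ^+ n + (soul F ^+ n.-1 * t) *+ n.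
  have alg (A : pzRingType) (x y : A) : x * y = y * x -> y * y = 0 ->
      forall m, (x + y) ^+ m = x ^+ m + (x ^+ m.-1 * y) *+ m.
    move=> xy yy; elim=> [|m ih]; first by rewrite mulr0n addr0.
    rewrite exprS ih mulrDl !mulrDr -exprS -addrA; congr (_ + _).
    have cy n' : y * x ^+ n' = x ^+ n' * y by apply: commrX; exact: esym.
    have e0 : y * (x ^+ m.-1 * y *+ m) = 0 by rewrite mulrnAr mulrA cy -mulrA yy mulr0 mul0rn.
    rewrite e0 addr0 cy.
    case: m ih {e0} => [|m] ih; first by rewrite mulr0n mulr0 add0r !expr0.
    by rewrite mulrnAr mulrA -exprS [RHS]mulrSr.
  by apply: alg => //; exact: seven_comm.
have nil : soul F ^+ #|crd| * t = 0.
  apply: sfP => p; rewrite sfM sfX.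
  have lt : lowdeg 1 (t p).
    by have := soul_lowdeg t p; rewrite soul_body0.
  have := lowdegM (lowdegX (n := #|crd|) (soul_lowdeg F p)) lt.
  by rewrite addn1 => /lowdeg_eq0; apply.
rewrite !fun_formE.
have E n : ffterm phi (F + t) n = ffterm phi F n + (if n is m.+1 then ffterm (derive1 phi) F m * t else 0).
  rewrite /ffterm st bE pw mulrDr; congr (_ + _); case: n => [|n]; first by rewrite mulr0n mulr0.
  rewrite mulrnAr -mulrnAl -[n.+1.-1]/n -mulrA; congr (_ * _).
  rewrite -scaler_nat scale_form0 form0M; congr form0; apply/funext => p.
  rewrite -derive1Sn derive1nS mulrA factS natrM invfM; congr (_ * _).
  by rewrite mulrA mulfV ?mul1r// pnatr_eq0.
apply: (etrans (eq_bigr _ (fun (n : 'I_#|crd|.+1) _ => E n))); rewrite big_split /=; congr (_ + _).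
rewrite big_ord_recl add0r mulr_suml big_ord_recr /= {3}/ffterm -mulrA nil mulr0 addr0.
by apply: eq_bigr.
Qed.

Lemma body_Jth s u k p : body (J s u * th k) p = 0.
Proof. by rewrite bodyM body_th mulr0. Qed.

Lemma fun_form_J phi s u : smooth1 phi -> Cinf u -> fun_form phi (J s u) = J s (fun l => phi (u l)).
Proof.
elim: s phi u => [|k s ih] phi u sphi cu.
  rewrite /= fun_formE big_ord_recl big1 ?addr0 => [|n _].
    rewrite /ffterm expr0 mulr1 body_form0; congr form0; apply/funext => p.
    by rewrite fact0 invr1 mul1r.
  rewrite /ffterm /= (_ : soul (form0 (at_z u)) = 0) ?exprS ?mul0r ?mulr0//.
  by rewrite /soul body_form0 subrr.
have sphi' : smooth1 (derive1 phi) by move=> n t; rewrite -derive1Sn; exact: sphi.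
have ms := smooth1_maps sphi (Cinf_lip cu).
have ms' := smooth1_maps sphi' (Cinf_lip cu).
rewrite [J (k :: s) u]/= fun_form_nilsq.
- rewrite ih// ih//= (partial_comp1 k cu ms) JM ?mulrA//; last exact: Cinf_partial.
  exact: Cinf_comp1.
- exact: J_even.
- by apply: sevenM; [exact: J_even|exact: th_even].
- exact: th_mul2.
- by move=> p; exact: body_Jth.
Qed.

Lemma fun_form_z phi i : smooth1 phi -> fun_form phi (z_ i) = JJ (fun l => phi (l i)).
Proof. by move=> sphi; rewrite -JJ_coord fun_form_J//; exact: Cinf_coord. Qed.

Section Expansion.
Variables (t : Lam -> sf) (b : (crd -> R) -> Lam -> R).
Hypothesis et : forall i, seven (t i).

(** The scheme of [J] for arbitrary bodies [b] and even increments [t]; it mediates between [J] and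
    the multi-index expansion of [fun_forms]. *)
Fixpoint Jhat s g : sf :=
  if s is k :: s' then Jhat s' g + Jhat s' (partial k g) * t k else form0 (fun p => g (b p)).

Lemma Jhat_expand s g : uniq s -> Cinf g -> Jhat s g =
  \sum_(A : {set Lam} | A \subset s) form0 (fun p => partials [seq k <- s | k \in A] g (b p)) *
    \prod_(k <- s | k \in A) t k.
Proof.
elim: s g => [|k s ih] g.
  move=> _ cg; rewrite (big_pred1 finset.set0) => [|A]; first by rewrite big_nil mulr1.
  apply/fintype.subsetP/eqP => [H|-> x]; last by rewrite inE.
  by apply/finset.setP => x; rewrite !inE; apply/negP => /H; rewrite in_nil.
rewrite cons_uniq => /andP[ks us] cg /=; rewrite !ih//; last exact: Cinf_partial.
have kA (A : {set Lam}) : A \subset s -> k \notin A by move=> /fintype.subsetP As; apply: contra ks => /As.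
rewrite [RHS](bigID (fun A : {set Lam} => k \in A)) /= addrC; congr (_ + _); last first.
  rewrite [RHS](reindex_onto (fun B : {set Lam} => finset.setU (finset.set1 k) B) (fun A : {set Lam} => finset.setD A (finset.set1 k))) /=; last first.
    by move=> A /andP[_ kA']; exact: finset.setD1K.
  rewrite mulr_suml; apply: eq_big => [B|B Bs].
    apply/idP/idP => [Bs|/andP[/andP[/fintype.subsetP H _] /eqP E]].
      apply/andP; split; last by apply/eqP; apply: finset.setU1K; exact: kA.
      apply/andP; split; last by rewrite !inE eqxx.
      by apply/fintype.subsetP => x; rewrite !inE => /orP[->//|/(fintype.subsetP Bs) ->]; rewrite orbT.
    apply/fintype.subsetP => x xB; have := H x; rewrite !inE xB orbT => /(_ isT).
    case/orP => // /eqP xk; move: xB; rewrite -E xk !inE eqxx //.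
  have fE : [seq j <- s | j \in finset.setU (finset.set1 k) B] = [seq j <- s | j \in B].
    by apply: eq_in_filter => j js; rewrite !inE (_ : j == k = false)//; apply: contraNF ks => /eqP <-.
  rewrite !inE eqxx /= fE big_cons !inE eqxx /=.
  rewrite -big_filter [in RHS](_ : \prod_(j <- s | _) t j = \prod_(j <- [seq j <- s | j \in B]) t j); last first.
    by rewrite -fE big_filter.
  rewrite -partials_partial//.
  have ep : seven (t k) by exact: et.
  have alg (A : pzRingType) (x y z : A) : z * y = y * z -> x * y * z = x * (z * y) by move=> e; rewrite e mulrA.
  by apply: alg; exact: seven_comm.
apply: eq_big => [A|A As].
  apply/idP/andP => [As|[/fintype.subsetP H kA']].
    by split; [apply/fintype.subsetP => x /(fintype.subsetP As); rewrite inE orbC => ->|exact: kA].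
  by apply/fintype.subsetP => x xA; have := H x xA; rewrite inE => /orP[/eqP xk|//]; move: kA'; rewrite -xk xA.
by rewrite (negPf (kA A As)) big_cons (negPf (kA A As)).
Qed.

(** As the souls square to zero, a multi-index with an entry above 1 contributes nothing; the
    remaining ones are indicators of sets of sites, and all their factorials are 1. *)
Lemma fun_forms_Jhat g (F : Lam -> sf) : Cinf g -> (forall i p, b p i = body (F i) p) ->
  (forall i, soul (F i) = t i) -> (forall i, t i * t i = 0) -> fun_forms g F = Jhat (enum Lam) g.
Proof.
move=> cg bE tE t2; rewrite Jhat_expand ?enum_uniq//.
have subE (A : {set Lam}) : A \subset enum Lam by apply/fintype.subsetP => x _; rewrite mem_enum.
under [RHS]eq_bigl do rewrite subE.
pose al (A : {set Lam}) : {ffun Lam -> 'I_#|crd|.+1} := [ffun k => if k \in A then inord 1 else ord0].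
have alE (A : {set Lam}) k : al A k = (k \in A) :> nat.
  rewrite ffunE; case: ifP => // _; rewrite inordK// ltnS; exact: card_crd_gt0.
rewrite /fun_forms (bigID (fun a : {ffun Lam -> 'I_#|crd|.+1} => [forall k, (a k <= 1)%N])) /=.
rewrite [X in _ + X]big1 ?addr0 => [|a].
  rewrite (reindex_onto al (fun a => [set k | a k == 1 :> nat]%SET)) /=; last first.
    move=> a /forallP a1; apply/ffunP => k; apply/val_inj; rewrite /= alE inE.
    by have := a1 k; case: (nat_of_ord (a k)) => [|[|]].
  apply: eq_big => [A|A _].
    rewrite (_ : [forall k, _]) /=; last by apply/forallP => k; rewrite alE; case: (_ \in _).
    by apply/eqP/finset.setP => k; rewrite inE alE; case: (_ \in _).
  have pE : (\prod_k (al A k)`!)%N = 1%N by rewrite big1// => k _; rewrite alE; case: (_ \in _).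
  have mE : mderive (fun k => al A k) g = partials [seq k <- enum Lam | k \in A] g.
    rewrite /mderive; congr partials; elim: (enum Lam) => [//|k s ih] /=.
    by rewrite ih alE; case: (_ \in _).
  congr (_ * _).
    by congr form0; apply/funext => p; rewrite pE invr1 mul1r mE; congr partials; apply/funext => k; rewrite bE.
  rewrite [index_enum _]unlock -enumT [RHS]big_mkcond /=; apply: eq_bigr => k _.
  by rewrite alE tE; case: (_ \in _).
rewrite negb_forall => /existsP[k]; rewrite -ltnNge => ak.
rewrite (_ : \prod_k soul (F k) ^+ a k = 0) ?mulr0// [index_enum _]unlock -enumT.
have : k \in enum Lam by rewrite mem_enum.
elim: (enum Lam) => [//|j s ih]; rewrite inE big_cons => /orP[/eqP <-|/ih ->]; last by rewrite mulr0.
move: ak; case: (nat_of_ord (a k)) => [|[|m]]// _.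
by rewrite tE !exprS mulrA t2 !mul0r.
Qed.

End Expansion.

(** The nilpotent part of [Z(z_k)] is [Z'(z_k) th k], which is exactly the increment that [Jhat]
    receives at site [k]. *)
Lemma J_comp_sep s (Z : R -> R) g : uniq s -> smooth1 Z -> Cinf g ->
  J s (fun l => g (fun j => Z (l j))) =
  Jhat (fun i => form0 (fun p => derive1 Z (zz i p)) * th i) (fun p j => Z (zz j p)) s g.
Proof.
move=> + sZ; elim: s g => [//|k s ih] g /= /andP[ks us] cg.
have sZ' : smooth1 (derive1 Z) by move=> n t; rewrite -derive1Sn; exact: sZ.
have cc (i : Lam) := @Cinf_coord R Lam i.
have cZ i : Cinf (fun l : Lam -> R => Z (l i)) by apply: (Cinf_comp1 (cc i)); exact: smooth1_maps (Cinf_lip (cc i)).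
have cZ' i : Cinf (fun l : Lam -> R => derive1 Z (l i)).
  by apply: (Cinf_comp1 (cc i)); exact: smooth1_maps (Cinf_lip (cc i)).
have sep (i j : Lam) (x : Lam -> R) t : j != i -> Z (upd x i t j) = Z (x j) by move=> ji; rewrite updE (negPf ji).
have cgp := Cinf_partial k cg.
rewrite ih//; congr (_ + _).
have pE : partial k (fun l : Lam -> R => g (fun j => Z (l j))) =
    fun l => partial k g (fun j => Z (l j)) * partial k (fun l : Lam -> R => Z (l k)) l.
  by apply: (partial_sep (Z := fun j (l : Lam -> R) => Z (l j)) (o := id)) => //.
rewrite pE (partial_comp1 k (cc k) (smooth1_maps sZ (Cinf_lip (cc k)))) partial_coord eqxx.
rewrite (_ : (fun x => _) = fun l : Lam -> R => partial k g (fun j => Z (l j)) * derive1 Z (l k)); last first.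
  by apply/funext => l; rewrite mulr1.
rewrite JM//; last by apply: (Cinf_sep (o := id)) => //.
rewrite ih// (J_comp1 k us sZ') (negPf ks) addr0 -mulrA //.
Qed.

Lemma smooth1_subr (V : R -> R) (c : R) : smooth1 V ->
  smooth1 (fun t => V t - c) /\ derive1 (fun t => V t - c) = derive1 V.
Proof.
move=> sV.
have dZ (t : R) : is_derive t 1 (fun t => V t - c) (derive1 V t).
  have dV : is_derive t 1 V (derive1 V t) by rewrite derive1E; apply: DeriveDef; [exact: (sV 0%N)|].
  by have := is_deriveB dV (is_derive_cst c t 1); rewrite subr0.
have Z1 : derive1 (fun t => V t - c) = derive1 V by apply/funext => t; rewrite derive1E; have [_ ->] := dZ t.
split; [move=> [|n] t|exact: Z1]; first by have [] := dZ t.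
by rewrite derive1Sn Z1 -derive1Sn; exact: sV.
Qed.

Lemma fun_form_zE V i : smooth1 V -> fun_form V (z_ i) =
  form0 (fun p => V (zz i p)) + form0 (fun p => derive1 V (zz i p)) * th i.
Proof. by move=> sV; rewrite fun_form_z// J_comp1 ?enum_uniq// mem_enum. Qed.

Lemma fun_forms_JJ (V : R -> R) (c : R) g : smooth1 V -> Cinf g ->
  fun_forms g (fun j => fun_form V (z_ j) - cform_ c) = JJ (fun l => g (fun j => V (l j) - c)).
Proof.
move=> sV cg; have [sZ Z1] := smooth1_subr c sV.
rewrite (J_comp_sep (enum_uniq _) sZ cg) Z1.
pose t i : sf := form0 (fun p => derive1 V (zz i p)) * th i.
have bt i p : body (t i) p = 0 by rewrite bodyM body_th mulr0.
have bE i : body (fun_form V (z_ i) - cform_ c) = fun p => V (zz i p) - c.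
  apply/funext => p; rewrite fun_form_zE// bodyD bodyN bodyD bt body_form0 addr0.
  by rewrite /cform body_form0.
apply: (fun_forms_Jhat (t := t)) => //.
- by move=> i; apply: sevenM; [exact: seven_form0|exact: th_even].
- by move=> i p; rewrite bE.
- move=> i; apply: sfP => p; rewrite soulE bE sfD sfN fun_form_zE// sfD /cform /form0 -/(t i).
  have alg (W : lmodType R) (x y : R) (e t' : W) : x *: e + t' - y *: e - (x - y) *: e = t'.
    by rewrite addrAC -addrA -opprD -scalerDl subrK addrC addKr.
  exact: alg.
- by move=> i; exact: th_mul2.
Qed.

Lemma sum_Vz (V : R -> R) (c d : R) : smooth1 V ->
  \sum_j (fun_form V (z_ j) - cform_ c - cform_ d) = JJ (fun l => \sum_j (V (l j) - c - d)).
Proof.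
move=> sV; have cV (i : Lam) : Cinf (fun l : Lam -> R => V (l i)).
  have cc := @Cinf_coord R Lam i.
  by apply: (Cinf_comp1 cc); exact: smooth1_maps (Cinf_lip cc).
have c1 (i : Lam) : Cinf (fun l : Lam -> R => V (l i) - c) by apply: CinfD => //; exact: Cinf_cst.
have c2 (i : Lam) : Cinf (fun l : Lam -> R => V (l i) - c - d) by apply: CinfD => //; exact: Cinf_cst.
elim: (index_enum Lam) => [|j r ih].
  by rewrite big_nil; under eq_fun do rewrite big_nil; rewrite J0.
rewrite big_cons ih; under [in RHS]eq_fun do rewrite big_cons.
rewrite JD//; last exact: Cinf_sum.
congr (_ + _); rewrite JD//; last exact: Cinf_cst.
rewrite JD//; last exact: Cinf_cst.
by rewrite !J_cst -fun_form_z// /cform !form0N.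
Qed.

Variables (beta : Lam -> Lam -> R) (a : Lam).

(** The test family of the theorem, as functions of local times. With [c = T / N] the argument of
    [del] is the clock minus [T], and [derive1 V (l b)] is the speed of the clock while the walk
    sits at [b]. *)
Definition hfun (V del : R -> R) g (c : R) (b : Lam) : (Lam -> R) -> R :=
  fun l => derive1 V (l b) * g (fun j => V (l j) - c) * del (\sum_j (V (l j) - V 1 - c)).

Lemma Cinf_hfun V del g c b : smooth1 V -> smooth1 del -> Cinf g -> Cinf (hfun V del g c b).
Proof.
move=> sV sd cg; have cc (i : Lam) := @Cinf_coord R Lam i.
have sV' : smooth1 (derive1 V) by move=> n t; rewrite -derive1Sn; exact: sV.
have cV i : Cinf (fun l : Lam -> R => V (l i)) by apply: (Cinf_comp1 (cc i)); exact: smooth1_maps (Cinf_lip (cc i)).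
have cVc (i : Lam) (d : R) : Cinf (fun l : Lam -> R => V (l i) - d) by apply: CinfD => //; exact: Cinf_cst.
have cs : Cinf (fun l : Lam -> R => \sum_j (V (l j) - V 1 - c)).
  by apply: Cinf_sum => j _; apply: CinfD => //; exact: Cinf_cst.
apply: CinfM; last by apply: (Cinf_comp1 cs); exact: smooth1_maps (Cinf_lip cs).
apply: CinfM; first by apply: (Cinf_comp1 (cc b)); exact: smooth1_maps (Cinf_lip (cc b)).
apply: (Cinf_sep (Z := fun j (l : Lam -> R) => V (l j) - c) (o := id)) => // i j x t ji.
by rewrite updE (negPf ji).
Qed.

Lemma superexp_mu2 V del g (c : R) : smooth1 V -> smooth1 del -> Cinf g ->
  \sum_i superexp beta (xform_ a * xform_ i * fun_form (derive1 V) (z_ i)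
         * fun_forms g (fun j => fun_form V (z_ j) - cform_ c)
         * fun_form del (\sum_j (fun_form V (z_ j) - cform_ (V 1) - cform_ c))) =
  mu2 beta a (hfun V del g c).
Proof.
move=> sV sd cg; apply: eq_bigr => i _; congr superexp.
have cc (i : Lam) := @Cinf_coord R Lam i.
have sV' : smooth1 (derive1 V) by move=> n t; rewrite -derive1Sn; exact: sV.
have cV j : Cinf (fun l : Lam -> R => V (l j)) by apply: (Cinf_comp1 (cc j)); exact: smooth1_maps (Cinf_lip (cc j)).
have cVc (j : Lam) (d : R) : Cinf (fun l : Lam -> R => V (l j) - d) by apply: CinfD => //; exact: Cinf_cst.
have cs : Cinf (fun l : Lam -> R => \sum_j (V (l j) - V 1 - c)).
  by apply: Cinf_sum => j _; apply: CinfD => //; exact: Cinf_cst.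
have c1 : Cinf (fun l : Lam -> R => derive1 V (l i)).
  by apply: (Cinf_comp1 (cc i)); exact: smooth1_maps (Cinf_lip (cc i)).
have c2 : Cinf (fun l : Lam -> R => g (fun j => V (l j) - c)).
  apply: (Cinf_sep (Z := fun j (l : Lam -> R) => V (l j) - c) (o := id)) => // k j x t jk.
  by rewrite updE (negPf jk).
have c3 : Cinf (fun l : Lam -> R => del (\sum_j (V (l j) - V 1 - c))).
  by apply: (Cinf_comp1 cs); exact: smooth1_maps (Cinf_lip cs).
have c12 : Cinf (fun l : Lam -> R => derive1 V (l i) * g (fun j => V (l j) - c)) by exact: CinfM.
rewrite fun_form_z// fun_forms_JJ// sum_Vz// fun_form_J// /hfun JM// JM//.
have alg (A : pzRingType) (x y p q r : A) : x * y * p * q * r = x * y * (p * q * r) by rewrite !mulrA.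
exact: alg.
Qed.

End Matching.

(** * The vertex-reinforced jump process *)

Section Expectation.
Variables (R : realType) (d : measure_display) (Om : measurableType d) (P : probability Om R).
Implicit Types (Y Z : Om -> R) (A : set Om) (B c : R).
Local Notation E Y := (\int[P]_w Y w).

Definition mbd Y : Prop := measurable_fun setT Y /\ exists B, forall w, `|Y w| <= B.

Lemma mbd_int Y : mbd Y -> P.-integrable setT (EFin \o Y).
Proof.
move=> [mY [B YB]]; apply: (mbd_integrable (B := B)) => //.
by apply: (@le_lt_trans _ _ 1%E); [exact: probability_le1|exact: ltry].
Qed.

Lemma mbd_cst c : mbd (fun=> c).
Proof. by split; [exact: measurable_cst|exists `|c|]. Qed.

Lemma mbdD Y Z : mbd Y -> mbd Z -> mbd (fun w => Y w + Z w).
Proof.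
move=> [mY [B YB]] [mZ [C ZC]]; split; first exact: measurable_funD.
by exists (B + C) => w; apply: (le_trans (ler_normD _ _)); exact: lerD.
Qed.

Lemma mbdM Y Z : mbd Y -> mbd Z -> mbd (fun w => Y w * Z w).
Proof.
move=> [mY [B YB]] [mZ [C ZC]]; split; first exact: measurable_funM.
by exists (B * C) => w; rewrite normrM ler_pM.
Qed.

Lemma mbdZ c Y : mbd Y -> mbd (fun w => c * Y w).
Proof. by move=> mY; apply: mbdM => //; exact: mbd_cst. Qed.

Lemma mbdB Y Z : mbd Y -> mbd Z -> mbd (fun w => Y w - Z w).
Proof.
move=> mY mZ; rewrite (_ : (fun w => _) = fun w => Y w + -1 * Z w).
  by apply: mbdD => //; exact: mbdZ.
by apply/funext => w; rewrite mulN1r.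
Qed.

Lemma mbd_sum (I : Type) (s : seq I) (F : I -> Om -> R) :
  (forall i, mbd (F i)) -> mbd (fun w => \sum_(i <- s) F i w).
Proof.
move=> mF; elim: s => [|i s ih].
  by under eq_fun do rewrite big_nil; exact: mbd_cst.
by under eq_fun do rewrite big_cons; exact: mbdD.
Qed.

Lemma mbd_sum_cond (I : finType) (p : pred I) (F : I -> Om -> R) :
  (forall i, mbd (F i)) -> mbd (fun w => \sum_(i | p i) F i w).
Proof.
move=> mF; rewrite (_ : (fun w => _) = fun w => \sum_i (if p i then F i w else 0)).
  by apply: mbd_sum => i; case: (p i) => //; exact: mbd_cst.
by apply/funext => w; exact: big_mkcond.
Qed.

Lemma mbd_indic A : measurable A -> mbd (\1_A).
Proof.
move=> mA; split; first exact: measurable_indic.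
by exists 1 => w; rewrite ger0_norm// indicE; case: (_ \in _).
Qed.

Lemma mbd_bool (p : Om -> bool) : measurable [set w | p w] -> mbd (fun w => (p w)%:R).
Proof.
move=> mp; have := mbd_indic mp; congr mbd; apply/funext => w; rewrite indicE.
by congr (_ %:R); congr nat_of_bool; apply/idP/idP; rewrite inE.
Qed.

Lemma EE Y : mbd Y -> (\int[P]_w (Y w)%:E)%E = (E Y)%:E.
Proof. by move=> mY; rewrite /Rintegral fineK//; apply: integrable_fin_num => //; exact: mbd_int. Qed.

Lemma E_cst c : E (fun=> c) = c.
Proof.
by rewrite Rintegral_cst//= probability_setT mulr1.
Qed.

Lemma ED Y Z : mbd Y -> mbd Z -> E (fun w => Y w + Z w) = E Y + E Z.
Proof. by move=> mY mZ; rewrite RintegralD//; exact: mbd_int. Qed.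

Lemma EZ c Y : mbd Y -> E (fun w => c * Y w) = c * E Y.
Proof. by move=> mY; rewrite RintegralZl//; exact: mbd_int. Qed.

Lemma EB Y Z : mbd Y -> mbd Z -> E (fun w => Y w - Z w) = E Y - E Z.
Proof. by move=> mY mZ; rewrite RintegralB//; exact: mbd_int. Qed.

Lemma E_sum (I : Type) (s : seq I) (F : I -> Om -> R) :
  (forall i, mbd (F i)) -> E (fun w => \sum_(i <- s) F i w) = \sum_(i <- s) E (F i).
Proof.
move=> mF; elim: s => [|i s ih].
  rewrite big_nil; under eq_Rintegral do rewrite big_nil; exact: E_cst.
rewrite big_cons -ih -ED//; last exact: mbd_sum.
by apply: eq_Rintegral => w _; rewrite big_cons.
Qed.

Lemma E_sum_cond (I : finType) (p : pred I) (F : I -> Om -> R) :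
  (forall i, mbd (F i)) -> E (fun w => \sum_(i | p i) F i w) = \sum_(i | p i) E (F i).
Proof.
move=> mF; transitivity (E (fun w => \sum_i (if p i then F i w else 0))).
  by apply: eq_Rintegral => w _; exact: big_mkcond.
rewrite E_sum; last by move=> i; case: (p i) => //; exact: mbd_cst.
by rewrite [RHS]big_mkcond; apply: eq_bigr => i _; case: (p i) => //; exact: E_cst.
Qed.

Lemma E_le Y Z : mbd Y -> mbd Z -> (forall w, Y w <= Z w) -> E Y <= E Z.
Proof. by move=> mY mZ YZ; apply: le_Rintegral => //; exact: mbd_int. Qed.

Lemma E_norm_le Y Z : mbd Y -> mbd Z -> (forall w, `|Y w| <= Z w) -> `|E Y| <= E Z.
Proof.
move=> mY mZ YZ; rewrite ler_norml -mulN1r -EZ//; apply/andP; split.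
  by apply: E_le => //; [exact: mbdZ|move=> w; have := YZ w; rewrite ler_norml mulN1r => /andP[]].
by apply: E_le => // w; have := YZ w; rewrite ler_norml => /andP[].
Qed.

Lemma E_bnd Y c : mbd Y -> (forall w, `|Y w| <= c) -> `|E Y| <= c.
Proof. by move=> mY Yc; rewrite -[leRHS]E_cst; apply: E_norm_le => //; exact: mbd_cst. Qed.

Lemma E_indic A : measurable A -> E (\1_A) = fine (P A).
Proof. by move=> mA; rewrite /Rintegral integral_indic// setIT. Qed.

Lemma mbd_lim (Yn : nat -> Om -> R) Y B : (forall n, mbd (Yn n)) -> (forall n w, `|Yn n w| <= B) ->
  (forall w, Yn n w @[n --> \oo] --> Y w) -> mbd Y.
Proof.
move=> mY YB cY; split; first by apply: (@measurable_fun_cvg _ _ _ _ Yn) => //= n; have [] := mY n.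
exists B => w; have /cvg_norm c := cY w; rewrite -(cvg_lim _ c)//.
by apply: limr_le; [apply/cvg_ex; eexists; exact: c|apply: nearW].
Qed.

Lemma E_cvg (Yn : nat -> Om -> R) Y B : (forall n, mbd (Yn n)) -> (forall n w, `|Yn n w| <= B) ->
  (forall w, Yn n w @[n --> \oo] --> Y w) -> E (Yn n) @[n --> \oo] --> E Y.
Proof.
move=> mY YB cY; have mY' := mbd_lim mY YB cY.
have := @dominated_cvg _ Om R P setT measurableT (fun n w => (Yn n w)%:E) (fun w => (Y w)%:E) (cst B%:E).
have H1 n : measurable_fun setT (fun w => (Yn n w)%:E) by apply/measurable_EFinP; have [] := mY n.
have H2 : P.-integrable setT (cst B%:E) by exact: (mbd_int (mbd_cst B)).
move=> /(_ H1 _ _ H2 _) H.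
have H' : ((\int[P]_x (Yn n x)%:E) @[n --> \oo] --> \int[P]_x (Y x)%:E)%E.
  by apply: H => // [w _|w n _]; [apply/cvg_EFin; [exact: nearW|exact: cY]|rewrite lee_fin].
rewrite EE// in H'; move/fine_cvg : H'; apply: cvg_trans; apply: near_eq_cvg; apply: nearW => n /=.
by rewrite EE.
Qed.

End Expectation.

Section IntervalIntegrals.
Variable R : realType.

Lemma cvg_sumr (I : Type) (s : seq I) (u : I -> nat -> R) (l : I -> R) :
  (forall i, u i n @[n --> \oo] --> l i) ->
  \sum_(i <- s) u i n @[n --> \oo] --> \sum_(i <- s) l i.
Proof.
move=> ul; elim: s => [|i s ih].
  by rewrite big_nil; under eq_fun do rewrite big_nil; exact: cvg_cst.
by rewrite big_cons; under eq_fun do rewrite big_cons; exact: cvgD.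
Qed.

Local Notation mu := (@lebesgue_measure R).
Local Notation rint f a b := (\int[mu]_(x in `[a, b]) f x).
Implicit Types (f F : R -> R) (a b c : R).

Lemma rint_cst c a b : a <= b -> rint (fun=> c) a b = c * (b - a).
Proof.
move=> ab; apply/eqP; rewrite -subr_eq0 -normr_le0 [c * _]mulrC.
apply: (le_trans (@rint_dist R a b (fun=> c) c 0 ab (rcb_cst _ _ _) _)); last by rewrite mul0r.
by move=> t _; rewrite subrr normr0.
Qed.

Lemma rint_mono f F a b : rcb a b f -> rcb a b F -> (forall t, a <= t <= b -> f t <= F t) ->
  rint f a b <= rint F a b.
Proof.
move=> cf cF H; by apply: le_Rintegral => //; exact: rcb_integrable.
Qed.

Lemma rcb_sum (I : Type) (r : seq I) (G : I -> R -> R) a b :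
  (forall i, rcb a b (G i)) -> rcb a b (fun t => \sum_(i <- r) G i t).
Proof.
move=> cG; elim: r => [|i r ih]; first by under eq_fun do rewrite big_nil; exact: rcb_cst.
by under eq_fun do rewrite big_cons; exact: rcbD.
Qed.

Lemma rint_sum (I : Type) (r : seq I) (G : I -> R -> R) a b : (forall i, rcb a b (G i)) ->
  rint (fun t => \sum_(i <- r) G i t) a b = \sum_(i <- r) rint (G i) a b.
Proof.
move=> cG; elim: r => [|i r ih].
  by rewrite big_nil -[RHS](rint0 a b); apply: eq_rint => t _; rewrite big_nil.
rewrite big_cons -ih -rintD//; last exact: rcb_sum.
by apply: eq_rint => t _; rewrite big_cons.
Qed.

End IntervalIntegrals.

(** * Occupation times of right-continuous paths *)

Section Paths.
Variables (R : realType) (Lam : finType) (T : Type) (X : R -> T -> Lam).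
Hypothesis Xright : forall w t, 0 <= t -> \forall r \near t^'+, X r w = X t w.
Local Notation mu := (@lebesgue_measure R).
Local Notation rint f a b := (\int[mu]_(x in `[a, b]) f x).
Implicit Types (i j k b : Lam) (w : T) (r s t : R).

Lemma path_right w t : 0 <= t -> exists2 e : R, 0 < e & forall h, 0 <= h < e -> X (t + h) w = X t w.
Proof.
move=> /(Xright w); rewrite /at_right near_withinE => /nbhs_ballP[e e0 H]; exists e => // h /andP[].
rewrite le_eqVlt => /predU1P[<- _|h0 he]; first by rewrite addr0.
by apply: H => /=; [rewrite /ball /= opprD addNKr normrN gtr0_norm|rewrite ltrDl].
Qed.

(** Convertible to [local_time (fun=> 1)], but over a bare type of paths, so that the sigma-algebra
    can be chosen later. *)
Definition occ j t w : R := 1 + rint (fun r => (X r w == j)%:R) 0 t.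

Lemma rcont_path (G : Lam -> R) w t : 0 <= t -> rcont (fun r => G (X r w)) t.
Proof.
move=> t0; have [e e0 H] := path_right w t0.
by apply: (rcont_near_cst e0) => h he; rewrite H.
Qed.

Lemma rcb_path (G : Lam -> R) w s t : 0 <= s -> rcb s t (fun r => G (X r w)).
Proof.
move=> s0; split; last by move=> r /andP[sr _]; apply: rcont_path; exact: le_trans sr.
exists (\sum_i `|G i|) => r _; rewrite (bigD1 (X r w))//= lerDl; exact: sumr_ge0.
Qed.

Lemma occ0 j w : occ j 0 w = 1.
Proof. by rewrite /occ rint_pt addr0. Qed.

Lemma occ_split j w s t : 0 <= s <= t -> occ j t w = occ j s w + rint (fun r => (X r w == j)%:R) s t.
Proof.
move=> /andP[s0 st]; rewrite /occ -addrA -rint_split ?s0//.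
exact: (rcb_path (fun i => (i == j)%:R)).
Qed.

Lemma occ_inc j w s t : 0 <= s <= t -> 0 <= occ j t w - occ j s w <= t - s.
Proof.
move=> st; rewrite (occ_split j w st) addrAC subrr add0r.
have /andP[s0 st'] := st; have cf := rcb_path (fun i => (i == j)%:R) w t s0.
rewrite -[X in X <= _ <= _](rint0 s t) -[X in _ <= _ <= X]mul1r -(rint_cst 1 st').
by apply/andP; split; apply: rint_mono => //; try exact: rcb_cst; move=> r _; case: (_ == j).
Qed.

Lemma occ_bnd j w t : 0 <= t -> 1 <= occ j t w <= 1 + t.
Proof.
move=> t0; have /= := @occ_inc j w 0 t; rewrite lexx t0 occ0 => /(_ isT); lra.
Qed.

Lemma path_box (S t : R) w : 0 <= t <= S -> box (1 + S) (fun j => occ j t w).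
Proof.
move=> /andP[t0 tS] j; have /andP[p1 p2] := occ_bnd j w t0.
rewrite ger0_norm; last exact: le_trans p1.
by rewrite (le_trans p2)// lerD2l.
Qed.

Lemma occ_sum w t : 0 <= t -> \sum_j occ j t w = #|Lam|%:R + t.
Proof.
move=> t0; rewrite big_split/= sumr_const; congr (_ + _).
rewrite -rint_sum//; last by move=> j; exact: (rcb_path (fun i => (i == j)%:R)).
transitivity (rint (fun=> 1 : R) 0 t); last by rewrite rint_cst// subr0 mul1r.
apply: eq_rint => r _; rewrite (bigD1 (X r w))//= eqxx big1 ?addr0// => j /negPf.
by rewrite eq_sym => ->.
Qed.

(** Pigeonhole: the local times at time [t] add up to [#|Lam| + t]. *)
Lemma occ_exceeds w t (M : R) : 0 <= t -> #|Lam|%:R * M < #|Lam|%:R + t -> exists k, M < occ k t w.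
Proof.
move=> t0 Mt; apply: contrapT => no; move: Mt; rewrite -(occ_sum w t0) ltNge => /negP; apply.
rewrite mulr_natl -sumr_const; apply: ler_sum => j _; rewrite leNgt.
by apply/negP => Hj; apply: no; exists j.
Qed.

Lemma occ_step w t : 0 <= t -> exists2 e : R, 0 < e &
  forall h, 0 <= h < e -> forall j, occ j (t + h) w = occ j t w + h * (j == X t w)%:R.
Proof.
move=> t0; have [e e0 H] := path_right w t0; exists e => // h /andP[h0 he] j.
rewrite (@occ_split j w t (t + h)) ?t0 ?lerDl//; congr (_ + _).
transitivity (rint (fun=> (X t w == j)%:R : R) t (t + h)).
  apply: eq_rint => r /andP[tr rt]; rewrite -(H (r - t)) 1?addrC ?subrK//; lra.
by rewrite rint_cst ?lerDl// [t + h]addrC addrK mulrC eq_sym.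
Qed.

End Paths.

Section PathMeasurability.
Variables (R : realType) (Lam : finType) (d : measure_display) (T : measurableType d).
Variables (X : R -> T -> Lam) (t : R).
Hypothesis t0 : 0 <= t.
Hypothesis Xright : forall w t, 0 <= t -> \forall r \near t^'+, X r w = X t w.
Hypothesis mX : forall r i, 0 <= r <= t -> measurable [set w | X r w = i].
Local Notation mu := (@lebesgue_measure R).
Local Notation rint f a b := (\int[mu]_(x in `[a, b]) f x).

Lemma measurable_path_bool r i : 0 <= r <= t -> measurable_fun setT (fun w => (X r w == i)%:R : R).
Proof.
move=> rt; have [] // := @mbd_bool R _ T (fun w => X r w == i).
rewrite (_ : [set _ | _] = [set w | X r w = i]); first exact: mX.
by apply/seteqP; split => w /= /eqP.
Qed.

Lemma measurable_path_seq (s : seq R) (G : seq Lam -> R) : {in s, forall r, 0 <= r <= t} ->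
  measurable_fun setT (fun w => G (map (fun r => X r w) s)).
Proof.
elim: s G => [|r s ih] G sP; first by rewrite (_ : (fun _ => _) = cst (G [::])); [exact: measurable_cst|].
have -> : (fun w => G (map (fun r => X r w) (r :: s))) =
    fun w => \sum_i (X r w == i)%:R * G (i :: map (fun r => X r w) s).
  apply/funext => w; rewrite (bigD1 (X r w))//= eqxx mul1r big1 ?addr0// => i /negPf.
  by rewrite eq_sym => ->; rewrite mul0r.
apply: measurable_sum => i; apply: measurable_funM.
  by apply: measurable_path_bool; apply: sP; rewrite mem_head.
by apply: (ih (fun l => G (i :: l))) => q qs; apply: sP; rewrite inE qs orbT.
Qed.

Lemma rint_path_cvg j w : t / n.+1%:R * (\sum_(k < n.+1) (X (k.+1%:R * (t / n.+1%:R)) w == j)%:R) @[n --> \oo]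
  --> rint (fun r => (X r w == j)%:R) 0 t.
Proof.
have := rint_rstep_cvg t0 (rcb_path Xright (fun i => (i == j)%:R) w t (lexx 0)).
by rewrite subr0; under eq_fun do under eq_bigr do rewrite add0r.
Qed.

Lemma grid_bnd n k : (k < n.+1)%N -> 0 <= k.+1%:R * (t / n.+1%:R) <= t.
Proof.
move=> kn; rewrite mulr_ge0 ?divr_ge0//= mulrCA ler_piMr// ler_pdivrMr ?ltr0n// mul1r ler_nat.
exact: kn.
Qed.

(** Riemann sums of the occupation integrals involve finitely many positions up to time [t]. Only
    these positions are assumed measurable, so the sigma-algebra may be the ambient one or the
    natural filtration at [t]. *)
Lemma measurable_occ_fun (f : (Lam -> R) -> R) : loclip f ->
  measurable_fun setT (fun w => f (fun j => occ X j t w)).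
Proof.
move=> lf.
pose Ln n w j : R := 1 + t / n.+1%:R * (\sum_(k < n.+1) (X (k.+1%:R * (t / n.+1%:R)) w == j)%:R).
have Lnb n w : box (1 + t) (Ln n w).
  move=> j; rewrite /Ln ger0_norm; last by rewrite addr_ge0// mulr_ge0// ?divr_ge0// sumr_ge0.
  rewrite lerD2l mulrAC ler_pdivrMr ?ltr0n// ler_wpM2l//.
  apply: (@le_trans _ _ (\sum_(k < n.+1) 1)); last by rewrite sumr_const card_ord.
  by apply: ler_sum => k _; case: eqP.
have Lb w : box (1 + t) (fun j => occ X j t w).
  move=> j; have /andP[p1 p2] := occ_bnd Xright j w t0.
  by rewrite ger0_norm//; exact: le_trans p1.
apply: (@measurable_fun_cvg _ _ _ _ (fun n w => f (Ln n w))) => [n|w _].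
  have := @measurable_path_seq [seq k.+1%:R * (t / n.+1%:R) | k <- iota 0 n.+1]
    (fun l => f (fun j => 1 + t / n.+1%:R * (\sum_(i <- l) (i == j)%:R))).
  have H : {in [seq k.+1%:R * (t / n.+1%:R) | k <- iota 0 n.+1], forall r : R, 0 <= r <= t}.
    by move=> r /mapP[k]; rewrite mem_iota => kn ->; exact: grid_bnd.
  move=> /(_ H); congr measurable_fun; apply/funext => w; congr f; apply/funext => j.
  by rewrite /Ln -map_comp big_map -[iota _ _]/(index_iota 0 n.+1) big_mkord.
have [C C0 HC] := lf (1 + t).
apply/cvgrPdist_le => e e0.
have cj j : Ln n w j @[n --> \oo] --> occ X j t w by apply: cvgD; [exact: cvg_cst|exact: rint_path_cvg].
have cd : dist1 (fun j => occ X j t w) (Ln n w) @[n --> \oo] --> (0 : R).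
  rewrite -[X in _ --> X](@big1 R 0 +%R Lam (index_enum Lam) xpredT (fun=> 0))//.
  by apply: cvg_sumr => j; have /cvgrPdist_le H := cj j; apply/cvgr0Pnorm_le => e' /H; apply: filterS => n; rewrite normr_id.
have d0 : 0 < e / (C + 1) by rewrite divr_gt0//; lra.
move/cvgr0Pnorm_le : cd => /(_ _ d0); apply: filterS => n.
rewrite ger0_norm ?dist1_ge0// ler_pdivlMr; last by lra.
move=> H; apply: (le_trans (HC _ _ (Lb w) (Lnb n w))); apply: le_trans H.
by rewrite mulrC ler_wpM2l ?dist1_ge0// lerDl.
Qed.

Lemma measurable_path_occ (h : Lam -> (Lam -> R) -> R) : (forall b, loclip (h b)) ->
  measurable_fun setT (fun w => h (X t w) (fun j => occ X j t w)).
Proof.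
move=> lh; have -> : (fun w => h (X t w) (fun j => occ X j t w)) =
    fun w => \sum_b (X t w == b)%:R * h b (fun j => occ X j t w).
  apply/funext => w; rewrite (bigD1 (X t w))//= eqxx mul1r big1 ?addr0// => i /negPf.
  by rewrite eq_sym => ->; rewrite mul0r.
apply: measurable_sum => i; apply: measurable_funM; last exact: measurable_occ_fun.
by apply: measurable_path_bool; rewrite t0 lexx.
Qed.

End PathMeasurability.

(** * Slicing a bounded function into level sets *)

Lemma staircase (R : realType) (y eta : R) m : 0 < eta -> 0 <= y <= m%:R * eta ->
  `|y - eta * \sum_(k < m) (k.+1%:R * eta <= y)%R%:R| <= eta.
Proof.
move=> e0; elim: m => [|m ih] /andP[y0 ym].
  rewrite big_ord0 mulr0 subr0 ger0_norm//; move: ym; rewrite mul0r; lra.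
have full n : n%:R * eta <= y -> \sum_(k < n) (k.+1%:R * eta <= y)%R%:R = n%:R :> R.
  move=> ny; transitivity (\sum_(k < n) (1 : R)); last by rewrite sumr_const card_ord.
  apply: eq_bigr => k _.
  suff -> : k.+1%:R * eta <= y by [].
  by apply: le_trans ny; rewrite ler_wpM2r ?(ltW e0)// ler_nat ltn_ord.
have [y1|y1] := leP (m.+1%:R * eta) y.
  have yE : y = m.+1%:R * eta by apply/le_anti; rewrite ym y1.
  by rewrite full// {1}yE mulrC subrr normr0 ltW.
rewrite big_ord_recr/= [m.+1%:R * eta <= y]leNgt y1/= addr0.
have [ym'|ym'] := leP y (m%:R * eta); first by apply: ih; rewrite y0.
rewrite full ?ltW// ger0_norm; last by rewrite subr_ge0 mulrC ltW.
move: y1; rewrite -natr1 mulrDl mul1r [eta * _]mulrC; lra.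
Qed.

Section LayerCake.
Variables (R : realType) (d : measure_display) (Om : measurableType d) (P : probability Om R).
Local Notation E Y := (\int[P]_w Y w).

(** [Y] is replaced by a staircase with [m] steps of height [eta]. Each level costs the error [e]
    known for events, and the replacement costs [eta] times the masses of [p] and [h * q], both of
    order [h]. *)
Lemma layer_cake_bound (Y p q : Om -> R) (h K e B eta : R) m :
  mbd Y -> mbd p -> mbd q -> (forall w, 0 <= p w) -> (forall w, 0 <= q w) -> 0 <= h -> 0 < eta ->
  (forall w, `|Y w| <= B) -> 2 * B <= m%:R * eta ->
  (forall c, `|E (fun w => (c <= Y w)%R%:R * p w) - h * E (fun w => (c <= Y w)%R%:R * q w)| <= e) ->
  E p <= h * K -> E q <= K ->
  `|E (fun w => Y w * p w) - h * E (fun w => Y w * q w)| <= (B + eta * m%:R) * e + 2 * eta * h * K.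
Proof.
move=> mY mp mq p0 q0 h0 e0 YB Bm He pK qK.
have mu_ : mbd (fun w => p w - h * q w) by apply: mbdB => //; exact: mbdZ.
have DE Z : mbd Z -> E (fun w => Z w * p w) - h * E (fun w => Z w * q w) = E (fun w => Z w * (p w - h * q w)).
  move=> mZ; rewrite -EZ -?EB; first by apply: eq_Rintegral => w _; rewrite mulrBr mulrCA.
  - exact: mbdM.
  - by apply: mbdZ; exact: mbdM.
  - exact: mbdM.
have mc c : mbd (fun w => (c <= Y w)%R%:R : R).
  apply: mbd_bool; rewrite (_ : [set _ | _] = [set: Om] `&` [set w | c <= Y w]); last by rewrite setTI.
  by apply: measurable_fun_le => //; case: mY.
have He' c : `|E (fun w => (c <= Y w)%R%:R * (p w - h * q w))| <= e by rewrite -DE.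
have e0' : 0 <= e by apply: le_trans (He 0).
(* An empty space cannot carry total mass one; a point is needed for [0 <= B]. *)
case: (EM (exists w : Om, True)) => [[w0 _]|no]; last first.
  rewrite DE// (_ : (fun w => _) = fun=> 0); last first.
    by apply/funext => w; exfalso; apply: no; exists w.
  have := probability_setT P; rewrite (_ : [set: Om] = set0) ?measure0.
    by move=> /eqP; rewrite eq_sym onee_eq0.
  by apply/seteqP; split => // w _; apply: no; exists w.
have B0 : 0 <= B by apply: le_trans (YB w0).
(* The constant [- B] is written as a multiple of the indicator of the sure level [- B <= Y w], so
   that the estimate for levels covers it as well. *)
pose Y' w : R := - B * (- B <= Y w)%R%:R + eta * \sum_(k < m) (- B + k.+1%:R * eta <= Y w)%R%:R.
have mY' : mbd Y' by apply: mbdD; apply: mbdZ => //; apply: mbd_sum => k; exact: mc.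
have YY' w : `|Y w - Y' w| <= eta.
  have /andP[Y1 Y2] : - B <= Y w <= B by rewrite -ler_norml.
  rewrite /Y' Y1 mulr1 opprD opprK addrA.
  have := @staircase R (Y w + B) eta m e0.
  have sE (k : 'I_m) : (- B + k.+1%:R * eta <= Y w)%R%:R = (k.+1%:R * eta <= Y w + B)%R%:R :> R.
    by rewrite addrC lerBlDr.
  under [in X in _ -> X]eq_bigr do rewrite sE.
  apply; lra.
rewrite DE//.
rewrite [X in `|X|](_ : _ = E (fun w => (Y w - Y' w) * (p w - h * q w)) + E (fun w => Y' w * (p w - h * q w))); last first.
  rewrite -ED; [|by apply: mbdM => //; exact: mbdB|exact: mbdM].
  by apply: eq_Rintegral => w _; rewrite -mulrDl subrK.
rewrite addrC (le_trans (ler_normD _ _))// lerD//.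
  have -> : E (fun w => Y' w * (p w - h * q w)) = - B * E (fun w => (- B <= Y w)%R%:R * (p w - h * q w)) +
      eta * \sum_(k < m) E (fun w => (- B + k.+1%:R * eta <= Y w)%R%:R * (p w - h * q w)).
    rewrite -E_sum; last by move=> k; exact: mbdM.
    rewrite -!EZ; [|exact: mbdM|by apply: mbd_sum => k; exact: mbdM].
    rewrite -ED; [|by apply: mbdZ; exact: mbdM|by apply: mbdZ; apply: mbd_sum => k; exact: mbdM].
    apply: eq_Rintegral => w _; rewrite /Y' mulrDl -mulrA -mulrA; congr (_ + eta * _).
    by rewrite mulr_suml.
  rewrite (le_trans (ler_normD _ _))// mulrDl !normrM normrN (ger0_norm B0) (gtr0_norm e0) lerD//.
    exact: ler_wpM2l.
  rewrite -mulrA ler_wpM2l ?(ltW e0)// (le_trans (ler_norm_sum _ _ _))//.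
  by rewrite (le_trans (ler_sum _ (fun k _ => He' _)))// sumr_const card_ord mulr_natl.
have mpq : mbd (fun w => p w + h * q w) by apply: mbdD => //; exact: mbdZ.
have EY : `|E (fun w => (Y w - Y' w) * (p w - h * q w))| <= E (fun w => eta * (p w + h * q w)).
  apply: E_norm_le; [by apply: mbdM => //; exact: mbdB|exact: mbdZ|].
  move=> w; rewrite normrM ler_pM//.
  rewrite (le_trans (ler_normD _ _))// normrN normrM (ger0_norm (p0 w)) (ger0_norm (q0 w)) (ger0_norm h0)//.
apply: (le_trans EY); rewrite EZ// ED//; last exact: mbdZ.
rewrite EZ// -!mulrA [2 * _]mulrCA ler_wpM2l ?(ltW e0)//.
have := ler_wpM2l h0 qK; lra.
Qed.

End LayerCake.

(** * Jump rates tested against functions *)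

Section ProcessMoments.
Variables (R : realType) (Lam : finType) (beta : Lam -> Lam -> R).
Hypothesis beta_ge0 : forall i j, 0 <= beta i j.
Variables (a : Lam) (d : measure_display) (Om : measurableType d) (P : probability Om R).
Variables (X : R -> Om -> Lam).
Hypothesis X_vrjp : is_vrjp beta a (fun=> 1) P X.
Local Notation E Y := (\int[P]_w Y w).
Local Notation L t w := (fun j => occ X j t w).
Implicit Types (i j k b : Lam) (r s t : R) (w : Om).

Let Xr := vrjp_right_continuous X_vrjp.
Let Xm := vrjp_measurable X_vrjp.

Lemma mbd_occ f t : 0 <= t -> loclip f -> mbd (fun w => f (L t w)).
Proof.
move=> t0 lf; split.
  by apply: measurable_occ_fun => // r i /andP[r0 _]; exact: Xm.
have [B B0 fB] := loclip_bnd (1 + t) lf; exists B => w; apply: fB => j.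
have /andP[p1 p2] := occ_bnd Xr j w t0.
by rewrite ger0_norm//; exact: le_trans p1.
Qed.

Lemma mbd_state i t : 0 <= t -> mbd (fun w => (X t w == i)%:R : R).
Proof.
move=> t0; apply: mbd_bool; rewrite (_ : [set _ | _] = [set w | X t w = i]); first exact: Xm.
by apply/seteqP; split => w /= /eqP.
Qed.

Lemma mbd_path_occ (h : Lam -> (Lam -> R) -> R) s t : 0 <= s -> 0 <= t -> (forall b, loclip (h b)) ->
  mbd (fun w => h (X s w) (L t w)).
Proof.
move=> s0 t0 lh; have -> : (fun w => h (X s w) (L t w)) =
    fun w => \sum_b (X s w == b)%:R * h b (L t w).
  apply/funext => w; rewrite (bigD1 (X s w))//= eqxx mul1r big1 ?addr0// => i /negPf.
  by rewrite eq_sym => ->; rewrite mul0r.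
by apply: mbd_sum => i; apply: mbdM; [exact: mbd_state|exact: mbd_occ].
Qed.

Lemma natural_filtration_measurable t A : natural_filtration X t A -> measurable A.
Proof.
apply: smallest_sub; first exact: sigma_algebra_measurable.
by move=> B [r [i [r0 rt ->]]]; exact: Xm.
Qed.

(** [measurable_path_occ] is instantiated with the sigma-algebra generated by the positions up to
    [t], which is the natural filtration. *)
Lemma filtration_level t (Y : Om -> R) c : 0 <= t ->
  (exists2 f : Lam -> (Lam -> R) -> R, (forall b, loclip (f b)) & Y = fun w => f (X t w) (L t w)) ->
  natural_filtration X t [set w | c <= Y w].
Proof.
move=> t0 [f lf ->].
pose Gen := [set A | exists r i, [/\ 0 <= r, r <= t & A = [set w : Om | X r w = i]]].
have H := @measurable_path_occ R Lam _ (g_sigma_algebraType Gen) X t t0 Xr.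
have HX r i : 0 <= r <= t -> measurable ([set w | X r w = i] : set (g_sigma_algebraType Gen)).
  by move=> /andP[r0 rt]; apply: sub_sigma_algebra; exists r, i.
have mY := H HX f lf.
have := measurable_fun_le measurableT (@measurable_cst _ _ (g_sigma_algebraType Gen) _ setT c) mY.
by rewrite setTI.
Qed.

Lemma E_setI (A : set Om) i t (Y : Om -> R) : 0 <= t -> measurable A ->
  \int[P]_(w in A `&` [set w | X t w = i]) Y w = E (fun w => \1_A w * ((X t w == i)%:R * Y w)).
Proof.
move=> t0 mA; rewrite Rintegral_mkcond; apply: eq_Rintegral => w _.
rewrite patchE indicE in_setI.
have -> : (w \in [set w0 | X t w0 = i]) = (X t w == i) by apply/idP/eqP; rewrite inE.
by case: (w \in A); case: (X t w == i); rewrite ?mul1r ?mul0r.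
Qed.

Lemma fine_P_setI (A : set Om) i j s t : 0 <= s -> 0 <= t -> measurable A ->
  fine (P (A `&` [set w | X t w = i] `&` [set w | X s w = j])) =
  E (fun w => \1_A w * ((X t w == i)%:R * (X s w == j)%:R)).
Proof.
move=> s0 t0 mA; rewrite -E_indic; last first.
  by apply: measurableI; [apply: measurableI => //; exact: Xm|exact: Xm].
apply: eq_Rintegral => w _; rewrite !indicE !in_setI.
have -> : (w \in [set w0 | X t w0 = i]) = (X t w == i) by apply/idP/eqP; rewrite inE.
have -> : (w \in [set w0 | X s w0 = j]) = (X s w == j) by apply/idP/eqP; rewrite inE.
by case: (w \in A); case: (X t w == i); case: (X s w == j); rewrite ?mul1r ?mul0r.
Qed.

Lemma jump_level S i j (e : R) : i != j -> 0 < e -> \forall h \near 0^'+,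
  forall t, 0 <= t <= S -> forall A, natural_filtration X t A ->
  `|E (fun w => \1_A w * ((X t w == i)%:R * (X (t + h) w == j)%:R)) -
    h * E (fun w => \1_A w * ((X t w == i)%:R * (beta i j * occ X j t w)))| <= e * h.
Proof.
move=> ij e0; have := jump_rate X_vrjp S ij e0.
apply: filterS2 (nbhs_right_gt 0) => h h0 H t tS A tA.
have /andP[t0 _] := tS; have mA := natural_filtration_measurable tA.
by have := H t tS A tA; rewrite fine_P_setI ?addr_ge0 ?(ltW h0)// E_setI.
Qed.

Lemma state_rate_bnd i j t w : 0 <= t ->
  0 <= (X t w == i)%:R * (beta i j * occ X j t w) <= beta i j * (1 + t).
Proof.
move=> t0; have /andP[p1 p2] := occ_bnd Xr j w t0.
have bo : 0 <= beta i j * occ X j t w <= beta i j * (1 + t).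
  by rewrite mulr_ge0 ?ler_wpM2l//; lra.
by case: eqP => _; rewrite ?mul1r ?mul0r ?lexx//=; case/andP: bo => b0; exact: le_trans.
Qed.

Lemma mbd_state_rate i j t : 0 <= t -> mbd (fun w => (X t w == i)%:R * (beta i j * occ X j t w)).
Proof.
move=> t0; apply: mbdM; first exact: mbd_state.
by apply: mbdZ; exact: (@mbd_occ (fun x => x j) t t0 (loclip_coord j)).
Qed.

Lemma E_state_rate S i j t : 0 <= t <= S ->
  E (fun w => (X t w == i)%:R * (beta i j * occ X j t w)) <= beta i j * (1 + S).
Proof.
move=> /andP[t0 tS]; rewrite -[leRHS](E_cst P); apply: E_le => //; [exact: mbd_state_rate|exact: mbd_cst|].
move=> w; have /andP[_ /le_trans] := @state_rate_bnd i j t w t0; apply.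
by rewrite ler_wpM2l// lerD2l.
Qed.

(** The rate estimate for the sure event with error [1 * h]; the rate itself is bounded because
    local times are at most [1 + S]. *)
Lemma jump_prob S i j : i != j -> \forall h \near 0^'+, forall t, 0 <= t <= S ->
  E (fun w => (X t w == i)%:R * (X (t + h) w == j)%:R) <= h * (beta i j * (1 + S) + 1).
Proof.
move=> ij; have := jump_level S ij (@ltr01 R); apply: filterS2 (nbhs_right_gt 0) => h h0 H t tS.
have nT : natural_filtration X t setT by exact: (@measurableT _ (g_sigma_algebraType _)).
have := H t tS setT nT; under eq_Rintegral do rewrite indicT mul1r.
under [in X in h * X]eq_Rintegral do rewrite indicT mul1r.
rewrite ler_norml mul1r => /andP[_].
have : h * E (fun w => (X t w == i)%:R * (beta i j * occ X j t w)) <= h * (beta i j * (1 + S)).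
  by rewrite ler_wpM2l ?(ltW h0)// E_state_rate.
rewrite mulrDr mulr1; lra.
Qed.

(* The rate is given on events; slicing at finitely many levels extends it to functions with an
   error that remains uniform. *)
Lemma jump_function S B i j (e : R) : i != j -> 0 <= S -> 0 <= B -> 0 < e -> \forall h \near 0^'+,
  forall t, 0 <= t <= S -> forall f, (forall b, loclip (f b)) ->
  (forall w, `|f (X t w) (L t w)| <= B) ->
  `|E (fun w => f (X t w) (L t w) * ((X t w == i)%:R * (X (t + h) w == j)%:R)) -
    h * E (fun w => f (X t w) (L t w) * ((X t w == i)%:R * (beta i j * occ X j t w)))| <= e * h.
Proof.
move=> ij S0 B0 e0.
pose K := beta i j * (1 + S) + 1.
have bS : 0 <= beta i j * (1 + S) by apply: mulr_ge0 => //; lra.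
have K0 : 0 < K by rewrite /K; lra.
(* [eta] makes the slicing error [2 * eta * K] equal to [e / 2], [m] is the number of steps needed
   to cover [[- B, B]], and [e'] keeps the accumulated level errors below [e / 2]. None of them
   depends on [t] or [f]. *)
pose eta := e / (4 * K).
have et0 : 0 < eta by rewrite divr_gt0//; lra.
pose m := (Num.truncn (2 * B / eta)).+1.
have Bm : 2 * B <= m%:R * eta.
  by rewrite -ler_pdivrMr//; apply/ltW/truncnS_gt.
pose D := B + eta * m%:R.
have D0 : 0 <= D by rewrite addr_ge0// mulr_ge0// ltW.
pose e' := e / (2 * (D + 1)).
have e'0 : 0 < e' by rewrite divr_gt0//; lra.
have := jump_level S ij e'0; have := jump_prob S ij.
apply: filterS3 (nbhs_right_gt 0) => h h0 H2 H1 t tS f lf fB.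
have /andP[t0 tS'] := tS.
have th0 : 0 <= t + h by rewrite addr_ge0// ltW.
pose p w : R := (X t w == i)%:R * (X (t + h) w == j)%:R.
pose q w : R := (X t w == i)%:R * (beta i j * occ X j t w).
have mp : mbd p by apply: mbdM; exact: mbd_state.
have mq : mbd q by exact: mbd_state_rate.
have mf : mbd (fun w => f (X t w) (L t w)) by exact: mbd_path_occ.
have Hl c : `|E (fun w => (c <= f (X t w) (L t w))%R%:R * p w) -
    h * E (fun w => (c <= f (X t w) (L t w))%R%:R * q w)| <= e' * h.
  have tA := @filtration_level t (fun w => f (X t w) (L t w)) c t0 (ex_intro2 _ _ f lf erefl).
  have := H1 t tS _ tA.
  have -> : \1_[set w | c <= f (X t w) (L t w)] = (fun w => (c <= f (X t w) (L t w))%R%:R : R).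
    by apply/funext => w; rewrite indicE; congr (_ %:R); congr nat_of_bool; apply/idP/idP; rewrite inE.
  by [].
have p0 w : 0 <= p w by rewrite mulr_ge0.
have q0 w : 0 <= q w by have /andP[] := @state_rate_bnd i j t w t0.
have EqK : E q <= K by rewrite (le_trans (@E_state_rate S i j t tS))// /K lerDl.
apply: (le_trans (layer_cake_bound mf mp mq p0 q0 (ltW h0) et0 fB Bm Hl (H2 t tS) EqK)).
rewrite -/D -/K mulrA.
have eD : D * e' <= e / 2.
  by rewrite /e' mulrA ler_pdivrMr; move: D0 e0; clear; nra.
have eK : 2 * eta * K = e / 2.
  have aux (x y : R) : 0 < y -> 2 * (x / (4 * y)) * y = x / 2.
    by move=> y0; field; exact: lt0r_neq0.
  exact: aux.
have -> : e * h = e / 2 * h + e / 2 * h by lra.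
by apply: lerD; [exact: (ler_wpM2r (ltW h0) eD)|rewrite -eK mulrAC].
Qed.

End ProcessMoments.

(** * Forward equation and Dynkin's formula *)

Section ProcessGenerator.
Variables (R : realType) (Lam : finType) (beta : Lam -> Lam -> R).
Hypothesis beta_ge0 : forall i j, 0 <= beta i j.
Variables (a : Lam) (d : measure_display) (Om : measurableType d) (P : probability Om R).
Variables (X : R -> Om -> Lam).
Hypothesis X_vrjp : is_vrjp beta a (fun=> 1) P X.
Local Notation mu := (@lebesgue_measure R).
Local Notation rint f a b := (\int[mu]_(x in `[a, b]) f x).
Local Notation E Y := (\int[P]_w Y w).
Local Notation L t w := (fun j => occ X j t w).
Implicit Types (i j k b : Lam) (r s t : R) (w : Om) (f h : Lam -> (Lam -> R) -> R).

Let Xr := vrjp_right_continuous X_vrjp.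
Let Xm := vrjp_measurable X_vrjp.

Lemma occ_dist1 w s t : 0 <= s <= t -> dist1 (L t w) (L s w) <= #|Lam|%:R * (t - s).
Proof.
move=> st; rewrite /dist1 mulr_natl -sumr_const; apply: ler_sum => j _.
by have /andP[p1 p2] := occ_inc Xr j w st; rewrite ger0_norm.
Qed.

Lemma loclip_family S h : (forall b, loclip (h b)) -> exists2 C : R, 0 <= C &
  forall b, (forall x, box S x -> `|h b x| <= C) /\
    forall x y, box S x -> box S y -> `|h b x - h b y| <= C * dist1 x y.
Proof.
move=> lh.
have H b : exists C : R, 0 <= C /\ ((forall x, box S x -> `|h b x| <= C) /\
    forall x y, box S x -> box S y -> `|h b x - h b y| <= C * dist1 x y).
  have [B B0 HB] := loclip_bnd S (lh b); have [C C0 HC] := lh b S.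
  exists (B + C); split; first exact: addr_ge0.
  split=> [x /HB H|x y bx by_]; first by rewrite (le_trans H)// lerDl.
  by rewrite (le_trans (HC _ _ bx by_))// ler_wpM2r ?dist1_ge0// lerDr.
have [C HC] := choice H; exists (\sum_b C b).
  by apply: sumr_ge0 => b _; have [] := HC b.
move=> b; have [C0 [H1 H2]] := HC b.
have le : C b <= \sum_b C b by rewrite (bigD1 b)//= lerDl; apply: sumr_ge0 => b' _; have [] := HC b'.
split=> [x /H1 H'|x y bx by_]; first exact: le_trans le.
by rewrite (le_trans (H2 _ _ bx by_))// ler_wpM2r ?dist1_ge0.
Qed.

(** Sums [jump_prob] over ordered pairs of distinct sites; that [K] and the range of [r] do not
    depend on [t] is what gives continuity of [phi] from both sides. *)
Lemma moving_prob S : exists2 K : R, 0 <= K & \forall r \near 0^'+, forall t, 0 <= t <= S ->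
  E (fun w => (X (t + r) w != X t w)%:R) <= K * r.
Proof.
pose K i j : R := `|beta i j * (1 + S) + 1|.
exists (\sum_i \sum_(j | j != i) K i j); first by apply: sumr_ge0 => i _; apply: sumr_ge0 => j _; exact: normr_ge0.
have : \forall r \near 0^'+, forall p : Lam * Lam, p.2 != p.1 -> forall t, 0 <= t <= S ->
    E (fun w => (X t w == p.1)%:R * (X (t + r) w == p.2)%:R) <= r * (beta p.1 p.2 * (1 + S) + 1).
  apply: filter_forall => -[i j] /=; have [->|ij] := eqVneq i j; first by apply: nearW.
  by have := jump_prob beta_ge0 X_vrjp S ij; apply: filterS => r H _.
apply: filterS2 (nbhs_right_gt 0) => r r0 H t tS.
have /andP[t0 _] := tS; have tr0 : 0 <= t + r by rewrite addr_ge0// ltW.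
have m2 i j : mbd (fun w => (X t w == i)%:R * (X (t + r) w == j)%:R : R).
  by apply: mbdM; exact: (mbd_state X_vrjp).
have -> : E (fun w => (X (t + r) w != X t w)%:R) =
    E (fun w => \sum_i \sum_(j | j != i) (X t w == i)%:R * (X (t + r) w == j)%:R).
  apply: eq_Rintegral => w _; rewrite (bigD1 (X t w))//= [X in _ = _ + X]big1 ?addr0; last first.
    by move=> i /negPf; rewrite eq_sym => ->; rewrite big1// => j _; rewrite mul0r.
  rewrite eqxx; under eq_bigr do rewrite mul1r.
  have [e|ne] := eqVneq (X (t + r) w) (X t w).
    by rewrite big1// => j; rewrite e eq_sym => /negPf ->.
  rewrite (bigD1 (X (t + r) w))//= eqxx big1 ?addr0// => j /andP[_ /negPf].
  by rewrite eq_sym => ->.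
rewrite E_sum; last by move=> i; exact: mbd_sum_cond.
rewrite mulr_suml; apply: ler_sum => i _; rewrite E_sum_cond// mulr_suml; apply: ler_sum => j ji.
apply: (le_trans (H (i, j) ji t tS)); rewrite mulrC ler_wpM2r ?(ltW r0)//.
exact: ler_norm.
Qed.

Definition phi h t : R := E (fun w => h (X t w) (L t w)).

Lemma phi_bnd S h (c : R) t : (forall b, loclip (h b)) -> 0 <= t <= S ->
  (forall b x, box (1 + S) x -> (forall j, 1 <= x j) -> `|h b x| <= c) -> `|phi h t| <= c.
Proof.
move=> lh tS hc; have /andP[t0 _] := tS.
apply: E_bnd => [|w]; first exact: (mbd_path_occ X_vrjp).
by apply: hc; [exact: (path_box Xr)|move=> j; have /andP[] := occ_bnd Xr j w t0].
Qed.

(** Over a time [r] the integrand changes by at most [2 * C] when the position has changed, an event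
    of probability [O(r)], and by a Lipschitz amount [O(r)] otherwise. The bound is uniform in [t],
    so exchanging the two times gives left continuity too. *)
Lemma phi_econt S h : (forall b, loclip (h b)) -> econt (phi h) 0 S.
Proof.
move=> lh; have [K K0 HK] := moving_prob S; have [C C0 HC] := loclip_family (1 + S) lh.
pose D := 2 * C * K + C * #|Lam|%:R.
have D0 : 0 <= D by rewrite addr_ge0 ?mulr_ge0.
have : \forall r \near 0^'+, forall t, 0 <= t <= S -> t + r <= S -> `|phi h (t + r) - phi h t| <= D * r.
  apply: filterS2 (nbhs_right_gt 0) HK => r r0 H t tS trS.
  have /andP[t0 _] := tS; have tr0 : 0 <= t + r by rewrite addr_ge0// ltW.
  have mm : mbd (fun w => (X (t + r) w != X t w)%:R : R).
    have -> : (fun w => (X (t + r) w != X t w)%:R : R) =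
      fun w => \sum_i (X t w == i)%:R * (1 - (X (t + r) w == i)%:R).
      apply/funext => w; rewrite (bigD1 (X t w))//= eqxx mul1r big1 ?addr0; last first.
        by move=> i /negPf; rewrite eq_sym => ->; rewrite mul0r.
      by case: eqP => _ /=; rewrite ?subrr ?subr0.
    apply: mbd_sum => i; apply: mbdM; first exact: (mbd_state X_vrjp).
    by apply: mbdB; [exact: mbd_cst|exact: (mbd_state X_vrjp)].
  rewrite /phi -EB; [|exact: (mbd_path_occ X_vrjp)|exact: (mbd_path_occ X_vrjp)].
  apply: (@le_trans _ _ (E (fun w => 2 * C * (X (t + r) w != X t w)%:R + C * (#|Lam|%:R * r)))).
    apply: E_norm_le.
    - by apply: mbdB; exact: (mbd_path_occ X_vrjp).
    - by apply: mbdD; [exact: mbdZ|exact: mbd_cst].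
    move=> w; have [H1 H2] := HC (X (t + r) w).
    have b1 : box (1 + S) (L (t + r) w) by apply: (path_box Xr); rewrite tr0.
    have b2 : box (1 + S) (L t w) by apply: (path_box Xr).
    case: eqP => [e|_] /=.
      rewrite -e mulr0 add0r (le_trans (H2 _ _ b1 b2))// ler_wpM2l//.
      by have := @occ_dist1 w t (t + r); rewrite [t + r]addrC addrK; apply; rewrite t0 lerDr ltW.
    rewrite mulr1 (le_trans (ler_normB _ _))//.
    have := H1 _ b1; have [H1' _] := HC (X t w); have := H1' _ b2.
    have : 0 <= C * (#|Lam|%:R * r) by rewrite !mulr_ge0// ltW.
    lra.
  rewrite ED; [|exact: mbdZ|exact: mbd_cst].
  rewrite EZ// E_cst; have C2 : 0 <= 2 * C by lra.
  have := ler_wpM2l C2 (H t tS); rewrite /D; move: (Rintegral _ _ _) => p; lra.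
rewrite /at_right near_withinE => /nbhs_ballP[dl dl0 H] t tS e e0.
have d0 : 0 < e / (D + 1) by rewrite divr_gt0//; lra.
exists (Num.min dl (e / (D + 1))); first by rewrite lt_min d0 andbT.
have H' s r : 0 <= s -> s < r -> r <= S -> r - s < dl -> `|phi h r - phi h s| <= D * (r - s).
  move=> s0 sr rS rsd; have := H (r - s) _ _ s; rewrite [s + _]addrC subrK; apply => //.
  - by rewrite /ball /= sub0r normrN gtr0_norm ?subr_gt0.
  - by rewrite subr_gt0.
  - by rewrite s0 (le_trans (ltW sr)).
have De x : x < e / (D + 1) -> 0 <= x -> D * x <= e.
  rewrite ltr_pdivlMr; last by lra.
  by move=> xe x0; apply: le_trans (ltW xe); rewrite mulrC ler_wpM2l// lerDl.
move=> s sS; rewrite lt_min => /andP[sd se].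
have /andP[s0 sS'] := sS; have /andP[t0 tS'] := tS.
have [st|ts|->] := ltgtP s t; last by rewrite subrr normr0 ltW.
- have E1 : `|s - t| = t - s by rewrite distrC gtr0_norm ?subr_gt0.
  rewrite E1 in sd se; rewrite distrC (le_trans (H' _ _ s0 st tS' sd))// De//.
  by rewrite subr_ge0 ltW.
- have E1 : `|s - t| = s - t by rewrite gtr0_norm ?subr_gt0.
  rewrite E1 in sd se; rewrite (le_trans (H' _ _ t0 ts sS' sd))// De//.
  by rewrite subr_ge0 ltW.
Qed.

Lemma phi_rcb S h : (forall b, loclip (h b)) -> rcb 0 S (phi h).
Proof.
move=> lh; apply: econt_rcb; first exact: phi_econt.
have [C C0 HC] := loclip_family (1 + S) lh; exists C => t tS.
by apply: (phi_bnd (S := S)) => // b x bx _; have [H1 _] := HC b; exact: H1.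
Qed.

(** Decomposition over ordered pairs of distinct sites, the only pairs for which jump rates are
    given; the diagonal is absent because [F] vanishes there. *)
Lemma moving_sum (F : Lam -> Lam -> R) b b' :
  (forall i, F i i = 0) ->
  F b b' = \sum_(p : Lam * Lam | p.2 != p.1) F p.1 p.2 * ((b == p.1)%:R * (b' == p.2)%:R).
Proof.
move=> F0; have [<-|ne] := eqVneq b b'.
  rewrite F0 big1// => -[i j] /= ji.
  by case: eqP => [->|_]; rewrite ?mul0r ?mulr0// eq_sym (negPf ji) !mulr0.
rewrite (bigD1 (b, b'))/= 1?eq_sym// !eqxx !mulr1 big1 ?addr0// => -[i j] /andP[_] /=.
by rewrite xpair_eqE negb_and ![_ == b]eq_sym ![_ == b']eq_sym => /orP[/negPf ->|/negPf ->]; rewrite ?mul0r !mulr0.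
Qed.

Lemma moving_rate_sum (F : Lam -> Lam -> R) (G : Lam -> R) b : (forall i, F i i = 0) ->
  \sum_j beta b j * (G j * F b j) =
  \sum_(p : Lam * Lam | p.2 != p.1) F p.1 p.2 * ((b == p.1)%:R * (beta p.1 p.2 * G p.2)).
Proof.
move=> F0; rewrite [RHS]big_mkcond -(pair_bigA _ (fun i j => if j != i then F i j * ((b == i)%:R * (beta i j * G j)) else 0))/=.
rewrite [RHS](bigD1 b)//= [X in _ = _ + X]big1 ?addr0; last first.
  by move=> i /negPf; rewrite eq_sym => ->; rewrite big1// => j _; rewrite mul0r mulr0 if_same.
apply: eq_bigr => j _; rewrite eqxx; have [->|_] := eqVneq j b; first by rewrite F0 !mulr0.
by rewrite /= mul1r; ring.
Qed.

(** With the local times frozen at [t] only the position moves: the increment is a sum over pairs of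
    sites of [t]-measurable functions against jump indicators, to which [jump_function] applies. *)
Lemma phi_jump f t (e : R) : (forall b, loclip (f b)) -> 0 <= t -> 0 < e -> \forall r \near 0^'+,
  `|E (fun w => f (X (t + r) w) (L t w) - f (X t w) (L t w)) -
    r * phi (fun b l => \sum_j beta b j * (l j * (f j l - f b l))) t| <= e * r.
Proof.
move=> lf t0 e0; have [C C0 HC] := loclip_family (1 + t) lf.
pose n : R := #|{: Lam * Lam}|%:R; have n0 : 0 <= n by rewrite /n ler0n.
pose e' := e / (n + 1); have e'0 : 0 < e' by rewrite divr_gt0//; lra.
have tt : 0 <= t <= t by rewrite t0 lexx.
have : \forall r \near 0^'+, forall p : Lam * Lam, p.2 != p.1 ->
    `|E (fun w => (f p.2 (L t w) - f p.1 (L t w)) * ((X t w == p.1)%:R * (X (t + r) w == p.2)%:R)) -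
      r * E (fun w => (f p.2 (L t w) - f p.1 (L t w)) * ((X t w == p.1)%:R * (beta p.1 p.2 * occ X p.2 t w)))| <= e' * r.
  apply: filter_forall => -[i j] /=; have [->|ij] := eqVneq i j; first by apply: nearW.
  have C2 : 0 <= 2 * C by lra.
  have := jump_function beta_ge0 X_vrjp ij t0 C2 e'0; apply: filterS => r H _.
  apply: (H t tt (fun _ l => f j l - f i l)) => [_|w].
    by apply: loclipD => //; exact: loclipN.
  have bw := path_box Xr w tt; have [H1 _] := HC i; have [H2 _] := HC j.
  by rewrite (le_trans (ler_normB _ _))//; have := H1 _ bw; have := H2 _ bw; lra.
apply: filterS2 (nbhs_right_gt 0) => r r0 H.
have tr0 : 0 <= t + r by rewrite addr_ge0// ltW.
have m1 (p : Lam * Lam) : mbd (fun w => (f p.2 (L t w) - f p.1 (L t w)) * ((X t w == p.1)%:R * (X (t + r) w == p.2)%:R)).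
  apply: mbdM; last by apply: mbdM; exact: (mbd_state X_vrjp).
  by apply: mbdB; exact: (mbd_occ X_vrjp).
have m2 (p : Lam * Lam) : mbd (fun w => (f p.2 (L t w) - f p.1 (L t w)) * ((X t w == p.1)%:R * (beta p.1 p.2 * occ X p.2 t w))).
  apply: mbdM; last exact: (mbd_state_rate X_vrjp).
  by apply: mbdB; exact: (mbd_occ X_vrjp).
rewrite (_ : E (fun w => f (X (t + r) w) (L t w) - _) =
    \sum_(p : Lam * Lam | p.2 != p.1) E (fun w => (f p.2 (L t w) - f p.1 (L t w)) * ((X t w == p.1)%:R * (X (t + r) w == p.2)%:R))); last first.
  rewrite -[RHS]E_sum_cond//; apply: eq_Rintegral => w _.
  exact: (@moving_sum (fun i j => f j (L t w) - f i (L t w)) _ _ (fun i => subrr _)).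
rewrite (_ : phi _ t = \sum_(p : Lam * Lam | p.2 != p.1) E (fun w => (f p.2 (L t w) - f p.1 (L t w)) * ((X t w == p.1)%:R * (beta p.1 p.2 * occ X p.2 t w)))); last first.
  rewrite -[RHS]E_sum_cond//; apply: eq_Rintegral => w _.
  exact: (@moving_rate_sum (fun i j => f j (L t w) - f i (L t w)) (fun j => occ X j t w) _ (fun i => subrr _)).
rewrite mulr_sumr -sumrB (le_trans (ler_norm_sum _ _ _))//.
apply: (@le_trans _ _ (\sum_(p : Lam * Lam) e' * r)).
  rewrite [leLHS]big_mkcond; apply: ler_sum => p _; case: ifP => [/H//|_].
  by rewrite mulr_ge0// ltW.
rewrite sumr_const -mulr_natr mulrAC ler_wpM2r ?(ltW r0)// -/n /e'.
rewrite mulrAC ler_pdivrMr; last by lra.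
by rewrite ler_wpM2l ?(ltW e0)// lerDl.
Qed.

(* Pathwise, [X] does not jump just after [t], so that dominated convergence applies. *)
Lemma phi_drift f t (e : R) : (forall b, Cinf (f b)) -> 0 <= t -> 0 < e -> \forall r \near 0^'+,
  `|E (fun w => f (X (t + r) w) (L (t + r) w) - f (X (t + r) w) (L t w)) -
    r * phi (fun b => partial b (f b)) t| <= e * r.
Proof.
move=> cf t0 e0; have lf b := Cinf_lip (cf b).
pose Q r w : R := (f (X (t + r) w) (L (t + r) w) - f (X (t + r) w) (L t w)) * r^-1.
have mQ r : 0 < r -> mbd (Q r).
  move=> r0; have tr0 : 0 <= t + r by rewrite addr_ge0// ltW.
  by apply: mbdM; [apply: mbdB; exact: (mbd_path_occ X_vrjp)|exact: mbd_cst].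
suff : E (Q r) @[r --> 0^'+] --> phi (fun b => partial b (f b)) t.
  move=> /cvgrPdist_le /(_ _ e0); apply: filterS2 (nbhs_right_gt 0) => r r0.
  rewrite distrC => H; have -> : E (fun w => f (X (t + r) w) (L (t + r) w) - f (X (t + r) w) (L t w)) = r * E (Q r).
    rewrite -EZ; last exact: mQ.
    by apply: eq_Rintegral => w _; rewrite /Q mulrC mulfVK// gt_eqF.
  by rewrite -mulrBr normrM (gtr0_norm r0) mulrC ler_wpM2r// ltW.
(* Dominated convergence is sequential. The bound [U] on the sequence of increments keeps all local
   times in one box, hence gives one Lipschitz constant. *)
apply/cvg_at_rightP => u [u0 cu].
have [U HU] : exists U : R, forall n, u n <= U.
  have /cvg_seq_bounded[M [_ HM]] : cvg (u n @[n --> \oo]) by apply/cvg_ex; exists 0.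
  by exists (M + 1) => n; apply: le_trans (ler_norm _) _; apply: HM => //; lra.
have [C C0 HC] := loclip_family (1 + (t + U)) lf.
apply: (@E_cvg _ _ _ P _ _ (C * #|Lam|%:R)) => [n|n w|w]; first exact: mQ.
  have tn0 : 0 <= t + u n by rewrite addr_ge0// ltW.
  have b1 : box (1 + (t + U)) (L (t + u n) w) by apply: (path_box Xr); rewrite tn0 lerD2l HU.
  have b2 : box (1 + (t + U)) (L t w).
    by apply: (path_box Xr); rewrite t0 lerDl; apply: le_trans (HU 0%N); exact: ltW.
  have [_ H2] := HC (X (t + u n) w).
  rewrite /Q normrM normfV (gtr0_norm (u0 n)) ler_pdivrMr//.
  rewrite (le_trans (H2 _ _ b1 b2))// -mulrA ler_wpM2l//.
  by have := @occ_dist1 w t (t + u n); rewrite [t + u n]addrC addrK; apply; rewrite t0 lerDr ltW.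
have [d1 d10 H1] := occ_step Xr w t0; have [d2 d20 H2] := path_right Xr w t0.
pose b := X t w.
have D : rderiv (fun s => f b (upd (L t w) b s)) (occ X b t w) (partial b (f b) (L t w)).
  apply: is_derive_rderiv.
  exact: (Cinf_pder b (cf b) (L t w)).
apply/cvgrPdist_le => e' e'0; have [d3 d30 H3] := D e' e'0.
have m0 : 0 < Num.min d1 (Num.min d2 d3) by rewrite !lt_min d10 d20.
move/cvgrPdist_lt : cu => /(_ _ m0); apply: filterS => n; rewrite sub0r normrN gtr0_norm//.
rewrite !lt_min => /and3P[n1 n2 n3]; have un0 := u0 n.
have E1 : L (t + u n) w = upd (L t w) b (occ X b t w + u n).
  apply/funext => j; rewrite H1 ?(ltW un0)// updE /b; case: eqP => [->|_]; rewrite ?mulr1//.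
  by rewrite mulr0 addr0.
rewrite /Q H2 ?(ltW un0)// E1 -/b distrC.
have := H3 (u n); rewrite n3 (ltW un0) => /(_ isT); rewrite upd_id => H.
rewrite -[partial _ _ _](mulfK (lt0r_neq0 un0)) -mulrBl normrM normfV (gtr0_norm un0).
by rewrite ler_pdivrMr// [partial _ _ _ * _]mulrC.
Qed.

(** The increment splits into a jump at frozen local times and a drift of the local times at the new
    position; they supply the two parts of the generator. *)
Lemma phi_rderiv f t : (forall b, Cinf (f b)) -> 0 <= t -> rderiv (phi f) t (phi (gen beta f) t).
Proof.
move=> cf t0 e e0; have lf b := Cinf_lip (cf b).
have e2 : 0 < e / 2 by lra.
have H1 := phi_jump lf t0 e2; have H2 := phi_drift cf t0 e2.
have : \forall r \near 0^'+, `|phi f (t + r) - phi f t - r * phi (gen beta f) t| <= e * r.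
  apply: filterS3 (nbhs_right_gt 0) H1 H2 => r r0.
  have tr0 : 0 <= t + r by rewrite addr_ge0// ltW.
  have mp s s' (g : Lam -> (Lam -> R) -> R) : 0 <= s -> 0 <= s' -> (forall b, loclip (g b)) ->
    mbd (fun w => g (X s w) (L s' w)) by exact: (mbd_path_occ X_vrjp).
  have lj b : loclip (fun l => \sum_j beta b j * (l j * (f j l - f b l))).
    apply: Cinf_lip; apply: Cinf_sum => j _; apply: CinfM; first exact: Cinf_cst.
    apply: CinfM; first exact: Cinf_coord.
    by apply: CinfD => //; exact: CinfN.
  have lp b : loclip (partial b (f b)) by apply: Cinf_lip; exact: Cinf_partial.
  have -> : phi (gen beta f) t = phi (fun b => partial b (f b)) t +
      phi (fun b l => \sum_j beta b j * (l j * (f j l - f b l))) t.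
    by rewrite -ED //; [exact: (mp t t (fun b => partial b (f b)))|
      exact: (mp t t (fun b l => \sum_j beta b j * (l j * (f j l - f b l))))].
  rewrite !EB; try exact: mp.
  rewrite -!/(phi _ _) mulrDr.
  have aux (x1 x2 x3 x4 x5 c : R) : `|x1 - x2 - r * x4| <= c / 2 * r -> `|x5 - x1 - r * x3| <= c / 2 * r ->
      `|x5 - x2 - (r * x3 + r * x4)| <= c * r.
    have -> : x5 - x2 - (r * x3 + r * x4) = (x1 - x2 - r * x4) + (x5 - x1 - r * x3) by ring.
    by move=> K1 K2; rewrite (le_trans (ler_normD _ _))//; lra.
  exact: aux.
rewrite /at_right near_withinE => /nbhs_ballP[dl dl0 H]; exists dl => // r /andP[].
rewrite le_eqVlt => /predU1P[<- _|r0 rd].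
  by rewrite addr0 subrr mul0r subrr normr0 mulr0.
by apply: H => //; rewrite /ball /= sub0r normrN gtr0_norm.
Qed.

(** The start at [a] is only almost sure, so the difference is dominated by a multiple of the
    indicator of a null event. *)
Lemma phi0 f : (forall b, loclip (f b)) -> phi f 0 = f a (fun=> 1).
Proof.
move=> lf; have m0 : mbd (fun w => f (X 0 w) (fun=> 1) : R).
  rewrite (_ : (fun w => _) = fun w => f (X 0 w) (L 0 w)); first exact: (mbd_path_occ X_vrjp).
  by apply/funext => w; congr (f _); apply/funext => j; rewrite occ0.
have -> : phi f 0 = E (fun w => f (X 0 w) (fun=> 1)).
  by apply: eq_Rintegral => w _; congr (f _); apply/funext => j; rewrite occ0.
have mne : mbd (\1_[set w | X 0 w <> a] : Om -> R).
  by apply: mbd_indic; rewrite (_ : [set _ | _] = ~` [set w | X 0 w = a])//; apply: measurableC; exact: Xm.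
have E0 : E (\1_[set w | X 0 w <> a]) = 0.
  rewrite E_indic; last first.
    by rewrite (_ : [set _ | _] = ~` [set w | X 0 w = a])//; apply: measurableC; exact: Xm.
  rewrite (_ : [set _ | _] = ~` [set w | X 0 w = a])// probability_setC; last exact: Xm.
  by rewrite (vrjp_start X_vrjp) subee.
apply/eqP; rewrite -subr_eq0 -normr_le0.
rewrite -[X in _ - X](E_cst P) -EB//; last exact: mbd_cst.
pose D := \sum_b `|f b (fun=> 1)|.
have D1 b : `|f b (fun=> 1)| <= D by rewrite /D (bigD1 b)//= lerDl sumr_ge0.
have E0' : E (fun w => 2 * D * \1_[set w | X 0 w <> a] w) = 0 by rewrite EZ// E0 mulr0.
rewrite -[leRHS]E0'.
apply: E_norm_le; [by apply: mbdB => //; exact: mbd_cst|exact: mbdZ|move=> w].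
rewrite indicE; case: (eqVneq (X 0 w) a) => [e|/eqP ne].
  by rewrite e subrr normr0 memNset ?mulr0//= => /(_ e).
rewrite mem_set// mulr1 (le_trans (ler_normB _ _))//.
by have := D1 (X 0 w); have := D1 a; lra.
Qed.

Lemma phi_usupp f t M : (forall b, usupp M (f b)) -> 1 <= M -> #|Lam|%:R * M < #|Lam|%:R + t -> 0 <= t ->
  phi f t = 0.
Proof.
move=> uf M1 Mt t0; rewrite /phi -[RHS](E_cst P); apply: eq_Rintegral => w _.
have [k Hk] := occ_exceeds Xr w t0 Mt.
by apply: uf Hk => j; have /andP[] := occ_bnd Xr j w t0.
Qed.

Lemma Cinf_gen f b : (forall b, Cinf (f b)) -> Cinf (gen beta f b).
Proof.
move=> cf; apply: CinfD; first exact: Cinf_partial.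
apply: Cinf_sum => j _; apply: CinfM; [exact: Cinf_cst|apply: CinfM; first exact: Cinf_coord].
by apply: CinfD; [exact: cf|apply: CinfN; exact: cf].
Qed.

Definition mu1 S h : R := rint (phi h) 0 S.

Lemma mu1_gen S f M : (forall b, Cinf (f b)) -> (forall b, usupp M (f b)) -> 1 <= M -> #|Lam|%:R * M < #|Lam|%:R + S ->
  0 <= S -> mu1 S (gen beta f) = - f a (fun=> 1).
Proof.
move=> cf uf M1 MS S0; have lf b := Cinf_lip (cf b).
have lg b : loclip (gen beta f b) by apply: Cinf_lip; exact: Cinf_gen.
rewrite /mu1 (@rderiv_FTC _ (phi f) _ 0 S)//.
- by rewrite (phi_usupp uf M1 MS S0) phi0// sub0r.
- exact: phi_econt.
- exact: phi_rcb.
- by move=> t /andP[t0 _]; exact: phi_rderiv.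
Qed.

Lemma mu1D S h h' : (forall b, loclip (h b)) -> (forall b, loclip (h' b)) ->
  mu1 S (fun b l => h b l + h' b l) = mu1 S h + mu1 S h'.
Proof.
move=> lh lh'; rewrite /mu1 -rintD; try exact: phi_rcb.
apply: eq_rint => t /andP[t0 _].
by rewrite /phi -ED; [|exact: (mbd_path_occ X_vrjp)|exact: (mbd_path_occ X_vrjp)].
Qed.

Lemma mu1_bnd S h (c : R) : 0 <= S -> (forall b, loclip (h b)) ->
  (forall b l, (forall j, 1 <= l j) -> `|h b l| <= c) -> `|mu1 S h| <= c * S.
Proof.
move=> S0 lh hc; rewrite -[S in leRHS]subr0; apply: rint_le => //; first exact: phi_rcb.
by move=> t tS; apply: (phi_bnd (S := S)) => // b x _; exact: hc.
Qed.

Hypothesis beta_sym : forall i j, beta i j = beta j i.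

(** [nu_null] for the difference of the two functionals; in the constant, [S] is the length of the
    time interval and [C] comes from [mu2_bnd]. *)
Lemma mu1_mu2 S M h : 1 <= M -> #|Lam|%:R * M < #|Lam|%:R + S -> 0 <= S -> adm M h ->
  mu1 S h = mu2 beta a h.
Proof.
move=> M1 MS S0 ah; apply/eqP; rewrite -subr_eq0; apply/eqP.
have lip g : adm M g -> forall b, loclip (g b) by move=> ag b; exact: Cinf_lip (ag b).1.
have [C C0 HC] := mu2_bnd beta a M1.
apply: (@nu_null _ _ beta beta_ge0 M M1 (fun g => mu1 S g - mu2 beta a g) _ _ (S + C)) => //.
- move=> g g' ag ag'; have c b := (ag b).1; have u b := (ag b).2; have c' b := (ag' b).1.
  have u' b := (ag' b).2.
  by rewrite (mu1D S (lip _ ag) (lip _ ag')) (mu2D beta a M1 c u c' u'); ring.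
- move=> f af; have c b := (af b).1; have u b := (af b).2.
  by rewrite (mu1_gen c u M1 MS S0) (mu2_gen beta_sym a M1 c u) subrr.
- exact: addr_ge0.
move=> g c c0 ag bg; rewrite mulrDl (le_trans (ler_normB _ _))// lerD//.
  rewrite mulrC; apply: mu1_bnd => //; first exact: lip.
  by move=> b l l1; exact: (bg b [::]).
by apply: HC => // b; have [] := ag b.
Qed.

End ProcessGenerator.

(** * Calculus along a single path *)

Lemma smooth1_continuous (R : realType) (f : R -> R) : smooth1 f -> continuous f.
Proof. by move=> sf t; apply: differentiable_continuous; apply/derivable1_diffP; exact: (sf 0%N t). Qed.

(** A smoothed Heaviside function. Composed with the clock, it makes the weight [del] times the
    clock speed a total time derivative. *)
Lemma bump_primitive (R : realType) (del : R -> R) (r : R) :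
  smooth1 del -> (forall t, 0 <= del t) -> (\int[lebesgue_measure]_t (del t)%:E = 1)%E ->
  (forall t, del t != 0 -> `|t| <= r) ->
  exists D : R -> R, [/\ smooth1 D, derive1 D = del, forall x, x < - r -> D x = 0 & forall x, r < x -> D x = 1].
Proof.
move=> sd d0 i1 dr.
have [D DF] : exists D : R -> R, D = fun x => \int[lebesgue_measure]_(t in `]-oo, x]) del t by eexists.
have mdel : measurable_fun setT del by apply: continuous_measurable_fun; exact: smooth1_continuous.
have idel : lebesgue_measure.-integrable setT (EFin \o del).
  apply/integrableP; split; first by apply/measurable_EFinP.
  under eq_integral do rewrite /= ger0_norm//.
  by rewrite i1 ltry.
have DD (x : R) : is_derive x 1 D (del x).
  have xu : x < x + 1 by rewrite ltrDl.
  have ix : lebesgue_measure.-integrable [set` Interval (BInfty R true) (BRight (x + 1))] (EFin \o del).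
    exact: integrableS idel.
  have [dD Dx] := continuous_FTC1 xu ix (ltNyr _) (@smooth1_continuous _ _ sd x).
  by rewrite DF -Dx derive1E; exact: DeriveDef dD erefl.
have dE : derive1 D = del by apply/funext => x; rewrite derive1E; have [_ ->] := DD x.
exists D; split; [|by []| |].
- move=> [|n] t; first by have [] := DD t.
  by rewrite derive1Sn dE; exact: sd.
- move=> x xr; rewrite DF (@eq_Rintegral _ _ _ _ _ (fun=> 0)) ?Rintegral_cst ?mul0r// => t.
  rewrite inE /= in_itv /= => tx; apply: contraTeq isT => /dr; rewrite ler_norml; lra.
move=> x rx; rewrite DF Rintegral_mkcond -[RHS]/(fine 1%E) -i1; congr fine.
apply: eq_integral => t _; rewrite patchE; case: ifPn => //; rewrite notin_setE /= in_itv /= => /negP.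
rewrite -ltNge => xt; congr (_%:E); apply/esym; apply: contraTeq isT => /dr; rewrite ler_norml; lra.
Qed.

Lemma econt_IVT (R : realType) (f : R -> R) (a b v : R) : a <= b -> econt f a b -> f a <= v <= f b ->
  exists2 c, a <= c <= b & f c = v.
Proof.
move=> ab cf /andP[av vb].
(* Clamping to [[a, b]] is 1-Lipschitz, hence turns continuity relative to the interval into
   continuity on the whole line. *)
pose cl t := Num.max a (Num.min b t).
have clab t : a <= cl t <= b by rewrite /cl le_max lexx /= ge_max ab ge_min lexx.
have clE t : a <= t <= b -> cl t = t.
  by move=> /andP[at_ tb]; rewrite /cl (min_idPr tb) (max_idPr at_).
have cll s t : `|cl s - cl t| <= `|s - t|.
  rewrite /cl; case: (leP b s) => ?; case: (leP b t) => ?; do ?[case: (leP a) => ?];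
  rewrite ler_norml; case: (ger0P (s - t)) => ?; lra.
have cF : continuous (f \o cl).
  move=> t; apply/cvgrPdist_le => e e0; have [d d0 H] := cf (cl t) (clab t) e e0.
  near=> s; rewrite distrC; apply: H => //=; apply: le_lt_trans (cll s t) _; rewrite distrC.
  by near: s; apply: cvgr_dist_lt.
have [|c cab fc] := @IVT R (f \o cl) a b v ab (continuous_subspaceT cF).
  rewrite /= !clE ?lexx ?ab// ge_min av le_max vb orbT//.
by exists (cl c).
Unshelve. all: by end_near. Qed.

Section PathCalculus.
Variables (R : realType) (Lam : finType) (T : Type) (X : R -> T -> Lam).
Hypothesis Xright : forall w t, 0 <= t -> \forall r \near t^'+, X r w = X t w.
Local Notation mu := (@lebesgue_measure R).
Local Notation rint f a b := (\int[mu]_(x in `[a, b]) f x).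
Local Notation L t w := (fun j => occ X j t w).
Implicit Types (i j k b : Lam) (w : T) (r s t S : R) (f : (Lam -> R) -> R).

Lemma occ_fun_econt f w S : loclip f -> econt (fun t => f (L t w)) 0 S.
Proof.
move=> lf; have [C C0 HC] := lf (1 + S).
apply: (@lip_econt _ _ _ _ (C * #|Lam|%:R)); first exact: mulr_ge0.
have H s t : 0 <= s -> s <= t -> t <= S -> `|f (L t w) - f (L s w)| <= C * #|Lam|%:R * (t - s).
  move=> s0 st tS; have bt : box (1 + S) (L t w) by apply: (path_box Xright); rewrite tS (le_trans s0).
  have bs : box (1 + S) (L s w) by apply: (path_box Xright); rewrite s0 (le_trans st).
  rewrite (le_trans (HC _ _ bt bs))// -mulrA ler_wpM2l// /dist1 mulr_natl -sumr_const.
  by apply: ler_sum => j _; have /andP[p1 p2] := @occ_inc _ _ _ _ Xright j w s t ltac:(by rewrite s0); rewrite ger0_norm.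
move=> s t /andP[s0 sS] /andP[t0 tS]; have [st|ts] := leP s t.
  by rewrite distrC [`|s - t|]distrC [`|t - s|]ger0_norm ?subr_ge0// H.
by rewrite [`|s - t|]gtr0_norm ?subr_gt0// H// ltW.
Qed.

Lemma occ_fun_rderiv f w t : Cinf f -> 0 <= t ->
  rderiv (fun s => f (L s w)) t (partial (X t w) f (L t w)).
Proof.
move=> cf t0; have [d1 d10 H1] := occ_step Xright w t0; pose b := X t w.
have := is_derive_rderiv (Cinf_pder b cf (L t w)); move=> D e e0; have [d2 d20 H2] := D e e0.
exists (Num.min d1 d2); first by rewrite lt_min d10.
move=> h /andP[h0]; rewrite lt_min => /andP[h1 h2].
have E1 : L (t + h) w = upd (L t w) b (occ X b t w + h).
  apply/funext => j; rewrite H1 ?h0// updE /b; case: eqP => [->|_]; rewrite ?mulr1//.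
  by rewrite mulr0 addr0.
by have := H2 h; rewrite h0 h2 => /(_ isT); rewrite upd_id E1.
Qed.

Lemma path_occ_rcb (h : Lam -> (Lam -> R) -> R) w S : (forall b, loclip (h b)) ->
  rcb 0 S (fun t => h (X t w) (L t w)).
Proof.
move=> lh; have -> : (fun t => h (X t w) (L t w)) = fun t => \sum_b (X t w == b)%:R * h b (L t w).
  apply/funext => t; rewrite (bigD1 (X t w))//= eqxx mul1r big1 ?addr0// => i /negPf.
  by rewrite eq_sym => ->; rewrite mul0r.
apply: rcb_sum => b; apply: rcbM; first exact: (rcb_path Xright (fun i => (i == b)%:R)).
apply: econt_rcb; first exact: occ_fun_econt.
have [B B0 HB] := loclip_bnd (1 + S) (lh b); exists B => t tS; apply: HB; exact: (path_box Xright).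
Qed.

Lemma occ_fun_FTC f w S : Cinf f -> 0 <= S ->
  rint (fun t => partial (X t w) f (L t w)) 0 S = f (L S w) - f (fun=> 1).
Proof.
move=> cf S0; rewrite (@rderiv_FTC _ (fun t => f (L t w)))//.
- by congr (_ - f _); apply/funext => j; rewrite occ0.
- by apply: occ_fun_econt; exact: Cinf_lip.
- apply: (@path_occ_rcb (fun b => partial b f)) => b.
  by apply: Cinf_lip; exact: Cinf_partial.
- by move=> t /andP[t0 _]; exact: occ_fun_rderiv.
Qed.

End PathCalculus.

Section ExpectedPathIntegral.
Variables (R : realType) (Lam : finType) (beta : Lam -> Lam -> R).
Hypothesis beta_ge0 : forall i j, 0 <= beta i j.
Variables (a : Lam) (d : measure_display) (Om : measurableType d) (P : probability Om R).
Variables (X : R -> Om -> Lam).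
Hypothesis X_vrjp : is_vrjp beta a (fun=> 1) P X.
Local Notation mu := (@lebesgue_measure R).
Local Notation rint f a b := (\int[mu]_(x in `[a, b]) f x).
Local Notation E Y := (\int[P]_w Y w).
Local Notation L t w := (fun j => occ X j t w).
Local Notation path_int S h w := (rint (fun t => h (X t w) (L t w)) 0 S).

(** Riemann sums commute with the expectation, and converge on both sides: pathwise by
    right-continuity with bounded convergence, and for [phi] by its continuity. *)
Lemma mu1_path_int (S : R) (h : Lam -> (Lam -> R) -> R) : 0 <= S -> (forall b, loclip (h b)) ->
  mbd (fun w => path_int S h w) /\ mu1 P X S h = E (fun w => path_int S h w).
Proof.
move=> S0 lh; have Xr := vrjp_right_continuous X_vrjp.
pose Y n w := S / n.+1%:R * (\sum_(k < n.+1) h (X (k.+1%:R * (S / n.+1%:R)) w) (L (k.+1%:R * (S / n.+1%:R)) w)).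
have gr n (k : 'I_n.+1) := @grid_bnd R S S0 n k (ltn_ord k).
have [C C0 HC] := loclip_family (1 + S) lh.
have mh n (k : 'I_n.+1) : mbd (fun w => h (X (k.+1%:R * (S / n.+1%:R)) w) (L (k.+1%:R * (S / n.+1%:R)) w)).
  by apply: (mbd_path_occ X_vrjp) => //; have /andP[] := gr n k.
have mY n : mbd (Y n) by apply: mbdZ; apply: mbd_sum => k; exact: mh.
have YC n w : `|Y n w| <= S * C.
  rewrite /Y normrM ger0_norm ?divr_ge0// -mulrA ler_wpM2l// mulrC ler_pdivrMr ?ltr0n//.
  rewrite (le_trans (ler_norm_sum _ _ _))// -[n.+1 in leRHS]card_ord mulr_natr -sumr_const.
  apply: ler_sum => k _; have [H _] := HC (X (k.+1%:R * (S / n.+1%:R)) w); apply: H.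
  by apply: (path_box Xr); exact: gr.
have cY w : Y n w @[n --> \oo] --> path_int S h w.
  have := rint_rstep_cvg S0 (path_occ_rcb Xr w S lh); rewrite subr0.
  by under eq_fun do under eq_bigr do rewrite add0r.
have cE : E (Y n) @[n --> \oo] --> mu1 P X S h.
  have := rint_rstep_cvg S0 (phi_rcb beta_ge0 X_vrjp S lh); rewrite subr0.
  rewrite (_ : (fun n => E (Y n)) = fun n => S / n.+1%:R * (\sum_(k < n.+1) phi P X h (0 + k.+1%:R * (S / n.+1%:R))))//.
  apply/funext => n; rewrite EZ; last by apply: mbd_sum => k; exact: mh.
  rewrite E_sum; last exact: mh.
  apply: (congr1 (fun z => S / n.+1%:R * z)).
  apply: eq_bigr => k _.
  rewrite add0r.
  by rewrite /phi.
split; first exact: mbd_lim mY YC cY.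
exact: (cvg_unique _ cE (E_cvg mY YC cY)).
Qed.

End ExpectedPathIntegral.

(** * The time change *)

Section ClockChange.
Variables (R : realType) (Lam : finType) (V W : R -> R) (T c : R).
Hypothesis sV : smooth1 V.
Hypothesis Vlt : {in `[1, +oo[ &, {homo V : s t / s < t}}.
Hypothesis W1 : forall t, V 1 <= t -> 1 <= W t /\ V (W t) = t.
Hypothesis T0 : 0 < T.
Hypothesis cT : #|Lam|%:R * c = T.
Implicit Types (b i j k : Lam) (l : Lam -> R) (s t : R).

(** The clock as a function of the local times alone; its partial derivative at the current site is
    the speed of the clock. *)
Definition age l : R := \sum_j (V (l j) - V 1).

Lemma V_mono s t : 1 <= s -> s <= t -> V s <= V t.
Proof.
move=> s1; rewrite le_eqVlt => /predU1P[->//|st]; apply/ltW/Vlt => //; rewrite in_itv /= andbT//.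
exact: le_trans (ltW st).
Qed.

Lemma V_is_derive t : is_derive t 1 V (derive1 V t).
Proof.
have dV : derivable V t 1 := @sV 0%N t.
by rewrite derive1E; exact: (DeriveDef dV erefl).
Qed.

(** Only right difference quotients are used, because monotonicity is known on [[1, oo[] and [t = 1]
    is allowed. *)
Lemma V_derive_ge0 t : 1 <= t -> 0 <= derive1 V t.
Proof.
move=> t1; rewrite leNgt; apply/negP => l0.
have e0 : 0 < - derive1 V t / 2 by lra.
have [d d0 H] := is_derive_rderiv (V_is_derive t) e0.
have := H (d / 2) ltac:(lra); have := @V_mono t (t + d / 2) t1 ltac:(lra).
rewrite ler_norml => le1 /andP[_]; move: l0 le1; move: (derive1 V t) (V (t + d / 2)) (V t) => x y z.
nra.
Qed.

Lemma Cinf_V_coord j : Cinf (fun l => V (l j)).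
Proof.
have cc := @Cinf_coord R Lam j.
by apply: (Cinf_comp1 cc); exact: smooth1_maps (Cinf_lip cc).
Qed.

Lemma Cinf_age : Cinf age.
Proof. by apply: Cinf_sum => j _; apply: CinfD; [exact: Cinf_V_coord|exact: Cinf_cst]. Qed.

Lemma partial_age b : partial b age = fun l => derive1 V (l b).
Proof.
apply: pder_partial => l.
have -> : (fun t : R => age (upd l b t)) = fun t => V t + (\sum_(j | j != b) (V (l j) - V 1) - V 1).
  apply/funext => t; rewrite /age (bigD1 b)//= eqxx -addrA; congr (_ + _); rewrite addrC.
  by congr (_ - _); apply: eq_bigr => j /negPf ->.
by have := is_deriveD (V_is_derive (l b)) (is_derive_cst _ _ _); rewrite addr0; apply.
Qed.

Lemma age1 : age (fun=> 1) = 0.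
Proof. by rewrite /age big1// => j _; rewrite subrr. Qed.

Lemma age_sum l : \sum_j (V (l j) - V 1 - c) = age l - T.
Proof. by rewrite sumrB sumr_const -[in LHS]mulr_natl cT. Qed.

Lemma age_coord l k : (forall j, 1 <= l j) -> 0 <= V (l k) - V 1 <= age l.
Proof.
move=> l1; have H j : 0 <= V (l j) - V 1 by rewrite subr_ge0 V_mono.
by rewrite H /age (bigD1 k)//= lerDl sumr_ge0.
Qed.

(** The local time at which a single site brings the clock to [T + 2], which lies outside the unit
    neighbourhood of [T] where [del] may be nonzero. *)
Let M := W (V 1 + T + 2).

Lemma threshold_ge1 : 1 <= M.
Proof. by have [|//] := @W1 (V 1 + T + 2); have := T0; lra. Qed.

Lemma age_threshold l k : (forall j, 1 <= l j) -> M < l k -> T + 2 <= age l.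
Proof.
move=> l1 Mk; have /andP[_ le] := age_coord k l1; apply: le_trans le.
have [|M1 VM] := @W1 (V 1 + T + 2); first by have := T0; lra.
by have := V_mono M1 (ltW Mk); rewrite VM; lra.
Qed.

Lemma usupp_hfun (del : R -> R) g b : (forall t, del t != 0 -> `|t| <= 1) ->
  usupp M (hfun V del g c b).
Proof.
move=> dr l k l1 Mk; rewrite /hfun age_sum; have := age_threshold l1 Mk => H.
rewrite [X in _ * X](_ : _ = 0) ?mulr0//.
by apply: contraTeq isT => /dr; rewrite ler_norml; lra.
Qed.

Variables (d : measure_display) (Om : measurableType d) (X : R -> Om -> Lam).
Hypothesis Xright : forall w t, 0 <= t -> \forall r \near t^'+, X r w = X t w.
Local Notation mu := (@lebesgue_measure R).
Local Notation rint f a b := (\int[mu]_(x in `[a, b]) f x).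
Local Notation L t w := (fun j => occ X j t w).
Implicit Types (w : Om).

Let L1 t w : 0 <= t -> forall j, 1 <= L t w j.
Proof. by move=> t0 j; have /andP[] := occ_bnd Xright j w t0. Qed.

Lemma clock_age s w : 0 <= s -> clock V X s w = age (L s w).
Proof.
move=> s0; rewrite -[RHS]subr0 -age1 -(occ_fun_FTC Xright w Cinf_age s0).
by apply: eq_rint => t _; rewrite partial_age.
Qed.

(** All coordinates [V (L^j)] are nondecreasing in time, so their [l1] distance is exactly the
    increment of the clock. *)
Lemma age_dist s t w : 0 <= s -> 0 <= t ->
  dist1 (fun j => V (L t w j) - c) (fun j => V (L s w j) - c) = `|age (L t w) - age (L s w)|.
Proof.
have H s' t' : 0 <= s' -> s' <= t' ->
  dist1 (fun j => V (L t' w j) - c) (fun j => V (L s' w j) - c) = age (L t' w) - age (L s' w).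
  move=> s0 st; rewrite /dist1 /age -sumrB; apply: eq_bigr => j _.
  have /andP[p1 p2] := @occ_inc _ _ _ _ Xright j w s' t' ltac:(by rewrite s0).
  have := V_mono (L1 w s0 j) (t := occ X j t' w) ltac:(by rewrite -subr_ge0).
  by move=> VV; rewrite ger0_norm; lra.
have dC x y : dist1 x y = dist1 y x :> R by apply: eq_bigr => j _; rewrite distrC.
move=> s0 t0; have [st|ts] := leP s t.
  by rewrite -H// ger0_norm//; exact: dist1_ge0.
by rewrite dC distrC -H ?(ltW ts)// ger0_norm//; exact: dist1_ge0.
Qed.

(** [xget] returns some time at which the clock shows [T]; the intermediate value theorem provides
    one before [S]. *)
Lemma clock_invP S w : 0 <= S -> T <= age (L S w) ->
  0 <= clock_inv V X T w /\ age (L (clock_inv V X T w) w) = T.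
Proof.
move=> S0 TS.
have [||s /andP[s0 sS] sT] := @econt_IVT R (fun t => age (L t w)) 0 S T S0.
- by apply: occ_fun_econt => //; exact: Cinf_lip Cinf_age.
- rewrite TS andbT (_ : L 0 w = fun=> 1) ?age1 ?(ltW T0)//.
  by apply/funext => j; rewrite occ0.
have : exists s, 0 <= s /\ clock V X s w = T by exists s; rewrite clock_age.
by move=> /(xgetPex 0)[H1 H2]; split => //; rewrite -clock_age.
Qed.

(** The weights of [g] along the path form a probability density [rho] in time. It charges only
    times at which the clock is within [r] of [T], where by [age_dist] the argument of [g] is within
    [r] of its value at [tau]. *)
Lemma changed_integral_dist (del : R -> R) (g : (Lam -> R) -> R) (r Cg S : R) w :
  smooth1 del -> (forall t, 0 <= del t) -> (\int[lebesgue_measure]_t (del t)%:E = 1)%E ->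
  (forall t, del t != 0 -> `|t| <= r) -> r <= 1 -> r < T -> Cinf g -> 0 <= Cg -> 0 <= S ->
  (forall x y, box (`|V 1| + T + 1 + `|c|) x -> box (`|V 1| + T + 1 + `|c|) y ->
     `|g x - g y| <= Cg * dist1 x y) ->
  T + 2 <= age (L S w) ->
  `|rint (fun t => hfun V del g c (X t w) (L t w)) 0 S -
    g (fun j => changed_local_time V X j T w - c)| <= Cg * r.
Proof.
move=> sd d0 i1 dr r1 rT cg Cg0 S0 gC TS.
have [tau0 tauT] : 0 <= clock_inv V X T w /\ age (L (clock_inv V X T w) w) = T.
  by apply: (clock_invP S0); lra.
set tau := clock_inv V X T w in tau0 tauT *.
rewrite (_ : (fun j => changed_local_time V X j T w - c) = fun j => V (L tau w j) - c)//.
set G := g _.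
have [D [sD dD D0 D1]] := bump_primitive sd d0 i1 dr.
pose q l := D (age l - T).
have cqi : Cinf (fun l => age l - T) by apply: CinfD; [exact: Cinf_age|exact: Cinf_cst].
have msD := smooth1_maps sD (Cinf_lip cqi).
have cq : Cinf q by exact: (Cinf_comp1 cqi).
have pq b l : partial b q l = del (age l - T) * derive1 V (l b).
  rewrite /q (partial_comp1 b cqi msD) dD (partialD _ Cinf_age (@Cinf_cst _ _ (- T))) partial_age.
  by rewrite partial_cst addr0.
pose rho t := partial (X t w) q (L t w).
have crho : rcb 0 S rho.
  apply: (@path_occ_rcb _ _ _ _ Xright (fun b => partial b q)) => b.
  by apply: Cinf_lip; exact: Cinf_partial.
(* [r < T] makes [D] vanish at time 0, where the clock shows 0, and the clock is beyond [T + r] at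
   time [S], where [D] is 1. *)
have irho : rint rho 0 S = 1.
  by rewrite (occ_fun_FTC Xright w cq S0) /q age1 D1 ?D0 ?subr0//; lra.
have cF : rcb 0 S (fun t => hfun V del g c (X t w) (L t w)).
  by apply: path_occ_rcb => // b; apply: Cinf_lip; exact: Cinf_hfun.
have cc := rcb_cst 0 S.
have -> : rint (fun t => hfun V del g c (X t w) (L t w)) 0 S - G =
    rint (fun t => hfun V del g c (X t w) (L t w) + (- G) * rho t) 0 S.
  by rewrite rintD ?rintZ ?irho ?mulr1//; exact: rcbM.
rewrite -[Cg * r]mulr1 -irho -rintZ//.
apply: rint_le_fun; [by apply: rcbD => //; exact: rcbM|exact: rcbM|move=> t /andP[t0 tS]].
have dv : 0 <= derive1 V (L t w (X t w)) by apply: V_derive_ge0; exact: L1.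
have dd : 0 <= del (age (L t w) - T) * derive1 V (L t w (X t w)) by exact: mulr_ge0.
have -> : hfun V del g c (X t w) (L t w) + - G * rho t =
    (g (fun j => V (L t w j) - c) - G) * (del (age (L t w) - T) * derive1 V (L t w (X t w))).
  by rewrite /hfun /rho age_sum pq; ring.
rewrite normrM (ger0_norm dd) /rho pq.
have [->|ne] := eqVneq (del (age (L t w) - T)) 0; first by rewrite !mul0r !mulr0.
apply: ler_wpM2r => //.
have ar : `|age (L t w) - T| <= r by exact: dr.
(* Each [V (L^j) - V 1] is at most the clock, which is at most [T + 1] where [del] does not vanish;
   this is the origin of the box on which [Cg] was taken. *)
have bx s : 0 <= s -> age (L s w) <= T + 1 -> box (`|V 1| + T + 1 + `|c|) (fun j => V (L s w j) - c).
  move=> s0 sT j; have /andP[p1 p2] := age_coord j (L1 w s0).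
  rewrite (le_trans (ler_normB _ _))// lerD2r.
  have -> : V (L s w j) = V 1 + (V (L s w j) - V 1) by rewrite addrC subrK.
  by rewrite (le_trans (ler_normD _ _))// -addrA lerD2l ger0_norm// (le_trans p2).
rewrite (le_trans (gC _ _ _ _))//.
- by apply: bx => //; move: ar; rewrite ler_norml; lra.
- by apply: bx => //; rewrite tauT; lra.
- by rewrite age_dist// tauT ler_wpM2l.
Qed.

End ClockChange.

(** For each [e] the superexpectation is the expectation of the time integral [K e], and [K e] is
    within [Cg * r] of [G] uniformly in the path, with [r] a radius of the support of [delta e]. *)
Theorem corollary7p2 (R : realType) (Lam : finType) (beta : Lam -> Lam -> R)
    (beta_sym : forall i j, beta i j = beta j i)
    (beta_ge0 : forall i j, 0 <= beta i j)
    (beta_connected : forall i j, connect (fun k l => 0 < beta k l) i j)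
    (V : R -> R) (V_diffeo : increasing_diffeo V)
    (a : Lam)
    (d : measure_display) (Omega : measurableType d) (P : probability Omega R)
    (X : R -> Omega -> Lam) (X_vrjp : is_vrjp beta a (fun=> 1) P X)
    (delta : R -> R -> R) (delta_approx0 : delta_approx delta)
    (g : (Lam -> R) -> R) (g_smooth : smooth g) (g_rapid : rapid_decay g)
    (T : R) (T_gt0 : 0 < T) :
  let N : R := #|Lam|%:R in
  let Vz : Lam -> superform R Lam := fun j => fun_form V (zform j) in
  (fun e : R =>
     (\sum_i superexp beta
        (xform a * xform i * fun_form (derive1 V) (zform i)
         * fun_forms g (fun j => Vz j - cform (T / N))
         * fun_form (delta e)
             (\sum_j (Vz j - cform (V 1) - cform (T / N)))))%:E)
    @ 0^'+
  --> 'E_P[fun w => g (fun i => (changed_local_time V X i T w - T / N)%R)]%E.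
Proof.
move=> N Vz; have [sV Vlt [W [sW WV VW]]] := V_diffeo; have [deltaP delta_supp] := delta_approx0.
have Xr := vrjp_right_continuous X_vrjp.
have N0 : 0 < N by rewrite ltr0n; apply/card_gt0P; exists a.
pose c := T / N; have cT : #|Lam|%:R * c = T by rewrite /c mulrC divfK// gt_eqF.
(* Decay with exponent [p = 0] gives bounds on all derivatives of [g], hence the Lipschitz form of
   smoothness. *)
have gb s : exists C : R, forall x, `|partials s g x| <= C.
  have [k Hk] := g_rapid; have [C HC] := Hk s 0%N; exists C => x.
  by have := HC x; rewrite expr0 invr1 mulr1.
have cg : Cinf g by exact: smooth_bounded_Cinf.
have [Bg HBg] := gb [::].
have [Cg Cg0 HCg] := Cinf_lip cg (`|V 1| + T + 1 + `|c|).
(* At time [S] the local times add up to [N + N * M], so one of them exceeds [M] and the process has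
   left the support. *)
pose M := W (V 1 + T + 2); pose S := N * M.
have M1 : 1 <= M by exact: (threshold_ge1 VW T_gt0).
have S0 : 0 <= S by rewrite mulr_ge0 ?(ltW N0)//; lra.
have MS : N * M < N + S by rewrite ltrDr.
have ageS w : T + 2 <= age V (fun j => occ X j S w).
  have [k Hk] := occ_exceeds Xr w S0 MS.
  by apply: (age_threshold Vlt VW T_gt0 _ Hk) => j; have /andP[] := occ_bnd Xr j w S0.
pose G w := g (fun i => changed_local_time V X i T w - c).
pose K e w := \int[lebesgue_measure]_(t in `[0, S]) hfun V (delta e) g c (X t w) (fun j => occ X j t w).
have key e r : 0 < e -> r <= 1 -> r < T -> closure [set t | delta e t != 0] `<=` [set t | `|t| <= r] ->
    [/\ mbd (K e), mu2 beta a (hfun V (delta e) g c) = \int[P]_w K e w &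
      forall w, `|K e w - G w| <= Cg * r].
  move=> e0 r1 rT sup; have [sd _ d0 i1] := deltaP e e0.
  have dr t : delta e t != 0 -> `|t| <= r by move=> nt; apply: sup; exact: subset_closure.
  have ch b := Cinf_hfun c b sV sd cg.
  have lh b := Cinf_lip (ch b).
  have [mK EK] := mu1_path_int beta_ge0 X_vrjp S0 lh.
  split => //; last first.
    move=> w; exact: (changed_integral_dist sV Vlt T_gt0 cT Xr sd d0 i1 dr r1 rT cg Cg0 S0 HCg (ageS w)).
  rewrite -EK; apply/esym; apply: (mu1_mu2 beta_ge0 X_vrjp beta_sym M1 MS S0) => b; split => //.
  by apply: (usupp_hfun Vlt VW T_gt0 cT) => t /dr tr; exact: le_trans r1.
(* An upper bound for the radii to which [key] applies: at most 1 and below [T]. *)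
pose r0 := Num.min 1 (T / 2).
have r00 : 0 < r0 by rewrite lt_min ltr01 divr_gt0.
have r01 : r0 <= 1 by rewrite ge_min lexx.
have r0T : r0 < T by rewrite gt_min; apply/orP; right; lra.
(* A sequence of parameters with radii tending to zero, along which [K] converges to [G]
   pointwise. *)
have ex n : exists e, 0 < e /\ closure [set t | delta e t != 0] `<=` [set t | `|t| <= r0 / n.+1%:R].
  have rn : 0 < r0 / n.+1%:R by rewrite divr_gt0.
  have H : \forall e \near 0^'+, 0 < e /\ closure [set t | delta e t != 0] `<=` [set t | `|t| <= r0 / n.+1%:R].
    by apply: filterS2 (nbhs_right_gt 0) (delta_supp _ rn) => e; split.
  by have [e He] := filter_ex H; exists e.
have [en Hen] := choice ex.
have rn1 n : r0 / n.+1%:R <= r0 by rewrite ler_pdivrMr ?ltr0n// ler_peMr ?(ltW r00)// ler1n.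
have keyn n := key (en n) (r0 / n.+1%:R) (Hen n).1 (le_trans (rn1 n) r01) (le_lt_trans (rn1 n) r0T) (Hen n).2.
(* [G] is evaluated at the random time [clock_inv]; its measurability is inherited from the time
   integrals [K (en n)] as their pointwise limit. *)
have mG : mbd G.
  apply: (@mbd_lim _ _ _ (fun n => K (en n)) _ (Bg + Cg)) => [n|n w|w].
  - by have [] := keyn n.
  - have [_ _ KG] := keyn n; rewrite -[K _ w](subrK (G w)) addrC (le_trans (ler_normD _ _))//.
    apply: lerD; first exact: HBg.
    by rewrite (le_trans (KG w))// ler_piMr// (le_trans (rn1 n)).
  apply/cvgrPdist_le => e e0.
  have [n Hn] : exists n : nat, Cg * r0 / e < n%:R by exists (Num.truncn (Cg * r0 / e)).+1; exact: truncnS_gt.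
  exists n => // m /= nm; have [_ _ KG] := keyn m; rewrite distrC (le_trans (KG w))// mulrA.
  rewrite ler_pdivrMr ?ltr0n// [e * _]mulrC -ler_pdivrMr// (le_trans (ltW Hn))// ler_nat.
  exact: leq_trans nm (leqnSn m).
have -> : ('E_P[fun w => g (fun i => (changed_local_time V X i T w - T / N)%R)] = (\int[P]_w G w)%:E)%E.
  by rewrite unlock; exact: EE mG.
apply/cvg_EFin; first exact: nearW.
apply/cvgrPdist_le => eps eps0.
pose r := Num.min r0 (eps / (Cg + 1)).
have rr : 0 < r by rewrite lt_min r00 divr_gt0//; lra.
have rr0 : r <= r0 by rewrite ge_min lexx.
apply: filterS2 (nbhs_right_gt 0) (delta_supp _ rr) => e e0 sup.
have [mK EK KG] := key e r e0 (le_trans rr0 r01) (le_lt_trans rr0 r0T) sup.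
have sd : smooth1 (delta e) by have [] := deltaP e e0.
rewrite /= (superexp_mu2 beta a c sV sd cg).
rewrite EK -EB// E_bnd//; first exact: mbdB.
move=> w; rewrite distrC (le_trans (KG w))//.
have : r <= eps / (Cg + 1) by rewrite ge_min lexx orbT.
rewrite ler_pdivlMr; last by lra.
by apply: le_trans; rewrite mulrC ler_wpM2l// ?(ltW rr)//; lra.
Qed.
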